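(* Let $N\ge2$ and let $m_0$ be a Lipschitz function on $\mathbb{T}$ such that $R_{m_0}1=1$, $m_0$ has finitely many zeros, and there is at least one $m_0$-cycle. Let $C_1,\dots,C_n$ be distinct $m_0$-cycles, $C_i=\{z_{i1},\dots,z_{ip_i}\}$ in cyclic order, $z_{ij}=e^{-i\theta_{ij}}$, and put $\alpha_{ij}:=m_0(z_{ij})/\sqrt N$, $\alpha_i:=(\alpha_{i1},\dots,\alpha_{ip_i})$. Define $\varphi_{C_i}=(\varphi_{C_i,1},\dots,\varphi_{C_i,p_i})$ by $$\widehat{\varphi}_{C_i,k}(x)=\prod_{l=1}^\infty\frac{\overline{\alpha_{i,k-l}}\;m_0\!\left(\frac{x}{N^l}+\theta_{i,k-l}\right)}{\sqrt N},\qquad x\in\mathbb{R},\ k\in\{1,\dots,p_i\},$$ where the second subscripts of $\alpha$ and $\theta$ are read modulo $p_i$. Then $\varphi_{C,\alpha}:=\varphi_{C_1}\oplus\dots\oplus\varphi_{C_n}$ is a scaling vector with filter $m_0$ for the wavelet representation $\mathfrak{R}_{C,\alpha}:=\mathfrak{R}_{C_1,\alpha_1}\oplus\dots\oplus\mathfrak{R}_{C_n,\alpha_n}$. Moreover, the following are equivalent: (i) $\varphi_{C,\alpha}$ is an orthogonal scaling vector; (ii) [Cohen's condition] the number of $m_0$-cycles is $n$; (iii) [Lawton's condition] the dimension of the eigenspace $\{h\in C(\mathbb{T}) : R_{m_0}h=h\}$ is $n$. Furthermore, suppose $n$ is smaller than the number of $m_0$-cycles, let $m_1,\dots,m_{N-1}\in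 L^\infty(\mathbb{T})$ be such that, with $\rho=e^{2\pi i/N}$, the $N\times N$ matrix $\frac1{\sqrt N}\big(m_i(\rho^jz)\big)_{0\le i,j\le N-1}$ is unitary for a.e. $z\in\mathbb{T}$, and define $\psi_i:=U_{C,\alpha}^{-1}\pi_{C,\alpha}(m_i)\varphi_{C,\alpha}$ for $i\in\{1,\dots,N-1\}$. Then $$\{U_{C,\alpha}^jT_{C,\alpha}^k\psi_i : i\in\{1,\dots,N-1\},\ j,k\in\mathbb{Z}\}$$ is a normalized tight frame for the Hilbert space $L^2(\mathbb{R})^{p_1}\oplus\dots\oplus L^2(\mathbb{R})^{p_n}$ of $\mathfrak{R}_{C,\alpha}$.
   Context: Conventions: $\widehat f(\xi)=\int_{\mathbb{R}} f(x)e^{-i\xi x}\,dx$; $\mathbb{T}$ is the unit circle; functions on $\mathbb{T}$ are identified with $2\pi$-periodic functions on $\mathbb{R}$ by $f(\theta)=f(z)$, $z=e^{-i\theta}$. The transfer operator is $R_{m_0}f(z)=\frac1N\sum_{w^N=z}|m_0(w)|^2f(w)$. A cycle of length $p$ is a set $\{z_1,\dots,z_p\}$ of distinct points of $\mathbb{T}$ with $z_1^N=z_2,\dots,z_{p-1}^N=z_p,\ z_p^N=z_1$ (cyclic order). It is an $m_0$-cycle if $|m_0(z_k)|=\sqrt N$ for all $k$. A wavelet representation of scale $N$ is a triple $\tilde\pi=(H,U,\pi)$ with $H$ a Hilbert space, $U$ a unitary on $H$ and $\pi$ a representation of $L^\infty(\mathbb{T})$ on $H$ with $U\pi(f)U^{-1}=\pi(f(z^N))$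 for all $f$; put $T:=\pi(z)$. The classical one is on $L^2(\mathbb{R})$: $U\xi(x)=\frac1{\sqrt N}\xi(x/N)$, and $\pi(f)$ is, on the Fourier transform side, multiplication by the $2\pi$-periodic function $x\mapsto f(e^{-ix})$ (so $T\xi(x)=\xi(x-1)$). For a cycle $C=\{z_1,\dots,z_p\}$ and $\alpha=(\alpha_1,\dots,\alpha_p)\in\mathbb{T}^p$, the wavelet representation $\mathfrak{R}_{C,\alpha}$ acts on $L^2(\mathbb{R})^p$ by $$U_{C,\alpha}(\xi_1,\dots,\xi_p)=(\alpha_1U\xi_2,\alpha_2U\xi_3,\dots,\alpha_{p-1}U\xi_p,\alpha_pU\xi_1),$$ $$\pi_{C,\alpha}(f)(\xi_1,\dots,\xi_p)=(\pi(f(z_1z))\xi_1,\dots,\pi(f(z_pz))\xi_p),$$ with $U,\pi$ the classical ones. Direct sums of wavelet representations are taken componentwise; for the direct sum $\mathfrak{R}_{C,\alpha}$ over several cycles, $U_{C,\alpha}$, $\pi_{C,\alpha}$ denote the direct sum operators and $T_{C,\alpha}=\pi_{C,\alpha}(z)$. A vector $\varphi\in H$ is a scaling vector with filter $m_0$ for $\tilde\pi=(H,U,\pi)$ if $U\varphi=\pi(m_0)\varphi$ and there is no orthogonal projection $p\ne1$ commuting with $U$ and all $\pi(f)$ such that $p\varphi=\varphi$. A multiresolution analysis (MRA) for $(H,U,\pi)$ is a sequence $(V_n)_{n\in\mathbb{Z}}$ of closed subspaces of $H$ with $V_n\subset V_{n+1}$; $\overline{\bigcup_n V_n}=H$; $\bigcap_n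 V_n=\{0\}$; $U(V_n)=V_{n-1}$; and some $\varphi\in V_0$ such that $\{T^k\varphi:k\in\mathbb{Z}\}$ is an orthonormal basis of $V_0$. A vector $\varphi\in H$ is an orthogonal scaling vector if there is an MRA for which $\varphi\in V_0$ has this last property. A normalized tight frame for $H$ is a family $(e_k)$ in $H$ with $\sum_k|\langle v\,|\,e_k\rangle|^2=\|v\|^2$ for all $v\in H$. *)

(* Defs.v *)
From HB Require Import structures.
From mathcomp Require Import all_boot all_order all_algebra ring_quotient complex.
From mathcomp Require Import all_classical all_reals all_analysis.
From mathcomp Require Import measurable_realfun ring lra.

Set Implicit Arguments.
Unset Strict Implicit.
Unset Printing Implicit Defensive.

Import Order.TTheory GRing.Theory Num.Theory.
Import numFieldNormedType.Exports.

Local Open Scope classical_set_scope.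
Local Open Scope card_scope.
Local Open Scope quotient_scope.
(* ring_scope is opened last so that x^* is the conjugation Num.conj. *)
Local Open Scope complex_scope.
Local Open Scope ring_scope.

HB.mixin Record NormedModule_isInnerProduct (R : realType) H
    & NormedModule R[i] H := {
  dot : H -> H -> R[i];
  dot_linear : forall w a u v, dot (a *: u + v) w = a * dot u w + dot v w;
  dotC : forall u v, dot v u = (dot u v)^*;
  dot_norm : forall u, dot u u = `|u| ^+ 2 }.

(* Complex inner product spaces: the inner product is linear in its first
   argument, and the norm (hence the topology) is the one it induces. Hilbert
   spaces are the complete ones, see hilbert_space below. *)
#[short(type="innerProductType")]
HB.structure Definition InnerProduct (R : realType) :=
  {H of NormedModule R[i] H & NormedModule_isInnerProduct R H}.

HB.factory Record Lmodule_isInnerProduct (R : realType) H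
    & GRing.Lmodule R[i] H := {
  dot : H -> H -> R[i];
  dot_linear : forall w a u v, dot (a *: u + v) w = a * dot u w + dot v w;
  dotC : forall u v, dot v u = (dot u v)^*;
  dot_ge0 : forall u, 0 <= dot u u;
  dot_eq0 : forall u, dot u u = 0 -> u = 0 }.

HB.builders Context R H & Lmodule_isInnerProduct R H.

Let nm (u : H) : R[i] := sqrtC (dot u u).
Let dotD u v w : dot (u + v) w = dot u w + dot v w.
Proof. by rewrite -{1}[u]scale1r dot_linear mul1r. Qed.
Let dot0 w : dot 0 w = 0.
Proof. by apply: (addIr (dot 0 w)); rewrite -dotD !add0r. Qed.
Let dotZ a u w : dot (a *: u) w = a * dot u w.
Proof. by rewrite -[a *: u]addr0 dot_linear dot0 addr0. Qed.
Let dotDr u v w : dot w (u + v) = dot w u + dot w v.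
Proof. by rewrite dotC dotD rmorphD/= -!dotC. Qed.
Let dotZr a u w : dot w (a *: u) = a^* * dot w u.
Proof. by rewrite dotC dotZ rmorphM/= -!dotC. Qed.

Let CS u v : `|dot u v| <= nm u * nm v.
Proof.
have [->|v0] := eqVneq v 0.
  by rewrite dotC dot0 rmorph0 normr0 mulr_ge0 ?sqrtC_ge0 ?dot_ge0.
have vv : 0 < dot v v.
  by rewrite lt0r dot_ge0 andbT; apply: contra v0 => /eqP/dot_eq0 ->.
rewrite -sqrtCM ?nnegrE ?dot_ge0//.
rewrite -[leLHS]sqrCK ?normr_ge0// ler_sqrtC ?qualifE/= ?mulr_ge0 ?exprn_ge0 ?dot_ge0//.
pose a := - (dot u v / dot v v).
have vJ : (dot v v)^* = dot v v by rewrite -dotC.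
have aJ : a^* = - ((dot u v)^* / dot v v).
  by rewrite /a rmorphN rmorphM/= fmorphV/= vJ.
have := dot_ge0 (u + a *: v).
rewrite dotD !dotDr !dotZ !dotZr.
have -> : dot v u = (dot u v)^* by rewrite -dotC.
rewrite aJ normCK => h.
rewrite -ler_pdivrMr// -subr_ge0; apply: le_trans h _.
rewrite le_eqVlt; apply/orP; left; apply/eqP.
rewrite /a; field.
by rewrite gt_eqF.
Qed.

Let nmD u v : nm (u + v) <= nm u + nm v.
Proof.

rewrite -ler_sqr ?qualifE/= ?addr_ge0 ?sqrtC_ge0 ?dot_ge0// sqrrD !sqrtCK.
rewrite dotD !dotDr.
have -> : dot u u + dot u v + (dot v u + dot v v) = dot u v + dot v u + (dot u u + dot v v) by ring.
rewrite [leRHS]addrAC [leRHS]addrC lerD2r.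
have -> : dot v u = (dot u v)^* by rewrite -dotC.
have -> : dot u v + (dot u v)^* = 'Re (dot u v) *+ 2.
  by rewrite ReE -mulr_natr divfK// pnatr_eq0.
rewrite lerMn2r/=; exact: (le_trans (leif_Re_Creal _)).
Qed.

Let nmZ l u : nm (l *: u) = `|l| * nm u.
Proof.
by rewrite /nm dotZ dotZr mulrA -normCK sqrtCM ?qualifE/= ?exprn_ge0 ?dot_ge0// sqrCK.
Qed.

Let nm0 u : nm u = 0 -> u = 0.
Proof. by move/eqP; rewrite sqrtC_eq0 => /eqP/dot_eq0. Qed.

HB.instance Definition _ := @Lmodule_isNormed.Build R[i] H nm nmD nmZ nm0.

Let dot_norm u : dot u u = `|u| ^+ 2.
Proof. by rewrite sqrtCK. Qed.

HB.instance Definition _ :=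
  NormedModule_isInnerProduct.Build R H dot_linear dotC dot_norm.
HB.end.
Section complex_valued.
Context d (T : measurableType d) (R : realType) (mu : {measure set T -> \bar R}).
Implicit Types (f g : T -> R[i]).

Definition cmeasurable f :=
  measurable_fun setT (fun x => complex.Re (f x)) /\
  measurable_fun setT (fun x => complex.Im (f x)).

Definition cintegrable f :=
  mu.-integrable setT (EFin \o (fun x => complex.Re (f x))) /\
  mu.-integrable setT (EFin \o (fun x => complex.Im (f x))).

Definition cintegral f : R[i] :=
  \int[mu]_x complex.Re (f x) +i* \int[mu]_x complex.Im (f x).

Definition square_integrable f :=
  cmeasurable f /\ (\int[mu]_x (Normc.normc (f x) ^+ 2)%:E < +oo)%E.

Lemma normc_sqr (z : R[i]) : Normc.normc z ^+ 2 = complex.Re z ^+ 2 + complex.Im z ^+ 2.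
Proof. by case: z => a b /=; rewrite sqr_sqrtr// addr_ge0// sqr_ge0. Qed.

Lemma cmeasurable_comb (a : R[i]) f g :
  cmeasurable f -> cmeasurable g -> cmeasurable (a *: f + g).
Proof.
move=> [mf1 mf2] [mg1 mg2]; split.
  rewrite (_ : (fun _ => _) =
      fun x => complex.Re a * complex.Re (f x) - complex.Im a * complex.Im (f x) + complex.Re (g x)); last first.
    apply/funext => x; rewrite -[(_ + _) x]/(a * f x + g x).
    by case: a (f x) (g x) => [a b] [c e] [h k].
  by apply: measurable_funD => //; apply: measurable_funB; apply: measurable_funM.
rewrite (_ : (fun _ => _) =
    fun x => complex.Re a * complex.Im (f x) + complex.Im a * complex.Re (f x) + complex.Im (g x)); last first.
  apply/funext => x; rewrite -[(_ + _) x]/(a * f x + g x).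
  by case: a (f x) (g x) => [a b] [c e] [h k] /=; rewrite addrC.
by apply: measurable_funD => //; apply: measurable_funD; apply: measurable_funM.
Qed.

Lemma cmeasurable_mul_conj f g :
  cmeasurable f -> cmeasurable g -> cmeasurable (fun x => f x * (g x)^*).
Proof.
move=> [mf1 mf2] [mg1 mg2]; split.
  rewrite (_ : (fun _ => _) =
      fun x => complex.Re (f x) * complex.Re (g x) + complex.Im (f x) * complex.Im (g x)); last first.
    apply/funext => x.
    by case: (f x) (g x) => [c e] [h k] /=; rewrite mulrN opprK.
  by apply: measurable_funD; apply: measurable_funM.
rewrite (_ : (fun _ => _) =
    fun x => complex.Im (f x) * complex.Re (g x) - complex.Re (f x) * complex.Im (g x)); last first.
  apply/funext => x.
  by case: (f x) (g x) => [c e] [h k] /=; rewrite mulrN addrC.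
by apply: measurable_funB; apply: measurable_funM.
Qed.

Lemma measurable_normc_sqr f : cmeasurable f ->
  measurable_fun setT (fun x => Normc.normc (f x) ^+ 2).
Proof.
move=> [mf1 mf2].
under eq_fun do rewrite normc_sqr.
by apply: measurable_funD; apply: measurable_funX.
Qed.

Lemma square_integrableE f : square_integrable f <->
  cmeasurable f /\ mu.-integrable setT (EFin \o (fun x => Normc.normc (f x) ^+ 2)).
Proof.
have E : (\int[mu]_x `|(Normc.normc (f x) ^+ 2)%:E| =
    \int[mu]_x (Normc.normc (f x) ^+ 2)%:E)%E.
  by apply: eq_integral => x _; rewrite /= ger0_norm ?sqr_ge0.
split=> -[mf h]; split => //.
  apply/integrableP; split; first exact/measurable_EFinP/measurable_normc_sqr.
  by rewrite E.
by move/integrableP: h => [_]; rewrite E.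
Qed.

Lemma square_integrable_comb (a : R[i]) f g :
  square_integrable f -> square_integrable g -> square_integrable (a *: f + g).
Proof.
move=> /square_integrableE[mf intf] /square_integrableE[mg intg].
apply/square_integrableE; split; first exact: cmeasurable_comb.
pose A := Normc.normc a ^+ 2.
apply: (@le_integrable _ _ _ mu _ _ _ (EFin \o (fun x => 2 * A * Normc.normc (f x) ^+ 2
    + 2 * Normc.normc (g x) ^+ 2))) => //.
- exact/measurable_EFinP/measurable_normc_sqr/cmeasurable_comb.
- move=> x _; rewrite /= lee_fin !ger0_norm ?sqr_ge0//; last first.
    have A0 : 0 <= A := sqr_ge0 _.
    apply: addr_ge0; (apply: mulr_ge0; last exact: sqr_ge0) => //.
    exact: mulr_ge0.
  rewrite -[(_ + _) x]/(a * f x + g x) /A.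
  case: a (f x) (g x) {A} => [a b] [c e] [h k]; rewrite !normc_sqr /=.
  rewrite -subr_ge0 (_ : _ - _ = (a * c - b * e - h) ^+ 2 + (a * e + b * c - k) ^+ 2); last by ring.
  by rewrite addr_ge0 ?sqr_ge0.
- rewrite (_ : EFin \o _ = (fun x => (2 * A)%:E * (Normc.normc (f x) ^+ 2)%:E) \+
     (fun x => 2%:E * (Normc.normc (g x) ^+ 2)%:E))%E; last first.
    by apply/funext => x /=; rewrite EFinD !EFinM.
  by apply: integrableD => //; apply: integrableZl.
Qed.

Lemma square_integrable0 : square_integrable 0.
Proof.
split; first by split; apply: measurable_cst.
under eq_integral do rewrite /= expr0n/= addr0 sqrtr0 expr0n/=.
by rewrite integral0.
Qed.

Lemma square_integrable_mul f g : square_integrable f -> square_integrable g ->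
  cintegrable (fun x => f x * (g x)^*).
Proof.
move=> /square_integrableE[mf intf] /square_integrableE[mg intg].
have [m1 m2] := cmeasurable_mul_conj mf mg.
have dom : mu.-integrable setT (EFin \o (fun x => Normc.normc (f x) ^+ 2
    + Normc.normc (g x) ^+ 2)).
  rewrite (_ : EFin \o _ = (fun x => (Normc.normc (f x) ^+ 2)%:E) \+
     (fun x => (Normc.normc (g x) ^+ 2)%:E))%E; last first.
    by apply/funext => x /=; rewrite EFinD.
  exact: integrableD.
split; apply: le_integrable dom => //; try exact/measurable_EFinP.
- move=> x _; rewrite /= lee_fin [leRHS]ger0_norm ?addr_ge0 ?sqr_ge0//.
  case: (f x) (g x) => [c e] [h k]; rewrite !normc_sqr /=.
  have := (sqr_ge0 (c + h), sqr_ge0 (c - h), sqr_ge0 (e + k), sqr_ge0 (e - k),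
    sqr_ge0 c, sqr_ge0 e, sqr_ge0 h, sqr_ge0 k) => -[[[[[[[? ?] ?] ?] ?] ?] ?] ?].
  by rewrite ler_norml; apply/andP; split; nra.
- move=> x _; rewrite /= lee_fin [leRHS]ger0_norm ?addr_ge0 ?sqr_ge0//.
  case: (f x) (g x) => [c e] [h k]; rewrite !normc_sqr /=.
  have := (sqr_ge0 (c + k), sqr_ge0 (c - k), sqr_ge0 (e + h), sqr_ge0 (e - h),
    sqr_ge0 c, sqr_ge0 e, sqr_ge0 h, sqr_ge0 k) => -[[[[[[[? ?] ?] ?] ?] ?] ?] ?].
  by rewrite ler_norml; apply/andP; split; nra.
Qed.

Lemma cintegral_comb (a : R[i]) f g : cintegrable f -> cintegrable g ->
  cintegral (fun x => a * f x + g x) = a * cintegral f + cintegral g.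
Proof.
move=> [f1 f2] [g1 g2]; rewrite /cintegral.
have iZ (b : R) h : mu.-integrable setT (EFin \o h) ->
    mu.-integrable setT (EFin \o (fun x => b * h x)).
  move=> ih; rewrite (_ : EFin \o _ = (fun x => b%:E * (h x)%:E)%E).
    exact: integrableZl.
  by apply/funext => x /=; rewrite EFinM.
have iD h k : mu.-integrable setT (EFin \o h) -> mu.-integrable setT (EFin \o k) ->
    mu.-integrable setT (EFin \o (fun x => h x + k x)).
  move=> ih ik; rewrite (_ : EFin \o _ = (EFin \o h) \+ (EFin \o k))%E.
    exact: integrableD.
  by apply/funext => x /=; rewrite EFinD.
rewrite (_ : (fun x => complex.Re _) =
    fun x => complex.Re a * complex.Re (f x) + - complex.Im a * complex.Im (f x) + complex.Re (g x)); last first.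
  apply/funext => x.
  by case: a (f x) (g x) => [a b] [c e] [h k] /=; rewrite mulNr.
rewrite (_ : (fun x => complex.Im _) =
    fun x => complex.Re a * complex.Im (f x) + complex.Im a * complex.Re (f x) + complex.Im (g x)); last first.
  apply/funext => x.
  by case: a (f x) (g x) => [a b] [c e] [h k].
rewrite !RintegralD//; try by [exact: iZ | apply: iD; exact: iZ].
rewrite !RintegralZl//; case: a => a b /=.
by apply/eqP; rewrite eq_complex /= mulNr !eqxx.
Qed.

Lemma ae_eq_cintegral f g : cmeasurable f -> cmeasurable g ->
  (\forall x \ae mu, f x = g x) -> cintegral f = cintegral g.
Proof.
move=> [f1 f2] [g1 g2] fg; rewrite /cintegral /Rintegral.
congr (fine _ +i* fine _); apply: ae_eq_integral => //;
  do ?exact/measurable_EFinP; by apply: filterS fg => x ->.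
Qed.

End complex_valued.

Section L2.
Context d (T : measurableType d) (R : realType) (mu : {measure set T -> \bar R}).

(* Square-integrable functions, and their quotient by a.e. equality. *)
Definition sqint : {pred T -> R[i]} := fun f => `[< square_integrable mu f >].

Let sqint_submod_closed : submod_closed sqint.
Proof.
split; first exact/asboolP/square_integrable0.
by move=> a f g /asboolP sf /asboolP sg; exact/asboolP/square_integrable_comb.
Qed.

HB.instance Definition _ :=
  GRing.isSubmodClosed.Build R[i] (T -> R[i]) sqint sqint_submod_closed.

Record sqfun := Sqfun { sqfun_val :> T -> R[i]; _ : sqfun_val \in sqint }.

HB.instance Definition _ := [isSub for sqfun_val].
HB.instance Definition _ := [Choice of sqfun by <:].
HB.instance Definition _ := [SubChoice_isSubLmodule of sqfun by <:].

Definition null_sqfun : {pred sqfun} :=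
  fun f => `[< \forall x \ae mu, f x = 0 >].

Let null_sqfun_zmod_closed : zmod_closed null_sqfun.
Proof.
split; first by apply/asboolP/aeW.
move=> f g /asboolP f0 /asboolP g0; apply/asboolP.
by apply: filterS2 f0 g0 => x /= fx gx; rewrite -[LHS]/(f x - g x) fx gx subr0.
Qed.

HB.instance Definition _ :=
  GRing.isZmodClosed.Build sqfun null_sqfun null_sqfun_zmod_closed.

Definition L2 : Type := Quotient.quot null_sqfun.
HB.instance Definition _ := GRing.Zmodule.on L2.

Local Notation pi := (\pi_(Quotient.quot null_sqfun)).

Lemma L2_eqP (f g : sqfun) : pi f = pi g <-> \forall x \ae mu, f x = g x.
Proof.
split=> [/eqP|fg].
  rewrite -Quotient.idealrBE => /asboolP; apply: filterS => x /= h.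
  by apply/eqP; rewrite -subr_eq0; apply/eqP.
apply/eqP; rewrite -Quotient.idealrBE; apply/asboolP.
by apply: filterS fg => x /= h; rewrite -[LHS]/(f x - g x) h subrr.
Qed.

Lemma L2_reprP (f : sqfun) : \forall x \ae mu, (repr (pi f) : sqfun) x = f x.
Proof. by apply/L2_eqP; rewrite reprK. Qed.

Definition L2_scale (a : R[i]) (f : L2) : L2 := pi (a *: (repr f : sqfun)).

Let L2_scale_pi a f : L2_scale a (pi f) = pi (a *: f).
Proof.
apply/L2_eqP; apply: filterS (L2_reprP f) => x /= h.
by rewrite -[LHS]/(a * (repr (pi f) : sqfun) x) h.
Qed.

Let piD f g : pi f + pi g = pi (f + g).
Proof. by rewrite !piE. Qed.

Let L2_ind (P : L2 -> Prop) : (forall f, P (pi f)) -> forall f, P f.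
Proof. by move=> h f; rewrite -[f]reprK. Qed.

Let L2_scaleA a b v : L2_scale a (L2_scale b v) = L2_scale (a * b) v.
Proof. by elim/L2_ind: v => f; rewrite !L2_scale_pi scalerA. Qed.

Let L2_scale1 : left_id 1 L2_scale.
Proof. by elim/L2_ind => f; rewrite L2_scale_pi scale1r. Qed.

Let L2_scaleDr : right_distributive L2_scale +%R.
Proof.
move=> a; elim/L2_ind => f; elim/L2_ind => g.
by rewrite piD !L2_scale_pi piD scalerDr.
Qed.

Let L2_scaleDl v : {morph L2_scale^~ v : a b / a + b}.
Proof. by move=> a b; elim/L2_ind: v => f; rewrite !L2_scale_pi piD scalerDl. Qed.

HB.instance Definition _ := GRing.Zmodule_isLmodule.Build R[i] L2
  L2_scaleA L2_scale1 L2_scaleDr L2_scaleDl.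

Definition L2_fun (f : L2) : T -> R[i] := sqfun_val (repr f).
Coercion L2_fun : L2 >-> Funclass.

(* The class of f; by convention 0 when f is not square-integrable. *)
Definition to_L2 (f : T -> R[i]) : L2 :=
  if pselect (f \in sqint) is left fL2 then pi (Sqfun fL2) else 0.

Definition L2_dot (f g : L2) : R[i] := cintegral mu (fun x => f x * (g x)^*).

Let L2P (f : L2) : square_integrable mu f.
Proof. by apply/asboolP; rewrite /L2_fun; case: (repr f). Qed.

Let L2_dot_linear (w : L2) a (u v : L2) :
  L2_dot (a *: u + v) w = a * L2_dot u w + L2_dot v w.
Proof.
have uw := square_integrable_mul (L2P u) (L2P w).
have vw := square_integrable_mul (L2P v) (L2P w).
rewrite /L2_dot -cintegral_comb//.
have [mu1 _] := L2P u; have [mv1 _] := L2P v; have [mw1 _] := L2P w.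
apply: ae_eq_cintegral.
- by apply: cmeasurable_mul_conj => //; have [] := L2P (a *: u + v).
- rewrite (_ : (fun _ => _) = fun x => (a * u x + v x) * (w x)^*).
    by apply: cmeasurable_mul_conj => //; exact: cmeasurable_comb.
  by apply/funext => x; ring.
have : \forall x \ae mu, (a *: u + v : L2) x = a * u x + v x.
  have := L2_reprP (a *: (repr u : sqfun) + (repr v : sqfun)).
  by rewrite -piD -L2_scale_pi !reprK.
by apply: filterS => x ->; ring.
Qed.

Let L2_dotC u v : L2_dot v u = (L2_dot u v)^*.
Proof.
have [_ i2] := square_integrable_mul (L2P u) (L2P v).
rewrite /L2_dot /cintegral.
have -> : (fun x => complex.Re (v x * (u x)^*)) = fun x => complex.Re (u x * (v x)^*).
  by apply/funext => x; case: (u x) (v x) => [a b] [c e] /=; ring.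
have -> : (fun x => complex.Im (v x * (u x)^*)) = fun x => -1 * complex.Im (u x * (v x)^*).
  by apply/funext => x; case: (u x) (v x) => [a b] [c e] /=; ring.
by rewrite RintegralZl// mulN1r.
Qed.

Let L2_dotE u : L2_dot u u = (\int[mu]_x (Normc.normc (u x) ^+ 2))%:C.
Proof.
rewrite /L2_dot /cintegral; congr (_ +i* _).
  apply: eq_Rintegral => x _; rewrite normc_sqr.
  by case: (u x) => a b /=; ring.
rewrite (_ : (fun _ => _) = cst 0) ?Rintegral_cst ?mul0r//.
by apply/funext => x; case: (u x) => a b /=; ring.
Qed.

Let L2_dot_ge0 u : 0 <= L2_dot u u.
Proof. by rewrite L2_dotE ler0c; apply: Rintegral_ge0 => x _; exact: sqr_ge0. Qed.

Let L2_dot_eq0 u : L2_dot u u = 0 -> u = 0.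
Proof.
have /square_integrableE[mu2 iu2] := L2P u.
rewrite L2_dotE => /(congr1 (@complex.Re R)) /= u0.
have : (\int[mu]_x `|(Normc.normc (u x) ^+ 2)%:E| = 0)%E.
  rewrite (eq_integral (fun x => (Normc.normc (u x) ^+ 2)%:E)); last first.
    by move=> x _; rewrite /= ger0_norm ?sqr_ge0.
  by rewrite -[LHS]fineK; [congr EFin|exact: integrable_fin_num].
move/ae_eq_integral_abs => /(_ measurableT) h.
have {}h := h (measurable_int _ iu2).
have -> : (0 : L2) = pi 0 by rewrite !piE.
rewrite -[u]reprK; apply/L2_eqP; apply: filterS h => x /(_ I) [] /eqP.
by rewrite sqrf_eq0 => /eqP /Normc.eq0_normc.
Qed.
HB.instance Definition _ := Lmodule_isInnerProduct.Build R L2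
  L2_dot_linear L2_dotC L2_dot_ge0 L2_dot_eq0.

End L2.
Section direct_sum.
Context (R : realType) (I : finType).

Definition dsum (H : I -> innerProductType R) : Type := forall i, H i.

Variable H : I -> innerProductType R.
Local Notation S := (dsum H).
Implicit Types u v w : S.

HB.instance Definition _ := gen_eqMixin S.
HB.instance Definition _ := gen_choiceMixin S.

Definition dsum_zero : S := fun=> 0.
Definition dsum_opp u : S := fun i => - u i.
Definition dsum_add u v : S := fun i => u i + v i.
Definition dsum_scale (a : R[i]) u : S := fun i => a *: u i.

Let dsumP u v : (forall i, u i = v i) -> u = v.
Proof. exact: functional_extensionality_dep. Qed.

Let dsum_addA : associative dsum_add.
Proof. by move=> u v w; apply: dsumP => i; exact: addrA. Qed.
Let dsum_addC : commutative dsum_add.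
Proof. by move=> u v; apply: dsumP => i; exact: addrC. Qed.
Let dsum_add0 : left_id dsum_zero dsum_add.
Proof. by move=> u; apply: dsumP => i; exact: add0r. Qed.
Let dsum_addN : left_inverse dsum_zero dsum_opp dsum_add.
Proof. by move=> u; apply: dsumP => i; exact: addNr. Qed.

HB.instance Definition _ :=
  GRing.isZmodule.Build S dsum_addA dsum_addC dsum_add0 dsum_addN.

Let dsum_scaleA a b u : dsum_scale a (dsum_scale b u) = dsum_scale (a * b) u.
Proof. by apply: dsumP => i; exact: scalerA. Qed.
Let dsum_scale1 : left_id 1 dsum_scale.
Proof. by move=> u; apply: dsumP => i; exact: scale1r. Qed.
Let dsum_scaleDr : right_distributive dsum_scale +%R.
Proof. by move=> a u v; apply: dsumP => i; exact: scalerDr. Qed.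
Let dsum_scaleDl u : {morph dsum_scale^~ u : a b / a + b}.
Proof. by move=> a b; apply: dsumP => i; exact: scalerDl. Qed.

HB.instance Definition _ := GRing.Zmodule_isLmodule.Build R[i] S
  dsum_scaleA dsum_scale1 dsum_scaleDr dsum_scaleDl.

Definition dsum_dot u v : R[i] := \sum_i dot (u i) (v i).

Let dsum_dot_linear w a u v :
  dsum_dot (a *: u + v) w = a * dsum_dot u w + dsum_dot v w.
Proof.
rewrite /dsum_dot mulr_sumr -big_split; apply: eq_bigr => i _.
exact: dot_linear.
Qed.

Let dsum_dotC u v : dsum_dot v u = (dsum_dot u v)^*.
Proof. by rewrite /dsum_dot rmorph_sum; apply: eq_bigr => i _; exact: dotC. Qed.

Let dsum_dot_ge0 u : 0 <= dsum_dot u u.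
Proof. by apply: sumr_ge0 => i _; rewrite dot_norm exprn_ge0. Qed.

Let dsum_dot_eq0 u : dsum_dot u u = 0 -> u = 0.
Proof.
move/eqP; rewrite psumr_eq0 => [/allP u0|i _]; last by rewrite dot_norm exprn_ge0.
apply: dsumP => i; have := u0 i (mem_index_enum i).
by rewrite dot_norm sqrf_eq0 normr_eq0 => /eqP.
Qed.

HB.instance Definition _ := Lmodule_isInnerProduct.Build R S
  dsum_dot_linear dsum_dotC dsum_dot_ge0 dsum_dot_eq0.

End direct_sum.

Section circle.
Context (R : realType).

Definition circle : Type := [set z : R[i]^o | `|z| = 1].
HB.instance Definition _ := Topological.on circle.
HB.instance Definition _ := Choice.on circle.

Definition cval (z : circle) : R[i] := val z.

Lemma cval_norm z : `|cval z| = 1.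
Proof. by case: z => x xP; exact: (set_mem xP). Qed.

Definition circle_mk (x : R[i]) (x1 : `|x| = 1) : circle := exist _ x (mem_set x1).

Fact circle_mul_subproof (z w : circle) : `|cval z * cval w| = 1.
Proof. by rewrite normrM !cval_norm mulr1. Qed.

Fact circle_exp_subproof (z : circle) n : `|cval z ^+ n| = 1.
Proof. by rewrite normrX cval_norm expr1n. Qed.

Fact expNi_subproof (x : R) : `|cos x -i* sin x| = 1 :> R[i].
Proof. by rewrite normc_def /= sqrrN cos2Dsin2 sqrtr1. Qed.

Definition circle_mul z w : circle := circle_mk (circle_mul_subproof z w).
Definition circle_exp z n : circle := circle_mk (circle_exp_subproof z n).
(* x |-> e^{-ix} *)
Definition expNi x : circle := circle_mk (expNi_subproof x).

(* Functions on the circle are identified with 2pi-periodic functions on the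
   real line through z = e^{-ix}; this also fixes the null sets of the circle. *)
Definition circle_ae (P : circle -> Prop) : Prop :=
  {ae lebesgue_measure, forall x : R, P (expNi x)}.

Definition Linfty (f : circle -> R[i]) : Prop :=
  cmeasurable (T := measurableTypeR R) (fun x => f (expNi x)) /\
  exists M : R, circle_ae (fun z => `|f z| <= M%:C).

End circle.

Definition hilbert_space (R : realType) (H : innerProductType R) : Prop :=
  forall F : set_system H, ProperFilter F -> cauchy F -> cvg F.

Section operators.
Context (R : realType) (H : innerProductType R).
Implicit Types (A : H -> H) (V : set H).

(* The inverse of A when A is bijective. *)
Definition op_inv A (v : H) : H := xget 0 [set w | A w = v].

Definition op_expz A (j : int) : H -> H :=
  match j with
  | Posz k => iter k A
  | Negz k => iter k.+1 (op_inv A)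
  end.

Definition linear_op A : Prop := forall a u v, A (a *: u + v) = a *: A u + A v.

Definition unitary_op A : Prop :=
  [/\ linear_op A, forall u v, dot (A u) (A v) = dot u v & range A = setT].

Definition orthogonal_projection A : Prop :=
  [/\ linear_op A, forall v, A (A v) = A v
    & forall u v, dot (A u) v = dot u (A v)].

Definition closed_subspace V : Prop :=
  [/\ closed V, V 0 & forall a u v, V u -> V v -> V (a *: u + v)].

Definition linear_span (E : set H) : set H :=
  [set v | exists k (c : 'I_k -> R[i]) (u : 'I_k -> H),
    (forall i, E (u i)) /\ v = \sum_i c i *: u i].

Definition orthonormal_basis (I : eqType) (e : I -> H) V : Prop :=
  (forall k l, dot (e k) (e l) = (k == l)%:R) /\
  closure (linear_span (range e)) = V.

Definition normalized_tight_frame (I : choiceType) (e : I -> H) : Prop :=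
  forall v, (\esum_(k in [set: I]) (complex.Re (`|dot v (e k)| ^+ 2))%:E =
    (complex.Re (`|v| ^+ 2))%:E)%E.

End operators.

Definition has_dim (K : nzRingType) (V : lmodType K) (E : set V) (n : nat) : Prop :=
  exists b : 'I_n -> V,
    (forall c : 'I_n -> K, \sum_i c i *: b i = 0 -> forall i, c i = 0) /\
    E = [set v | exists c : 'I_n -> K, v = \sum_i c i *: b i].

(* The pair (U, pi) of a wavelet representation (H, U, pi). The operator pi f is
   only meaningful for f in L^infty of the circle; the axioms are gathered in
   wavelet_representation. *)
Record wavelet_data (R : realType) (H : innerProductType R) := WaveletData {
  wU : H -> H;
  wpi : (circle R -> R[i]) -> H -> H }.

Section wavelet.
Context (R : realType) (H : innerProductType R).
Implicit Types (W : wavelet_data H) (f g : circle R -> R[i]).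

(* A unital *-representation of L^infty of the circle; rep_ae says that pi f
   depends only on the a.e. class of f. *)
Record Linfty_representation (pi : (circle R -> R[i]) -> H -> H) : Prop := {
  rep_linear_op : forall f, Linfty f -> linear_op (pi f) /\ continuous (pi f);
  rep_ae : forall f g, Linfty f -> Linfty g ->
    circle_ae (fun z => f z = g z) -> pi f = pi g;
  rep_linear : forall a f g, Linfty f -> Linfty g ->
    forall v, pi (fun z => a * f z + g z) v = a *: pi f v + pi g v;
  rep_mul : forall f g, Linfty f -> Linfty g ->
    forall v, pi (fun z => f z * g z) v = pi f (pi g v);
  rep_one : forall v, pi (fun=> 1) v = v;
  rep_adj : forall f, Linfty f ->
    forall u v, dot (pi f u) v = dot u (pi (fun z => (f z)^*) v) }.

Record wavelet_representation (N : nat) W : Prop := {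
  wavelet_hilbert : hilbert_space H;
  wavelet_unitary : unitary_op (wU W);
  wavelet_rep : Linfty_representation (wpi W);
  wavelet_covariant : forall f, Linfty f -> forall v,
    wU W (wpi W f (op_inv (wU W) v)) = wpi W (fun z => f (circle_exp z N)) v }.

Definition wT W : H -> H := wpi W (@cval R).

Definition scaling_vector W f (phi : H) : Prop :=
  wU W phi = wpi W f phi /\
  ~ exists P : H -> H,
      [/\ orthogonal_projection P, P <> id,
          forall v, P (wU W v) = wU W (P v),
          forall g, Linfty g -> forall v, P (wpi W g v) = wpi W g (P v)
        & P phi = phi].

Definition mra_generator W (V : int -> set H) (phi : H) : Prop :=
  V 0 phi /\ orthonormal_basis (fun k : int => op_expz (wT W) k phi) (V 0).

Record mra W (V : int -> set H) : Prop := {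
  mra_closed : forall n, closed_subspace (V n);
  mra_incr : forall n, V n `<=` V (n + 1);
  mra_dense : closure (\bigcup_n V n) = setT;
  mra_trivial : \bigcap_n V n = [set 0];
  mra_dilation : forall n, wU W @` V n = V (n - 1);
  mra_basis : exists phi, mra_generator W V phi }.

Definition orthogonal_scaling_vector W (phi : H) : Prop :=
  exists V, mra W V /\ mra_generator W V phi.

End wavelet.

Definition dsum_wavelet (R : realType) (I : finType) (H : I -> innerProductType R)
    (W : forall i, wavelet_data (H i)) : wavelet_data (dsum H) :=
  WaveletData (fun (v : dsum H) i => wU (W i) (v i))
              (fun f (v : dsum H) i => wpi (W i) f (v i)).

Section classical.
Context (R : realType).
Local Notation leb := (@lebesgue_measure R).

Definition L2R : innerProductType R := L2 leb.

Definition fourier_integral (f : R -> R[i]) (x : R) : R[i] :=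
  cintegral leb (fun t => f t * cval (expNi (x * t))).

(* The Fourier transform on L^2: the L^2-limit of the Fourier integrals of the
   truncations of xi to [-n, n]. *)
Definition fourier (xi : L2R) : L2R :=
  lim ((fun n : nat => to_L2 leb (fourier_integral
    (fun t => if `|t| <= n%:R then L2_fun xi t else 0)) : L2R) @ \oo).

(* The vector of L^2 whose Fourier transform is g. *)
Definition fourier_inv (g : L2R) : L2R := xget 0 [set xi | fourier xi = g].

Definition dilation (N : nat) (xi : L2R) : L2R :=
  to_L2 leb (fun x => (Num.sqrt N%:R)^-1%:C * L2_fun xi (x / N%:R)).

Definition fourier_mult (f : circle R -> R[i]) (xi : L2R) : L2R :=
  fourier_inv (to_L2 leb (fun x => f (expNi x) * L2_fun (fourier xi) x)).

Definition classical_wavelet (N : nat) : wavelet_data L2R :=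
  WaveletData (dilation N) fourier_mult.

(* Cycles z_1, ..., z_p are indexed by 'I_p; ordS and ord_pred are the cyclic
   successor and predecessor, so the indices are read modulo p. *)
Definition cycle_space (p : nat) : innerProductType R := dsum (fun _ : 'I_p => L2R).

Definition cycle_wavelet (N p : nat) (z : 'I_p -> circle R) (alpha : 'I_p -> R[i]) :
    wavelet_data (cycle_space p) :=
  let W := classical_wavelet N in
  WaveletData
    (fun (xi : cycle_space p) k => alpha k *: wU W (xi (ordS k)))
    (fun f (xi : cycle_space p) k => wpi W (fun w => f (circle_mul (z k) w)) (xi k)).

End classical.

Section low_pass.
Context (R : realType) (N : nat) (m0 : circle R -> R[i]).

Definition sqrtN : R[i] := (Num.sqrt N%:R)%:C.

Definition transfer (f : circle R -> R[i]) (z : circle R) : R[i] :=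
  N%:R^-1 * \sum_(w \in [set w | circle_exp w N = z]) `|m0 w| ^+ 2 * f w.

Definition lipschitz_circle : Prop :=
  exists K : R, forall z w, `|m0 z - m0 w| <= K%:C * `|cval z - cval w|.

Definition m0_cycle_enum (p : nat) (z : 'I_p -> circle R) : Prop :=
  [/\ (0 < p)%N, injective z, forall k, circle_exp (z k) N = z (ordS k)
    & forall k, `|m0 (z k)| = sqrtN].

Definition m0_cycles : set (set (circle R)) :=
  [set C | exists p (z : 'I_p -> circle R), m0_cycle_enum z /\ C = range z].

(* The index k - l modulo p is iter l ord_pred k. *)
Definition phi_hat_partial (p : nat) (alpha : 'I_p -> R[i]) (theta : 'I_p -> R)
    (k : 'I_p) (x : R) (L : nat) : R[i]^o :=
  \prod_(1 <= l < L.+1)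
    ((alpha (iter l (@ord_pred p) k))^* *
     m0 (expNi (x / N%:R ^+ l + theta (iter l (@ord_pred p) k))) / sqrtN).

Definition phi_hat (p : nat) (alpha : 'I_p -> R[i]) (theta : 'I_p -> R)
    (k : 'I_p) (x : R) : R[i] :=
  lim (phi_hat_partial alpha theta k x @ \oo).

Definition cycle_phi (p : nat) (alpha : 'I_p -> R[i]) (theta : 'I_p -> R) :
    cycle_space R p :=
  fun k => fourier_inv (to_L2 (@lebesgue_measure R) (phi_hat alpha theta k)).

Definition transfer_fixed : set (circle R -> R[i]) :=
  [set h | continuous (h : circle R -> R[i]^o) /\ transfer h = h].

(* The point of index j is rho^j z, with rho = e^{2 pi i / N}. *)
Definition filter_matrix (m : nat -> circle R -> R[i]) (z : circle R) : 'M[R[i]]_N :=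
  \matrix_(i, j) (sqrtN^-1 *
    m i (circle_mul (circle_exp (expNi (- (2 * pi / N%:R))) j) z)).

End low_pass.

(* Main.v *)
Require Import Defs.
From HB Require Import structures.
From mathcomp Require Import all_boot all_order all_algebra complex.
From mathcomp Require Import all_classical all_reals all_analysis.
From mathcomp Require Import measurable_realfun ring lra zify.

Set Implicit Arguments.
Unset Strict Implicit.
Unset Printing Implicit Defensive.

Import Order.TTheory GRing.Theory Num.Theory.
Import numFieldNormedType.Exports.

Local Open Scope classical_set_scope.
Local Open Scope card_scope.
Local Open Scope complex_scope.
Local Open Scope ring_scope.

(* Let [w_j] be the square modulus of the Fourier transform of the component of [phi] attached
   to the cycle point [j] of angle [theta_j]. Truncating the infinite products at a large level
   [L] bounds the numbers [w_j(y - theta_j + 2 pi l)] by the weights of distinct [N^L]-th roots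
   of [e^{-iy}] under the [L]-step walk of transition probabilities [|m0|^2 / N]. Hence their sum
   [G(y)] over [j] and [l] is at most 1. Moreover [G >= R G], and [G] is lower semicontinuous, so
   the set where it is minimal is closed and stable under preimages of positive weight. Such a
   set contains a point of some cycle, whence [G = 1] when all the cycles are present. The same
   minimum principle shows that a continuous fixed point of [R] is determined by its values on
   the cycles, which gives the dimension of the eigenspace.

   Let [Q(v) = sum_k |<v, T^k phi>|^2]. If the Fourier transform of [v] is bounded with compact
   support away from 0, Parseval's identity on the circle writes [Q(v)] as the integral over a
   period of the square modulus of a finite sum. Cauchy-Schwarz and [G <= 1] give
   [Q(v) <= |v|^2]; [Q(U^n v)] tends to [|v|^2] because the supports shrink to 0, where the
   transform of [phi] is close to 1; and [Q(U^-n v)] tends to 0 because [w_j] is integrable. The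
   unitarity of the filter matrix gives [Q(v) = Q(U^-1 v) + sum |<v, U T^k psi_i>|^2], and
   telescoping along the powers of [U] gives the frame identity. A vector [v] orthogonal to all
   [U^n T^k phi] satisfies [Q(U^n v) = 0] for all [n], hence vanishes, so [phi] is cyclic. Finally
   [2 pi |phi|^2] is the integral of [G] over a period. If it is [2 pi], then [Q(phi) <= |phi|^2]
   makes the [T^k phi] orthonormal; and this happens exactly when all cycles are present, since
   an additional cycle would contribute a positive amount to [G <= 1]. *)

(** * Complex inner products *)

(** All estimates are made for an abstract finite set [J] of cycle points with its predecessor map,
    and for a Hilbert space tied to it by a [fourier_model]. They then serve three systems: the
    given cycles, all the cycles (for the eigenspace), and the given cycles enlarged by a missing
    one (for Cohen's condition).

    The function G is a supremum of finite sums of continuous functions: it is lower semicontinuous,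
    but its continuity is not known beforehand, hence a minimum principle for lower semicontinuous
    functions. The parts of G coming from single cycles become continuous, and fixed by R, once they
    are known to add up to 1.

    Test vectors are bounded on the Fourier side with support in an annulus. This keeps the sums
    over translates finite, and the class is dense and stable under all powers of [U]. The bound on
    Q makes Q continuous, which extends to all vectors what holds on this class.

    Parseval's identity rests on an explicit positive kernel sampled at finitely many nodes;
    Plancherel's identity is its average over translated grids; the Fourier transform is onto by the
    multiplication formula. *)

Section complex_facts.
Context {R : realType}.
Implicit Types z w : R[i].

(** The square modulus as an element of [R]. The norm of [R[i]] takes its values in [R[i]], while
    the sums, integrals and limits below are real. *)
Definition sqn z : R := complex.Re z ^+ 2 + complex.Im z ^+ 2.

Lemma sqn_ge0 z : 0 <= sqn z.
Proof. by rewrite addr_ge0 ?sqr_ge0. Qed.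

Lemma normc_sqn z : Normc.normc z ^+ 2 = sqn z.
Proof. exact: normc_sqr. Qed.

Lemma norm_normc z : `|z| = (Normc.normc z)%:C.
Proof. by case: z => a b; rewrite normc_def. Qed.

Lemma normc_ge0 z : 0 <= Normc.normc z.
Proof. by case: z => a b; exact: sqrtr_ge0. Qed.

Lemma normcE z : Normc.normc z = Num.sqrt (sqn z).
Proof. by case: z. Qed.

Lemma norm_sqn z : `|z| ^+ 2 = (sqn z)%:C.
Proof. by rewrite norm_normc -rmorphXn/= normc_sqn. Qed.

Lemma mul_conjc_sqn z : z * z^* = (sqn z)%:C.
Proof. by rewrite -norm_sqn normCK. Qed.

Lemma sqnM z w : sqn (z * w) = sqn z * sqn w.
Proof. by case: z w => a b [c d]; rewrite /sqn/=; ring. Qed.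

Lemma sqn_conj z : sqn z^* = sqn z.
Proof. by case: z => a b; rewrite /sqn/= sqrrN. Qed.

Lemma sqn0 : sqn 0 = 0. Proof. by rewrite /sqn/= expr0n/= addr0. Qed.
Lemma sqn1 : sqn 1 = 1. Proof. by rewrite /sqn/= expr0n/= addr0 expr1n. Qed.

Lemma sqn_real (a : R) : sqn a%:C = a ^+ 2.
Proof. by rewrite /sqn/= expr0n/= addr0. Qed.

Lemma sqn_eq0 z : sqn z = 0 -> z = 0.
Proof.
case: z => a b; rewrite /sqn/= => /eqP; rewrite paddr_eq0 ?sqr_ge0// !sqrf_eq0.
by move=> /andP[/eqP -> /eqP ->].
Qed.

Lemma sqn_norm1 z : `|z| = 1 -> sqn z = 1.
Proof. by move=> z1; move: (norm_sqn z); rewrite z1 expr1n => -[]. Qed.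

Lemma sqnN z : sqn (- z) = sqn z.
Proof. by case: z => a b; rewrite /sqn/= !sqrrN. Qed.

Lemma sqnD_le2 z w : sqn (z + w) <= 2 * sqn z + 2 * sqn w.
Proof.
case: z w => a b [c d]; rewrite /sqn/=.
have := sqr_ge0 (a - c); have := sqr_ge0 (b - d); nra.
Qed.

(** The difference of the two sides is [t |z - w / t|^2]. A small weight [t] keeps the coefficient
    of [z] near 1, as the continuity of quadratic forms requires. *)
Lemma sqnD_le z w (t : R) : 0 < t ->
  sqn (z + w) <= (1 + t) * sqn z + (1 + t^-1) * sqn w.
Proof.
move=> t0; case: z w => a b [c d]; rewrite /sqn/=.
rewrite -subr_ge0 (_ : _ - _ = t * (a - t^-1 * c) ^+ 2 + t * (b - t^-1 * d) ^+ 2).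
  by rewrite addr_ge0// mulr_ge0 ?sqr_ge0// ltW.
by field; rewrite gt_eqF.
Qed.

Lemma Re_normsq z : complex.Re (`|z| ^+ 2) = sqn z.
Proof. by rewrite norm_sqn. Qed.

Lemma normc_lt_sqn z (e : R) : 0 <= e -> (`|z| < e%:C) = (sqn z < e ^+ 2).
Proof.
move=> e0; rewrite norm_normc ltcR -normc_sqn.
by rewrite ltr_sqr// ?nnegrE ?normc_ge0.
Qed.

Lemma sqn_prod (I : Type) (s : seq I) (P : pred I) (F : I -> R[i]) :
  sqn (\prod_(i <- s | P i) F i) = \prod_(i <- s | P i) sqn (F i).
Proof. by elim/big_rec2 : _ => [|i y1 y2 _ <-]; rewrite ?sqn1 ?sqnM. Qed.

Lemma gt0_complex (e : R[i]) : 0 < e -> exists2 r : R, 0 < r & e = r%:C.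
Proof. by case: e => a b; rewrite ltcE/= => /andP[/eqP -> a0]; exists a. Qed.

Lemma sqn_sum_CS (I : Type) (s : seq I) (P : pred I) (F G : I -> R[i]) :
  sqn (\sum_(i <- s | P i) F i * G i) <=
  (\sum_(i <- s | P i) sqn (F i)) * (\sum_(i <- s | P i) sqn (G i)).
Proof.
elim: s => [|i s IH]; first by rewrite !big_nil sqn0 mulr0.
rewrite !big_cons; case: ifP => // Pi.
set A := \sum_(j <- s | P j) sqn (F j) in IH *.
set B := \sum_(j <- s | P j) sqn (G j) in IH *.
set X := \sum_(j <- s | P j) F j * G j in IH *.
have A0 : 0 <= A by apply: sumr_ge0 => j _; exact: sqn_ge0.
have B0 : 0 <= B by apply: sumr_ge0 => j _; exact: sqn_ge0.
have f0 := sqn_ge0 (F i); have g0 := sqn_ge0 (G i).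
have [A00|An] := eqVneq A 0.
  have /sqn_eq0 -> : sqn X = 0.
    by apply/eqP; rewrite eq_le sqn_ge0 andbT (le_trans IH)// A00 mul0r.
  by rewrite addr0 sqnM A00 addr0 ler_wpM2l// lerDl.
have [F0|Fn] := eqVneq (sqn (F i)) 0.
  rewrite (sqn_eq0 F0) mul0r sqn0 !add0r (le_trans IH)//.
  by rewrite ler_wpM2l// lerDr.
have Ap : 0 < A by rewrite lt0r An.
have Fp : 0 < sqn (F i) by rewrite lt0r Fn.
(* The weight [A / |F i|^2] is the one for which the two terms recombine into the product of the
   sums. *)
apply: le_trans (sqnD_le _ _ (divr_gt0 Ap Fp)) _.
rewrite sqnM invf_div.
apply: (@le_trans _ _ ((1 + A / sqn (F i)) * (sqn (F i) * sqn (G i)) +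
  (1 + sqn (F i) / A) * (A * B))).
  by rewrite lerD2l ler_wpM2l// addr_ge0// divr_ge0.
rewrite le_eqVlt; apply/orP; left; apply/eqP; field.
by rewrite An Fn.
Qed.

End complex_facts.

Section hilbert.
Context {R : realType} {H : innerProductType R}.
Implicit Types (u v w : H) (a : R[i]).

Lemma dotDl u v w : dot (u + v) w = dot u w + dot v w.
Proof. by rewrite -{1}[u]scale1r dot_linear mul1r. Qed.
Lemma dot0l w : dot 0 w = 0.
Proof. by apply: (addIr (dot 0 w)); rewrite -dotDl !add0r. Qed.
Lemma dotZl a u w : dot (a *: u) w = a * dot u w.
Proof. by rewrite -[a *: u]addr0 dot_linear dot0l addr0. Qed.
Lemma dotDr u v w : dot w (u + v) = dot w u + dot w v.
Proof. by rewrite dotC dotDl rmorphD/= -!dotC. Qed.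
Lemma dotZr a u w : dot w (a *: u) = a^* * dot w u.
Proof. by rewrite dotC dotZl rmorphM/= -!dotC. Qed.
Lemma dot0r w : dot w 0 = 0.
Proof. by rewrite dotC dot0l rmorph0. Qed.
Lemma dotNl u w : dot (- u) w = - dot u w.
Proof. by rewrite -scaleN1r dotZl mulN1r. Qed.
Lemma dotNr u w : dot w (- u) = - dot w u.
Proof. by rewrite dotC dotNl rmorphN/= -dotC. Qed.
Lemma dotBl u v w : dot (u - v) w = dot u w - dot v w.
Proof. by rewrite dotDl dotNl. Qed.
Lemma dotBr u v w : dot w (u - v) = dot w u - dot w v.
Proof. by rewrite dotDr dotNr. Qed.
Lemma dot_suml (I : Type) (s : seq I) (P : pred I) (F : I -> H) w :
  dot (\sum_(i <- s | P i) F i) w = \sum_(i <- s | P i) dot (F i) w.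
Proof. by elim/big_rec2 : _ => [|i x y _ <-]; rewrite ?dot0l ?dotDl. Qed.
Lemma dot_sumr (I : Type) (s : seq I) (P : pred I) (F : I -> H) w :
  dot w (\sum_(i <- s | P i) F i) = \sum_(i <- s | P i) dot w (F i).
Proof. by elim/big_rec2 : _ => [|i x y _ <-]; rewrite ?dot0r ?dotDr. Qed.

(* The norm of an [R[i]]-module takes values in [R[i]]; [hn] is its real value. *)
Definition hn u : R := complex.Re `|u|.

Lemma hnE u : `|u| = (hn u)%:C.
Proof. by have := normr_ge0 u; rewrite /hn lecE => /andP[/eqP]; case: `|u| => a b /= ->. Qed.
Lemma hn_ge0 u : 0 <= hn u.
Proof. by have := normr_ge0 u; rewrite /hn lecE => /andP[]. Qed.
Lemma dotuu u : dot u u = (hn u ^+ 2)%:C.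
Proof. by rewrite dot_norm hnE rmorphXn. Qed.
Lemma hn0 : hn 0 = 0. Proof. by rewrite /hn normr0. Qed.
Lemma hn_eq0 u : hn u = 0 -> u = 0.
Proof. by move=> h; apply/eqP; rewrite -normr_eq0 hnE h. Qed.
Lemma hnD u v : hn (u + v) <= hn u + hn v.
Proof. by have := ler_normD u v; rewrite !hnE -rmorphD lecR. Qed.
Lemma hnN u : hn (- u) = hn u. Proof. by rewrite /hn normrN. Qed.
Lemma hnBC u v : hn (u - v) = hn (v - u). Proof. by rewrite -hnN opprB. Qed.
Lemma hnZ a u : hn (a *: u) = Normc.normc a * hn u.
Proof.
have := normrZ a u; rewrite !hnE norm_normc -rmorphM/= => /(congr1 (@complex.Re R)).
by [].
Qed.
Lemma hn_dist u v : hn u <= hn v + hn (u - v).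
Proof. by rewrite -{1}(subrKC v u) hnD. Qed.
Lemma hn2E u : hn u ^+ 2 = complex.Re (dot u u). Proof. by rewrite dotuu. Qed.
Lemma hn2Z a u : hn (a *: u) ^+ 2 = sqn a * hn u ^+ 2.
Proof. by rewrite hnZ exprMn normc_sqn. Qed.

Lemma hn2D u v : hn (u + v) ^+ 2 = hn u ^+ 2 + hn v ^+ 2 + 2 * complex.Re (dot u v).
Proof.
rewrite !hn2E dotDl !dotDr !raddfD/= (dotC u v).
by case: (dot u v) => a b /=; ring.
Qed.

Lemma dot_CS u v : sqn (dot u v) <= hn u ^+ 2 * hn v ^+ 2.
Proof.
have [v0|v0] := eqVneq (hn v) 0.
  by rewrite (hn_eq0 v0) dot0r sqn0 hn0 expr0n/= mulr0.
have vp : 0 < hn v ^+ 2 by rewrite exprn_gt0// lt0r v0 hn_ge0.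
have := sqr_ge0 (hn (u + (- (dot u v / (hn v ^+ 2)%:C)) *: v)).
rewrite hn2D hn2Z dotZr sqnN sqnM.
have -> : sqn ((hn v ^+ 2)%:C^-1) = (hn v ^+ 2)^-1 ^+ 2.
  by rewrite -fmorphV/= sqn_real.
rewrite rmorphN rmorphM/= -fmorphV/=.
have -> : complex.Re (- (conjc (dot u v) * conjc (hn v ^+ 2)^-1%:C) * dot u v) =
   - (sqn (dot u v) / hn v ^+ 2).
  by case: (dot u v) => a b; rewrite /sqn/=; ring.
set X := sqn _; set Y := hn v ^+ 2 in vp *; set Z := hn u ^+ 2.
have -> : Z + X * Y^-1 ^+ 2 * Y + 2 * - (X / Y) = Z - X / Y.
  by field; rewrite gt_eqF.
by rewrite subr_ge0 ler_pdivrMr.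
Qed.

End hilbert.

Section hilbert_topology.
Context {R : realType} {H : innerProductType R}.
Implicit Types (u v w : H) (a : R[i]).

Lemma cvg_hnP (u : nat -> H) l :
  u @ \oo --> l <-> (hn (u n - l) @[n --> \oo] --> (0 : R)).
Proof.
split.
  move/cvgrPdist_lt => h; apply/cvgrPdist_lt => e e0.
  have : 0 < e%:C by rewrite ltcR.
  move/h; apply: filterS => n; rewrite hnE ltcR sub0r normrN ger0_norm ?hn_ge0//.
  by rewrite hnBC.
move/cvgrPdist_lt => h; apply/cvgrPdist_lt => e /gt0_complex[r r0 ->].
move/h: r0; apply: filterS => n; rewrite hnE ltcR sub0r normrN ger0_norm ?hn_ge0//.
by rewrite hnBC.
Qed.

Lemma closure_hnP (E : set H) v :
  closure E v <-> forall e : R, 0 < e -> exists2 w, E w & hn (v - w) < e.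
Proof.
split=> [cE e e0|h B /nbhs_ballP[r /= r0 rB]].
  have [|w [Ew]] := cE (ball v e%:C); first by apply: nbhsx_ballx; rewrite ltcR.
  by rewrite -ball_normE /= hnE ltcR; exists w.
case/gt0_complex: r0 rB => r' r'0 -> rB.
have [w Ew vw] := h _ r'0; exists w; split => //; apply: rB.
by rewrite -ball_normE /= hnE ltcR.
Qed.

Lemma closure_hn_seq (E : set H) v : closure E v ->
  exists w : nat -> H, (forall n, E (w n)) /\ w @ \oo --> v.
Proof.
move=> /closure_hnP cv.
have h n : exists w, E w /\ hn (v - w) < n.+1%:R^-1.
  have /cv[w Ew wv] : 0 < n.+1%:R^-1 :> R by rewrite invr_gt0.
  by exists w.
have [w wP] := choice h; exists w; split; first by move=> n; have [] := wP n.
apply/cvg_hnP/cvgrPdist_lt => eps e0.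
have := @cvg_harmonic R; move/cvgrPdist_lt => /(_ _ e0).
apply: filterS => n; rewrite !sub0r !normrN /= ger0_norm// ger0_norm ?hn_ge0// hnBC.
by move=> hh; rewrite (lt_trans _ hh)// (wP n).2.
Qed.

Lemma closed_hnP (E : set H) :
  (forall v, (forall e : R, 0 < e -> exists2 w, E w & hn (v - w) < e) -> E v) -> closed E.
Proof. by move=> h v /closure_hnP; exact: h. Qed.

(** Balls of radius [2^-n / 4] belonging to the Cauchy filter have centres whose consecutive
    distances are at most [2^-n]; the limit of the centres is the limit of the filter. *)
Lemma hilbert_of_seq :
  (forall u : nat -> H, (forall n, hn (u n.+1 - u n) <= 2^-1 ^+ n) ->
    exists l : H, u @ \oo --> l) -> hilbert_space H.
Proof.
move=> h F FF /cauchyP Fc.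
have F1 n : exists x, F (ball x (((2^-1 ^+ n / 4) : R)%:C)).
  by apply: Fc; rewrite ltcR divr_gt0// exprn_gt0.
have [x Hx] := choice F1.
have dd n m y : ball (x n) ((2^-1 ^+ n / 4) : R)%:C y -> ball (x m) ((2^-1 ^+ m / 4) : R)%:C y ->
    hn (x m - x n) < (2^-1 ^+ n + 2^-1 ^+ m) / 4.
  rewrite -!ball_normE /= !hnE !ltcR => h1 h2.
  rewrite -(subrK y (x m)) -addrA (le_lt_trans (hnD _ _))// [y - x n]addrC mulrDl.
  by rewrite [- x n + y]addrC (hnBC y) addrC ltrD.
have [l xl] : exists l : H, x @ \oo --> l.
  apply: h => n.
  have [y [y1 y2]] := @filter_ex _ F _ _ (filterI (Hx n) (Hx n.+1)).
  apply: le_trans (ltW (dd _ _ _ y1 y2)) _.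
  have : 0 < (2^-1 : R) ^+ n by rewrite exprn_gt0.
  rewrite exprS; lra.
apply/cvg_ex; exists l; apply/cvgrPdist_lt => e /gt0_complex[r r0 ->].
move/cvg_hnP/cvgrPdist_lt : xl => /(_ (r / 2)) []; first by rewrite divr_gt0.
move=> N1 _ N1P.
have [N2 _ N2P] : \forall n \near \oo, (2^-1 : R) ^+ n < r / 2.
  have /cvgrPdist_lt/(_ (r / 2)) : (2^-1 : R) ^+ n @[n --> \oo] --> (0 : R).
    by apply: cvg_expr; rewrite ger0_norm// invf_lt1// ltr1n.
  move=> /(_ (divr_gt0 r0 _)) []// N _ NP; exists N => // n /NP.
  by rewrite sub0r normrN ger0_norm// exprn_ge0.
pose n := maxn N1 N2.
apply: filterS (Hx n) => y.
rewrite -ball_normE /= !hnE !ltcR => xy.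
have := N1P n (leq_maxl _ _); have := N2P n (leq_maxr _ _) => /= h2.
rewrite sub0r normrN ger0_norm ?hn_ge0// => h1.
rewrite -(subrK (x n) l) -addrA (le_lt_trans (hnD _ _))// hnBC.
have : 0 < (2^-1 : R) ^+ n by rewrite exprn_gt0.
lra.
Qed.

Lemma continuous_of_bound (A : H -> H) (C : R) : linear_op A ->
  (forall v, hn (A v) <= C * hn v) -> continuous A.
Proof.
move=> lA bA v; apply/cvgrPdist_lt => e /gt0_complex[r r0 ->].
have C1 : 0 < `|C| + 1 by rewrite ltr_wpDl.
have : 0 < (r / (`|C| + 1))%:C by rewrite ltcR divr_gt0.
move/nbhsx_ballx => /(_ _ v); apply: filterS => w.
rewrite -ball_normE /= !hnE !ltcR => vw.
have -> : A v - A w = A (v - w).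
  by rewrite -scaleN1r addrC -lA scaleN1r addrC.
rewrite (le_lt_trans (bA _))// (@le_lt_trans _ _ ((`|C| + 1) * hn (v - w)))//.
  by rewrite ler_wpM2r ?hn_ge0// (le_trans (ler_norm _))// lerDl.
by rewrite mulrC -ltr_pdivlMr.
Qed.

End hilbert_topology.

(** * Linear and unitary operators *)

Section operators.
Context {R : realType} {H : innerProductType R}.
Implicit Types (A : H -> H) (u v w : H).

Lemma linear_opD A u v : linear_op A -> A (u + v) = A u + A v.
Proof. by move=> lA; rewrite -{1}[u]scale1r lA scale1r. Qed.
Lemma linear_op0 A : linear_op A -> A 0 = 0.
Proof. by move=> lA; apply: (addIr (A 0)); rewrite -linear_opD// !add0r. Qed.
Lemma linear_opZ A a u : linear_op A -> A (a *: u) = a *: A u.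
Proof. by move=> lA; rewrite -[a *: u]addr0 lA linear_op0// addr0. Qed.
Lemma linear_opB A u v : linear_op A -> A (u - v) = A u - A v.
Proof. by move=> lA; rewrite linear_opD// -scaleN1r linear_opZ// scaleN1r. Qed.
Lemma linear_op_sum A (I : Type) (s : seq I) (P : pred I) (F : I -> H) : linear_op A ->
  A (\sum_(i <- s | P i) F i) = \sum_(i <- s | P i) A (F i).
Proof.
by move=> lA; elim/big_rec2 : _ => [|i x y _ <-]; rewrite ?linear_op0 ?linear_opD.
Qed.

(** Polarization: the norm of a sum gives the real part, and replacing [u] by [i u] the imaginary
    part. *)
Lemma dot_of_hn A : linear_op A -> forall C : R, (forall u, hn (A u) ^+ 2 = C * hn u ^+ 2) ->
  forall u v, dot (A u) (A v) = C%:C * dot u v.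
Proof.
move=> lA C nA u v.
have ReE x y : complex.Re (dot (A x) (A y)) = C * complex.Re (dot x y).
  have := nA (x + y); rewrite (linear_opD _ _ lA) !hn2D !nA; lra.
have := ReE u v; have := ReE ('i *: u) v.
rewrite linear_opZ// !dotZl; case: (dot (A u) (A v)) (dot u v) => a b [c d] /= h1 h2.
apply/eqP; rewrite eq_complex/=; apply/andP; split; apply/eqP; lra.
Qed.

Section unitary.
Variable A : H -> H.
Hypothesis uA : unitary_op A.
Let lA : linear_op A. Proof. by case: uA. Qed.
Let dA u v : dot (A u) (A v) = dot u v. Proof. by case: uA => _ + _; apply. Qed.

Lemma unitary_hn v : hn (A v) = hn v.
Proof.
have : hn (A v) ^+ 2 = hn v ^+ 2 by rewrite !hn2E dA.
by move/eqP; rewrite eqrXn2 ?hn_ge0// => /eqP.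
Qed.

Lemma unitary_inj : injective A.
Proof.
move=> u v e; apply/eqP; rewrite -subr_eq0; apply/eqP/hn_eq0.
by rewrite -unitary_hn linear_opB// e subrr hn0.
Qed.

Lemma op_invK v : A (op_inv A v) = v.
Proof.
have [_ _ sA] := uA.
have : range A v by rewrite sA.
case=> w _ wv; rewrite /op_inv.
by case: xgetP => //= /(_ w).
Qed.

Lemma op_invKl v : op_inv A (A v) = v.
Proof. by apply: unitary_inj; rewrite op_invK. Qed.

Lemma op_inv_unitary : unitary_op (op_inv A).
Proof.
split.
- by move=> a u v; apply: unitary_inj; rewrite lA !op_invK.
- by move=> u v; rewrite -dA !op_invK.
- by apply/seteqP; split => // v _; exists (A v) => //; rewrite op_invKl.
Qed.

End unitary.

Lemma unitary_iter A n : unitary_op A -> unitary_op (iter n A).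
Proof.
move=> uA; elim: n => [|n [l d s]] /=.
  by split => //; apply/seteqP; split => // v _; exists v.
have [lA dA sA] := uA; split.
- by move=> a u v /=; rewrite l lA.
- by move=> u v /=; rewrite dA d.
- apply/seteqP; split => // v _.
  have [w _ <-] : range A v by rewrite sA.
  have [x _ <-] : range (iter n A) w by rewrite s.
  by exists x.
Qed.

Lemma op_expz_unitary A j : unitary_op A -> unitary_op (op_expz A j).
Proof.
move=> uA; case: j => n; first exact: unitary_iter.
exact/unitary_iter/op_inv_unitary.
Qed.

Lemma op_expzS A j v : unitary_op A -> op_expz A (j + 1) v = A (op_expz A j v).
Proof.
move=> uA; case: j => n; first by rewrite -PoszD addn1.
case: n => [|n]; first by rewrite /= op_invK.
by rewrite (_ : Negz n.+1 + 1 = Negz n); [rewrite /= op_invK|lia].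
Qed.

Lemma op_expzP A j v : unitary_op A -> op_expz A (j - 1) v = op_inv A (op_expz A j v).
Proof. by move=> uA; rewrite -{2}(subrK 1 j) op_expzS// op_invKl. Qed.

Lemma op_expzSr A j v : unitary_op A -> op_expz A (j + 1) v = op_expz A j (A v).
Proof.
move=> uA; case: j => n; first by rewrite -PoszD addn1 [LHS]iterSr.
case: n => [|n]; first by rewrite /= op_invKl.
rewrite (_ : Negz n.+1 + 1 = Negz n); last lia.
rewrite [RHS](_ : _ = iter n.+2 (op_inv A) (A v))// [RHS]iterSr op_invKl//.
Qed.

Lemma dot_op_expz A j u v : unitary_op A -> dot u (op_expz A j v) = dot (op_expz A (- j) u) v.
Proof.
move=> uA; have uj := op_expz_unitary j uA.
have K w : op_expz A (- j) (op_expz A j w) = w.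
  elim/int_ind: j {uj} w => [|n IH|n IH] w //.
    rewrite [X in op_expz A X w](_ : _ = n%:Z + 1); last lia.
    rewrite op_expzS// -op_expzSr//.
    by rewrite (_ : - n.+1%:Z + 1 = - n%:Z) ?IH//; lia.
  rewrite opprK [X in op_expz A X _](_ : _ = n%:Z + 1); last lia.
  rewrite op_expzSr// -op_expzS//.
  by have := IH w; rewrite opprK (_ : - n.+1%:Z + 1 = - n%:Z) //; lia.
have uj' := op_expz_unitary (- j) uA.
by have [_ d _] := uj'; rewrite -d K.
Qed.

End operators.

(** * Quadratic forms attached to families of vectors *)
Section esum_facts.
Context {R : realType} {I : choiceType}.
Implicit Types a b : I -> R.

(** Unordered sums are handled through duplicate-free lists: an upper bound is tested on all of
    them, a strict lower bound is witnessed by one. *)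
Lemma esum_seq_le a (s : seq I) : (forall k, 0 <= a k) -> uniq s ->
  ((\sum_(k <- s) a k)%:E <= \esum_(k in [set: I]) (a k)%:E)%E.
Proof.
move=> a0 us; apply: esum_ge; exists [set` s].
  by split => //; exact: finite_seq.
by rewrite -fsbig_seq// -sumEFin.
Qed.

Lemma esum_le_seq a (M : \bar R) : (forall s, uniq s -> ((\sum_(k <- s) a k)%:E <= M)%E) ->
  (\esum_(k in [set: I]) (a k)%:E <= M)%E.
Proof.
move=> h; apply: ge_ereal_sup => _ [A [fA _] <-].
by rewrite fsbig_finite//= sumEFin h.
Qed.

Lemma esum_leP a (M : \bar R) : (forall k, 0 <= a k) ->
  (\esum_(k in [set: I]) (a k)%:E <= M)%E <->
  (forall s, uniq s -> ((\sum_(k <- s) a k)%:E <= M)%E).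
Proof.
move=> a0; split; last exact: esum_le_seq.
by move=> h s us; apply: le_trans h; exact: esum_seq_le.
Qed.

Lemma esum_gt_seq a (M : \bar R) : (M < \esum_(k in [set: I]) (a k)%:E)%E ->
  exists2 s, uniq s & (M < (\sum_(k <- s) a k)%:E)%E.
Proof.
move=> h; apply: contrapT => h'; move: h; rewrite ltNge => /negP; apply.
apply: esum_le_seq => s us; rewrite leNgt; apply/negP => hs.
by apply: h'; exists s.
Qed.

Lemma esum_ltyP a M : (forall k, 0 <= a k) ->
  (\esum_(k in [set: I]) (a k)%:E <= M%:E)%E ->
  (\esum_(k in [set: I]) (a k)%:E)%E = (fine (\esum_(k in [set: I]) (a k)%:E))%:E.
Proof.
move=> a0 h; rewrite fineK// ge0_fin_numE ?(le_lt_trans h) ?ltry//.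
by apply: esum_ge0 => k _; rewrite lee_fin.
Qed.

End esum_facts.

Lemma ler_sum_subseq (R : realType) (I : eqType) (a : I -> R) (s t : seq I) :
  uniq s -> uniq t -> {subset s <= t} -> (forall k, 0 <= a k) ->
  \sum_(k <- s) a k <= \sum_(k <- t) a k.
Proof.
move=> us ut st a0; rewrite [leRHS](bigID (mem s))/=.
have p : perm_eq [seq x <- t | x \in s] s.
  apply: uniq_perm => //; first exact: filter_uniq.
  by move=> x; rewrite mem_filter; apply: andb_idr; exact: st.
by rewrite -[X in _ <= X + _]big_filter (perm_big _ p)/= lerDl sumr_ge0.
Qed.

Section quadratic.
Context {R : realType} {H : innerProductType R} {I : choiceType}.
Variable e : I -> H.
Implicit Types (u v w : H).

(** The quadratic form Q of the family [e], with values in the extended reals. [Qr] is its real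
    value, faithful once the bound [Qb] below excludes infinite sums. *)
Definition Qe v : \bar R := \esum_(k in [set: I]) (sqn (dot v (e k)))%:E.
Definition Qr v : R := fine (Qe v).

Lemma Qe_ge0 v : (0 <= Qe v)%E.
Proof. by apply: esum_ge0 => k _; rewrite lee_fin sqn_ge0. Qed.

Lemma cvg_dotl (w : nat -> H) v x : w @ \oo --> v ->
  sqn (dot (w n) x) @[n --> \oo] --> sqn (dot v x).
Proof.
move/cvg_hnP => wv.
have wx : hn (w n - v) * hn x @[n --> \oo] --> (0 : R).
  by rewrite -[0](mul0r (hn x)); apply: cvgM => //; exact: cvg_cst.
have bnd (z : R[i]) : `|complex.Re z| <= Num.sqrt (sqn z) /\ `|complex.Im z| <= Num.sqrt (sqn z).
  case: z => a b; rewrite /sqn/=; split.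
    by rewrite -sqrtr_sqr ler_sqrt ?lerDl ?addr_ge0 ?sqr_ge0.
  by rewrite -[leLHS]sqrtr_sqr ler_sqrt ?lerDr ?addr_ge0 ?sqr_ge0.
have dn n : Num.sqrt (sqn (dot (w n - v) x)) <= hn (w n - v) * hn x.
  rewrite -[leRHS]ger0_norm ?mulr_ge0 ?hn_ge0// -[leRHS]sqrtr_sqr ler_sqrt ?sqr_ge0//.
  by rewrite exprMn dot_CS.
have sq0 (f : nat -> R) l : (forall n, `|f n - l| <= hn (w n - v) * hn x) -> f @ \oo --> l.
  move=> fl; apply/cvgrPdist_le => eps e0.
  move/cvgrPdist_le : wx => /(_ _ e0); apply: filterS => n.
  rewrite sub0r normrN ger0_norm ?mulr_ge0 ?hn_ge0// => h.
  by rewrite distrC (le_trans (fl n)).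
rewrite /sqn.
have cre : complex.Re (dot (w n) x) @[n --> \oo] --> complex.Re (dot v x).
  apply: sq0 => n; apply: le_trans (dn n).
  by rewrite dotBl; have [+ _] := bnd (dot (w n) x - dot v x); rewrite raddfB.
have cim : complex.Im (dot (w n) x) @[n --> \oo] --> complex.Im (dot v x).
  apply: sq0 => n; apply: le_trans (dn n).
  by rewrite dotBl; have [_] := bnd (dot (w n) x - dot v x); rewrite raddfB.
by apply: cvgD; rewrite ?expr2; apply: cvgM.
Qed.

Lemma cvg_hn (w : nat -> H) v : w @ \oo --> v -> hn (w n) @[n --> \oo] --> hn v.
Proof.
move/cvg_hnP/cvgrPdist_le => wv; apply/cvgrPdist_le => eps e0.
move: (wv _ e0); apply: filterS => n; rewrite sub0r normrN ger0_norm ?hn_ge0//.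
apply: le_trans; rewrite ler_norml lerBrDr lerBlDr.
have := hn_dist (w n) v; have := hn_dist v (w n); rewrite (hnBC v).
move=> h1 h2; apply/andP; split; lra.
Qed.

Definition dense_in (D : set H) := forall v (eps : R), 0 < eps -> exists2 w, D w & hn (v - w) < eps.

Lemma dense_seq D v : dense_in D -> exists w : nat -> H, (forall n, D (w n)) /\ w @ \oo --> v.
Proof. by move=> dD; apply: closure_hn_seq; apply/closure_hnP => eps; exact: dD. Qed.

(** Each finite partial sum is continuous in the vector, so the bound passes to limits before the
    supremum is taken. *)
Lemma Qe_bounded D : dense_in D -> (forall w, D w -> (Qe w <= (hn w ^+ 2)%:E)%E) ->
  forall v, (Qe v <= (hn v ^+ 2)%:E)%E.
Proof.
move=> dD hD v; have [w [Dw wv]] := dense_seq v dD.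
apply: esum_le_seq => s us; rewrite lee_fin.
have c1 : \sum_(k <- s) sqn (dot (w n) (e k)) @[n --> \oo] --> \sum_(k <- s) sqn (dot v (e k)).
  elim: s {us} => [|k s IH]; first by under eq_fun do rewrite big_nil; rewrite big_nil; exact: cvg_cst.
  under eq_fun do rewrite big_cons; rewrite big_cons; apply: cvgD => //; exact: cvg_dotl.
have c2 : hn (w n) ^+ 2 @[n --> \oo] --> hn v ^+ 2.
  by rewrite expr2; apply: cvgM; exact: cvg_hn.
apply: (ler_cvg_to c1 c2); apply: nearW => n; have := hD _ (Dw n).
by move=> /esum_leP -/(_ (fun k => sqn_ge0 _) _ us); rewrite lee_fin.
Qed.

Hypothesis Qb : forall v, (Qe v <= (hn v ^+ 2)%:E)%E.

Lemma QeE v : Qe v = (Qr v)%:E.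
Proof. exact: esum_ltyP (fun k => sqn_ge0 _) (Qb v). Qed.

Lemma Qr_le v : Qr v <= hn v ^+ 2.
Proof. by have := Qb v; rewrite QeE lee_fin. Qed.

Lemma Qr_ge0 v : 0 <= Qr v.
Proof. by have := Qe_ge0 v; rewrite QeE lee_fin. Qed.

Lemma Qr_seq v s : uniq s -> \sum_(k <- s) sqn (dot v (e k)) <= Qr v.
Proof.
move=> us; rewrite -lee_fin -QeE; apply: esum_seq_le => // k; exact: sqn_ge0.
Qed.

Lemma Qr_leP v M : (forall s, uniq s -> \sum_(k <- s) sqn (dot v (e k)) <= M) -> Qr v <= M.
Proof. by move=> h; rewrite -lee_fin -QeE; apply: esum_le_seq => s /h; rewrite lee_fin. Qed.

Lemma Qr_D u v t : 0 < t -> Qr (u + v) <= (1 + t) * Qr u + (1 + t^-1) * Qr v.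
Proof.
move=> t0; apply: Qr_leP => s us.
apply: (@le_trans _ _ ((1 + t) * \sum_(k <- s) sqn (dot u (e k)) +
   (1 + t^-1) * \sum_(k <- s) sqn (dot v (e k)))).
  rewrite !mulr_sumr -big_split; apply: ler_sum => k _.
  by rewrite dotDl sqnD_le.
by apply: lerD; rewrite ler_wpM2l ?Qr_seq// addr_ge0// ltW// invr_gt0.
Qed.

Lemma Qr_Z a u : Qr (a *: u) = sqn a * Qr u.
Proof.
rewrite /Qr /Qe.
have aux b v : Qr (b *: v) <= sqn b * Qr v.
  apply: Qr_leP => s us; under eq_bigr do rewrite dotZl sqnM.
  by rewrite -mulr_sumr ler_wpM2l ?sqn_ge0 ?Qr_seq.
have [->|a0] := eqVneq a 0.
  rewrite sqn0 mul0r; apply/eqP; rewrite eq_le Qr_ge0 andbT.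
  by rewrite (le_trans (aux _ _))// sqn0 mul0r.
apply/eqP; rewrite eq_le aux/=.
(* The inequality [aux] for [a^-1], applied to [a *: u], gives the reverse inequality. *)
have := aux a^-1 (a *: u); rewrite scalerA mulVf// scale1r => h.
apply: le_trans (ler_wpM2l (sqn_ge0 a) h) _.
by rewrite mulrA -sqnM mulfV// sqn1 mul1r.
Qed.

(** [Qr_D] compares the two values in both directions; a weight of the order of the distance makes
    both error terms vanish. *)
Lemma Qr_cvg (w : nat -> H) v : w @ \oo --> v -> Qr (w n) @[n --> \oo] --> Qr v.
Proof.
move=> wv; have hwv := cvg_hn wv; move/cvg_hnP : (wv) => dwv.
(* The summand [1 / (n + 1)] keeps the weight positive when [w n = v]. *)
pose d n := hn (w n - v) + n.+1%:R^-1.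
have d0 n : 0 < d n by rewrite ltr_wpDl ?hn_ge0// invr_gt0.
have dc : d @ \oo --> (0 : R).
  by rewrite -[0 in X in _ --> X](addr0 0); apply: cvgD => //; exact: cvg_harmonic.
have key x y n : hn (x - y) <= d n -> Qr x <= Qr y + d n * hn y ^+ 2 + d n ^+ 2 + d n.
  move=> xy.
  have := Qr_D y (x - y) (d0 n); rewrite subrKC => h; apply: le_trans h _.
  rewrite mulrDl mul1r -!addrA lerD2l; apply: lerD.
    by rewrite ler_wpM2l ?Qr_le// ltW.
  apply: (@le_trans _ _ ((1 + (d n)^-1) * d n ^+ 2)).
    rewrite ler_wpM2l//; first by rewrite addr_ge0// ltW// invr_gt0.
    by rewrite (le_trans (Qr_le _))// ler_sqr ?nnegrE ?hn_ge0// ltW.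
  by rewrite mulrDl mul1r expr2 mulKf// gt_eqF.
pose B n := d n * hn (w n) ^+ 2 + d n * hn v ^+ 2 + d n ^+ 2 + d n.
have Bc : B @ \oo --> (0 : R).
  have -> : 0 = 0 * hn v ^+ 2 + 0 * hn v ^+ 2 + 0 * 0 + 0 :> R by rewrite !mul0r !addr0.
  rewrite /B; do ![apply: cvgD]; rewrite ?expr2 //; apply: cvgM => //.
    by apply: cvgM.
  exact: cvg_cst.
apply/cvgrPdist_le => eps e0.
move/cvgrPdist_le : Bc => /(_ _ e0); apply: filterS => n; rewrite sub0r normrN.
move=> /(le_trans (ler_norm _)); apply: le_trans.
have h1 : hn (w n - v) <= d n by rewrite lerDl invr_ge0.
have := key _ _ _ h1; rewrite hnBC in h1; have := key _ _ _ h1 => h2 h3.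
have p1 : 0 <= d n * hn (w n) ^+ 2 by rewrite mulr_ge0 ?sqr_ge0// ltW.
have p2 : 0 <= d n * hn v ^+ 2 by rewrite mulr_ge0 ?sqr_ge0// ltW.
rewrite ler_norml /B; apply/andP; split; lra.
Qed.

Lemma Qr_eq_dense D : dense_in D -> (forall w, D w -> Qr w = hn w ^+ 2) ->
  forall v, Qr v = hn v ^+ 2.
Proof.
move=> dD h v; have [w [Dw wv]] := dense_seq v dD.
have h1 := Qr_cvg wv.
have h2 : hn (w n) ^+ 2 @[n --> \oo] --> hn v ^+ 2.
  by rewrite expr2; apply: cvgM; exact: cvg_hn.
have h3 : (fun n => Qr (w n)) = (fun n => hn (w n) ^+ 2) by apply/funext => n; rewrite h.
rewrite h3 in h1.
exact: (@cvg_unique _ _ (hn (w n) ^+ 2 @[n --> \oo])).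
Qed.

Lemma Qr_parallelogram u v : Qr (u + v) + Qr (u - v) = 2 * Qr u + 2 * Qr v.
Proof.
have dn x := (fun k => sqn_ge0 (dot x (e k))).
apply: EFin_inj; rewrite EFinD !EFinD !EFinM -!QeE /Qe.
have dbl x : (2%:E * (\esum_(k in [set: I]) (sqn (dot x (e k)))%:E) =
    (\esum_(k in [set: I]) (sqn (dot x (e k)))%:E) + (\esum_(k in [set: I]) (sqn (dot x (e k)))%:E))%E.
  by rewrite (_ : \esum_(k in _) _ = Qe x)// QeE -EFinM -EFinD; congr EFin; ring.
rewrite !dbl -!esumD; first last.
all: try by move=> k _; rewrite ?adde_ge0 ?lee_fin ?sqn_ge0.
apply: eq_esum => k _; rewrite -!EFinD; congr EFin.
by rewrite dotDl dotBl; case: (dot u _) (dot v _) => a b [c f]; rewrite /sqn/=; ring.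
Qed.

Lemma hn_parallelogram u v : hn (u + v) ^+ 2 + hn (u - v) ^+ 2 = 2 * hn u ^+ 2 + 2 * hn v ^+ 2.
Proof. by rewrite !hn2D hnN dotNr raddfN/=; ring. Qed.

(* The vectors with [Qr v = hn v ^+ 2] form the zero set of a nonnegative quadratic form,
   hence a closed subspace. *)
Lemma Qr_eq_closure (E : set H) : (forall v, E v -> Qr v = hn v ^+ 2) ->
  forall v, closure (linear_span E) v -> Qr v = hn v ^+ 2.
Proof.
move=> hE.
have h0 : Qr 0 = hn (0 : H) ^+ 2.
  by have := Qr_Z 0 (0 : H); rewrite scale0r sqn0 mul0r hn0 expr0n.
(* Both forms satisfy the parallelogram law, so the inequalities between them at [u + v] and [u - v]
   add up to an equality, and each is an equality. *)
have hD u v : Qr u = hn u ^+ 2 -> Qr v = hn v ^+ 2 -> Qr (u + v) = hn (u + v) ^+ 2.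
  move=> hu hv; have := Qr_parallelogram u v; have := hn_parallelogram u v.
  have := Qr_le (u + v); have := Qr_le (u - v); rewrite hu hv; lra.
have hZ a u : Qr u = hn u ^+ 2 -> Qr (a *: u) = hn (a *: u) ^+ 2.
  by move=> hu; rewrite Qr_Z hn2Z hu.
have hs v : linear_span E v -> Qr v = hn v ^+ 2.
  case=> k [c [u [Eu ->]]].
  by elim/big_ind : _ => // i _; apply: hZ; exact: hE.
move=> v cv.
have [w [Dw wv]] := closure_hn_seq cv.
have h1 := Qr_cvg wv.
have h2 : hn (w n) ^+ 2 @[n --> \oo] --> hn v ^+ 2.
  by rewrite expr2; apply: cvgM; exact: cvg_hn.
have h3 : (fun n => Qr (w n)) = (fun n => hn (w n) ^+ 2) by apply/funext => n; rewrite hs.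
rewrite h3 in h1.
exact: (@cvg_unique _ _ (hn (w n) ^+ 2 @[n --> \oo])).
Qed.

End quadratic.

(** * Affine changes of variable *)

Section affine.
Context {R : realType}.
Local Notation leb := (@lebesgue_measure R).

Lemma measurable_affine (a b : R) : measurable_fun [set: R] (fun x : R => a * x + b).
Proof.
apply: measurable_funD => //; exact: measurable_funM.
Qed.

Definition aff (a b : R) : measurableTypeR R -> measurableTypeR R := fun x => a * x + b.

Lemma maff (a b : R) : measurable_fun [set: measurableTypeR R] (aff a b).
Proof. exact: measurable_affine. Qed.

HB.instance Definition _ a b := isMeasurableFun.Build _ _ _ _ (aff a b) (maff a b).

(** The image measure scaled by [a] agrees with Lebesgue measure on the intervals []x, y]], hence
    everywhere by uniqueness. *)
Lemma lebesgue_affine (a b : R) (a0 : 0 < a) (A : set (measurableTypeR R)) : measurable A ->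
  leb (aff a b @^-1` A) = ((a^-1)%:E * leb A)%E.
Proof.
move=> mA.
pose r : {nonneg R} := NngNum (ltW a0).
have h : leb A = (a%:E * leb (aff a b @^-1` A))%E.
  apply: (@lebesgue_measure_unique R (mscale r (pushforward leb (aff a b))) _ A mA) => X -[[x y] _ <-] /=.
  rewrite /mscale /= /pushforward.
  have -> : aff a b @^-1` `]x, y] = `](x - b) / a, (y - b) / a]%classic.
    apply/seteqP; split => u; rewrite /aff /= !in_itv/=.
      by rewrite ltr_pdivrMr// ler_pdivlMr// ltrBlDr lerBrDr mulrC.
    by rewrite ltr_pdivrMr// ler_pdivlMr// ltrBlDr lerBrDr mulrC.
  rewrite !lebesgue_measure_itv/= !lte_fin ltr_pM2r ?invr_gt0// ltrD2r.
  case: ifPn => xy; last by rewrite mule0.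
  rewrite -!EFinD -EFinM; congr EFin; field; exact: lt0r_neq0.
by rewrite h muleA -EFinM mulVf ?mul1e// gt_eqF.
Qed.

Lemma ge0_integral_affine (a b : R) (f : R -> \bar R) : 0 < a ->
  measurable_fun [set: R] f -> (forall x, (0 <= f x)%E) ->
  (\int[leb]_x f (a * x + b)%R = (a^-1)%:E * \int[leb]_x f x)%E.
Proof.
move=> a0 mf f0.
have ai0 : 0 <= a^-1 by rewrite invr_ge0 ltW.
pose r : {nonneg R} := NngNum ai0.
have := @ge0_integral_pushforward _ _ _ _ R _ (maff a b) leb setT f measurableT mf (fun x _ => f0 x).
rewrite preimage_setT => <-.
rewrite (eq_measure_integral (mscale r leb)).
  by rewrite ge0_integral_mscale.
by move=> A mA _; exact: lebesgue_affine.
Qed.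

Lemma integrable_affine (a b : R) (f : R -> R) : 0 < a ->
  leb.-integrable setT (EFin \o f) -> leb.-integrable setT (EFin \o (fun x => f (a * x + b))).
Proof.
move=> a0 /integrableP[/measurable_EFinP mf fi]; apply/integrableP; split.
  apply/measurable_EFinP; apply: measurableT_comp mf _; exact: measurable_affine.
have mf' : measurable_fun [set: R] (fun x : R => `|(f x)%:E|%E).
  by apply/measurableT_comp => //; exact/measurable_EFinP.
rewrite (ge0_integral_affine b a0 mf')//.
by rewrite lte_mul_pinfty// lee_fin invr_ge0 ltW.
Qed.

Lemma Rintegral_affine (a b : R) (f : R -> R) : 0 < a ->
  leb.-integrable setT (EFin \o f) ->
  \int[leb]_x f (a * x + b) = a^-1 * \int[leb]_x f x.
Proof.
move=> a0 fi.
have fai := integrable_affine b a0 fi.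
have ai0 : 0 <= a^-1 by rewrite invr_ge0 ltW.
pose r : {nonneg R} := NngNum ai0.
have mf := measurable_int _ fi.
rewrite /Rintegral (integralE leb setT (EFin \o f)) (integralE leb setT (fun x => (f _)%:E)).
have mp := measurable_funepos mf; have mn := measurable_funeneg mf.
have e1 : (\int[leb]_x ((fun x => (f (a * x + b))%:E)^\+ x) = a^-1%:E * \int[leb]_x ((EFin \o f)^\+ x))%E.
  transitivity (\int[leb]_x ((EFin \o f)^\+ (a * x + b)%R))%E.
    by apply: eq_integral => x _; rewrite ?funeposE ?funenegE.
  by apply: (ge0_integral_affine b a0 mp) => x; exact: funepos_ge0.
have e2 : (\int[leb]_x ((fun x => (f (a * x + b))%:E)^\- x) = a^-1%:E * \int[leb]_x ((EFin \o f)^\- x))%E.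
  transitivity (\int[leb]_x ((EFin \o f)^\- (a * x + b)%R))%E.
    by apply: eq_integral => x _; rewrite ?funeposE ?funenegE.
  by apply: (ge0_integral_affine b a0 mn) => x; exact: funeneg_ge0.
rewrite e1 e2.
have fp := integrable_fin_num measurableT (integrable_funepos measurableT fi).
have fn := integrable_fin_num measurableT (integrable_funeneg measurableT fi).
by rewrite -(fineK fp) -(fineK fn) -!EFinM -!EFinB /= mulrBr.
Qed.

Lemma ae_affine (a b : R) (P : R -> Prop) : 0 < a ->
  {ae leb, forall x, P x} -> {ae leb, forall x, P (a * x + b)}.
Proof.
move=> a0 [N [mN N0 PN]]; exists (aff a b @^-1` N); split.
- by rewrite -[X in measurable X]setTI; exact: (maff a b).
- by rewrite lebesgue_affine// N0 mule0.
- by move=> x /= h; apply: PN.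
Qed.

End affine.

(** * The circle, its angles and its topology *)

Section circle_facts.
Context {R : realType}.
Implicit Types (z w : circle R) (x y : R).

Lemma cval_inj : injective (@cval R).
Proof. exact: val_inj. Qed.

Lemma sqn_cval z : sqn (cval z) = 1.
Proof. by apply: sqn_norm1; exact: cval_norm. Qed.

Lemma cval_neq0 z : cval z != 0.
Proof. by rewrite -normr_eq0 cval_norm oner_eq0. Qed.

Lemma cval_conj z : (cval z)^* = (cval z)^-1.
Proof.
apply: (mulfI (cval_neq0 z)); rewrite mul_conjc_sqn sqn_cval mulfV//.
exact: cval_neq0.
Qed.

Lemma cval_exp z n : cval (circle_exp z n) = cval z ^+ n. Proof. by []. Qed.
Lemma cval_mul z w : cval (circle_mul z w) = cval z * cval w. Proof. by []. Qed.
Lemma cval_expNi x : cval (expNi x) = cos x -i* sin x. Proof. by []. Qed.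

Lemma circle_exp1 z : circle_exp z 1 = z. Proof. by apply: cval_inj; rewrite cval_exp expr1. Qed.
Lemma circle_expM z m n : circle_exp z (m * n) = circle_exp (circle_exp z m) n.
Proof. by apply: cval_inj; rewrite !cval_exp exprM. Qed.
Lemma circle_mulX z w n : circle_exp (circle_mul z w) n = circle_mul (circle_exp z n) (circle_exp w n).
Proof. by apply: cval_inj; rewrite !(cval_exp,cval_mul) exprMn. Qed.

Lemma expNiD x y : expNi (x + y) = circle_mul (expNi x) (expNi y).
Proof.
apply: cval_inj; rewrite cval_mul !cval_expNi cosD sinD.
by apply/eqP; rewrite eq_complex/=; apply/andP; split; apply/eqP; ring.
Qed.

Lemma expNi0 : cval (expNi (0 : R)) = 1.
Proof. by rewrite cval_expNi cos0 sin0 oppr0. Qed.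

Lemma expNiMn x n : expNi (n%:R * x) = circle_exp (expNi x) n.
Proof.
elim: n => [|n IH]; first by apply: cval_inj; rewrite mul0r expNi0 cval_exp expr0.
rewrite -natr1 mulrDl mul1r expNiD IH; apply: cval_inj.
by rewrite cval_mul !cval_exp exprSr.
Qed.

Lemma cval_expNiN x : cval (expNi (- x)) = (cval (expNi x))^*.
Proof. by rewrite !cval_expNi cosN sinN. Qed.

Lemma expNi2pi_nat (n : nat) : cval (expNi (2 * pi * n%:R : R)) = 1.
Proof.
rewrite mulrC expNiMn cval_exp cval_expNi.
have -> : 2 * pi = pi *+ 2 :> R by rewrite mulr_natl.
by rewrite cos2pi sin2pi oppr0 expr1n.
Qed.

Lemma expNi2pi (l : int) : cval (expNi (2 * pi * l%:~R : R)) = 1.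
Proof.
case: l => n; first by rewrite -pmulrn expNi2pi_nat.
by rewrite NegzE mulrNz mulrN cval_expNiN -pmulrn expNi2pi_nat rmorph1.
Qed.

Lemma expNi_periodic x (l : int) : expNi (x + 2 * pi * l%:~R) = expNi x.
Proof. by apply: cval_inj; rewrite expNiD cval_mul expNi2pi mulr1. Qed.

Lemma expNi_surj z : exists x, expNi x = z.
Proof.
have := sqn_cval z; case E : (cval z) => [a b]; rewrite /sqn/= => ab.
have a1 : -1 <= a <= 1.
  have : a ^+ 2 <= 1 by rewrite -ab lerDl sqr_ge0.
  by move=> h; apply/andP; split; nra.
have c : cos (acos a) = a by rewrite acosK// in_itv/=.
have s : sin (acos a) = `|b|.
  by rewrite sin_acos// -sqrtr_sqr -ab addrAC subrr add0r.
have [b0|b0] := lerP 0 b.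
  exists (- acos a); apply: cval_inj; rewrite cval_expNi cosN sinN opprK c s E.
  by rewrite ger0_norm.
exists (acos a); apply: cval_inj; rewrite cval_expNi c s E ltr0_norm// opprK.
by [].
Qed.

Lemma cos_eq1_2pi x : cos x = 1 -> 0 <= x < 2 * pi -> x = 0.
Proof.
move=> c /andP[x0 x2].
have [xp|xp] := lerP x pi.
  have := @cosK R x; rewrite in_itv/= x0 xp => /(_ isT) <-.
  by rewrite c acos1.
have c' : cos (2 * pi - x) = 1.
  have -> : 2 * pi - x = - x + pi *+ 2 by rewrite mulr_natl addrC.
  by rewrite cosD2pi cosN.
have := @cosK R (2 * pi - x); rewrite in_itv/= c' acos1.
have h : (0 <= 2 * pi - x <= pi) by apply/andP; split; lra.
by rewrite h => /(_ isT); lra.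
Qed.

Lemma expNi_mod x : exists l : int, 0 <= x + 2 * pi * l%:~R < 2 * pi.
Proof.
have pi0 : 0 < 2 * pi :> R by rewrite mulr_gt0// pi_gt0.
exists (- Num.floor (x / (2 * pi))).
have := real_floor_itv (num_real (x / (2 * pi))) => /andP[h1 h2].
rewrite mulrNz mulrN; apply/andP; split.
  rewrite subr_ge0 mulrC -ler_pdivlMr//.
move: h2; rewrite ltr_pdivrMr// intrD mulrDl mul1r => h2.
by rewrite mulrC ltrBlDr addrC.
Qed.

Lemma expNi_eq x y : expNi x = expNi y -> exists l : int, x = y + 2 * pi * l%:~R.
Proof.
move=> e.
have [l hl] := expNi_mod (x - y).
have e1 : cval (expNi (x - y)) = 1.
  rewrite expNiD cval_mul e cval_expNiN cval_conj mulfV//; exact: cval_neq0.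
have : cos (x - y + 2 * pi * l%:~R) = 1.
  have := expNi_periodic (x - y) l => /(congr1 (@cval R)).
  by rewrite e1 cval_expNi => -[].
move=> /cos_eq1_2pi /(_ hl) h; exists (- l).
by rewrite mulrNz; lra.
Qed.

Lemma sin_le_norm x : `|sin x| <= `|x|.
Proof.
wlog x0 : x / 0 < x.
  move=> h; have [xp|xn|<-] := ltrgtP 0 x; [exact: h| |by rewrite sin0].
  by rewrite -normrN -sinN -(normrN x) h// oppr_gt0.
have h1 y : y \in `]0, x[ -> is_derive y 1 (@sin R) (cos y) by move=> _; exact: is_derive_sin.
have h2 : {within `[0, x], continuous (@sin R)}.
  by apply: continuous_subspaceT => y; exact: continuous_sin.
have [c _] := MVT x0 h1 h2.
rewrite sin0 !subr0 => ->; rewrite normrM.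
by rewrite ler_piMl// cos_max.
Qed.

(** The chord has length [2 |sin ((x - y) / 2)|], at most the arc. *)
Lemma expNi_dist x y : sqn (cval (expNi x) - cval (expNi y)) <= (x - y) ^+ 2.
Proof.
have -> : sqn (cval (expNi x) - cval (expNi y)) = (2 * sin ((x - y) / 2)) ^+ 2.
  rewrite !cval_expNi /sqn/=.
  have h : cos (x - y) = 1 - 2 * sin ((x - y) / 2) ^+ 2.
    rewrite -[in LHS](divfK (_ : 2 != 0 :> R) (x - y))//.
    by rewrite mulr_natr cos_mulr2n cos2sin2; ring.
  have := cosB x y; rewrite h => {}h.
  have := cos2Dsin2 x; have := cos2Dsin2 y.
  rewrite exprMn; nra.
have := sin_le_norm ((x - y) / 2).
rewrite -ler_sqr ?nnegrE// !real_normK ?num_real// => h; nra.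
Qed.

End circle_facts.

Section circle_topology.
Context {R : realType}.

Lemma nbhs_circleP (z : circle R) (A : set (circle R)) :
  nbhs z A <-> exists2 e : R, 0 < e & forall w, sqn (cval w - cval z) < e -> A w.
Proof.
split.
  case=> B [[C oC <-] /= Cz CA].
  have /nbhs_ballP[e /= e0 eC] := open_nbhs_nbhs (conj oC Cz).
  have [r r0 er] := gt0_complex e0.
  exists (r ^+ 2); first by rewrite exprn_gt0.
  move=> w wz; apply: CA; apply: eC; rewrite -ball_normE /= er.
  by rewrite normc_lt_sqn ?ltW// -sqnN opprB.
case=> e e0 h.
have s0 : 0 < Num.sqrt e by rewrite sqrtr_gt0.
pose B : set R[i]^o := ball (cval z : R[i]^o) (Num.sqrt e)%:C.
have nB : nbhs (cval z : R[i]^o) B by apply: nbhsx_ballx; rewrite ltcR.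
exists ((@cval R) @^-1` (interior B)); split.
- by exists (interior B) => //; exact: open_interior.
- exact: nB.
- move=> w /= /interior_subset; rewrite /B -ball_normE /= normc_lt_sqn ?ltW//.
  by rewrite sqr_sqrtr ?ltW// -sqnN opprB; exact: h.
Qed.

Lemma continuous_expNi : continuous (@expNi R).
Proof.
move=> x A /nbhs_circleP[e e0 h].
have s0 : 0 < Num.sqrt e by rewrite sqrtr_gt0.
have := nbhsx_ballx x _ s0; apply: filterS => y.
rewrite -ball_normE /= => xy; apply: h.
rewrite (le_lt_trans (expNi_dist _ _))// -(sqr_sqrtr (ltW e0)) -(real_normK (num_real (y - x))).
by rewrite ltr_sqr ?nnegrE// 1?distrC// ltW.
Qed.

Lemma cvg_sqnP (T : Type) (F : set_system T) (FF : Filter F) (f : T -> R[i]^o) (l : R[i]^o) :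
  (f @ F --> l) <-> (forall e : R, 0 < e -> \forall t \near F, sqn (f t - l) < e).
Proof.
split=> [/cvgrPdist_lt h e e0|h].
  have s0 : 0 < (Num.sqrt e)%:C by rewrite ltcR sqrtr_gt0.
  move: (h _ s0); apply: filterS => t.
  by rewrite normc_lt_sqn ?sqrtr_ge0// sqr_sqrtr ?ltW// -sqnN opprB.
apply/cvgrPdist_lt => e /gt0_complex[r r0 ->].
move: (h _ (exprn_gt0 2 r0)); apply: filterS => t.
by rewrite normc_lt_sqn ?ltW// -sqnN opprB.
Qed.

Lemma cvg_complex_unique (T : Type) (F : set_system T) (FF : ProperFilter F)
  (f : T -> R[i]^o) (l l' : R[i]^o) : f @ F --> l -> f @ F --> l' -> l = l'.
Proof. exact: (cvg_unique (@norm_hausdorff _ _)). Qed.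

Lemma cvg_complex_lim (f : nat -> R[i]^o) (l : R[i]^o) : f @ \oo --> l -> lim (f @ \oo) = l.
Proof. exact: (cvg_lim (@norm_hausdorff _ _)). Qed.

(** [expNi] is open: after a rotation to the point 1, the angle is recovered from the imaginary part
    by [asin], which is continuous at 0. *)
Lemma expNi_local (x : R) (e : R) : 0 < e -> exists2 d : R, 0 < d &
  forall w, sqn (cval w - cval (expNi x)) < d -> exists2 y, `|y - x| < e & expNi y = w.
Proof.
move=> e0.
have := @continuous_asin R 0; rewrite ltrN10 ltr01 => /(_ isT).
move/cvgrPdist_lt => /(_ _ e0) [r /= r0 hr].
(* The bound 1 forces a positive real part, so that [asin] yields the right angle; [r ^+ 2] makes
   the imaginary part smaller than [r]. *)
exists (Num.min 1 (r ^+ 2)); first by rewrite lt_min ltr01 exprn_gt0.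
move=> w; rewrite lt_min => /andP[].
have -> : cval w - cval (expNi x) = cval (expNi x) * (cval w / cval (expNi x) - 1).
  by rewrite mulrBr mulr1 mulrC divfK// cval_neq0.
rewrite sqnM sqn_cval mul1r.
have : sqn (cval w / cval (expNi x)) = 1.
  by rewrite -cval_conj sqnM sqn_conj !sqn_cval mulr1.
case E : (cval w / cval (expNi x)) => [a b]; rewrite /sqn/= subr0 => ab h1 h2.
have a0 : 0 < a by have := sqr_ge0 b; nra.
have b1 : -1 <= b <= 1 by apply/andP; split; nra.
have br : `|b| < r.
  have := sqr_ge0 (a - 1); rewrite ltr_norml; move=> h3; apply/andP; split; nra.
exists (x - asin b).
  rewrite addrAC subrr add0r normrN.
  have := hr b; rewrite /ball_/= sub0r normrN => /(_ br).
  have -> : asin 0 = 0 :> R.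
    have := @sinK R 0; rewrite sin0 in_itv/= => -> //.
    by rewrite oppr_le0 divr_ge0 ?pi_ge0.
  by rewrite sub0r normrN.
apply: cval_inj; rewrite expNiD cval_mul (cval_expNi (- _)) cosN sinN opprK.
rewrite asinK ?in_itv//= cos_asin// -ab addrK.
by rewrite sqrtr_sqr gtr0_norm// -E mulrC divfK// cval_neq0.
Qed.

(** [expNi] is continuous, open and onto, so continuity on the circle can be tested on angles. *)
Lemma continuous_circle_fun (f : circle R -> R[i]^o) :
  continuous (f \o @expNi R) <-> continuous f.
Proof.
split=> h; last first.
  by move=> x; apply: continuous_comp; [exact: continuous_expNi|exact: h].
move=> z; have [x <-] := expNi_surj z.
apply/(@cvg_sqnP _ _ (nbhs_filter _)) => e e0; apply/nbhs_circleP.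
have /cvg_sqnP /(_ _ e0) [r /= r0 hr] := h x.
have [d d0 hd] := expNi_local x r0.
exists d => // w /hd[y yx <-]; apply: hr.
by rewrite /ball_/= distrC.
Qed.

End circle_topology.

(** * Cycles and invariant sets *)
Section roots.
Context {R : realType}.
Variable N : nat.
Hypothesis N2 : (2 <= N)%N.
Implicit Types (z w : circle R) (x y : R).

Let N0 : N%:R != 0 :> R.
Proof. by rewrite pnatr_eq0; case: N N2. Qed.
Let Np : 0 < N%:R :> R. Proof. by rewrite ltr0n; case: N N2. Qed.

Definition nroot y (r : nat) : circle R := expNi ((y + 2 * pi * r%:R) / N%:R).

Lemma nroot_exp y r : circle_exp (nroot y r) N = expNi y.
Proof.
rewrite /nroot -expNiMn mulrC divfK//.
by rewrite -[r%:R]/(r%:~R) pmulrn expNi_periodic.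
Qed.

Lemma nroot_inj y r s : (r < N)%N -> (s < N)%N -> nroot y r = nroot y s -> r = s.
Proof.
move=> rN sN /expNi_eq[l].
have pi0 : pi != 0 :> R by rewrite gt_eqF// pi_gt0.
move=> h; have {h} : (r%:Z)%:~R = (s%:Z + l * N%:Z)%:~R :> R.
  apply: (mulfI pi0); rewrite intrD intrM -!pmulrn.
  have := congr1 (fun t => t * N%:R) h.
  rewrite [RHS]mulrDl !divfK// => {}h.
  have -> : pi * r%:R = (y + 2 * pi * r%:R) / 2 - y / 2 by field.
  by rewrite h; field.
move/intr_inj => h.
have l0 : l = 0 by nia.
by move: h; rewrite l0 mul0r addr0 => -[].
Qed.

Lemma nroot_surj y w : circle_exp w N = expNi y -> exists2 r, (r < N)%N & w = nroot y r.
Proof.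
have [x <-] := expNi_surj w; rewrite -expNiMn => /expNi_eq[l hl].
have xE : x = (y + 2 * pi * l%:~R) / N%:R by rewrite -hl mulrC mulKf.
have [k [r [rN lE]]] : exists k : int, exists r : nat, (r < N)%N /\ l = (k * N%:Z + r%:Z)%R.
  exists (l %/ N)%Z, `|(l %% N)%Z|%N; split; last first.
    rewrite gez0_abs ?modz_ge0//; last by case: N N2.
    exact: divz_eq.
  rewrite -ltz_nat gez0_abs ?modz_ge0 ?ltz_pmod//; by case: N N2.
exists r => //; rewrite /nroot xE lE -(expNi_periodic _ (- k)); congr expNi.
by rewrite intrD intrM mulrNz -!pmulrn; field.
Qed.

Lemma sum_nroot (f : circle R -> R[i]) y :
  \sum_(w \in [set w | circle_exp w N = expNi y]) f w = \sum_(r < N) f (nroot y r).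
Proof.
rewrite (@reindex_fsbig _ _ _ _ _ (fun r => nroot y r) `I_N); last first.
  split.
  - by move=> r /= _; exact: nroot_exp.
  - by move=> r s; rewrite !inE/= => rN sN; exact: nroot_inj.
  - by move=> w /= /nroot_surj[r rN ->]; exists r.
by rewrite (fsbig_ord _ _ (fun i => f (nroot y i))).
Qed.

End roots.

Section cycle_points.
Context {R : realType}.
Variable N : nat.
Hypothesis N2 : (2 <= N)%N.
Variable m0 : circle R -> R[i].
Hypothesis m0R : forall y, \sum_(r < N) sqn (m0 (nroot N y r)) = N%:R.
Hypothesis m0Z : finite_set [set w | m0 w = 0].
Implicit Types (z w u : circle R).

Local Notation E z k := (circle_exp z (N ^ k)).

Lemma EE z j k : E (E z j) k = E z (j + k).
Proof. by rewrite -circle_expM -expnD. Qed.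
Lemma E0 z : E z 0 = z. Proof. exact: circle_exp1. Qed.
Lemma E1 z : E z 1 = circle_exp z N. Proof. by []. Qed.
Lemma E_mul z d n : E z d = z -> E z (n * d) = z.
Proof. by move=> zd; elim: n => [|n IH]; rewrite ?E0// mulSn -EE zd. Qed.

(** Lying on a cycle as a property of one point: [d] is any period. The enumeration by the minimal
    period is recovered in [cycle_pt_enum]. *)
Definition cycle_pt z := exists d, [/\ (0 < d)%N, E z d = z &
  forall k, sqn (m0 (E z k)) = N%:R].

Lemma exists_pos_root z : exists w, circle_exp w N = z /\ m0 w != 0.
Proof.
have [y <-] := expNi_surj z; apply: contrapT => h.
have := m0R y; rewrite big1 => [/esym/eqP|r _].
  by rewrite pnatr_eq0; case: N N2.
have -> : m0 (nroot N y r) = 0; last exact: sqn0.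
apply/eqP; apply: contrapT => /negP hr; apply: h.
by exists (nroot N y r); split => //; exact: nroot_exp.
Qed.

(** The other roots have weight zero, so [w] carries the whole sum [N]. *)
Lemma unique_pos_root w : (forall u, circle_exp u N = circle_exp w N -> m0 u != 0 -> u = w) ->
  sqn (m0 w) = N%:R.
Proof.
have [y yE] := expNi_surj (circle_exp w N).
have [r rN wE] := nroot_surj N2 (esym yE); move=> h.
rewrite -(m0R y) (bigD1 (Ordinal rN))//= -wE big1 ?addr0// => s sr.
have [->|hs] := eqVneq (m0 (nroot N y s)) 0; first exact: sqn0.
have /h : circle_exp (nroot N y s) N = circle_exp w N by rewrite nroot_exp// yE.
move=> /(_ hs); rewrite wE => /nroot_inj-/(_ N2 (ltn_ord s) rN) sE.
by move/eqP : sr; case; exact: val_inj.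
Qed.

(** The preimages of [z] at level [k] are [N^k] equally spaced points, so they come arbitrarily
    close to any point of the circle. *)
Lemma backward_dense (F : set (circle R)) z : closed F ->
  (forall k w, E w k = z -> F w) -> F = setT.
Proof.
move=> cF h; apply/seteqP; split => // u _.
apply: cF => B /nbhs_circleP[e e0 he].
have [y yE] := expNi_surj z; have [t tE] := expNi_surj u.
have s0 : 0 < Num.sqrt e / (2 * pi) by rewrite divr_gt0 ?sqrtr_gt0// mulr_gt0// pi_gt0.
have pp : 0 < 2 * pi :> R by rewrite mulr_gt0// pi_gt0.
have Np : 0 < N%:R :> R by rewrite ltr0n; case: N N2.
have [k _ hk] : \forall k \near \oo, (N%:R^-1 : R) ^+ k < Num.sqrt e / (2 * pi).
  have /cvgrPdist_lt/(_ _ s0) [k _ hk] : (N%:R^-1 : R) ^+ k @[k --> \oo] --> (0 : R).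
    apply: cvg_expr; rewrite ger0_norm ?invr_ge0 ?ltW// invf_lt1// ltr1n.
    by case: N N2 => [|[]].
  exists k => // n /hk /=; rewrite sub0r normrN ger0_norm// exprn_ge0// invr_ge0 ltW//.
have {}hk := hk k (leqnn k).
have Nk : 0 < (N%:R : R) ^+ k by rewrite exprn_gt0.
have := real_floor_itv (num_real ((t * N%:R ^+ k - y) / (2 * pi))).
set l := Num.floor _ => /andP[h1 h2].
pose x := (y + 2 * pi * l%:~R) / N%:R ^+ k.
exists (expNi x); split.
  apply: (h k); rewrite -expNiMn natrX /x mulrC divfK ?gt_eqF//.
  by rewrite expNi_periodic.
apply: he; rewrite -tE (le_lt_trans (expNi_dist _ _))//.
have xt : `|x - t| <= 2 * pi / N%:R ^+ k.
  rewrite ler_pdivlMr// in h1 *; rewrite ltr_pdivrMr// intrD mulrDl mul1r in h2.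
  have -> : x - t = (2 * pi * l%:~R - (t * N%:R ^+ k - y)) / N%:R ^+ k.
    by rewrite /x; field; rewrite gt_eqF.
  rewrite normrM normfV (gtr0_norm Nk) ler_pM2r ?invr_gt0//.
  rewrite ler_norml; apply/andP; split; lra.
have xt' : `|x - t| < Num.sqrt e.
  rewrite (le_lt_trans xt)// mulrC -ltr_pdivlMr//.
  by rewrite -exprVn.
by rewrite -(real_normK (num_real (x - t))) -(sqr_sqrtr (ltW e0)) ltr_sqr ?nnegrE ?sqrtr_ge0.
Qed.

(* Conze and Raugi. *)
Lemma invariant_set_cycle (F : set (circle R)) : closed F -> F !=set0 ->
  (forall w, F (circle_exp w N) -> m0 w != 0 -> F w) ->
  (exists z, cycle_pt z) -> exists2 z, F z & cycle_pt z.
Proof.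
move=> cF [z0 Fz0] Finv [c0 hc0].
(* If some point of [F] has no zero of [m0] among its strict iterated preimages, these all lie in
   [F]; they are dense, so [F] is the whole circle and contains the given cycle point. *)
have [[z [Fz hz]]|hF] := pselect (exists z, F z /\ forall w k, E w k.+1 = z -> m0 w != 0).
  exists c0 => //; rewrite (@backward_dense F z) => //.
  elim=> [|k IH] w; first by rewrite E0 => ->.
  move=> wz; apply: Finv; last exact: hz wz.
  by apply: IH; rewrite -E1 EE.
have {}hF z : F z -> exists w, exists k, E w k.+1 = z /\ m0 w = 0.
  move=> Fz; apply: contrapT => h; apply: hF; exists z; split => // w k wz.
  by apply/eqP => w0; apply: h; exists w, k.
have /finite_seqP[s sE] := m0Z.
(* [ch] follows a backward path inside [F] along nonzero values of [m0]. *)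
have /choice[ch hch] : forall z, exists w, F z -> [/\ F w, circle_exp w N = z & m0 w != 0].
  move=> z.
  have [w [wz w0]] := exists_pos_root z; exists w => Fz; split => //.
  by apply: Finv => //; rewrite wz.
have pF z i : F z -> F (iter i ch z).
  by move=> Fz; elim: i => [//|i IH]; have [] := hch _ IH.
have pE z i j : F z -> (i <= j)%N -> E (iter j ch z) (j - i) = iter i ch z.
  move=> Fz; elim: j => [|j IH]; first by rewrite leqn0 => /eqP ->; rewrite E0.
  rewrite leq_eqVlt => /predU1P[->|]; first by rewrite subnn E0.
  rewrite ltnS => ij; rewrite (_ : j.+1 - i = 1 + (j - i))%N; last lia.
  rewrite -EE E1 /=.
  by have [_ -> _] := hch _ (pF z j Fz); exact: IH.
(* Every point of the backward path from [z] is a forward iterate of a zero of [m0]. The zeros are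
   finitely many, so a single one reaches points arbitrarily far back on the path; comparing two
   such visits shows that the path, hence [z], is periodic. *)
have per z : F z -> exists2 d, (0 < d)%N & E z d = z.
  move=> Fz; pose p i := iter i ch z.
  have [zeta hzeta] : exists zeta, forall m, exists i, exists k, (m <= i)%N /\ E zeta k.+1 = p i.
    apply: contrapT => h.
    have {}h zeta : exists m, forall i k, (m <= i)%N -> E zeta k.+1 <> p i.
      apply: contrapT => h'; apply: h; exists zeta => m.
      apply: contrapT => h''; apply: h'; exists m => i k mi e.
      by apply: h''; exists i, k.
    have [mm hmm] := choice h.
    pose M := \max_(t <- s) mm t.
    have [w [k [wk w0]]] := hF _ (pF z M Fz).
    have ws : w \in s by have : [set w | m0 w = 0] w by []; rewrite sE.
    by apply: (hmm w M k) wk; rewrite /M; exact: leq_bigmax_seq.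
  have [i [k [_ hi]]] := hzeta 0%N.
  (* With [j] beyond [i + k], the arrival at [p i] through [p j] takes place strictly later than the
     first one, so that the period [d] is positive. *)
  have [j [k' [ij hj]]] := hzeta (i + k).+1.
  have ij' : (i <= j)%N by lia.
  have e1 : E zeta (k'.+1 + (j - i)) = p i by rewrite -EE hj pE.
  pose d := (k'.+1 + (j - i) - k.+1)%N.
  have d0 : (0 < d)%N by rewrite /d; lia.
  have pd : E (p i) d = p i.
    by rewrite -{1}hi EE (_ : k.+1 + d = k'.+1 + (j - i))%N// /d; lia.
  exists d => //; have zE : E (p i) i = z by have := pE z 0%N i Fz (leq0n i); rewrite subn0.
  by rewrite -{1}zE EE addnC -EE pd zE.
(* Periodic points with the same image agree: a common period less one step leads from the image
   back to each of them. *)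
have uniqp w u : F w -> F u -> circle_exp w N = circle_exp u N -> w = u.
  move=> /per[d d0 wd] /per[d' d'0 ud] e.
  have D0 : (0 < d * d')%N by rewrite muln_gt0 d0.
  have wD : E w (d * d') = w by rewrite mulnC E_mul.
  have uD : E u (d * d') = u by rewrite E_mul.
  have K (x : circle R) : E x (d * d') = x -> x = E (circle_exp x N) (d * d').-1.
    by move=> xD; rewrite -E1 EE add1n prednK.
  by rewrite (K _ wD) (K _ uD) e.
(* By [uniqp] the chosen preimage is the only one of nonzero weight, so it carries the whole
   mass. *)
have qch z : F z -> sqn (m0 (ch z)) = N%:R.
  move=> Fz; have [Fw wz w0] := hch _ Fz.
  apply: unique_pos_root => u uw u0; apply: uniqp => //.
  by apply: Finv => //; rewrite uw wz.
exists z0 => //; have [d d0 zd] := per _ Fz0.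
exists d; split => // k.
(* As [i + k] is a multiple of the period, [i] steps back amount to [k] steps forward; [i > 0] makes
   the [k]-th iterate a value of [ch]. *)
pose i := (k.+1 * d - k)%N.
have i0 : (0 < i)%N by rewrite /i; nia.
have [e e0 ue] := per _ (pF z0 i Fz0).
have uz : E (iter i ch z0) i = z0 by have := pE z0 0%N i Fz0 (leq0n i); rewrite subn0.
have ud : E (iter i ch z0) d = iter i ch z0.
  have uE : iter i ch z0 = E z0 (e * i - i).
    rewrite -[X in E X (e * i - i)]uz EE subnKC ?leq_pmull//.
    by rewrite mulnC E_mul.
  by rewrite uE EE addnC -EE zd.
have <- : iter i ch z0 = E z0 k.
  rewrite -[X in E X k]uz EE (_ : i + k = k.+1 * d)%N; last by rewrite /i subnK//; nia.
  by rewrite E_mul.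
by rewrite -(prednK i0) /=; exact/qch/pF.
Qed.

End cycle_points.

(** * Square-integrable functions *)
Section real_sequences.
Context {R : realType}.

Lemma cvg_geometric_steps (a : nat -> R) (C r : R) : 0 <= C -> 0 < r < 1 ->
  (forall n, `|a n.+1 - a n| <= C * r ^+ n) ->
  exists l : R, a @ \oo --> l /\ forall n, `|a n - l| <= C * r ^+ n / (1 - r).
Proof.
move=> C0 /andP[r0 r1] ha.
have r1' : 0 < 1 - r by rewrite subr_gt0.
have hb n k : `|a (n + k)%N - a n| <= C * r ^+ n / (1 - r).
  have : `|a (n + k)%N - a n| <= C * r ^+ n * (1 - r ^+ k) / (1 - r).
    elim: k => [|k IH]; first by rewrite addn0 subrr normr0 expr0 subrr mulr0 mul0r.
    rewrite addnS -(subrK (a (n + k)%N) (a (n + k).+1)) -addrA.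
    apply: le_trans (ler_normD _ _) _.
    apply: le_trans (lerD (ha _) IH) _.
    rewrite exprD le_eqVlt; apply/orP; left; apply/eqP.
    by rewrite exprS; field; rewrite gt_eqF.
  move=> /le_trans; apply; rewrite ler_pM2r ?invr_gt0// ler_piMr//.
    by rewrite mulr_ge0// exprn_ge0// ltW.
  by rewrite gerBl exprn_ge0// ltW.
have rc : C * r ^+ n / (1 - r) @[n --> \oo] --> (0 : R).
  rewrite -[0 in X in _ --> X](mul0r (1 - r)^-1) -[0 in X in X * _](mulr0 C).
  apply: cvgM; last exact: cvg_cst.
  by apply: cvgM; [exact: cvg_cst|apply: cvg_expr; rewrite ger0_norm// ltW].
have ca : cvg (a @ \oo).
  apply/cauchy_cvgP/cauchy_exP => e e0.
  have /cvgrPdist_lt /(_ _ e0)[n _ hn] := rc.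
  exists (a n); exists n => // m /= nm; rewrite -ball_normE/= distrC.
  rewrite -(subnKC nm) (le_lt_trans (hb _ _))//.
  by have := hn n (leqnn n); rewrite sub0r normrN => /(le_lt_trans (ler_norm _)).
exists (lim (a @ \oo)); split => // n.
have c1 : `|a n - a (n + k)%N| @[k --> \oo] --> `|a n - lim (a @ \oo)|.
  apply: cvg_norm; apply: cvgB; first exact: cvg_cst.
  have -> : (fun k => a (n + k)%N) = [sequence a (k + n)%N]_k by apply/funext => k; rewrite addnC.
  by rewrite (cvg_shiftn n).
apply: (@cvgr_to_le _ _ _ _ _ _ _ c1).
by apply: nearW => k; rewrite distrC.
Qed.

Lemma norm_Re_le (z : R[i]) (s : R) : sqn z <= s -> `|complex.Re z| <= Num.sqrt s.
Proof.
case: z => a b; rewrite /sqn/= => h.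
by rewrite -sqrtr_sqr ler_wsqrtr// (le_trans _ h)// lerDl sqr_ge0.
Qed.
Lemma norm_Im_le (z : R[i]) (s : R) : sqn z <= s -> `|complex.Im z| <= Num.sqrt s.
Proof.
case: z => a b; rewrite /sqn/= => h.
by rewrite -sqrtr_sqr ler_wsqrtr// (le_trans _ h)// lerDr sqr_ge0.
Qed.

Lemma cvg_geometric_steps_sqn (a : nat -> R[i]) (C r : R) : 0 <= C -> 0 < r < 1 ->
  (forall n, sqn (a n.+1 - a n) <= (C * r ^+ n) ^+ 2) ->
  exists l : R[i], [/\ complex.Re (a n) @[n --> \oo] --> complex.Re l,
     complex.Im (a n) @[n --> \oo] --> complex.Im l &
     forall n, sqn (a n - l) <= 2 * (C * r ^+ n / (1 - r)) ^+ 2].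
Proof.
move=> C0 /[dup] rr /andP[r0 r1] ha.
have Crn n : 0 <= C * r ^+ n by rewrite mulr_ge0// exprn_ge0// ltW.
have hre n : `|complex.Re (a n.+1) - complex.Re (a n)| <= C * r ^+ n.
  by have := norm_Re_le (ha n); rewrite raddfB sqrtr_sqr (ger0_norm (Crn n)).
have him n : `|complex.Im (a n.+1) - complex.Im (a n)| <= C * r ^+ n.
  by have := norm_Im_le (ha n); rewrite raddfB sqrtr_sqr (ger0_norm (Crn n)).
have [l1 [c1 b1]] := cvg_geometric_steps C0 rr hre.
have [l2 [c2 b2]] := cvg_geometric_steps C0 rr him.
exists (l1 +i* l2); split => // n.
have := b1 n; have := b2 n; rewrite /sqn.
case: (a n) => x y /=.
have B0 : 0 <= C * r ^+ n / (1 - r) by rewrite divr_ge0// subr_ge0 ltW.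
move: B0; set s := C * r ^+ n / (1 - r) => s0; rewrite !ler_norml => /andP[h1 h2] /andP[h3 h4].
have q1 : (x - l1) ^+ 2 <= s ^+ 2 by nra.
have q2 : (y - l2) ^+ 2 <= s ^+ 2 by nra.
lra.
Qed.

End real_sequences.

Lemma cvg_EFinR (R : realType) (f : nat -> R) (a : R) : f @ \oo --> a ->
  (fun n => (f n)%:E) @ \oo --> a%:E.
Proof. by move=> h; apply/fine_cvgP; split; [exact: nearW|exact: h]. Qed.

Section L2_facts.
Context d (T : measurableType d) (R : realType) (mu : {measure set T -> \bar R}).
Implicit Types (f g : T -> R[i]) (u v : L2 mu).
Local Notation pi := (\pi_(Quotient.quot (@null_sqfun d T R mu)))%qT.

Lemma L2_sqint u : square_integrable mu u.
Proof. by apply/asboolP; rewrite /L2_fun; case: (repr u). Qed.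

Lemma L2_cmeas u : cmeasurable u. Proof. by have [] := L2_sqint u. Qed.

Lemma to_L2E f : square_integrable mu f -> \forall x \ae mu, to_L2 mu f x = f x.
Proof.
move=> sf; rewrite /to_L2; case: pselect => [h|]; last by case; apply/asboolP.
exact: (L2_reprP (Sqfun h)).
Qed.

Lemma L2_ext u v : (\forall x \ae mu, u x = v x) -> u = v.
Proof. by move=> uv; rewrite -[u]reprK -[v]reprK; apply/L2_eqP. Qed.

Lemma L2_lin a u v : \forall x \ae mu, (a *: u + v : L2 mu) x = a * u x + v x.
Proof.
have : \forall x \ae mu, (repr (pi (a *: repr u + repr v)) : sqfun mu) x = a * u x + v x.
  exact: (L2_reprP (a *: repr u + repr v)).
suff -> : a *: u + v = pi (a *: repr u + repr v) by [].
rewrite -[v in LHS]reprK -[a *: u]/(L2_scale a u) /L2_scale.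
by rewrite !piE.
Qed.

Lemma L2_0 : \forall x \ae mu, (0 : L2 mu) x = 0.
Proof. by have := L2_lin (-1) 0 (0 : L2 mu); rewrite scaler0 add0r; apply: filterS => x ->; ring. Qed.

Lemma L2_Z a u : \forall x \ae mu, (a *: u : L2 mu) x = a * u x.
Proof.
have := L2_lin a u (0 : L2 mu); rewrite addr0; have := L2_0.
by apply: filterS2 => x -> ->; rewrite addr0.
Qed.

Lemma L2_B u v : \forall x \ae mu, (u - v : L2 mu) x = u x - v x.
Proof.
have := L2_lin (-1) v u; rewrite scaleN1r addrC.
by apply: filterS => x ->; ring.
Qed.

Lemma square_integrable_sqn f : square_integrable mu f <->
  cmeasurable f /\ (\int[mu]_x (sqn (f x))%:E < +oo)%E.
Proof.
rewrite /square_integrable.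
by under eq_integral do rewrite normc_sqn.
Qed.

Lemma measurable_sqn f : cmeasurable f -> measurable_fun setT (fun x => sqn (f x)).
Proof. by move=> [m1 m2]; apply: measurable_funD; apply: measurable_funX. Qed.

Lemma square_integrable_le f (M : R) : cmeasurable f ->
  (\int[mu]_x (sqn (f x))%:E <= M%:E)%E -> square_integrable mu f.
Proof. by move=> mf h; apply/square_integrable_sqn; split => //; rewrite (le_lt_trans h)// ltry. Qed.

Lemma sqint_integrable f : square_integrable mu f ->
  mu.-integrable setT (EFin \o (fun x => sqn (f x))).
Proof.
move=> /square_integrableE[_]; congr (_.-integrable _ _).
by apply/funext => x /=; rewrite normc_sqn.
Qed.

Lemma L2_dotE u v : dot u v = cintegral mu (fun x => u x * (v x)^*).
Proof. by []. Qed.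

Lemma hn2_L2 u : (\int[mu]_x (sqn (u x))%:E = (hn u ^+ 2)%:E)%E.
Proof.
have iu := sqint_integrable (L2_sqint u).
rewrite hn2E L2_dotE /cintegral /= /Rintegral.
rewrite -[LHS]fineK ?(integrable_fin_num measurableT)//.
congr (_%:E); congr fine; apply: eq_integral => x _.
by rewrite mul_conjc_sqn.
Qed.

Lemma hn2_to_L2 f : square_integrable mu f ->
  (\int[mu]_x (sqn (f x))%:E = (hn (to_L2 mu f : L2 mu) ^+ 2)%:E)%E.
Proof.
move=> sf; rewrite -hn2_L2; have [mf _] := sf.
apply: ae_eq_integral => //.
- exact/measurable_EFinP/measurable_sqn.
- exact/measurable_EFinP/measurable_sqn/L2_cmeas.
- by have := to_L2E sf; apply: filterS => x -> .
Qed.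

Lemma to_L2_ext f g : square_integrable mu f -> square_integrable mu g ->
  (\forall x \ae mu, f x = g x) -> to_L2 mu f = to_L2 mu g.
Proof.
move=> sf sg fg; apply: L2_ext; have := to_L2E sf; have := to_L2E sg.
by apply: filterS3 fg => x -> -> ->.
Qed.

Lemma to_L2K u : to_L2 mu (u : T -> R[i]) = u.
Proof. by apply: L2_ext; exact: to_L2E (L2_sqint u). Qed.

Lemma cmeasurableB f g : cmeasurable f -> cmeasurable g -> cmeasurable (fun x => f x - g x).
Proof.
move=> mf mg; have := cmeasurable_comb (-1) mg mf.
by congr cmeasurable; apply/funext => x; rewrite -[LHS]/(-1 * g x + f x); ring.
Qed.

Lemma to_L2B f g : square_integrable mu f -> square_integrable mu g ->
  square_integrable mu (fun x => f x - g x) /\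
  to_L2 mu (fun x => f x - g x) = to_L2 mu f - to_L2 mu g.
Proof.
move=> sf sg.
have e : (fun x => f x - g x) = -1 *: g + f.
  by apply/funext => x; rewrite -[RHS]/(-1 * g x + f x); ring.
have sh : square_integrable mu (fun x => f x - g x) by rewrite e; exact: square_integrable_comb.
split => //; apply: L2_ext.
have := to_L2E sf; have := to_L2E sg; have := to_L2E sh; have := L2_B (to_L2 mu f) (to_L2 mu g).
by move=> h1 h2 h3 h4; near=> x; rewrite (near h1 x)// (near h2 x)// (near h3 x)// (near h4 x).
Unshelve. all: by end_near. Qed.

Lemma to_L2Z a f : square_integrable mu f ->
  square_integrable mu (fun x => a * f x) /\ to_L2 mu (fun x => a * f x) = a *: to_L2 mu f.
Proof.
move=> sf.
have e : (fun x => a * f x) = a *: f + 0 by apply/funext => x; rewrite addr0.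
have sh : square_integrable mu (fun x => a * f x).
  by rewrite e; apply: square_integrable_comb => //; exact: square_integrable0.
split => //; apply: L2_ext; have := to_L2E sf; have := to_L2E sh.
by apply: filterS3 (L2_Z a (to_L2 mu f)) => x -> -> ->.
Qed.

Lemma dot_to_L2 f g : square_integrable mu f -> square_integrable mu g ->
  dot (to_L2 mu f : L2 mu) (to_L2 mu g) = cintegral mu (fun x => f x * (g x)^*).
Proof.
move=> sf sg; rewrite L2_dotE; have [mf _] := sf; have [mg _] := sg.
apply: ae_eq_cintegral; try by apply: cmeasurable_mul_conj => //; exact: L2_cmeas.
by apply: filterS2 (to_L2E sf) (to_L2E sg) => x -> ->.
Qed.

Lemma square_integrable_dom f (g : T -> R) : cmeasurable f ->
  mu.-integrable setT (EFin \o g) -> (forall x, sqn (f x) <= g x) -> square_integrable mu f.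
Proof.
move=> mf ig fg; apply/square_integrable_sqn; split => //.
have /integrableP[_] := ig; apply: le_lt_trans.
apply: ge0_le_integral => //.
- by move=> x _; rewrite lee_fin sqn_ge0.
- exact/measurable_EFinP/measurable_sqn.
- by apply: measurableT_comp => //; exact: measurable_int ig.
- by move=> x _; rewrite /= lee_fin (le_trans (fg x))// ler_norm.
Qed.

Lemma L2_cvg_dct (f_ : nat -> T -> R[i]) f (g : T -> R) :
  (forall n, square_integrable mu (f_ n)) -> square_integrable mu f ->
  mu.-integrable setT (EFin \o g) ->
  (forall n x, sqn (f_ n x - f x) <= g x) ->
  (\forall x \ae mu, sqn (f_ n x - f x) @[n --> \oo] --> (0 : R)) ->
  (fun n => to_L2 mu (f_ n) : L2 mu) @ \oo --> (to_L2 mu f : L2 mu).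
Proof.
move=> sf_ sf ig fg f0; apply/cvg_hnP.
have E n : ((hn (to_L2 mu (f_ n) - to_L2 mu f : L2 mu) ^+ 2)%:E =
    \int[mu]_x (sqn (f_ n x - f x))%:E)%E.
  by have [sh <-] := to_L2B (sf_ n) sf; rewrite -hn2_to_L2.
have m_ n : measurable_fun [set: T] (fun x => (sqn (f_ n x - f x))%:E).
  apply/measurable_EFinP; apply: (@measurable_sqn (fun x => f_ n x - f x)).
  by apply: cmeasurableB; [have [] := sf_ n | case: sf].
have [] := @dominated_convergence _ _ _ mu setT measurableT
  (fun n x => (sqn (f_ n x - f x))%:E) (cst 0%E) (EFin \o g).
- exact: m_.
- exact: measurable_cst.
- by apply: filterS f0 => x h _; apply/fine_cvgP; split; [exact: nearW|].
- exact: ig.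
- by apply: aeW => x n _; rewrite /= lee_fin ger0_norm ?sqn_ge0.
move=> _ _; rewrite integral0 => h.
have {}h : (fun n => (hn (to_L2 mu (f_ n) - to_L2 mu f : L2 mu) ^+ 2)%:E) @ \oo --> 0%E.
  by under eq_fun do rewrite E.
move/fine_cvgP : h => [_ h].
apply/cvgrPdist_lt => e e0.
move/cvgrPdist_lt : h => /(_ _ (exprn_gt0 2 e0)); apply: filterS => n /=.
rewrite !sub0r !normrN !ger0_norm ?hn_ge0 ?sqr_ge0//.
by rewrite ltr_sqr ?nnegrE ?hn_ge0// ltW.
Qed.

(** Riesz-Fischer. The series of the squared steps with weights [2^n] is integrable, so almost
    everywhere the steps are of order [2^(-n/2)] and the sequence converges, at a rate that controls
    the norm of the remainder. *)
Lemma L2_complete : hilbert_space (L2 mu).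
Proof.
apply: hilbert_of_seq => u0 hu.
pose u n : L2 mu := u0 n.
pose D n x : R := sqn (u n.+1 x - u n x).
have mD n : measurable_fun setT (fun x => D n x).
  by apply: (@measurable_sqn (fun x => u n.+1 x - u n x)); apply: cmeasurableB; exact: L2_cmeas.
have iD n : (\int[mu]_x (D n x)%:E <= ((4^-1 : R) ^+ n)%:E)%E.
  have -> : (\int[mu]_x (D n x)%:E = (hn (u n.+1 - u n) ^+ 2)%:E)%E.
    have [sh h] := to_L2B (L2_sqint (u n.+1)) (L2_sqint (u n)).
    by rewrite (hn2_to_L2 sh) h !to_L2K.
  rewrite lee_fin (_ : 4^-1 ^+ n = (2^-1 ^+ n) ^+ 2 :> R).
    by rewrite ler_sqr ?nnegrE ?hn_ge0 ?exprn_ge0.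
  by rewrite exprAC; congr (_ ^+ n); field.
pose S x : \bar R := (\sum_(n <oo) ((2 ^+ n * D n x)%R)%:E)%E.
have mS : measurable_fun [set: T] S.
  apply: ge0_emeasurable_sum => [n x _ _|n _].
    by rewrite lee_fin mulr_ge0 ?exprn_ge0 ?sqn_ge0.
  by apply/measurable_EFinP; apply: measurable_funM.
have iS : (\int[mu]_x S x <= 2%:E)%E.
  rewrite integral_nneseries//; last 2 first.
    by move=> n; apply/measurable_EFinP; apply: measurable_funM.
    by move=> n x _; rewrite lee_fin mulr_ge0 ?exprn_ge0 ?sqn_ge0.
  apply: (@le_trans _ _ (\sum_(n <oo) (2 * (2^-1 : R) ^+ n.+1)%:E)%E).
    apply: lee_nneseries => n _.
      by move=> _; apply: integral_ge0 => x _; rewrite lee_fin mulr_ge0 ?exprn_ge0 ?sqn_ge0.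
    under eq_integral do rewrite EFinM.
    rewrite ge0_integralZl//; last 2 first.
      exact/measurable_EFinP.
      by move=> x _; rewrite lee_fin sqn_ge0.
    apply: le_trans (lee_wpmul2l _ (iD n)) _; first by rewrite lee_fin exprn_ge0.
    rewrite -EFinM lee_fin exprS mulrA mulfV// mul1r.
    by rewrite -exprMn; have -> : 2 * 4^-1 = 2^-1 :> R by field.
  apply: lime_le; first by apply: is_cvg_nneseries => n _ _; rewrite lee_fin mulr_ge0 ?exprn_ge0.
  apply: nearW => n; rewrite sumEFin lee_fin -mulr_sumr.
  have : \sum_(0 <= i < n) (2^-1 : R) ^+ i.+1 = 1 - 2^-1 ^+ n.
    elim: n => [|n IH]; first by rewrite big_nil expr0 subrr.
    by rewrite big_nat_recr//= IH exprS; field.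
  move=> ->; have : 0 <= (2^-1 : R) ^+ n by rewrite exprn_ge0.
  lra.
have S0 x : (0 <= S x)%E.
  by apply: nneseries_ge0 => n _ _; rewrite lee_fin mulr_ge0 ?exprn_ge0 ?sqn_ge0.
have intS : mu.-integrable setT S.
  apply/integrableP; split => //; under eq_integral do rewrite gee0_abs//.
  by rewrite (le_lt_trans iS)// ltry.
pose r : R := Num.sqrt 2^-1.
have r2 : r ^+ 2 = 2^-1 by rewrite sqr_sqrtr// invr_ge0.
have r0 : 0 < r by rewrite sqrtr_gt0 invr_gt0.
have r1 : r < 1 by rewrite -(@ltr_pXn2r _ 2%N) ?nnegrE ?ltW// r2 expr1n invf_lt1// ltr1n.
(* Upper limits give a limit function that is measurable everywhere; where they are infinite, [fine]
   returns 0. *)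
pose g x : R[i] := fine (limn_esup (fun n => (complex.Re (u n x))%:E)) +i*
   fine (limn_esup (fun n => (complex.Im (u n x))%:E)).
have mg : cmeasurable g.
  split; apply: (measurableT_comp (@fine_measurable _ setT measurableT)) => //=; apply: measurable_fun_limn_esup => n;
    apply/measurable_EFinP; by have [] := L2_cmeas (u n).
have key : \forall x \ae mu, forall n, ((sqn (u n x - g x))%:E <= (2 * (r ^+ n / (1 - r)) ^+ 2)%:E * S x)%E.
  apply: filterS (integrable_ae measurableT intS) => x /(_ I) fx n.
  have Dx k : sqn (u k.+1 x - u k x) <= (Num.sqrt (fine (S x)) * r ^+ k) ^+ 2.
    rewrite exprMn sqr_sqrtr ?fine_ge0// -exprM mulnC exprM r2.
    rewrite exprVn ler_pdivlMr ?exprn_gt0// mulrC -lee_fin fineK//.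
    rewrite /S (@nneseriesD1 _ _ k xpredT)//; last by move=> j _; rewrite lee_fin mulr_ge0 ?exprn_ge0 ?sqn_ge0.
    by rewrite leeDl//; apply: nneseries_ge0 => j _ _; rewrite lee_fin mulr_ge0 ?exprn_ge0 ?sqn_ge0.
  have [|l [l1 l2 lb]] := cvg_geometric_steps_sqn (sqrtr_ge0 (fine (S x))) _ Dx.
    by rewrite r0 r1.
  have -> : g x = l.
    rewrite /g; case: l l1 l2 lb => a b /= l1 l2 _.
    have {l1}l1 := cvg_EFinR l1; have {l2}l2 := cvg_EFinR l2.
    by congr (_ +i* _); rewrite is_cvg_limn_esupE ?(cvg_lim _ l1) ?(cvg_lim _ l2)//; apply/cvg_ex; eexists; eassumption.
  rewrite -[X in (_ <= _ * X)%E]fineK// -EFinM lee_fin.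
  apply: le_trans (lb n) _; rewrite -mulrA exprMn sqr_sqrtr ?fine_ge0//.
  by rewrite mulrA mulrAC mulrA.
have sB n : square_integrable mu (fun x => u n x - g x) /\
    (\int[mu]_x (sqn (u n x - g x))%:E <= (4 * (r ^+ n / (1 - r)) ^+ 2)%:E)%E.
  have mB : cmeasurable (fun x => u n x - g x) by apply: cmeasurableB => //; exact: L2_cmeas.
  have c0 : 0 <= 2 * (r ^+ n / (1 - r)) ^+ 2 by rewrite mulr_ge0 ?sqr_ge0.
  have bnd : (\int[mu]_x (sqn (u n x - g x))%:E <= (4 * (r ^+ n / (1 - r)) ^+ 2)%:E)%E.
    apply: (@le_trans _ _ (\int[mu]_x ((2 * (r ^+ n / (1 - r)) ^+ 2)%:E * S x))%E).
      apply: ae_ge0_le_integral => //.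
      - by move=> x _; rewrite lee_fin sqn_ge0.
      - exact/measurable_EFinP/measurable_sqn.
      - by move=> x _; rewrite mule_ge0 ?lee_fin.
      - exact: measurable_funeM.
      - by apply: filterS key => x h _; exact: h.
    rewrite ge0_integralZl// (le_trans (lee_wpmul2l _ iS))// -EFinM lee_fin.
    by rewrite le_eqVlt; apply/orP; left; apply/eqP; ring.
  by split => //; exact: square_integrable_le bnd.
have sg : square_integrable mu g.
  have [+ _] := to_L2B (L2_sqint (u 0%N)) (sB 0%N).1.
  by congr square_integrable; apply/funext => x; ring.
exists (to_L2 mu g : L2 mu); rewrite -[u0]/u; apply/cvg_hnP.
have hB n : hn (u n - to_L2 mu g : L2 mu) <= 2 * (r ^+ n / (1 - r)).
  have B0 : 0 <= 2 * (r ^+ n / (1 - r)) by rewrite mulr_ge0// divr_ge0 ?exprn_ge0 ?ltW// subr_gt0.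
  rewrite -(@ler_pXn2r _ 2%N) ?nnegrE ?hn_ge0//.
  have [sh hE] := to_L2B (L2_sqint (u n)) sg; rewrite to_L2K in hE; rewrite -lee_fin -hE -hn2_to_L2//.
  apply: le_trans (sB n).2 _; rewrite lee_fin le_eqVlt; apply/orP; left; apply/eqP; ring.
have c : 2 * (r ^+ n / (1 - r)) @[n --> \oo] --> (0 : R).
  rewrite -[0 in X in _ --> X](mulr0 2); apply: cvgM; first exact: cvg_cst.
  rewrite -[0 in X in _ --> X](mul0r (1 - r)^-1).
  apply: cvgM; last exact: cvg_cst.
  by apply: cvg_expr; rewrite ger0_norm// ltW.
apply: (@squeeze_cvgr _ _ _ _ (cst 0) (fun n => 2 * (r ^+ n / (1 - r)))) => //.
  by apply: nearW => n; rewrite hn_ge0 hB.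
exact: cvg_cst.
Qed.
End L2_facts.

(* [K] is a Lipschitz constant for [m0], which is moreover quadrature-mirror. *)
Record lowpass (R : realType) (N : nat) (m0 : circle R -> R[i]) (K : R) : Prop := {
  lp_N2 : (2 <= N)%N;
  lp_R : forall y, \sum_(r < N) sqn (m0 (nroot N y r)) = N%:R;
  lp_L : forall z w, sqn (m0 z - m0 w) <= K ^+ 2 * sqn (cval z - cval w);
  lp_K : 0 <= K;
  lp_Z : finite_set [set w | m0 w = 0] }.

(* Angles of a finite union of cycles; [tau] is the cyclic predecessor. *)
Record csystem (R : realType) (N : nat) (m0 : circle R -> R[i]) (J : finType)
    (theta : J -> R) (tau : J -> J) : Prop := {
  cs_inj : injective (fun j => expNi (theta j));
  cs_tau : forall j, circle_exp (expNi (theta (tau j))) N = expNi (theta j);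
  cs_m0 : forall j, sqn (m0 (expNi (theta j))) = N%:R }.

(** * The infinite products *)
Section lowpass.
Context {R : realType}.
Variables (N : nat) (m0 : circle R -> R[i]) (K : R).
Hypothesis lp : lowpass N m0 K.
Let N2 : (2 <= N)%N := lp_N2 lp.
Let m0R := lp_R lp.
Let Np : 0 < N%:R :> R. Proof. by rewrite ltr0n; case: N N2. Qed.
Let N0 : N%:R != 0 :> R. Proof. by rewrite gt_eqF. Qed.

Lemma sqn_sqrtN : sqn (sqrtN R N) = N%:R.
Proof. by rewrite /sqrtN sqn_real sqr_sqrtr// ltW. Qed.

Lemma sqrtN_neq0 : sqrtN R N != 0.
Proof. by rewrite /sqrtN eq_complex/= eqxx andbT gt_eqF// sqrtr_gt0. Qed.

Lemma sqn_inv (z : R[i]) : sqn z^-1 = (sqn z)^-1.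
Proof.
have [->|z0] := eqVneq z 0; first by rewrite invr0 sqn0 invr0.
have s0 : sqn z != 0 by apply: contra z0 => /eqP/sqn_eq0 ->.
by apply: (mulfI s0); rewrite -sqnM mulfV// sqn1 mulfV.
Qed.

Definition qm0 (w : circle R) : R := sqn (m0 w) / N%:R.

Lemma qm0_ge0 w : 0 <= qm0 w. Proof. by rewrite divr_ge0 ?sqn_ge0// ltW. Qed.

Lemma sum_qm0 y : \sum_(r < N) qm0 (nroot N y r) = 1.
Proof. by rewrite -mulr_suml m0R mulfV. Qed.

Lemma qm0_le1 w : qm0 w <= 1.
Proof.
have [y yE] := expNi_surj (circle_exp w N).
have [r rN ->] := nroot_surj N2 (esym yE).
rewrite -(sum_qm0 y) (bigD1 (Ordinal rN))//= lerDl.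
by apply: sumr_ge0 => i _; exact: qm0_ge0.
Qed.

(** The product is the probability of reaching [w] from [z] in [L] backward steps. In the induction
    the points are grouped by the iterate [circle_exp w (N ^ L)], which is an [N]-th root of [z]. *)
Lemma level_sum_le1 (L : nat) (z : circle R) (s : seq (circle R)) : uniq s ->
  (forall w, w \in s -> circle_exp w (N ^ L) = z) ->
  \sum_(w <- s) \prod_(i < L) qm0 (circle_exp w (N ^ i)) <= 1.
Proof.
elim: L z s => [|L IH] z s us hs.
  under eq_bigr do rewrite big_ord0.
  rewrite big_const_seq count_predT iter_addr_0.
  have s1 : (size s <= 1)%N.
    case: s us hs => [//|a [//|b s]] /= /andP[+ _] hs.
    have /= := hs a; rewrite mem_head => /(_ isT).
    have /= := hs b; rewrite !inE eqxx orbT => /(_ isT).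
    by rewrite expn0 !circle_exp1 => -> ->; rewrite eqxx.
  by rewrite -[leRHS]/(1%:R) ler_nat.
have [y yE] := expNi_surj z.
rewrite -[leRHS](sum_qm0 y).
apply: (@le_trans _ _ (\sum_(w <- s) \sum_(r < N) (if circle_exp w (N ^ L) == nroot N y r then
    \prod_(i < L.+1) qm0 (circle_exp w (N ^ i)) else 0))).
  rewrite big_seq [leRHS]big_seq; apply: ler_sum => w ws.
  have [|r rN wr] := @nroot_surj R N N2 y (circle_exp w (N ^ L)).
    by rewrite -circle_expM -expnSr hs.
  rewrite (bigD1 (Ordinal rN))//= wr eqxx lerDl; apply: sumr_ge0 => i _.
  by case: ifP => // _; apply: prodr_ge0 => k _; exact: qm0_ge0.
rewrite exchange_big/=; apply: ler_sum => r _.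
rewrite -big_mkcond/=.
under eq_bigr => w wr do rewrite big_ord_recr/= (eqP wr) mulrC.
rewrite -mulr_sumr -[leRHS]mulr1 ler_wpM2l ?qm0_ge0// -big_filter.
apply: (IH (nroot N y r)); first exact: filter_uniq.
by move=> w; rewrite mem_filter => /andP[/eqP].
Qed.

Let m0L := lp_L lp.
Let K0 := lp_K lp.

Variables (J : finType) (theta : J -> R) (tau : J -> J).
Hypothesis cs : csystem N m0 theta tau.

Let c_m0 := cs_m0 cs.

Definition alp j : R[i] := m0 (expNi (theta j)) / sqrtN R N.

(* [ph] is [phi_hat] for an arbitrary finite set of cycle points, and [fac] its factor. *)
Definition fac j (x : R) : R[i] := (alp j)^* * m0 (expNi (x + theta j)) / sqrtN R N.

Definition php j (x : R) (L : nat) : R[i]^o :=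
  \prod_(1 <= l < L.+1) fac (iter l tau j) (x / N%:R ^+ l).

Definition ph j (x : R) : R[i] := lim (php j x @ \oo).

Lemma sqn_alp j : sqn (alp j) = 1.
Proof. by rewrite sqnM sqn_inv c_m0 sqn_sqrtN mulfV. Qed.

Lemma sqn_fac j x : sqn (fac j x) = qm0 (expNi (x + theta j)).
Proof. by rewrite /fac !sqnM sqn_conj sqn_alp mul1r sqn_inv sqn_sqrtN. Qed.

Lemma fac0 j : fac j 0 = 1.
Proof. by rewrite /fac add0r -mulrA -/(alp j) mulrC mul_conjc_sqn sqn_alp. Qed.

Lemma fac_dist j x y : sqn (fac j x - fac j y) <= K ^+ 2 * (x - y) ^+ 2.
Proof.
rewrite /fac -mulrBl -mulrBr !sqnM sqn_conj sqn_alp mul1r sqn_inv sqn_sqrtN.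
rewrite ler_pdivrMr//; apply: le_trans (m0L _ _) _.
have h := expNi_dist (x + theta j) (y + theta j).
apply: (@le_trans _ _ (K ^+ 2 * (x - y) ^+ 2)).
  rewrite ler_wpM2l ?sqr_ge0// (le_trans h)// le_eqVlt; apply/orP; left; apply/eqP; ring.
apply: ler_peMr; first by rewrite mulr_ge0 ?sqr_ge0.
by rewrite ler1n; case: N N2.
Qed.

Lemma phpS j x L : php j x L.+1 = php j x L * fac (iter L.+1 tau j) (x / N%:R ^+ L.+1).
Proof. by rewrite /php big_nat_recr. Qed.

Lemma sqn_php_le1 j x L : sqn (php j x L) <= 1.
Proof.
rewrite /php sqn_prod; apply: prodr_ile1 => l _; rewrite sqn_ge0 sqn_fac qm0_le1.
by [].
Qed.

(** The new factor differs from its value 1 at the origin by at most [K |x| / N^(L+1)]: the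
    Lipschitz condition and the normalization by [alp] together make the product converge
    geometrically. *)
Lemma php_step j x L :
  sqn (php j x L.+1 - php j x L) <= (K * `|x| / N%:R * N%:R^-1 ^+ L) ^+ 2.
Proof.
rewrite phpS -[X in _ - X]mulr1 -mulrBr sqnM -(fac0 (iter L.+1 tau j)).
apply: (@le_trans _ _ (1 * (K ^+ 2 * (x / N%:R ^+ L.+1 - 0) ^+ 2))).
  by rewrite ler_pM ?sqn_ge0 ?sqn_php_le1 ?fac_dist.
rewrite mul1r subr0 le_eqVlt; apply/orP; left; apply/eqP.
rewrite -mulrA -exprS !exprMn real_normK ?num_real//.
have -> : (N%:R^-1 : R) ^+ L.+1 = (N%:R ^+ L.+1)^-1 by rewrite exprVn.
by rewrite mulrA.
Qed.

Let r01 : 0 < (N%:R^-1 : R) < 1.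
Proof. by rewrite invr_gt0 Np/= invf_lt1// ltr1n; case: N N2 => [|[]]. Qed.

(** The constant of [cvg_geometric_steps_sqn] for the ratio [1 / N], with the dependence on [x]
    factored out. *)
Definition phC : R := 2 * (K / N%:R / (1 - N%:R^-1)) ^+ 2.

Lemma php_cvg j x : (php j x @ \oo --> (ph j x : R[i]^o)) /\
  forall L, sqn (php j x L - ph j x) <= phC * (x * N%:R^-1 ^+ L) ^+ 2.
Proof.
have C0 : 0 <= K * `|x| / N%:R by rewrite divr_ge0 ?mulr_ge0// ltW.
have [l [_ _ hl]] := cvg_geometric_steps_sqn C0 r01 (php_step j x).
have hl' L : sqn (php j x L - l) <= phC * (x * N%:R^-1 ^+ L) ^+ 2.
  apply: le_trans (hl L) _; rewrite le_eqVlt; apply/orP; left; apply/eqP.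
  by rewrite /phC !exprMn real_normK ?num_real//; ring.
have cl : php j x @ \oo --> (l : R[i]^o).
  apply/cvg_sqnP => e e0.
  have : phC * (x * N%:R^-1 ^+ L) ^+ 2 @[L --> \oo] --> (0 : R).
    rewrite -[0 in X in _ --> X](mulr0 phC); apply: cvgM; first exact: cvg_cst.
    have c : x * N%:R^-1 ^+ L @[L --> \oo] --> (0 : R).
      rewrite -[0 in X in _ --> X](mulr0 x); apply: cvgM; first exact: cvg_cst.
      by apply: cvg_expr; have /andP[? ?] := r01; rewrite ger0_norm// ltW.
    by rewrite -[0 in X in _ --> X](mulr0 0); exact: cvgM.
  move/cvgrPdist_lt => /(_ _ e0); apply: filterS => L.
  by rewrite sub0r normrN => /(le_lt_trans (ler_norm _)); apply: le_lt_trans.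
have -> : ph j x = l by exact: cvg_complex_lim.
by [].
Qed.

Lemma cvg_sqn (T : Type) (F : set_system T) (FF : Filter F) (f : T -> R[i]^o) (l : R[i]^o) :
  f @ F --> l -> sqn (f x) @[x --> F] --> sqn l.
Proof.
move=> /cvgrPdist_lt h.
have bnd (g : R[i] -> R) : (forall z, `|g z| <= Num.sqrt (sqn z)) -> (forall z w, g (z - w) = g z - g w) ->
    g (f x) @[x --> F] --> g l.
  move=> g1 g2; apply/cvgrPdist_lt => e e0.
  have : 0 < e%:C by rewrite ltcR.
  move/h; apply: filterS => t; rewrite -g2 norm_normc ltcR normcE.
  exact: le_lt_trans.
rewrite /sqn; apply: cvgD; rewrite ?expr2; apply: cvgM; apply: bnd.
1,3,5,7: by move=> z; first [exact: norm_Re_le|exact: norm_Im_le].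
all: by move=> z w; rewrite raddfB.
Qed.

Lemma ph0 j : ph j 0 = 1.
Proof.
apply/eqP; rewrite -subr_eq0; apply/eqP/sqn_eq0/eqP; rewrite eq_le sqn_ge0 andbT.
have [_ /(_ 0%N)] := php_cvg j 0; rewrite mul0r expr0n/= mulr0 /php big_nil.
by rewrite -sqnN opprB.
Qed.

(** All factors have modulus at most 1, so the moduli of the partial products decrease to the
    limit. *)
Lemma sqn_ph_le j x L : sqn (ph j x) <= sqn (php j x L).
Proof.
have [/cvg_sqn c _] := php_cvg j x.
apply: (@cvgr_to_le _ _ _ _ _ _ _ c); exists L => // M /= LM.
rewrite -(subnKC LM); elim: (M - L)%N => [|k IH]; first by rewrite addn0.
by rewrite addnS phpS sqnM (le_trans _ IH)// ler_piMr ?sqn_ge0// sqn_fac qm0_le1.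
Qed.

Lemma sqn_ph_le1 j x : sqn (ph j x) <= 1.
Proof. by rewrite (le_trans (sqn_ph_le j x 0)) ?sqn_php_le1. Qed.

(** The refinement equation, which becomes [U phi = pi(m0) phi]: the first factor at [N x] is taken
    at [x], and the remaining ones form the product of the predecessor. *)
Lemma ph_refine j x : ph j (N%:R * x) = fac (tau j) x * ph (tau j) x.
Proof.
have [c1 _] := php_cvg j (N%:R * x); have [c2 _] := php_cvg (tau j) x.
have h L : php j (N%:R * x) L.+1 = fac (tau j) x * php (tau j) x L.
  rewrite /php big_nat_recl//= expr1 (mulrC N%:R) mulfK//; congr (_ * _).
  apply: eq_bigr => l _; rewrite -iterSr -iterS; congr fac.
  by rewrite exprS invfM mulrA mulfK.
have c3 : fac (tau j) x * php (tau j) x L @[L --> \oo] --> (fac (tau j) x * ph (tau j) x : R[i]^o).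
  exact: (@cvgM _ _ _ _ (fun _ : nat => fac (tau j) x : R[i]^o) (php (tau j) x) _ _ (cvg_cst _) c2).
rewrite -cvg_shiftS in c1.
have e : [sequence php j (N%:R * x) n.+1]_n = (fun L => fac (tau j) x * php (tau j) x L).
  by apply/funext => L /=; rewrite h.
rewrite e in c1.
exact: (cvg_complex_unique _ c1 c3).
Qed.

Lemma continuous_fac j : continuous (fac j : R -> R[i]^o).
Proof.
move=> x; apply/(@cvg_sqnP _ _ _ (nbhs_filter _)) => e e0.
have K1 : 0 < K ^+ 2 + 1 by rewrite ltr_wpDl ?sqr_ge0.
have s0 : 0 < Num.sqrt (e / (K ^+ 2 + 1)) by rewrite sqrtr_gt0 divr_gt0.
have := nbhsx_ballx x _ s0; apply: filterS => y; rewrite -ball_normE/= => xy.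
apply: le_lt_trans (fac_dist _ _ _) _.
have : (y - x) ^+ 2 < e / (K ^+ 2 + 1).
  rewrite -(sqr_sqrtr (ltW (divr_gt0 e0 K1))) -(real_normK (num_real (y - x))) distrC.
  by rewrite ltr_sqr ?nnegrE// ltW.
rewrite ltr_pdivlMr// => h; apply: le_lt_trans h.
by rewrite mulrC ler_wpM2l ?sqr_ge0// lerDl.
Qed.

Lemma continuous_php j L : continuous (fun x => php j x L).
Proof.
elim: L => [|L IH] x.
  by rewrite /php; under eq_fun do rewrite big_nil; exact: cvg_cst.
under eq_fun do rewrite phpS.
apply: (@cvgM _ _ _ _ (fun x => php j x L) (fun x => fac (iter L.+1 tau j) (x / N%:R ^+ L.+1) : R[i]^o)).
  exact: IH.
apply: (@continuous_comp _ _ _ (fun x : R => x / N%:R ^+ L.+1) (fac (iter L.+1 tau j) : R -> R[i]^o)).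
  by apply: cvgM; [exact: cvg_id|exact: cvg_cst].
exact: continuous_fac.
Qed.

(** The partial products are continuous and, by the explicit remainder in [php_cvg], converge
    uniformly on bounded sets. *)
Lemma continuous_ph j : continuous (ph j : R -> R[i]^o).
Proof.
move=> x; apply/(@cvg_sqnP _ _ _ (nbhs_filter _)) => e e0.
have phC0 : 0 <= phC by rewrite /phC mulr_ge0 ?sqr_ge0.
have [L hL] : exists L, phC * ((`|x| + 1) * N%:R^-1 ^+ L) ^+ 2 < e / 16.
  have : phC * ((`|x| + 1) * N%:R^-1 ^+ L) ^+ 2 @[L --> \oo] --> (0 : R).
    rewrite -[0 in X in _ --> X](mulr0 phC); apply: cvgM; first exact: cvg_cst.
    have c : (`|x| + 1) * N%:R^-1 ^+ L @[L --> \oo] --> (0 : R).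
      rewrite -[0 in X in _ --> X](mulr0 (`|x| + 1)); apply: cvgM; first exact: cvg_cst.
      by apply: cvg_expr; have /andP[? ?] := r01; rewrite ger0_norm// ltW.
    by rewrite -[0 in X in _ --> X](mulr0 0); exact: cvgM.
  move/cvgrPdist_lt => /(_ (e / 16)) []; first by rewrite divr_gt0.
  move=> L _ /(_ L (leqnn L)); rewrite sub0r normrN => h; exists L.
  by rewrite (le_lt_trans _ h)// ler_norm.
have bd y : `|y| <= `|x| + 1 -> sqn (php j y L - ph j y) < e / 16.
  move=> hy; apply: le_lt_trans hL; have [_ /(_ L) h] := php_cvg j y.
  apply: le_trans h _; rewrite ler_wpM2l// !exprMn ler_wpM2r ?sqr_ge0//.
  by rewrite -(real_normK (num_real y)) ler_sqr ?nnegrE ?addr_ge0.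
have /cvg_sqnP /(_ (e / 16)) c := @continuous_php j L x.
have e16 : 0 < e / 16 by rewrite divr_gt0.
have n1 : \forall y \near x, `|y| <= `|x| + 1.
  have := nbhsx_ballx x 1 ltr01; apply: filterS => y; rewrite -ball_normE/= => xy.
  have := ler_normD x (y - x); rewrite addrC subrK distrC => h.
  by rewrite (le_trans h)// lerD2l ltW.
have c' := c e16.
apply: filterS2 n1 c' => y hy1 hy2.
have b1 := bd _ hy1; have b2 : sqn (php j x L - ph j x) < e / 16 by apply: bd; rewrite lerDl.
have -> : ph j y - ph j x = (- (php j y L - ph j y) + (php j x L - ph j x)) + (php j y L - php j x L).
  by ring.
apply: le_lt_trans (sqnD_le2 _ _) _.
have := sqnD_le2 (- (php j y L - ph j y)) (php j x L - ph j x); rewrite sqnN.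
lra.
Qed.

Lemma continuous_sqn_ph j : continuous (fun x => sqn (ph j x)).
Proof. by move=> x; apply: cvg_sqn; exact: continuous_ph. Qed.

End lowpass.

(** * The periodized square modulus *)

Section correlation.
Context {R : realType}.
Variables (N : nat) (m0 : circle R -> R[i]) (K : R).
Hypothesis lp : lowpass N m0 K.
Let N2 : (2 <= N)%N := lp_N2 lp.
Let Np : 0 < N%:R :> R. Proof. by rewrite ltr0n; case: N N2. Qed.
Let N0 : N%:R != 0 :> R. Proof. by rewrite gt_eqF. Qed.
Let pi20 : 0 < 2 * pi :> R. Proof. by rewrite mulr_gt0// pi_gt0. Qed.

Variables (J : finType) (theta : J -> R) (tau : J -> J).
Hypothesis cs : csystem N m0 theta tau.
Local Notation ph := (ph N m0 theta tau).
Local Notation c j := (expNi (theta j)).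

Lemma tau_inj : injective tau.
Proof.
move=> j k e; apply: (cs_inj cs); rewrite -(cs_tau cs j) -(cs_tau cs k) e.
by [].
Qed.

Lemma cs_gap : exists2 d : R, 0 < d & forall j k, j != k -> d <= sqn (cval (c j) - cval (c k)).
Proof.
pose d := \big[Num.min/1]_(p : J * J | p.1 != p.2) sqn (cval (c p.1) - cval (c p.2)).
exists d; last by move=> j k jk; rewrite /d (bigminD1 (j, k))//= ge_min lexx.
rewrite /d; elim/big_ind: _ => //= [x y x0 y0|[j k] /= jk]; first by rewrite lt_min x0.
rewrite lt0r sqn_ge0 andbT; apply: contra jk => /eqP/sqn_eq0/eqP.
by rewrite subr_eq0 => /eqP/cval_inj/(cs_inj cs)/eqP.
Qed.

(* The real arguments at which the [|ph j|^2] enter the periodization [corr]. *)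
Definition arg (p : J * int) (y : R) : R := y - theta p.1 + 2 * pi * p.2%:~R.

(* [lev p y L] is the point of the circle occurring in the [L]-th factor of [ph] at [arg p y]. *)
Definition lev (p : J * int) (y : R) (L : nat) : circle R :=
  expNi (arg p y / N%:R ^+ L + theta (iter L tau p.1)).

Lemma lev_exp p y L k : circle_exp (lev p y (L + k)) (N ^ k) = lev p y L.
Proof.
rewrite /lev; elim: k => [|k IH]; first by rewrite addn0 expn0 circle_exp1.
rewrite expnS circle_expM -IH; congr (circle_exp _ (N ^ k)).
rewrite addnS expNiD circle_mulX /= (cs_tau cs) -expNiMn -expNiD.
by rewrite exprS invfM (mulrCA N%:R) mulVKf.
Qed.

Lemma lev0 p y : lev p y 0 = expNi y.
Proof.
rewrite /lev /arg expr0 divr1 /= addrAC addrNK.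
exact: expNi_periodic.
Qed.

(** As [L] grows, [lev p y L] approaches the cycle point of [iter L tau p.1]. Coincidence at all
    levels thus forces equal cycle points, by [cs_gap], and then equal arguments: their difference
    divided by [N^L] is a multiple of [2 pi] that tends to 0. *)
Lemma lev_sep p q y : p != q -> exists L0, forall L, (L0 <= L)%N -> lev p y L != lev q y L.
Proof.
move=> pq; apply: contrapT => h.
(* A coincidence descends to all lower levels by [lev_exp], so coincidences at arbitrarily high
   levels give one at every level. *)
have e L : lev p y L = lev q y L.
  apply: contrapT => hL; apply: h; exists L => M LM; apply/eqP => hM; apply: hL.
  by rewrite -(lev_exp p y L (M - L)) -(lev_exp q y L (M - L)) subnKC// hM.
have [d d0 hd] := cs_gap.
have r01 : 0 < (N%:R^-1 : R) < 1.
  by rewrite invr_gt0 Np/= invf_lt1// ltr1n; case: N N2 => [|[]].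
have ev (x e1 : R) : 0 < e1 -> exists L0, forall L, (L0 <= L)%N -> `|x / N%:R ^+ L| < e1.
  move=> e0; have : x * N%:R^-1 ^+ L @[L --> \oo] --> (0 : R).
    rewrite -[0 in X in _ --> X](mulr0 x); apply: cvgM; first exact: cvg_cst.
    by apply: cvg_expr; have /andP[? ?] := r01; rewrite ger0_norm// ltW.
  move/cvgrPdist_lt => /(_ _ e0)[L0 _ hL0]; exists L0 => L /hL0 /=.
  by rewrite sub0r normrN exprVn.
pose x := arg p y - arg q y.
have pq1 : p.1 = q.1.
  have s0 : 0 < Num.sqrt d by rewrite sqrtr_gt0.
  have [L hL] := ev x _ s0; have {}hL := hL L (leqnn L).
  have : iter L tau p.1 = iter L tau q.1.
    apply/eqP; apply: contrapT => /negP /hd; apply/negP; rewrite -ltNge.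
    have := expNi_dist (- (arg p y / N%:R ^+ L)) (- (arg q y / N%:R ^+ L)).
    have hc k : c (iter L tau k) = c (iter L tau k) by [].
    have ce p' : cval (c (iter L tau p'.1)) = cval (expNi (- (arg p' y / N%:R ^+ L))) * cval (lev p' y L).
      by rewrite /lev -cval_mul -expNiD addrA addNr add0r.
    rewrite !ce e -mulrBl sqnM sqn_cval mulr1 => /le_lt_trans; apply.
    rewrite -(sqr_sqrtr (ltW d0)) -(real_normK (num_real (_ - _))).
    by rewrite ltr_sqr ?nnegrE// 1?ltW// opprK addrC -mulrBl -normrN -mulNr opprB.
  by elim: L {hL} => //= L IH /tau_inj.
have x0 : x = 0.
  have [L hL] := ev x (2 * pi) pi20; have {}hL := hL L (leqnn L).
  have := e L; rewrite /lev pq1 => /expNi_eq[l hl].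
  have xl : x / N%:R ^+ L = 2 * pi * l%:~R by rewrite /x mulrBl; lra.
  move: hL; rewrite xl normrM gtr0_norm// gtr_pMr// -intr_norm -[1]/(1%:~R) ltr_int.
  move=> l1; have l0 : l = 0 by lia.
  have := xl; rewrite l0 mulr0 => /eqP; rewrite mulf_eq0 invr_eq0 expf_eq0 (negbTE N0) andbF orbF.
  by move/eqP.
move/eqP: pq; apply; rewrite [p]surjective_pairing [q]surjective_pairing pq1; congr (_, _).
move: x0; rewrite /x /arg pq1 => h'.
have : 2 * pi * p.2%:~R = 2 * pi * q.2%:~R :> R by lra.
by move/(mulfI (lt0r_neq0 pi20))/intr_inj.
Qed.

Lemma sum_sqn_ph_le1 y (s : seq (J * int)) : uniq s ->
  \sum_(p <- s) sqn (ph p.1 (arg p y)) <= 1.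
Proof.
move=> us.
have [L hL] : exists L, forall p q, p \in s -> q \in s -> p != q -> lev p y L != lev q y L.
  have h (pq : (J * int) * (J * int)) : exists L0, pq.1 != pq.2 -> forall L, (L0 <= L)%N -> lev pq.1 y L != lev pq.2 y L.
    have [->|ne] := eqVneq pq.1 pq.2; first by exists 0%N.
    by have [L0 hL0] := lev_sep y ne; exists L0.
  have [f hf] := choice h.
  exists (\max_(t <- [seq (p, q) | p <- s, q <- s]) f t) => p q ps qs pq.
  apply: (hf (p, q)) => //; apply: leq_bigmax_seq => //.
  by apply/allpairsP; exists (p, q).
apply: (@le_trans _ _ (\sum_(w <- [seq lev p y L | p <- s]) \prod_(i < L) qm0 N m0 (circle_exp w (N ^ i)))).
  rewrite big_map; apply: ler_sum => p _.
  apply: le_trans (sqn_ph_le lp cs p.1 (arg p y) L) _.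
  rewrite /php sqn_prod big_add1 /= big_mkord.
  (* Factor [l] of the product sits at level [l], the [N^(L-l)]-th power of the point at level [L],
     whence the reversal of the indices. *)
  rewrite (reindex_inj rev_ord_inj)/= le_eqVlt; apply/orP; left; apply/eqP.
  apply: eq_bigr => i _; rewrite (sqn_fac lp cs); congr qm0.
  have iL := ltn_ord i.
  rewrite -[X in X = _]/(lev p y (L - i.+1).+1) (_ : (L - i.+1).+1 = (L - i)%N); last lia.
  by rewrite -(lev_exp p y (L - i) i) subnK// ltnW.
apply: (level_sum_le1 lp (z := expNi y)).
  rewrite map_inj_in_uniq// => p q ps qs e; apply/eqP; apply: contrapT => /negP pq.
  by have := hL p q ps qs pq; rewrite e eqxx.
move=> w /mapP[p ps ->].
by have := lev_exp p y 0 L; rewrite add0n lev0.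
Qed.

(* [b] selects some of the cycles. *)
Variable b : pred J.
Hypothesis b_tau : forall j, b (tau j) = b j.

Definition term (p : J * int) (y : R) : R := if b p.1 then sqn (ph p.1 (arg p y)) else 0.

Lemma term_ge0 p y : 0 <= term p y.
Proof. by rewrite /term; case: ifP => // _; exact: sqn_ge0. Qed.

Lemma term_le p y : term p y <= sqn (ph p.1 (arg p y)).
Proof. by rewrite /term; case: ifP => // _; exact: sqn_ge0. Qed.

(** The function G restricted to the cycles selected by [b]; [corrR] is its real value. *)
Definition corr (y : R) : \bar R := \esum_(p in [set: J * int]) (term p y)%:E.
Definition corrR y : R := fine (corr y).

Lemma corr_le1 y : (corr y <= 1%:E)%E.
Proof.
apply: esum_le_seq => s us; rewrite lee_fin; apply: le_trans (sum_sqn_ph_le1 y us).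
by apply: ler_sum => p _; exact: term_le.
Qed.

Lemma corrE y : corr y = (corrR y)%:E.
Proof. exact: esum_ltyP (fun p => term_ge0 p y) (corr_le1 y). Qed.

Lemma corrR_le1 y : corrR y <= 1. Proof. by rewrite -lee_fin -corrE corr_le1. Qed.

Lemma corrR_seq y s : uniq s -> \sum_(p <- s) term p y <= corrR y.
Proof. by move=> us; rewrite -lee_fin -corrE; apply: esum_seq_le => // p; exact: term_ge0. Qed.

Lemma corrR_ge0 y : 0 <= corrR y.
Proof. by have := @corrR_seq y [::] isT; rewrite big_nil. Qed.

Lemma corrR_gt y (a : R) : a < corrR y ->
  exists2 s, uniq s & a < \sum_(p <- s) term p y.
Proof.
move=> h; have [|s us hs] := @esum_gt_seq R _ (fun p => term p y) a%:E.
  by rewrite -/(corr y) corrE lte_fin.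
by exists s => //; rewrite -lte_fin.
Qed.

Lemma corrR_cycle j : b j -> 1 <= corrR (theta j).
Proof.
move=> bj; have := @corrR_seq (theta j) [:: (j, 0)] isT.
by rewrite big_seq1 /term /= bj /arg subrr mulr0 addr0 (ph0 lp cs) sqn1.
Qed.

(** A finite sum exceeding [a] at [y] is continuous, so it still exceeds [a] nearby. *)
Lemma corrR_lsc y (a : R) : a < corrR y ->
  exists2 d : R, 0 < d & forall x, `|x - y| < d -> a < corrR x.
Proof.
move=> /corrR_gt[s us hs].
have : \sum_(p <- s) term p x @[x --> y] --> \sum_(p <- s) term p y.
  elim: s {us hs} => [|p s IH]; first by under eq_fun do rewrite big_nil; rewrite big_nil; exact: cvg_cst.
  under eq_fun do rewrite big_cons; rewrite big_cons; apply: cvgD => //.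
  rewrite /term; case: ifP => _; last exact: cvg_cst.
  apply: (@continuous_comp _ _ _ (arg p) (fun x => sqn (ph p.1 x))).
    by apply: cvgD; [apply: cvgB; [exact: cvg_id|exact: cvg_cst]|exact: cvg_cst].
  exact: (continuous_sqn_ph lp cs).
move/cvgrPdist_lt => /(_ (\sum_(p <- s) term p y - a)).
rewrite subr_gt0 => /(_ hs)[d /= d0 hd]; exists d => // x xy.
apply: lt_le_trans (corrR_seq x us).
have := hd x; rewrite /ball_/= distrC => /(_ xy) /(le_lt_trans (ler_norm _)); lra.
Qed.

Lemma corrR_periodic y (l : int) : corrR (y + 2 * pi * l%:~R) = corrR y.
Proof.
have h x (k : int) : corrR (x + 2 * pi * k%:~R) <= corrR x.
  rewrite -lee_fin -corrE; apply: esum_le_seq => s us; rewrite lee_fin.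
  have := @corrR_seq x [seq (p.1, p.2 + k) | p <- s]; rewrite big_map map_inj_uniq; last first.
    by move=> [j a] [j' a'] /= [-> /addIr ->].
  move=> /(_ us); apply: le_trans; rewrite le_eqVlt; apply/orP; left; apply/eqP.
  apply: eq_bigr => p _; rewrite /term /=; case: ifP => // _.
  by rewrite /arg /= intrD; congr (sqn (ph _ _)); ring.
apply/eqP; rewrite eq_le h/=.
by have := h (y + 2 * pi * l%:~R) (- l); rewrite mulrNz mulrN addrK.
Qed.

Lemma corrR_expNi x y : expNi x = expNi y -> corrR x = corrR y.
Proof. by move=> /expNi_eq[l ->]; rewrite corrR_periodic. Qed.

(** By the refinement equation, the term of index [(j, a)] at a root, times the probability of that
    root, is a term at [y]. Distinct roots and indices give distinct terms, which yields the
    inequality on finite lists. *)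
Lemma corrR_transfer y :
  \sum_(r < N) qm0 N m0 (nroot N y r) * corrR ((y + 2 * pi * r%:R) / N%:R) <= corrR y.
Proof.
have /choice[k hk] j : exists l : int, N%:R * theta (tau j) = theta j + 2 * pi * l%:~R.
  by apply: expNi_eq; rewrite expNiMn (cs_tau cs).
have [sg tsK sgK] : exists2 sg, cancel tau sg & cancel sg tau.
  by have [sg h1 h2] := injF_bij tau_inj; exists sg.
(* [sg] is the cyclic successor. The integer [r + N p.2] is a Euclidean division by [N], which makes
   the map injective; [k] corrects for the turns made by [N theta]. *)
pose idx (r : 'I_N) (p : J * int) := (sg p.1, (r%:Z + N%:Z * p.2 - k (sg p.1))%R).
have fin (s : seq (J * int)) : uniq s ->
    \sum_(r < N) qm0 N m0 (nroot N y r) *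
      \sum_(p <- s) term p ((y + 2 * pi * r%:R) / N%:R) <= corrR y.
  move=> us.
  have := @corrR_seq y [seq idx r p | r <- enum 'I_N, p <- s].
  have -> : uniq [seq idx r p | r <- enum 'I_N, p <- s].
    apply: allpairs_uniq => //; first exact: enum_uniq.
    move=> [r1 [j1 a1]] [r2 [j2 a2]] _ _ /= [/(can_inj sgK) <- e].
    have r1N := ltn_ord r1; have r2N := ltn_ord r2.
    have {}e : (r1%:Z + N%:Z * a1 = r2%:Z + N%:Z * a2)%R by lia.
    have a12 : a1 = a2 by nia.
    by rewrite a12; congr (_, _); apply: val_inj => /=; move: e; rewrite a12 => /addIr [].
  move=> /(_ isT); apply: le_trans; rewrite big_allpairs_dep big_enum/=.
  apply: ler_sum => r _; rewrite mulr_sumr; apply: ler_sum => -[j a] _ /=.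
  rewrite /term /= -(b_tau (sg j)) sgK; case: ifP => _; last by rewrite mulr0.
  set x := arg _ (_ / _).
  have -> : arg (idx r (j, a)) y = N%:R * x.
    rewrite /x /idx /arg /= intrB intrD intrM -!pmulrn.
    have := hk (sg j); rewrite sgK => h.
    have -> : N%:R * ((y + 2 * pi * r%:R) / N%:R - theta j + 2 * pi * a%:~R) =
      y + 2 * pi * r%:R - N%:R * theta j + N%:R * (2 * pi * a%:~R) by field.
    by rewrite h; ring.
  rewrite (ph_refine lp cs) sgK sqnM (sqn_fac lp cs) /x /arg /= le_eqVlt; apply/orP; left; apply/eqP.
  congr (qm0 _ _ _ * _); rewrite /nroot -[LHS](expNi_periodic _ a); congr expNi; ring.
apply/ler_addgt0Pr => e e0.
have /choice[sr hsr] (r : 'I_N) : exists s : seq (J * int), uniq s /\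
   corrR ((y + 2 * pi * r%:R) / N%:R) - e < \sum_(p <- s) term p ((y + 2 * pi * r%:R) / N%:R).
  have [|s us hs] := @corrR_gt ((y + 2 * pi * r%:R) / N%:R) (corrR ((y + 2 * pi * r%:R) / N%:R) - e).
    by rewrite gtrBl.
  by exists s.
(* The lists that nearly exhaust the sums at the [N] roots are merged into one, to which [fin]
   applies. *)
pose s := undup (flatten [seq sr r | r <- enum 'I_N]).
have hs (r : 'I_N) : corrR ((y + 2 * pi * r%:R) / N%:R) - e <=
    \sum_(p <- s) term p ((y + 2 * pi * r%:R) / N%:R).
  have [ur /ltW h] := hsr r; apply: le_trans h _.
  apply: ler_sum_subseq => //; first exact: undup_uniq.
    by move=> p ps; rewrite mem_undup; apply/flatten_mapP; exists r; rewrite ?mem_enum.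
  by move=> *; exact: term_ge0.
apply: le_trans (_ : _ <= \sum_(r < N) qm0 N m0 (nroot N y r) *
    (\sum_(p <- s) term p ((y + 2 * pi * r%:R) / N%:R) + e)) _.
  apply: ler_sum => r _; have q0 := @qm0_ge0 R N m0 (nroot N y r).
  by have := hs r; rewrite lerBlDr => h; exact: ler_wpM2l.
under eq_bigr do rewrite mulrDr.
rewrite big_split/= -mulr_suml (sum_qm0 lp) mul1r lerD2r.
exact: fin (undup_uniq _).
Qed.

End correlation.

(** * The minimum principle and fixed points of the transfer operator *)
Section minimum_principle.
Context {R : realType}.
Variables (N : nat) (m0 : circle R -> R[i]) (K : R).
Hypothesis lp : lowpass N m0 K.
Let N2 : (2 <= N)%N := lp_N2 lp.
Hypothesis ex_cycle : exists z, cycle_pt N m0 z.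

Variable h : R -> R.
Hypothesis h0 : forall y, 0 <= h y.
Hypothesis h_per : forall x y, expNi x = expNi y -> h x = h y.
Hypothesis h_lsc : forall y a, a < h y -> exists2 d : R, 0 < d & forall x, `|x - y| < d -> a < h x.
Hypothesis h_transfer : forall y,
  \sum_(r < N) qm0 N m0 (nroot N y r) * h ((y + 2 * pi * r%:R) / N%:R) <= h y.

(** By periodicity a minimizing sequence can be taken in [[0, 2 pi[]; at an accumulation point,
    lower semicontinuity bounds the value by the infimum. *)
Lemma lsc_min : exists y0, forall y, h y0 <= h y.
Proof.
have hi : has_inf (range h).
  by split; [exists (h 0), 0|exists 0 => _ [y _ <-]].
pose m := inf (range h).
have mle y : m <= h y by apply: ge_inf; [case: hi|exists y].
have h1 n : exists u, 0 <= u < 2 * pi /\ h u < m + n.+1%:R^-1.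
  have [_ [y _ <-] hy] : exists2 t, range h t & t < m + n.+1%:R^-1.
    by apply: inf_adherent => //; rewrite invr_gt0.
  have [l hl] := expNi_mod y; exists (y + 2 * pi * l%:~R); split => //.
  by rewrite (h_per (expNi_periodic y l)).
have [u hu] := choice h1.
have bu : bounded_fun u.
  exists (2 * pi); split; first exact: num_real.
  move=> x hx n _ /=; have [/andP[u0 u1] _] := hu n.
  by rewrite ger0_norm// (le_trans (ltW u1))// ltW.
have [f fi /cvg_ex[l fl]] := bolzano_weierstrass bu.
exists l => y; apply: le_trans (mle y); rewrite leNgt; apply/negP => ml.
have ma : m < (m + h l) / 2 by lra.
have /h_lsc[d d0 hd] : (m + h l) / 2 < h l by lra.
have e0 : 0 < (h l - m) / 2 by rewrite divr_gt0// subr_gt0.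
move/cvgrPdist_lt : fl => /(_ _ d0) [n1 _ hn1].
have /cvgrPdist_lt /(_ _ e0) [n2 _ hn2] := @cvg_harmonic R.
pose n := maxn n1 n2.
have := hn1 n (leq_maxl _ _); rewrite /= distrC => /hd.
have [_ hf] := hu (f n).
have fS k : (f k < f k.+1)%N by rewrite ltnNge; have := fi k.+1 k; rewrite !leEnat ltnn => ->.
have nf : (n <= f n)%N by elim: (n) => // k IH; exact: leq_ltn_trans IH (fS k).
have := hn2 n (leq_maxr _ _); rewrite /= sub0r normrN ger0_norm// => hn.
have : (f n).+1%:R^-1 <= n.+1%:R^-1 :> R by rewrite lef_pV2 ?posrE// ler_nat ltnS.
move: hf hn; set A := h _; set B := _.+1%:R^-1; set C := _.+1%:R^-1 => q1 q2 q3 q4.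
by clear -q1 q2 q3 q4; lra.
Qed.

(* The minimum set of [h] is closed and stable under preimages of positive
   probability, so it meets a cycle. *)
Lemma minimum_at_cycle (a : R) : (forall y, cycle_pt N m0 (expNi y) -> a <= h y) ->
  forall y, a <= h y.
Proof.
move=> ha y; have [y0 hy0] := lsc_min.
apply: le_trans (hy0 y).
pose F := [set z : circle R | exists x, expNi x = z /\ h x <= h y0].
have cF : closed F.
  move=> z cz; have [x xz] := expNi_surj z; exists x; split => //.
  rewrite leNgt; apply/negP => /h_lsc[d d0 hd].
  have [e e0 he] := expNi_local x d0.
  have [|w [[x' [x'w hx']] /= wz]] := cz [set w | sqn (cval w - cval z) < e].
    by apply/nbhs_circleP; exists e.
  rewrite -xz in wz; have [x'' xx'' x''w] := he _ wz.
  have := hd _ xx''; rewrite (h_per (etrans x''w (esym x'w))).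
  by move=> /lt_le_trans -/(_ _ hx'); rewrite ltxx.
have [|w [x [xw hx]] m0w|z [x [xz hx]] cz] := invariant_set_cycle N2 (lp_R lp) (lp_Z lp) cF _ _ ex_cycle.
- by exists (expNi y0); exists y0.
- have [r rN wr] := nroot_surj N2 (esym xw).
  exists ((x + 2 * pi * r%:R) / N%:R); split => //.
  have q0 : 0 < qm0 N m0 w.
    rewrite /qm0 divr_gt0// ?ltr0n; last by case: N N2.
    rewrite lt0r sqn_ge0 andbT; apply: contra m0w => /eqP/sqn_eq0 ->.
    by [].
  (* The mean of [h - h y0] over the roots is at most 0 although its terms are nonnegative, so every
     root of positive weight is again a minimum. *)
  have : \sum_(s < N) qm0 N m0 (nroot N x s) * (h ((x + 2 * pi * s%:R) / N%:R) - h y0) <= 0.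
    under eq_bigr do rewrite mulrBr.
    rewrite sumrB -mulr_suml (sum_qm0 lp) mul1r subr_le0.
    exact: le_trans (h_transfer x) hx.
  rewrite (bigD1 (Ordinal rN))//= -wr => hs.
  have : qm0 N m0 w * (h ((x + 2 * pi * r%:R) / N%:R) - h y0) <= 0.
    apply: le_trans hs; rewrite lerDl; apply: sumr_ge0 => s _.
    by rewrite mulr_ge0 ?qm0_ge0// subr_ge0.
  by rewrite pmulr_rle0// subr_le0.
- by apply: le_trans hx; apply: ha; rewrite xz.
Qed.

End minimum_principle.

Section full_system.
Context {R : realType}.
Variables (N : nat) (m0 : circle R -> R[i]) (K : R).
Hypothesis lp : lowpass N m0 K.
Variables (J : finType) (theta : J -> R) (tau : J -> J).
Hypothesis cs : csystem N m0 theta tau.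
Hypothesis full : forall z, cycle_pt N m0 z -> exists j, expNi (theta j) = z.
Hypothesis ex_cycle : exists z, cycle_pt N m0 z.
Local Notation h b := (corrR N m0 theta tau b).

Lemma corrR_full y : h xpredT y = 1.
Proof.
apply/eqP; rewrite eq_le (corrR_le1 lp cs)//= .
apply: (@minimum_at_cycle _ _ _ _ lp ex_cycle (h xpredT)).
- exact: (corrR_ge0 lp cs).
- exact: (corrR_expNi lp cs).
- exact: (corrR_lsc lp cs).
- exact: (corrR_transfer lp cs).
- move=> {}y /full[j /(corrR_expNi lp cs) <-].
  by rewrite (corrR_cycle lp cs).
Qed.

Variables (M : nat) (kappa : J -> 'I_M).
Hypothesis kappa_tau : forall j, kappa (tau j) = kappa j.
Local Notation b i := (fun j => kappa j == i).
Let b_tau i j : (kappa (tau j) == i) = (kappa j == i). Proof. by rewrite kappa_tau. Qed.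

Lemma corrR_sum y : \sum_i h (b i) y = 1.
Proof.
rewrite -(corrR_full y); apply: EFin_inj; rewrite -sumEFin -(corrE lp cs).
under eq_bigr do rewrite -(corrE lp cs).
rewrite /corr -(@esum_sum _ _ _ setT (index_enum 'I_M) xpredT (fun p i => (term N m0 theta tau (b i) p y)%:E)).
  apply: eq_esum => p _; rewrite (bigD1 (kappa p.1))//= {1}/term eqxx big1 ?adde0//.
  by move=> i /negbTE ik; rewrite /term eq_sym ik.
by move=> p i _ _; rewrite lee_fin term_ge0.
Qed.

(** Each of these functions is 1 minus the sum of the others, hence upper as well as lower
    semicontinuous. *)
Lemma corrR_continuous i : continuous (h (b i)).
Proof.
move=> y; apply/cvgrPdist_lt => e e0.
pose S x := \sum_(k | k != i) h (b k) x.
have hS x : h (b i) x = 1 - S x by rewrite -(corrR_sum x) (bigD1 i)//= addrK.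
have [d1 d10 hd1] : exists2 d : R, 0 < d & forall x, `|x - y| < d -> h (b i) y - e < h (b i) x.
  by apply: (corrR_lsc lp cs); rewrite gtrBl.
have [d2 d20 hd2] : exists2 d : R, 0 < d & forall x, `|x - y| < d -> S y - e < S x.
  pose e' := e / (M%:R + 1).
  have M1 : 0 < M%:R + 1 :> R by rewrite ltr_wpDl.
  have e'0 : 0 < e' by rewrite divr_gt0.
  have /choice[d hd] (k : 'I_M) : exists d : R, 0 < d /\ forall x, `|x - y| < d -> h (b k) y - e' < h (b k) x.
    have [|d d0 hd] := @corrR_lsc _ _ _ _ lp _ _ _ cs (b k) y (h (b k) y - e').
      by rewrite gtrBl.
    by exists d.
  exists (\big[Num.min/1]_k d k).
    by elim/big_ind: _ => // [x z x0 z0|k _]; [rewrite lt_min x0|case: (hd k)].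
  move=> x xy.
  have : \sum_(k | k != i) (h (b k) y - e') <= S x.
    apply: ler_sum => k _; apply/ltW; have [_] := hd k; apply.
    by apply: lt_le_trans xy _; exact: bigmin_le_cond.
  rewrite sumrB => /(lt_le_trans _); apply; rewrite ltrD2l ltrN2.
  apply: (@le_lt_trans _ _ (M%:R * e')); last first.
    by rewrite /e' mulrCA gtr_pMr// ltr_pdivrMr// mul1r ltrDl.
  rewrite (_ : M%:R * e' = \sum_(k < M) e'); last by rewrite sumr_const card_ord mulr_natl.
  by rewrite [leRHS](bigD1 i)//= lerDr ltW.
have dm : 0 < Num.min d1 d2 by rewrite lt_min d10.
have := nbhsx_ballx y _ dm; apply: filterS => x; rewrite -ball_normE/= distrC lt_min => /andP[x1 x2].
have := hd1 _ x1; have {hd1 hd2} := hd2 _ x2; rewrite !hS ltr_norml; set A := S x; set B := S y => q1 q2; clear -q1 q2.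
by apply/andP; split; lra.
Qed.

(** The defects in the inequalities of [corrR_transfer] are nonnegative and add up to
    [1 - 1 = 0]. *)
Lemma corrR_fixed i y :
  \sum_(r < N) qm0 N m0 (nroot N y r) * h (b i) ((y + 2 * pi * r%:R) / N%:R) = h (b i) y.
Proof.
pose D k := h (b k) y - \sum_(r < N) qm0 N m0 (nroot N y r) * h (b k) ((y + 2 * pi * r%:R) / N%:R).
have D0 k : 0 <= D k by rewrite subr_ge0 (corrR_transfer lp cs).
have : \sum_k D k = 0.
  rewrite sumrB corrR_sum exchange_big/=.
  under eq_bigr do rewrite -mulr_sumr corrR_sum mulr1.
  by rewrite (sum_qm0 lp) subrr.
by move/eqP; rewrite psumr_eq0// => /allP/(_ i (mem_index_enum _))/eqP/eqP; rewrite subr_eq0 => /eqP.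
Qed.

(** The function of the cycle through this point already takes the value 1 there, which leaves 0 for
    the others. *)
Lemma corrR_cycle_pt i j : h (b i) (theta j) = (kappa j == i)%:R.
Proof.
have := corrR_sum (theta j).
rewrite (bigD1 (kappa j))//=; set S := \sum_(k | _) _ => hS.
have S0 : 0 <= S by apply: sumr_ge0 => k _; exact: (corrR_ge0 lp cs).
have hj : h (b (kappa j)) (theta j) = 1.
  apply/eqP; rewrite eq_le (corrR_le1 lp cs)//= (corrR_cycle lp cs)//=.
have S00 : S = 0 by lra.
have [<-|ne] := eqVneq (kappa j) i; first exact: hj.
move/eqP : S00; rewrite psumr_eq0 => [/allP /(_ i (mem_index_enum _))|k _]; last exact: (corrR_ge0 lp cs).
by rewrite eq_sym ne => /eqP.
Qed.

End full_system.

Section dimension.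

(** A relation between the rows of the matrix expressing the first basis in the second would be one
    between basis vectors; so the rank is [n], and it is at most [m]. *)
Lemma has_dim_le (F : fieldType) (V : lmodType F) (E : set V) n m :
  has_dim E n -> has_dim E m -> (n <= m)%N.
Proof.
move=> [b [bf Eb]] [b' [_ Eb']].
have /choice[A hA] (i : 'I_n) : exists c : 'I_m -> F, b i = \sum_j c j *: b' j.
  have : E (b i).
    rewrite Eb; exists (fun k => (k == i)%:R).
    rewrite (bigD1 i)//= eqxx scale1r big1 ?addr0// => k /negbTE ->.
    by rewrite scale0r.
  by rewrite Eb'.
pose M : 'M[F]_(n, m) := \matrix_(i, j) A i j.
suff : row_free M by rewrite /row_free => /eqP <-; exact: rank_leq_col.
apply/row_freeP; apply: contrapT => hM.
have : ~~ row_free M by apply/negP => /row_freeP.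
rewrite -kermx_eq0 => /rowV0Pn[v /sub_kermxP vM v0].
have : \sum_i v 0 i *: b i = 0.
  under eq_bigr => i _ do rewrite hA scaler_sumr.
  rewrite exchange_big/= big1// => j _.
  under eq_bigr => i _ do rewrite scalerA.
  rewrite -scaler_suml.
  have := congr1 (fun X : 'rV_m => X 0 j) vM; rewrite !mxE.
  by under eq_bigr do rewrite mxE; move=> ->; rewrite scale0r.
move/bf => h; move/eqP: v0; apply; apply/rowP => i; rewrite mxE; exact: h.
Qed.

Lemma has_dim_uniq (F : fieldType) (V : lmodType F) (E : set V) n m :
  has_dim E n -> has_dim E m -> n = m.
Proof. by move=> h1 h2; apply/eqP; rewrite eqn_leq !(has_dim_le _ _ (E := E)). Qed.

End dimension.

(** * The eigenspace of the transfer operator *)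

Section fixed_space.
Context {R : realType}.
Variables (N : nat) (m0 : circle R -> R[i]) (K : R).
Hypothesis lp : lowpass N m0 K.
Let N2 : (2 <= N)%N := lp_N2 lp.
Let N0 : N%:R != 0 :> R. Proof. by rewrite pnatr_eq0; case: N N2. Qed.

Lemma transferE (f : circle R -> R[i]) y :
  transfer N m0 f (expNi y) = \sum_(r < N) (qm0 N m0 (nroot N y r))%:C * f (nroot N y r).
Proof.
rewrite /transfer sum_nroot// mulr_sumr; apply: eq_bigr => r _.
rewrite norm_sqn mulrA; congr (_ * _).
by rewrite /qm0 rmorphM/= mulrC fmorphV/= rmorph_nat.
Qed.

(** The minimum principle is stated for nonnegative functions; it is applied to [g - min g] at the
    level [- min g]. *)
Lemma fixed_nonneg (g : R -> R) : (exists z, cycle_pt N m0 z) -> continuous g ->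
  (forall x y, expNi x = expNi y -> g x = g y) ->
  (forall y, \sum_(r < N) qm0 N m0 (nroot N y r) * g ((y + 2 * pi * r%:R) / N%:R) = g y) ->
  (forall y, cycle_pt N m0 (expNi y) -> 0 <= g y) -> forall y, 0 <= g y.
Proof.
move=> exc cg pg fg hg.
have pp : 0 <= 2 * pi :> R by rewrite mulr_ge0// pi_ge0.
have [|c _ hc] := @EVT_min R g 0 (2 * pi) pp; first exact: continuous_subspaceT.
have gm y : g c <= g y.
  have [l /andP[l0 l1]] := expNi_mod y.
  rewrite -(pg _ _ (expNi_periodic y l)); apply: hc.
  by rewrite in_itv/= l0 ltW.
have key : forall y, - g c <= g y - g c.
  apply: (@minimum_at_cycle _ _ _ _ lp exc).
  - by move=> y; rewrite subr_ge0.
  - by move=> x y /pg ->.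
  - move=> y a hay.
    have /cvgrPdist_lt /(_ (g y - g c - a)) := cg y.
    rewrite subr_gt0 => /(_ hay)[d /= d0 hd]; exists d => // x xy.
    have := hd x; rewrite /ball_/= distrC => /(_ xy) /(le_lt_trans (ler_norm _)); lra.
  - move=> y; under eq_bigr do rewrite mulrBr.
    by rewrite sumrB fg -mulr_suml (sum_qm0 lp) mul1r.
  - by move=> y /hg; lra.
by move=> y; have := key y; lra.
Qed.

Variables (J : finType) (theta : J -> R) (tau : J -> J).
Hypothesis cs : csystem N m0 theta tau.
Hypothesis full : forall z, cycle_pt N m0 z -> exists j, expNi (theta j) = z.
Hypothesis ex_cycle : exists z, cycle_pt N m0 z.
Variables (M : nat) (kappa : J -> 'I_M) (jj : 'I_M -> J).
Hypothesis kappa_tau : forall j, kappa (tau j) = kappa j.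
Hypothesis kappa_jj : forall i, kappa (jj i) = i.
Hypothesis jj_orbit : forall j, exists l, iter l tau (jj (kappa j)) = j.

(** Among the roots of a cycle point its predecessor has probability 1, so the transfer operator
    reads [f] there alone. *)
Lemma transfer_cycle (f : circle R -> R[i]) j : transfer N m0 f = f ->
  f (expNi (theta (tau j))) = f (expNi (theta j)).
Proof.
move=> ff; rewrite -[in RHS]ff transferE.
have [r rN wr] := nroot_surj N2 (cs_tau cs j).
have q1 : qm0 N m0 (nroot N (theta j) r) = 1.
  by rewrite -wr /qm0 (cs_m0 cs) mulfV.
rewrite (bigD1 (Ordinal rN))//= q1 mul1r -wr big1 ?addr0// => s sr.
have : \sum_(s < N | s != Ordinal rN) qm0 N m0 (nroot N (theta j) s) = 0.
  by have := sum_qm0 lp (theta j); rewrite (bigD1 (Ordinal rN))//= q1 => h; lra.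
move/eqP; rewrite psumr_eq0 => [/allP/(_ s (mem_index_enum _))|k _]; last exact: qm0_ge0.
by rewrite sr => /eqP ->; rewrite mul0r.
Qed.

(** The basis consists of the functions [corrR] of the single cycles. On cycle points they are
    indicators of the cycles, which gives independence; a fixed point minus the combination with the
    same values on the cycles vanishes by [fixed_nonneg]. *)
Lemma fixed_dim : has_dim (transfer_fixed N m0) M.
Proof.
(* A choice of angle for each point of the circle, through which periodic functions become functions
   on the circle. *)
have /choice[ag hag] := @expNi_surj R.
pose h i := corrR N m0 theta tau (fun j => kappa j == i).
have hp i x y : expNi x = expNi y -> h i x = h i y := @corrR_expNi _ _ _ _ lp _ _ _ cs _ x y.
pose b i (z : circle R) : R[i] := (h i (ag z))%:C.
have bE i y : b i (expNi y) = (h i y)%:C by rewrite /b (hp i _ y) ?hag.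
have bfix i : transfer_fixed N m0 (b i).
  split.
    apply/continuous_circle_fun => y; rewrite /continuous_at /= bE.
    apply/(@cvg_sqnP _ _ _ (nbhs_filter _)) => e e0.
    have s0 : 0 < Num.sqrt e by rewrite sqrtr_gt0.
    have /cvgrPdist_lt /(_ _ s0) := @corrR_continuous _ _ _ _ lp _ _ _ cs full ex_cycle M kappa i y.
    apply: filterS => x /=; rewrite bE -rmorphB/= sqn_real => hx.
    rewrite -(sqr_sqrtr (ltW e0)) -(real_normK (num_real (_ - _))) distrC.
    by rewrite ltr_sqr ?nnegrE// ltW.
  apply/funext => z; have [y <-] := expNi_surj z; rewrite transferE bE.
  rewrite /h -(corrR_fixed lp cs full ex_cycle kappa_tau) rmorph_sum; apply: eq_bigr => r _.
  by rewrite /nroot bE -rmorphM.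
have bpt i j : b i (expNi (theta j)) = (kappa j == i)%:R.
  by rewrite bE /h (corrR_cycle_pt lp cs full ex_cycle) rmorph_nat.
exists b; split.
  move=> c hc i; have := congr1 (fun f : circle R -> R[i] => f (expNi (theta (jj i)))) hc.
  rewrite fct_sumE (bigD1 i)//= big1 => [|k ki].
    rewrite addr0 -[LHS]/(c i * b i (expNi (theta (jj i)))) bpt kappa_jj eqxx mulr1.
    by [].
  by rewrite -[LHS]/(c k * b k (expNi (theta (jj i)))) bpt kappa_jj eq_sym (negbTE ki) mulr0.
have sumE (c : 'I_M -> R[i]) z : (\sum_i c i *: b i : circle R -> R[i]) z = \sum_i c i * b i z.
  by rewrite fct_sumE; apply: eq_bigr.
have spanfix (c : 'I_M -> R[i]) : transfer_fixed N m0 (\sum_i c i *: b i).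
  split.
    have -> : (\sum_i c i *: b i : circle R -> R[i]) = (fun z => \sum_i c i * b i z).
      by apply/funext => z; exact: sumE.
    elim: (index_enum 'I_M) => [|i s IH] z.
      have E : (fun z0 => \sum_(i <- [::]) c i * b i z0) = (fun=> 0 : R[i]^o).
        by apply/funext => ?; rewrite big_nil.
      by have := @cst_continuous (circle R) R[i]^o 0 z; rewrite -E.
    have E : (fun z0 => \sum_(j <- i :: s) c j * b j z0) =
        (fun z0 => c i * b i z0 + \sum_(j <- s) c j * b j z0 : R[i]^o).
      by apply/funext => ?; rewrite big_cons.
    rewrite E.
    apply: (@cvgD _ R[i]^o _ _ (nbhs_filter z)); last exact: IH.
    have [bc _] := bfix i.
    apply/(@cvg_sqnP _ _ _ (nbhs_filter _)) => e e0.
    have d0 : 0 < e / (sqn (c i) + 1) by rewrite divr_gt0// ltr_wpDl ?sqn_ge0.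
    have /(@cvg_sqnP _ _ _ (nbhs_filter _)) /(_ _ d0) := bc z.
    apply: filterS => x /=; rewrite -mulrBr sqnM ltr_pdivlMr ?ltr_wpDl ?sqn_ge0// mulrC => hx.
    by apply: le_lt_trans hx; rewrite ler_wpM2r ?sqn_ge0// lerDl.
  apply/funext => z; have [y <-] := expNi_surj z; rewrite transferE sumE.
  under eq_bigr do rewrite sumE mulr_sumr.
  rewrite exchange_big/=; apply: eq_bigr => i _.
  have [_ /(congr1 (fun f => f (expNi y)))] := bfix i; rewrite transferE => <-.
  by rewrite mulr_sumr; apply: eq_bigr => r _; rewrite mulrCA.
apply/seteqP; split=> [f [fc ff]|_ [c ->]]; last exact: spanfix.
pose c i := f (expNi (theta (jj i))).
exists c; have [gc gf] := spanfix c.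
have fpt j : f (expNi (theta j)) = (\sum_i c i *: b i : circle R -> R[i]) (expNi (theta j)).
  rewrite sumE (bigD1 (kappa j))//= bpt eqxx mulr1 big1 ?addr0; last first.
    by move=> i ik; rewrite bpt eq_sym (negbTE ik) mulr0.
  have [l <-] := jj_orbit j; rewrite /c.
  have -> : kappa (iter l tau (jj (kappa j))) = kappa j.
    by elim: l => [|l IH] /=; rewrite ?kappa_jj// kappa_tau.
  by elim: l => //= l IH; rewrite (transfer_cycle _ ff).
set g := \sum_i c i *: b i in gc gf fpt *.
(* Real and imaginary parts are treated together as additive maps [L]: both [L (f - g)] and its
   opposite are fixed and vanish on the cycles, so both are nonnegative. *)
have lin (L : {additive R[i] -> R}) : (forall (a : R) z, L (a%:C * z) = a * L z) ->
    (forall z, `|L z| <= Num.sqrt (sqn z)) -> forall y, L (f (expNi y)) = L (g (expNi y)).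
  move=> LZ Lb.
  pose d y := L (f (expNi y) - g (expNi y)).
  have dc : continuous d.
    move=> y; apply/cvgrPdist_lt => e e0.
    have fgc : continuous ((fun z => f z - g z : R[i]^o) \o @expNi R).
      apply/continuous_circle_fun => z; apply: (@cvgB _ R[i]^o _ _ (nbhs_filter z)); [exact: fc|exact: gc].
    have /cvg_sqnP /(_ _ (exprn_gt0 2 e0)) := fgc y.
    apply: filterS => x /= hx; rewrite distrC /d -raddfB.
    apply: le_lt_trans (Lb _) _; rewrite -[ltRHS]ger0_norm ?ltW// -sqrtr_sqr.
    by rewrite ltr_sqrt// exprn_gt0.
  have dp x y : expNi x = expNi y -> d x = d y by rewrite /d => ->.
  have df y : \sum_(r < N) qm0 N m0 (nroot N y r) * d ((y + 2 * pi * r%:R) / N%:R) = d y.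
    rewrite [in RHS]/d -[in RHS]ff -[in RHS]gf !transferE -sumrB raddf_sum/=.
    by apply: eq_bigr => r _; rewrite -mulrBr LZ.
  have d0 y : cycle_pt N m0 (expNi y) -> d y = 0.
    by move=> /full[j jy]; rewrite /d -jy fpt subrr raddf0.
  have h1 := fixed_nonneg ex_cycle dc dp df (fun y hy => eq_ind_r (fun t => 0 <= t) (lexx 0) (d0 y hy)).
  move=> y; apply/eqP; rewrite -subr_eq0 -raddfB -/(d y) eq_le h1 andbT -oppr_ge0.
  move: y; apply: (@fixed_nonneg (fun y => - d y)) => //.
  - by move=> y; apply: cvgN; exact: dc.
  - by move=> x y /dp ->.
  - by move=> y; under eq_bigr do rewrite mulrN; rewrite sumrN df.
  - by move=> y /d0 ->; rewrite oppr0.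
apply/funext => z; have [y <-] := expNi_surj z.
apply/eqP; rewrite eq_complex; apply/andP; split; apply/eqP.
  by apply: (lin (@complex.Re R)) => [a [u v]|w] /=; [ring|exact: norm_Re_le].
by apply: (lin (@complex.Im R)) => [a [u v]|w] /=; [ring|exact: norm_Im_le].
Qed.

End fixed_space.

(** * Parseval's identity *)
Section trigonometric_polynomials.
Context {R : realType}.
Implicit Types (x y s : R) (k l : int).

Definition ek (k : int) (x : R) : R[i] := cval (expNi (k%:~R * x)).

Lemma ek_add k l x : ek (k + l) x = ek k x * ek l x.
Proof. by rewrite /ek intrD mulrDl expNiD. Qed.
Lemma ekD k x y : ek k (x + y) = ek k x * ek k y.
Proof. by rewrite /ek mulrDr expNiD. Qed.
Lemma ek0 x : ek 0 x = 1. Proof. by rewrite /ek mul0r expNi0. Qed.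
Lemma ekN k x : ek (- k) x = (ek k x)^*.
Proof. by rewrite /ek mulrNz mulNr cval_expNiN. Qed.
Lemma ek_opp k x : ek k (- x) = ek (- k) x.
Proof. by rewrite /ek mulrNz mulNr mulrN. Qed.
Lemma sqn_ek k x : sqn (ek k x) = 1. Proof. exact: sqn_cval. Qed.
Lemma ek_nat (n : nat) x : ek n x = cval (expNi x) ^+ n.
Proof. by rewrite /ek -pmulrn expNiMn. Qed.
Lemma ekX k (n : nat) x : ek k x ^+ n = ek k (n%:R * x).
Proof. by rewrite /ek mulrCA expNiMn cval_exp. Qed.
Lemma ek_periodic k l x : ek k (x + 2 * pi * l%:~R) = ek k x.
Proof.
rewrite ekD (_ : ek k (2 * pi * l%:~R) = 1) ?mulr1// /ek mulrCA -intrM.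
exact: expNi2pi.
Qed.

Lemma measurable_ek k : cmeasurable (T := measurableTypeR R) (ek k).
Proof.
split.
  have -> : (fun x => complex.Re (ek k x)) = (fun x : R => cos (k%:~R * x)) by [].
  apply: continuous_measurable_fun => x; apply: continuous_comp; last exact: continuous_cos.
  by apply: cvgM; [exact: cvg_cst|exact: cvg_id].
have -> : (fun x => complex.Im (ek k x)) = (fun x : R => - sin (k%:~R * x)) by [].
apply: continuous_measurable_fun => x; apply: cvgN.
apply: (@continuous_comp _ _ _ (fun x : R => k%:~R * x) (@sin R)); last exact: continuous_sin.
by apply: cvgM; [exact: cvg_cst|exact: cvg_id].
Qed.

(** This is [cos (s / 2) ^ (2 n)], de la Vallee-Poussin's kernel without its normalization:
    nonnegative, and a trigonometric polynomial of degree [n]. *)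
Definition Kn (n : nat) (s : R) : R := ((1 + cos s) / 2) ^+ n.

Lemma Kn_ge0 n s : 0 <= Kn n s.
Proof.
have := cos_geN1 s => h; rewrite exprn_ge0// divr_ge0//; lra.
Qed.

Lemma Kn_trig n s : (Kn n s)%:C =
  \sum_(k < (2 * n).+1) ('C(2 * n, k)%:R / 4 ^+ n) * ek (k%:Z - n%:Z) s.
Proof.
have -> : (Kn n s)%:C = ((1 + ek 1 s) ^+ 2 * ek (-1) s / 4) ^+ n.
  rewrite /Kn rmorphXn; congr (_ ^+ n).
  have e1 : ek 1 s * ek (-1) s = 1 by rewrite -ek_add subrr ek0.
  have -> : (1 + ek 1 s) ^+ 2 * ek (-1) s = ek (-1) s + 2 + ek 1 s.
    transitivity (ek (-1) s + 2 * (ek 1 s * ek (-1) s) + ek 1 s * (ek 1 s * ek (-1) s)); first by ring.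
    by rewrite e1; ring.
  have -> : ek (-1) s + 2 + ek 1 s = (2 * (1 + cos s))%:C.
    rewrite ekN /ek mul1r; apply/eqP; rewrite eq_complex/=; apply/andP; split; apply/eqP; first ring.
    by ring.
  by rewrite -[4](rmorph_nat (real_complex R)) -fmorphV -rmorphM/=; congr (_ %:C); field.
rewrite expr_div_n exprMn -exprM ekX.
rewrite [X in X * _ / _]exprDn !mulr_suml; apply: eq_bigr => k _.
rewrite expr1n mul1r ekX ek_add [in RHS]ekN.
rewrite -[ek (- 1) _]ek_opp.
have -> : ek 1 (k%:R * s) = ek k%:Z s by rewrite /ek mul1r -pmulrn.
have -> : ek 1 (- (n%:R * s)) = (ek n%:Z s)^* by rewrite ek_opp ekN /ek mul1r -pmulrn.
by rewrite -[ek k%:Z s *+ _]mulr_natl; ring.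
Qed.

(** A geometric sum: [0 < |t| < m] ensures that the ratio, an [m]-th root of unity, is not 1. *)
Lemma sum_roots (m : nat) (t : int) : (0 < m)%N -> (`|t| < m)%N -> t != 0 ->
  \sum_(j < m) ek t (2 * pi * j%:R / m%:R) = 0.
Proof.
move=> m0 tm t0.
have mn0 : m%:R != 0 :> R by rewrite pnatr_eq0 -lt0n.
pose rho := ek t (2 * pi / m%:R).
have -> : \sum_(j < m) ek t (2 * pi * j%:R / m%:R) = \sum_(j < m) rho ^+ j.
  apply: eq_bigr => j _; rewrite /rho ekX; congr (ek t _); ring.
have r1 : rho - 1 != 0.
  rewrite subr_eq0; apply/eqP => h.
  have : expNi (t%:~R * (2 * pi / m%:R)) = expNi (0 : R).
    by apply: cval_inj; rewrite expNi0.
  move/expNi_eq => [l]; rewrite add0r => hl.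
  have {}hl : t%:~R = (l * m%:Z)%:~R :> R.
    have pi0 : pi != 0 :> R by rewrite gt_eqF// pi_gt0.
    rewrite intrM -pmulrn.
    apply: (mulIf (x := 2 * pi)); first by rewrite mulf_neq0.
    transitivity (t%:~R * (2 * pi / m%:R) * m%:R : R); last by rewrite hl; ring.
    by rewrite -!mulrA mulVf// mulr1.
  move/intr_inj : hl => hl; move: tm t0; rewrite hl abszM absz_nat.
  have [->|l0] := eqVneq l 0; first by rewrite mul0r eqxx.
  by have : (0 < absz l)%N by [rewrite absz_gt0]; move=> + + _; nia.
apply: (mulfI r1); rewrite mulr0 -subrX1 /rho ekX.
have -> : m%:R * (2 * pi / m%:R) = 0 + 2 * pi * 1%:~R :> R by field.
by rewrite ek_periodic /ek mulr0 expNi0 subrr.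
Qed.

(** With more than [n] equally spaced nodes, the frequency 0 is the only one of [Kn n] that survives
    the summation, so the value does not depend on [x]. *)
Lemma sum_Kn (n m : nat) (x : R) : (n < m)%N ->
  \sum_(j < m) Kn n (x - 2 * pi * j%:R / m%:R) = m%:R * ('C(2 * n, n)%:R / 4 ^+ n).
Proof.
move=> nm; have m0 : (0 < m)%N by apply: leq_ltn_trans nm.
apply: (fmorph_inj (real_complex R)); rewrite raddf_sum/=.
under eq_bigr do rewrite Kn_trig.
rewrite exchange_big/=.
have nn : (n < (2 * n).+1)%N by rewrite ltnS leq_pmull.
rewrite (bigD1 (Ordinal nn))//= [X in _ + X]big1 => [|k kn].
  rewrite addr0 subrr; under eq_bigr do rewrite ek0 mulr1.
  transitivity (m%:R * ('C(2 * n, n)%:R / 4 ^+ n) : R[i]).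
    by rewrite sumr_const card_ord [RHS]mulr_natl.
  by rewrite [RHS]rmorphM/= rmorphM/= fmorphV/= rmorphXn/= !rmorph_nat.
under eq_bigr do rewrite ekD ek_opp.
rewrite -!mulr_sumr.
under eq_bigr do rewrite -opprB.
rewrite sum_roots ?mulr0//.
  by have := ltn_ord k; lia.
apply: contra kn => /eqP h; apply/eqP/val_inj => /=; lia.
Qed.

(** The mean value of [Kn n] over a period. *)
Definition an (n : nat) : R := 'C(2 * n, n)%:R / 4 ^+ n.

Lemma an_gt0 n : 0 < an n.
Proof. by rewrite /an divr_gt0 ?exprn_gt0// ltr0n bin_gt0 leq_pmull. Qed.

Lemma anS n : an n.+1 = an n * (1 - (2 * n.+1%:R)^-1).
Proof.
have h : (n.+1 * 'C(2 * n.+1, n.+1) = 2 * (2 * n).+1 * 'C(2 * n, n))%N.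
  have e : (2 * n.+1 = (2 * n).+2)%N by lia.
  have h1 := mul_bin_diag (2 * n).+1 n.
  have h2 := mul_bin_left (2 * n).+1 n.
  have h3 := mul_bin_down (2 * n).+1 n.
  move: h1 h3; rewrite e /= => h1 h3.
  have e2 : ((2 * n).+1 - n = n.+1)%N by lia.
  rewrite e2 in h3.
  rewrite binS mulnDr -h1 -h3; lia.
have n1 : n.+1%:R != 0 :> R by rewrite pnatr_eq0.
rewrite /an exprS.
have {}h : n.+1%:R * 'C(2 * n.+1, n.+1)%:R = 2 * (2 * n%:R + 1) * 'C(2 * n, n)%:R :> R.
  by have := congr1 (fun k : nat => k%:R : R) h; rewrite !natrM -[(2 * n).+1]addn1 natrD natrM.
apply: (mulfI n1); rewrite mulrA h -[n.+1]addn1 natrD.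
field; rewrite ?mulf_neq0//; do ?(apply/andP; split) => //.
all: rewrite -?natr1 in n1 *; by [].
Qed.

Lemma cos_periodic x (l : int) : cos (x + 2 * pi * l%:~R) = cos x.
Proof. by have := congr1 (fun z => complex.Re (cval z)) (expNi_periodic x l). Qed.

(** Points at circular distance at most [d] have values within [eps]; for the others
    [1 - cos (x - y)] is at least [1 - cos d]. The condition [f 0 = f (2 pi)] lets the distance be
    measured across the end points. A bound of this shape can be averaged against the kernel. *)
Lemma circle_modulus (f : R -> R) (M L eps : R) :
  {in `[0, 2 * pi], forall x, `|f x| <= M} ->
  {in `[0, 2 * pi] &, forall x y, `|f x - f y| <= L * `|x - y|} ->
  f 0 = f (2 * pi) -> 0 < eps ->
  exists2 C : R, 0 <= C &
    {in `[0, 2 * pi] &, forall x y, `|f x - f y| <= eps + C * (1 - cos (x - y))}.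
Proof.
move=> fM fL f0 e0.
have pi0 := pi_gt0 R.
have i0 : (0 : R) \in `[0, 2 * pi]%R.
  rewrite in_itv.
  by rewrite /= lexx mulr_ge0// ltW.
have i1 : (2 * pi : R) \in `[0, 2 * pi]%R by rewrite in_itv/= lexx andbT mulr_ge0// ltW.
have M0 : 0 <= M by apply: le_trans (fM 0 i0).
have L1 : 0 < `|L| + 1 by rewrite ltr_wpDl.
have {}fL : {in `[0, 2 * pi] &, forall x y, `|f x - f y| <= (`|L| + 1) * `|x - y|}.
  move=> x y xi yi; apply: le_trans (fL _ _ xi yi) _.
  by rewrite ler_wpM2r//; apply: le_trans (ler_norm _) _; rewrite lerDl.
pose d := Num.min (eps / (`|L| + 1)) pi.
have d0 : 0 < d by rewrite lt_min divr_gt0.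
have dpi : d <= pi by rewrite ge_min lexx orbT.
have dL s : s <= d -> (`|L| + 1) * s <= eps.
  move=> sd; rewrite mulrC -ler_pdivlMr//; apply: (le_trans sd).
  by rewrite ge_min lexx.
have cd : 0 < 1 - cos d.
  rewrite subr_gt0 -[ltRHS]cos0 ltr_cos ?in_itv/= ?lexx ?(ltW d0) ?dpi ?(ltW pi0)//.
exists (2 * M / (1 - cos d)); first by rewrite divr_ge0 ?mulr_ge0// ltW.
have C0 : 0 <= 2 * M / (1 - cos d) by rewrite divr_ge0 ?mulr_ge0// ltW.
have close x y : `|f x - f y| <= eps ->
    `|f x - f y| <= eps + 2 * M / (1 - cos d) * (1 - cos (x - y)).
  by move=> h; apply: (le_trans h); rewrite lerDl mulr_ge0// subr_ge0 cos_le1.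
have far x y : x \in `[0, 2 * pi] -> y \in `[0, 2 * pi] -> cos (x - y) <= cos d ->
    `|f x - f y| <= eps + 2 * M / (1 - cos d) * (1 - cos (x - y)).
  move=> xi yi cxd; apply: (@le_trans _ _ (2 * M)).
    by apply: le_trans (ler_normB _ _) _; have := fM x xi; have := fM y yi; lra.
  apply: (@le_trans _ _ (2 * M / (1 - cos d) * (1 - cos (x - y)))); last by rewrite lerDr ltW.
  rewrite mulrAC ler_pdivlMr// ler_wpM2l ?mulr_ge0//; lra.
have key x y : x \in `[0, 2 * pi] -> y \in `[0, 2 * pi] -> y <= x ->
    `|f x - f y| <= eps + 2 * M / (1 - cos d) * (1 - cos (x - y)).
  move=> xi yi yx; have [xd|dx] := leP (x - y) d.
    by apply: close; apply: le_trans (fL _ _ xi yi) _; apply: dL; rewrite ger0_norm ?subr_ge0.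
  move: (xi) (yi); rewrite !in_itv/= => /andP[x0 x1] /andP[y0 y1].
  have [xd|{}xd] := leP (2 * pi - (x - y)) d.
    apply: close; have -> : f x - f y = (f x - f (2 * pi)) + (f 0 - f y) by rewrite f0; ring.
    apply: le_trans (ler_normD _ _) _.
    apply: le_trans (lerD (fL _ _ xi i1) (fL _ _ i0 yi)) _.
    rewrite -mulrDr; apply: dL; rewrite ler0_norm ?subr_le0// ler0_norm ?subr_le0//; lra.
  apply: far => //; have [h|h] := leP (x - y) pi.
    by rewrite ltW// ltr_cos ?in_itv/= ?subr_ge0 ?yx ?h ?(ltW d0) ?dpi.
  have -> : cos (x - y) = cos (2 * pi - (x - y)).
    by rewrite -(cos_periodic (x - y) (- 1)) -cosN; congr cos; rewrite mulrNz mulr1z; ring.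
  rewrite ltW// ltr_cos ?in_itv/= ?(ltW d0) ?dpi//; apply/andP; split; lra.
move=> x y xi yi; have [yx|/ltW xy] := leP y x; first exact: key.
rewrite distrC (_ : cos (x - y) = cos (y - x)); first exact: key.
by rewrite -cosN opprB.
Qed.

(* The mesh kernel [Kn n (x - x_j) / (m a_n)] is a discrete approximate identity, since
   [(1 - cos s) * Kn n s = 2 * (Kn n s - Kn n.+1 s)] and [a_(n+1) / a_n] tends to 1. *)
Lemma trig_approx (f : R -> R) (M L eps : R) :
  {in `[0, 2 * pi], forall x, `|f x| <= M} ->
  {in `[0, 2 * pi] &, forall x y, `|f x - f y| <= L * `|x - y|} ->
  f 0 = f (2 * pi) -> 0 < eps ->
  exists (I : finType) (c : I -> R[i]) (k : I -> int),
    {in `[0, 2 * pi], forall x, sqn ((f x)%:C - \sum_i c i * ek (k i) x) <= eps ^+ 2}.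
Proof.
move=> fM fL fp e0.
have e2 : 0 < eps / 2 by rewrite divr_gt0.
have [C C0 hC] := circle_modulus fM fL fp e2.
have [n hn] : exists n : nat, C / n.+1%:R <= eps / 2.
  pose n := Num.bound (C / (eps / 2)).
  exists n; rewrite ler_pdivrMr// mulrC -ler_pdivrMr//.
  apply: (@le_trans _ _ n%:R); last by rewrite ler_nat.
  by apply/ltW/archi_boundP; rewrite divr_ge0// ltW.
(* [n + 2] nodes, because [sum_Kn] is also applied to the kernel of degree [n + 1]. *)
pose m := n.+2; pose xj (j : 'I_m) : R := 2 * pi * j%:R / m%:R.
have m0 : 0 < m%:R :> R by rewrite ltr0n.
have xji j : xj j \in `[0, 2 * pi]%R.
  have pp : 0 < 2 * pi :> R by rewrite mulr_gt0// pi_gt0.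
  rewrite in_itv/= /xj divr_ge0 ?mulr_ge0 ?pi_ge0//= ler_pdivrMr// ler_wpM2l ?(ltW pp)//.
  by rewrite ler_nat ltnW.
have a0 := an_gt0 n.
have ma0 : 0 < m%:R * an n by rewrite mulr_gt0.
pose K x j := Kn n (x - xj j) / (m%:R * an n).
have K0 x j : 0 <= K x j by rewrite divr_ge0 ?Kn_ge0// ltW.
have K1 x : \sum_j K x j = 1.
  by rewrite -mulr_suml sum_Kn// mulfV// gt_eqF.
(* The mean of [1 - cos] is [2 (1 - an n.+1 / an n)], and [anS] evaluates it exactly. *)
have K2 x : \sum_j K x j * (1 - cos (x - xj j)) = n.+1%:R^-1.
  transitivity (\sum_j (2 * K x j - 2 * (Kn n.+1 (x - xj j) / (m%:R * an n)))).
    apply: eq_bigr => j _; 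
    have -> : Kn n.+1 (x - xj j) = (1 + cos (x - xj j)) / 2 * Kn n (x - xj j) by rewrite /Kn exprS.
    by rewrite /K; field; rewrite ?gt_eqF.
  rewrite sumrB -!mulr_sumr K1 -mulr_suml sum_Kn// -/(an n.+1) anS.
  by field; rewrite ?gt_eqF//= ?gt_eqF// -natr1 ltr_wpDl.
exists ('I_m * 'I_(2 * n).+1)%type.
exists (fun i : 'I_m * 'I_(2 * n).+1 => (f (xj i.1))%:C * (m%:R * an n)^-1%:C * ('C(2 * n, i.2)%:R / 4 ^+ n) * ek (i.2%:Z - n%:Z) (- xj i.1)).
exists (fun i : 'I_m * 'I_(2 * n).+1 => i.2%:Z - n%:Z) => x xi.
have -> : \sum_(i : 'I_m * 'I_(2 * n).+1) (f (xj i.1))%:C * (m%:R * an n)^-1%:C *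
   ('C(2 * n, i.2)%:R / 4 ^+ n) * ek (i.2%:Z - n%:Z) (- xj i.1) * ek (i.2%:Z - n%:Z) x =
   (\sum_j f (xj j) * K x j)%:C.
  rewrite -(pair_big xpredT xpredT (fun (j : 'I_m) (k : 'I_(2 * n).+1) => (f (xj j))%:C * (m%:R * an n)^-1%:C *
   ('C(2 * n, k)%:R / 4 ^+ n) * ek (k%:Z - n%:Z) (- xj j) * ek (k%:Z - n%:Z) x))/=.
  rewrite raddf_sum/=; apply: eq_bigr => j _.
  rewrite /K !rmorphM/= Kn_trig mulr_suml mulr_sumr; apply: eq_bigr => k _.
  by rewrite ekD fmorphV/= rmorphM/=; ring.
rewrite -rmorphB/= sqn_real -(real_normK (num_real (_ - _))) ler_sqr ?nnegrE ?(ltW e0)//.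
have -> : f x - \sum_j f (xj j) * K x j = \sum_j (f x - f (xj j)) * K x j.
  by under [RHS]eq_bigr do rewrite mulrBl; rewrite sumrB -mulr_sumr K1 mulr1.
apply: le_trans (ler_norm_sum _ _ _) _.
apply: (@le_trans _ _ (\sum_j (eps / 2 * K x j + C * (K x j * (1 - cos (x - xj j)))))).
  apply: ler_sum => j _; rewrite normrM (ger0_norm (K0 x j)).
  apply: le_trans (ler_wpM2r (K0 x j) (hC _ _ xi (xji j))) _; rewrite le_eqVlt; apply/orP; left; apply/eqP; ring.
rewrite big_split/= -!mulr_sumr K1 K2 mulr1 [leRHS]splitr lerD2l; exact: hn.
Qed.

End trigonometric_polynomials.

Section complex_measurable.
Context d (T : measurableType d) (R : realType).
Implicit Types f g : T -> R[i].

Lemma cmeasurable_real (c : T -> R) : measurable_fun setT c -> cmeasurable (fun x => (c x)%:C).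
Proof. by split => //=; exact: measurable_cst. Qed.

Lemma cmeasurable_cst (c : R[i]) : cmeasurable (fun _ : T => c).
Proof. by split; exact: measurable_cst. Qed.

Lemma cmeasurable_conj f : cmeasurable f -> cmeasurable (fun x => (f x)^*).
Proof.
move=> [m1 m2]; split.
  by have -> : (fun x => complex.Re (f x)^*) = fun x => complex.Re (f x)
    by apply/funext => x; case: (f x).
have -> : (fun x => complex.Im (f x)^*) = fun x => - complex.Im (f x).
  by apply/funext => x; case: (f x).
exact: measurableT_comp.
Qed.

Lemma cmeasurableM f g : cmeasurable f -> cmeasurable g -> cmeasurable (fun x => f x * g x).
Proof.
move=> mf mg; have := cmeasurable_mul_conj mf (cmeasurable_conj mg).
by under eq_fun do rewrite conjCK.
Qed.

Lemma cmeasurableD f g : cmeasurable f -> cmeasurable g -> cmeasurable (fun x => f x + g x).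
Proof.
move=> mf mg; have := cmeasurable_comb 1 mf mg.
by congr cmeasurable; apply/funext => x; rewrite -[LHS]/(1 * f x + g x) mul1r.
Qed.

Lemma cmeasurable_sum (I : Type) (s : seq I) (P : pred I) (f : I -> T -> R[i]) :
  (forall i, cmeasurable (f i)) -> cmeasurable (fun x => \sum_(i <- s | P i) f i x).
Proof.
move=> mf; elim: s => [|i s IH].
  by under eq_fun do rewrite big_nil; exact: cmeasurable_cst.
under eq_fun do rewrite big_cons.
by case: (P i) => //; exact: cmeasurableD.
Qed.

Context (mu : {measure set T -> \bar R}).

Lemma cintegralZ (a : R[i]) f : cintegrable mu f ->
  cintegral mu (fun x => a * f x) = a * cintegral mu f.
Proof.
move=> cf; have c0 : cintegrable mu (fun=> 0 : R[i]).
  by split; exact: integrable0.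
have := cintegral_comb a cf c0; under eq_fun do rewrite addr0.
by move=> ->; rewrite /cintegral !Rintegral_cst// !mul0r addr0.
Qed.

Lemma cintegralD f g : cintegrable mu f -> cintegrable mu g ->
  cintegral mu (fun x => f x + g x) = cintegral mu f + cintegral mu g.
Proof.
move=> cf cg; have := cintegral_comb 1 cf cg.
by under eq_fun do rewrite mul1r; rewrite mul1r.
Qed.

Lemma cintegral_conj f : cintegrable mu f ->
  cintegral mu (fun x => (f x)^*) = (cintegral mu f)^*.
Proof.
move=> [_ i2]; rewrite /cintegral.
have -> : (fun x => complex.Re (f x)^*) = fun x => complex.Re (f x).
  by apply/funext => x; case: (f x).
have -> : (fun x => complex.Im (f x)^*) = fun x => -1 * complex.Im (f x).
  by apply/funext => x; case: (f x) => a b /=; rewrite mulN1r.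
by rewrite RintegralZl// mulN1r.
Qed.

End complex_measurable.

Lemma conjCR (R : realType) (a : R) : (a%:C)^* = a%:C.
Proof. by apply/eqP; rewrite eq_complex/= oppr0 !eqxx. Qed.

Section window.
Context {R : realType}.
Local Notation leb := (@lebesgue_measure R).
Implicit Types (a b x : R).

(** The indicator of [[a, b[], used as a factor so that all integrals are over the whole line. *)
Definition wn a b x : R := ((a <= x)%R && (x < b)%R)%:R.

Lemma wnE a b : wn a b = \1_(`[a, b[%classic : set R).
Proof. by apply/funext => x; rewrite indicE mem_setE in_itv. Qed.

Lemma wn_ge0 a b x : 0 <= wn a b x. Proof. by rewrite /wn ler0n. Qed.
Lemma wn_le1 a b x : wn a b x <= 1. Proof. by rewrite /wn lern1 leq_b1. Qed.
Lemma wn_sqr a b x : wn a b x ^+ 2 = wn a b x.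
Proof. by rewrite /wn; case: (_ && _); rewrite ?expr1n ?expr0n. Qed.
Lemma wn_in a b x : a <= x < b -> wn a b x = 1. Proof. by rewrite /wn => ->. Qed.
Lemma wn_out a b x : ~~ (a <= x < b) -> wn a b x = 0. Proof. by rewrite /wn => /negbTE ->. Qed.

Lemma measurable_wn a b : measurable_fun setT (wn a b).
Proof. by rewrite wnE; exact: measurable_indic. Qed.

Lemma integrable_wn a b : leb.-integrable setT (EFin \o wn a b).
Proof. by rewrite wnE; exact: integrable_indic_itv. Qed.

Lemma integral_wn a b : a <= b -> (\int[leb]_x (wn a b x)%:E = (b - a)%:E)%E.
Proof.
move=> ab; transitivity (leb `[a, b[%classic).
  by rewrite wnE integral_indic// setIT.
rewrite lebesgue_measure_itv/= lte_fin.
by case: ltgtP ab => // -> _; rewrite subrr.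
Qed.

Lemma sqn_wn a b x z : sqn ((wn a b x)%:C * z) = wn a b x * sqn z.
Proof. by rewrite sqnM sqn_real wn_sqr. Qed.

Lemma cmeasurable_wn a b (f : R -> R[i]) : cmeasurable (T := measurableTypeR R) f ->
  cmeasurable (T := measurableTypeR R) (fun x => (wn a b x)%:C * f x).
Proof. by apply: cmeasurableM; apply: cmeasurable_real; exact: measurable_wn. Qed.

Lemma sqint_wn a b M (f : R -> R[i]) : cmeasurable (T := measurableTypeR R) f ->
  (forall x, a <= x < b -> sqn (f x) <= M) ->
  square_integrable leb (fun x => (wn a b x)%:C * f x).
Proof.
move=> mf fM; refine (square_integrable_dom (mu := leb) (g := fun x => M * wn a b x) (cmeasurable_wn a b mf) _ _).
- have -> : EFin \o (fun x => M * wn a b x) = (fun x => M%:E * (EFin \o wn a b) x)%E.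
    by apply/funext => x.
  by apply: integrableZl => //; exact: integrable_wn.
- move=> x; rewrite sqn_wn mulrC; have [h|h] := boolP (a <= x < b).
    by rewrite wn_in// !mulr1 fM.
  by rewrite wn_out// !mulr0.
Qed.

Lemma hn2_wn a b M (f : R -> R[i]) : a <= b -> cmeasurable (T := measurableTypeR R) f ->
  (forall x, a <= x < b -> sqn (f x) <= M) -> 0 <= M ->
  hn (to_L2 leb (fun x => (wn a b x)%:C * f x) : L2 leb) ^+ 2 <= M * (b - a).
Proof.
move=> ab mf fM M0; have sf := sqint_wn mf fM.
rewrite -lee_fin -(hn2_to_L2 sf) EFinM -(integral_wn ab) -ge0_integralZl//; last 2 first.
- by apply/measurable_EFinP; exact: measurable_wn.
- by move=> x _; rewrite lee_fin wn_ge0.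
apply: ge0_le_integral => //.
- by move=> x _; rewrite lee_fin sqn_ge0.
- by apply/measurable_EFinP/measurable_sqn; case: sf.
- by apply: measurable_funeM; apply/measurable_EFinP; exact: measurable_wn.
- move=> x _; rewrite -EFinM lee_fin sqn_wn mulrC; have [h|h] := boolP (a <= x < b).
    by rewrite wn_in// !mulr1 fM.
  by rewrite wn_out// !mulr0.
Qed.

Lemma sqint_cintegrable a b (f : R -> R[i]) : square_integrable leb f ->
  (forall x, ~~ (a <= x < b) -> f x = 0) -> cintegrable leb f.
Proof.
move=> sf f0.
have s1 : square_integrable leb (fun x => (wn a b x)%:C * 1).
  apply: (@sqint_wn a b 1) => [|x _]; first exact: cmeasurable_cst.
  by rewrite sqn1.
have := square_integrable_mul sf s1; congr cintegrable; apply/funext => x.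
rewrite mulr1; have [h|h] := boolP (a <= x < b).
  by rewrite wn_in// rmorph1 mulr1.
by rewrite f0// mul0r.
Qed.

Lemma Rintegral_wn_FTC a b (f F : R -> R) : a < b -> continuous f ->
  (forall x, is_derive x 1 F (f x)) -> \int[leb]_x (wn a b x * f x) = F b - F a.
Proof.
move=> ab cf dF.
have cF : continuous F.
  by move=> x; apply: differentiable_continuous; apply/derivable1_diffP; have [] := dF x.
have i1 : leb.-integrable `[a, b] (EFin \o f).
  apply: continuous_compact_integrable; first exact: segment_compact.
  exact: continuous_subspaceT.
have i2 : leb.-integrable `[a, b[ (EFin \o f).
  by apply: integrableS i1 => //; apply: subset_itvl; rewrite bnd_simp.
have -> : (fun x => wn a b x * f x) = f \_ `[a, b[.
  apply/funext => x; rewrite patchE mem_setE in_itv /wn.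
  by case: (_ && _); rewrite ?mul1r ?mul0r.
rewrite -Rintegral_mkcond Rintegral_itv_bndo_bndc// /Rintegral.
rewrite (@continuous_FTC2 _ f F a b)//; first exact: continuous_subspaceT.
- split.
  + by move=> x _; have [] := dF x.
  + by apply: cvg_at_right_filter; exact: cF.
  + by apply: cvg_at_left_filter; exact: cF.
- by move=> x _; rewrite derive1E; have [_ ->] := dF x.
Qed.

Lemma cintegral_ek (m : int) :
  cintegral leb (fun t => (wn 0 (2 * pi) t)%:C * ek m t) = (2 * pi * (m == 0)%:R)%:C.
Proof.
have pp : 0 < 2 * pi :> R by rewrite mulr_gt0// pi_gt0.
rewrite /cintegral.
have -> : (fun t => complex.Re ((wn 0 (2 * pi) t)%:C * ek m t)) =
    (fun t => wn 0 (2 * pi) t * cos (m%:~R * t)).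
  by apply/funext => t; rewrite /= mul0r subr0.
have -> : (fun t => complex.Im ((wn 0 (2 * pi) t)%:C * ek m t)) =
    (fun t => wn 0 (2 * pi) t * (- sin (m%:~R * t))).
  by apply/funext => t; rewrite /= mul0r addr0.
have [->|m0] := eqVneq m 0.
  have -> : (fun t : R => wn 0 (2 * pi) t * cos (0%:~R * t)) = wn 0 (2 * pi).
    by apply/funext => t; rewrite mul0r cos0 mulr1.
  have -> : (fun t : R => wn 0 (2 * pi) t * - sin (0%:~R * t)) = (fun=> 0).
    by apply/funext => t; rewrite mul0r sin0 oppr0 mulr0.
  by rewrite /Rintegral (integral_wn (ltW pp)) integral0 subr0 mulr1.
have m0' : m%:~R != 0 :> R by rewrite intr_eq0.
have ml x : {for x, continuous (fun x : R => m%:~R * x)} by apply: cvgM; [exact: cvg_cst|exact: cvg_id].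
have p1 : sin (m%:~R * (2 * pi)) = 0 :> R.
  by have := congr1 (@complex.Im R) (expNi2pi m); rewrite mulrC /= => /eqP; rewrite oppr_eq0 => /eqP.
have p2 : cos (m%:~R * (2 * pi)) = 1 :> R.
  by have := congr1 (@complex.Re R) (expNi2pi m); rewrite mulrC /=.
have c1 : continuous (fun t : R => cos (m%:~R * t)).
  by move=> x; apply: (continuous_comp (ml x)); exact: continuous_cos.
have c2 : continuous (fun t : R => - sin (m%:~R * t)).
  by move=> x; apply: cvgN; apply: (continuous_comp (ml x)); exact: continuous_sin.
have dm x : is_derive x 1 (fun t : R => m%:~R * t) m%:~R.
  by apply: is_derive_eq; rewrite -[_ *: _]/(m%:~R * 1) mulr1.
have d1 x : is_derive x 1 (fun t : R => m%:~R^-1 * sin (m%:~R * t)) (cos (m%:~R * x)).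
  have := is_deriveZ (m%:~R^-1) (is_derive1_comp (is_derive_sin (m%:~R * x)) (dm x)).
  by rewrite -[_ *: _ in X in X -> _]/(_ * _) mulrCA mulVf// mulr1.
have d2 x : is_derive x 1 (fun t : R => m%:~R^-1 * cos (m%:~R * t)) (- sin (m%:~R * x)).
  have := is_deriveZ (m%:~R^-1) (is_derive1_comp (is_derive_cos (m%:~R * x)) (dm x)).
  by rewrite -[_ *: _ in X in X -> _]/(_ * _) mulrCA mulVf// mulr1.
rewrite (Rintegral_wn_FTC pp c1 d1) (Rintegral_wn_FTC pp c2 d2).
by rewrite p1 p2 !mulr0 sin0 cos0 !mulr0 !subrr.
Qed.

End window.

Section L2_sums.
Context d (T : measurableType d) (R : realType) (mu : {measure set T -> \bar R}).
Implicit Types f g : T -> R[i].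

Lemma to_L2D f g : square_integrable mu f -> square_integrable mu g ->
  square_integrable mu (fun x => f x + g x) /\
  to_L2 mu (fun x => f x + g x) = to_L2 mu f + to_L2 mu g.
Proof.
move=> sf sg; have [s1 e1] := to_L2Z (-1) sg.
have [s2 e2] := to_L2B sf s1.
have E : (fun x => f x - -1 * g x) = (fun x => f x + g x).
  by apply/funext => x; rewrite mulN1r opprK.
by rewrite E in s2 e2; rewrite e2 e1 scaleN1r opprK.
Qed.

Lemma to_L2_sum (I : Type) (s : seq I) (c : I -> R[i]) (f : I -> T -> R[i]) :
  (forall i, square_integrable mu (f i)) ->
  square_integrable mu (fun x => \sum_(i <- s) c i * f i x) /\
  to_L2 mu (fun x => \sum_(i <- s) c i * f i x) = \sum_(i <- s) c i *: to_L2 mu (f i).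
Proof.
move=> sf; elim: s => [|i s [IH1 IH2]].
  have -> : (fun x => \sum_(i <- [::]) c i * f i x) = (0 : T -> R[i]).
    by apply/funext => x; rewrite big_nil.
  split; first exact: square_integrable0.
  rewrite big_nil; apply: L2_ext; have := to_L2E (square_integrable0 mu).
  by have := L2_0 mu; apply: filterS2 => x -> ->.
have -> : (fun x => \sum_(j <- i :: s) c j * f j x) =
    (fun x => c i * f i x + \sum_(j <- s) c j * f j x).
  by apply/funext => x; rewrite big_cons.
have [s1 e1] := to_L2Z (c i) (sf i).
by have [s2 e2] := to_L2D s1 IH1; split => //; rewrite e2 e1 IH2 big_cons.
Qed.

Lemma sqint_mul_bounded (M : R) f g : square_integrable mu f -> cmeasurable g ->
  (forall x, sqn (g x) <= M) -> square_integrable mu (fun x => f x * g x).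
Proof.
move=> sf mg gM; have [mf _] := sf.
refine (square_integrable_dom (mu := mu) (g := fun x => M * sqn (f x)) (cmeasurableM mf mg) _ _).
  have -> : EFin \o (fun x => M * sqn (f x)) = (fun x => M%:E * (EFin \o (fun x => sqn (f x))) x)%E.
    by apply/funext => x.
  by apply: integrableZl => //; exact: sqint_integrable.
by move=> x; rewrite sqnM mulrC ler_wpM2r ?sqn_ge0.
Qed.

End L2_sums.

Lemma measurable_expNiM (R : realType) (x : R) :
  cmeasurable (T := measurableTypeR R) (fun t => cval (expNi (x * t))).
Proof.
have ml (t : R) : {for t, continuous (fun t : R => x * t)} by apply: cvgM; [exact: cvg_cst|exact: cvg_id].
split.
  apply: (@continuous_measurable_fun R (fun t => cos (x * t))) => t.
  by apply: (continuous_comp (ml t)); exact: continuous_cos.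
apply: (@continuous_measurable_fun R (fun t => - sin (x * t))) => t; apply: cvgN.
by apply: (continuous_comp (ml t)); exact: continuous_sin.
Qed.

Section span.
Context {R : realType} {H : innerProductType R}.

Lemma linear_span_subspace (E : set H) :
  linear_span E 0 /\ forall a u v, linear_span E u -> linear_span E v -> linear_span E (a *: u + v).
Proof.
split.
  exists 0%N, (fun=> 0), (fun=> 0); split; first by case.
  by rewrite big_ord0.
move=> a u v [k [c [x [Ex ->]]]] [l [d [y [Ey ->]]]].
exists (k + l)%N, (fun i => match fintype.split i with inl j => a * c j | inr j => d j end),
  (fun i => match fintype.split i with inl j => x j | inr j => y j end); split.
  by move=> i; case: (fintype.split i).
rewrite big_split_ord/= scaler_sumr; congr (_ + _); apply: eq_bigr => i _.
  by rewrite (_ : fintype.split _ = inl i) ?scalerA//; exact: (unsplitK (inl i)).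
by rewrite (_ : fintype.split _ = inr i)//; exact: (unsplitK (inr i)).
Qed.

Lemma linear_span_fin (E : set H) (I : finType) (c : I -> R[i]) (u : I -> H) :
  (forall i, E (u i)) -> linear_span E (\sum_i c i *: u i).
Proof.
move=> Eu; exists #|I|, (fun k => c (enum_val k)), (fun k => u (enum_val k)); split => //.
by rewrite (reindex (@enum_val I I))//=; exact: onW_bij (enum_val_bij I).
Qed.

Lemma closure_span_subspace (E : set H) : closed_subspace (closure (linear_span E)).
Proof.
have [s0 sl] := linear_span_subspace E.
split; first exact: closed_closure.
  exact: subset_closure.
move=> a u v /closure_hnP cu /closure_hnP cv; apply/closure_hnP => e e0.
pose A := Normc.normc a + 1.
have A0 : 0 < A by rewrite ltr_wpDl// normc_ge0.
have e2 : 0 < e / 2 by rewrite divr_gt0.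
have [u' su uu] := cu _ (divr_gt0 e2 A0).
have [v' sv vv] := cv _ e2.
exists (a *: u' + v'); first exact: sl.
have -> : a *: u + v - (a *: u' + v') = a *: (u - u') + (v - v').
  by rewrite scalerBr opprD addrACA.
apply: le_lt_trans (hnD _ _) _; rewrite hnZ [ltRHS]splitr ler_ltD//.
apply: (@le_trans _ _ (A * hn (u - u'))).
  by rewrite ler_wpM2r ?hn_ge0// lerDl.
by rewrite mulrC -ler_pdivlMr// ltW.
Qed.

Lemma span_sub_closure (E : set H) u : E u -> closure (linear_span E) u.
Proof.
move=> Eu; apply: subset_closure; exists 1%N, (fun=> 1), (fun=> u); split => //.
by rewrite big_ord1 scale1r.
Qed.

Lemma closed_subspace_cvg (V : set H) (w : nat -> H) v : closed_subspace V ->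
  (forall n, V (w n)) -> w @ \oo --> v -> V v.
Proof. by move=> [cV _ _] Vw; apply: (closed_cvg V cV); exact: nearW. Qed.

Context {I : choiceType} (e : I -> H).
Hypothesis onb : forall k l, dot (e k) (e l) = (k == l)%:R.

Lemma onb_proj v s : uniq s ->
  hn (v - \sum_(k <- s) dot v (e k) *: e k) ^+ 2 = hn v ^+ 2 - \sum_(k <- s) sqn (dot v (e k)).
Proof.
move=> us; set w := \sum_(k <- s) _.
have vw : dot v w = (\sum_(k <- s) sqn (dot v (e k)))%:C.
  rewrite dot_sumr rmorph_sum/=; apply: eq_bigr => k _.
  by rewrite dotZr mulrC mul_conjc_sqn.
have ww : hn w ^+ 2 = \sum_(k <- s) sqn (dot v (e k)).
  rewrite hn2E; suff -> : dot w w = dot v w by rewrite vw.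
  rewrite {2 3}/w dot_sumr [RHS]dot_sumr; apply: eq_big_seq => k ks.
  rewrite !dotZr; congr (_ * _).
  rewrite /w dot_suml (bigD1_seq k)//= dotZl onb eqxx mulr1 big1 ?addr0//.
  by move=> l lk; rewrite dotZl onb (negbTE lk) mulr0.
by rewrite hn2D hnN dotNr raddfN/= vw ww /=; ring.
Qed.

Lemma bessel v : (Qe e v <= (hn v ^+ 2)%:E)%E.
Proof.
apply: esum_le_seq => s us; rewrite lee_fin -subr_ge0 -onb_proj//.
exact: sqr_ge0.
Qed.

Lemma parseval_closure v : closure (linear_span (range e)) v -> Qr e v = hn v ^+ 2.
Proof.
move: v; apply: (Qr_eq_closure bessel) => _ [k _ <-].
apply/eqP; rewrite eq_le Qr_le ?bessel//=; last exact: bessel.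
have := Qr_seq bessel (e k) (s := [:: k]) isT.
by rewrite big_seq1 onb eqxx sqn1 => h; rewrite hn2E onb eqxx.
Qed.

End span.

Section trigonometric_density.
Context {R : realType}.
Local Notation leb := (@lebesgue_measure R).
Implicit Types (k l : int) (x y t : R).

(** Normalized exponentials on one period. The sign of the index makes the inner product with [Ek k]
    a multiple of [fourier_integral] at [k]. *)
Definition Ek k : L2 leb :=
  to_L2 leb (fun t => (wn 0 (2 * pi) t)%:C * ((Num.sqrt (2 * pi))^-1%:C * ek (- k) t)).

Let pp : 0 < 2 * pi :> R. Proof. by rewrite mulr_gt0// pi_gt0. Qed.
Let sp : 0 < Num.sqrt (2 * pi) :> R. Proof. by rewrite sqrtr_gt0. Qed.

Lemma sqint_wek (c : R[i]) k :
  square_integrable leb (fun t => (wn 0 (2 * pi) t)%:C * (c * ek k t)).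
Proof.
apply: (@sqint_wn _ _ _ (sqn c)).
  by apply: cmeasurableM; [exact: cmeasurable_cst|exact: measurable_ek].
by move=> x _; rewrite sqnM sqn_ek mulr1.
Qed.

Lemma Ek_onb k l : dot (Ek k) (Ek l) = (k == l)%:R.
Proof.
rewrite dot_to_L2; [|exact: sqint_wek|exact: sqint_wek].
have -> : (fun t => (wn 0 (2 * pi) t)%:C * ((Num.sqrt (2 * pi))^-1%:C * ek (- k) t) *
    ((wn 0 (2 * pi) t)%:C * ((Num.sqrt (2 * pi))^-1%:C * ek (- l) t))^*) =
    (fun t => (2 * pi)^-1%:C * ((wn 0 (2 * pi) t)%:C * ek (l - k) t)).
  apply/funext => t; rewrite !rmorphM/= -ekN opprK !conjCR ek_add.
  have -> : (2 * pi)^-1%:C = (Num.sqrt (2 * pi))^-1%:C * (Num.sqrt (2 * pi))^-1%:C :> R[i].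
    by rewrite -rmorphM/= -invfM -expr2 sqr_sqrtr// ltW.
  have {3}-> : wn 0 (2 * pi) t = wn 0 (2 * pi) t * wn 0 (2 * pi) t by rewrite -expr2 wn_sqr.
  by rewrite [in RHS]rmorphM/=; ring.
rewrite cintegralZ; last first.
  apply: (@sqint_cintegrable _ 0 (2 * pi)) => [|x h]; last by rewrite wn_out// mul0r.
  by have := sqint_wek 1 (l - k); under eq_fun do rewrite mul1r.
rewrite cintegral_ek subr_eq0 eq_sym -rmorphM/= mulrA mulVf ?mul1r ?rmorph_nat//.
by rewrite gt_eqF.
Qed.

Local Notation V := (closure (linear_span (range Ek))).

Lemma lipschitz_continuous (f : R -> R) (L : R) :
  (forall x y, `|f x - f y| <= L * `|x - y|) -> continuous f.
Proof.
move=> fL x; apply/cvgrPdist_lt => e e0.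
have L1 : 0 < `|L| + 1 by rewrite ltr_wpDl.
have := nbhsx_ballx x _ (divr_gt0 e0 L1); apply: filterS => y; rewrite -ball_normE/= => xy.
apply: le_lt_trans (fL _ _) _; apply: (@le_lt_trans _ _ ((`|L| + 1) * `|x - y|)).
  by rewrite ler_wpM2r//; apply: le_trans (ler_norm _) _; rewrite lerDl.
by rewrite mulrC -ltr_pdivlMr.
Qed.

Lemma closure_Ek_lipschitz (f : R -> R) (M L : R) : measurable_fun setT f ->
  {in `[0, 2 * pi], forall x, `|f x| <= M} ->
  {in `[0, 2 * pi] &, forall x y, `|f x - f y| <= L * `|x - y|} ->
  f 0 = f (2 * pi) -> V (to_L2 leb (fun t => (wn 0 (2 * pi) t)%:C * (f t)%:C)).
Proof.
move=> mf fM fL f0; apply/closure_hnP => e e0.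
(* A uniform error of this size, on a window of length [2 pi], is an error [e / 2] in norm. *)
have e1 : 0 < e / (2 * Num.sqrt (2 * pi)) by rewrite divr_gt0// mulr_gt0.
have [I [c [k hc]]] := trig_approx fM fL f0 e1.
exists (\sum_i (c i * (Num.sqrt (2 * pi))%:C) *: Ek (- k i)).
  by apply: linear_span_fin => i; exists (- k i).
have sw i : square_integrable leb (fun t => (wn 0 (2 * pi) t)%:C * ((Num.sqrt (2 * pi))^-1%:C * ek (- - k i) t)).
  exact: sqint_wek.
have [s1 <-] := to_L2_sum (index_enum I) (fun i => c i * (Num.sqrt (2 * pi))%:C) sw.
have mfC : cmeasurable (T := measurableTypeR R) (fun t => (f t)%:C) by exact: cmeasurable_real.
have s2 : square_integrable leb (fun t => (wn 0 (2 * pi) t)%:C * (f t)%:C).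
  apply: (@sqint_wn _ _ _ (M ^+ 2)) => // x /andP[x0 x1].
  rewrite sqn_real -real_normK ?num_real// ler_sqr ?nnegrE//.
    by apply: fM; rewrite in_itv/= x0 ltW.
  by apply: le_trans (fM 0 _); rewrite // in_itv/= lexx ltW.
have [_ <-] := to_L2B s2 s1.
have -> : (fun x => (wn 0 (2 * pi) x)%:C * (f x)%:C - \sum_i c i * (Num.sqrt (2 * pi))%:C *
      ((wn 0 (2 * pi) x)%:C * ((Num.sqrt (2 * pi))^-1%:C * ek (- - k i) x))) =
    (fun x => (wn 0 (2 * pi) x)%:C * ((f x)%:C - \sum_i c i * ek (k i) x)).
  apply/funext => x; rewrite mulrBr; congr (_ - _); rewrite mulr_sumr; apply: eq_bigr => i _.
  rewrite opprK fmorphV/=; field.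
  by rewrite (fmorph_eq0 (real_complex R)) gt_eqF.
rewrite -(@ltr_pXn2r _ 2) ?nnegrE ?hn_ge0 ?(ltW e0)//.
apply: (@le_lt_trans _ _ ((e / (2 * Num.sqrt (2 * pi))) ^+ 2 * (2 * pi - 0))).
  apply: hn2_wn; rewrite ?(ltW pp)// ?sqr_ge0//.
    have := cmeasurableB mfC; apply.
    by apply: cmeasurable_sum => i; apply: cmeasurableM; [exact: cmeasurable_cst|exact: measurable_ek].
  by move=> x /andP[x0 x1]; apply: hc; rewrite in_itv/= x0 ltW.
rewrite subr0 expr_div_n exprMn sqr_sqrtr ?(ltW pp)//.
have -> : e ^+ 2 / (2 ^+ 2 * (2 * pi)) * (2 * pi) = e ^+ 2 / 4.
  have q0 : 2 * pi != 0 :> R by rewrite gt_eqF.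
  by move: (2 * pi : R) q0 => q q0; rewrite invfM mulrA divfK// -natrX.
by rewrite ltr_pdivrMr// ltr_pMr ?exprn_gt0// ltr1n.
Qed.

Lemma minr1_lipschitz (u v : R) : `|Num.min 1 u - Num.min 1 v| <= `|u - v|.
Proof.
have := ler_norm (u - v); have := ler_norm (v - u); rewrite [`|v - u|]distrC => h1 h2.
by rewrite ler_norml; apply/andP; split; rewrite !minEle; case: ifP; case: ifP; move=> + +; lra.
Qed.

(** The primitive of [F] is Lipschitz; its difference quotients of step [1 / (n + 1)] are Lipschitz,
    bounded by [M], and tend to [F] almost everywhere by Lebesgue's differentiation theorem.
    Dominated convergence concludes. *)
Lemma closure_Ek_bounded (F : R -> R) (M : R) : measurable_fun setT F ->
  (forall x, `|F x| <= M) -> (forall x, ~~ (0 <= x < 2 * pi) -> F x = 0) ->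
  V (to_L2 leb (fun t => (F t)%:C)).
Proof.
move=> mF FM F0.
have M0 : 0 <= M by apply: le_trans (FM 0).
have mFC : cmeasurable (T := measurableTypeR R) (fun t => (F t)%:C) by exact: cmeasurable_real.
have FE : (fun t => (F t)%:C) = (fun t => (wn 0 (2 * pi) t)%:C * (F t)%:C).
  apply/funext => t; have [h|h] := boolP (0 <= t < 2 * pi); first by rewrite wn_in// mul1r.
  by rewrite F0// mulr0.
have sqF x : sqn (F x)%:C <= M ^+ 2.
  by rewrite sqn_real -real_normK ?num_real// ler_sqr ?nnegrE.
have sF : square_integrable leb (fun t => (F t)%:C).
  by rewrite FE; apply: (@sqint_wn _ _ _ (M ^+ 2)).
have iF : leb.-integrable setT (EFin \o F).
  by have [] := @sqint_cintegrable _ 0 (2 * pi) _ sF (fun x h => congr1 _ (F0 x h)).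
have iFy y : leb.-integrable `]-oo, y] (EFin \o F) by exact: integrableS iF.
pose Phi x := \int[leb]_(t in `]-oo, x]) F t.
have PhiB x y : x <= y -> Phi y - Phi x = \int[leb]_(t in `]x, y]) F t.
  by move=> xy; rewrite /Phi Rintegral_itvB// bnd_simp.
have Phi_lip0 x y : x <= y -> `|Phi y - Phi x| <= M * (y - x).
  move=> xy; rewrite PhiB//.
  have ixy : leb.-integrable `]x, y] (EFin \o F) by exact: integrableS iF.
  apply: le_trans (le_normr_Rintegral _ ixy) _ => //.
  have fin : (leb `]x, y]%classic < +oo)%E.
    by rewrite lebesgue_measure_itv/=; case: ifP => _; rewrite ?ltry.
  apply: (@le_trans _ _ (\int[leb]_(t in `]x, y]) M)).
    apply: le_Rintegral => //; first exact: integrable_norm.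
    apply: measurable_bounded_integrable => //; exact: bounded_cst.
  rewrite Rintegral_cst//.
  suff -> : fine (leb `]x, y]%classic) = y - x by [].
  rewrite lebesgue_measure_itv/= lte_fin.
  by case: ltgtP xy => //= -> _; rewrite subrr.
have Phi_lip x y : `|Phi x - Phi y| <= M * `|x - y|.
  have [xy|/ltW yx] := leP y x; first by rewrite [in leRHS]ger0_norm ?subr_ge0// Phi_lip0.
  by rewrite distrC [in leRHS]distrC [in leRHS]ger0_norm ?subr_ge0// Phi_lip0.
pose a n : R := n.+1%:R.
have a0 n : 0 < a n by rewrite ltr0n.
pose D n x := a n * (Phi (x + (a n)^-1) - Phi x).
(* [chi n] vanishes at 0 and [D n] at [2 pi], so [G n] has the equal end values that
   [closure_Ek_lipschitz] requires. *)
pose chi n x := Num.min 1 (a n * x).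
pose G n x := chi n x * D n x.
have DM n x : `|D n x| <= M.
  rewrite normrM gtr0_norm// mulrC -ler_pdivlMr//; apply: le_trans (Phi_lip _ _) _.
  by rewrite addrAC subrr add0r ger0_norm// invr_ge0 ltW.
have DL n x y : `|D n x - D n y| <= a n * (2 * M) * `|x - y|.
  rewrite -mulrBr normrM gtr0_norm// -mulrA ler_wpM2l ?(ltW (a0 n))//.
  have -> : Phi (x + (a n)^-1) - Phi x - (Phi (y + (a n)^-1) - Phi y) =
    (Phi (x + (a n)^-1) - Phi (y + (a n)^-1)) - (Phi x - Phi y) by ring.
  apply: le_trans (ler_normB _ _) _.
  have := Phi_lip (x + (a n)^-1) (y + (a n)^-1); have := Phi_lip x y.
  by rewrite (_ : x + (a n)^-1 - (y + (a n)^-1) = x - y); [lra|ring].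
have chiL n x y : `|chi n x - chi n y| <= a n * `|x - y|.
  by apply: le_trans (minr1_lipschitz _ _) _; rewrite -mulrBr normrM gtr0_norm.
have chi1 n x : 0 <= x -> 0 <= chi n x <= 1.
  by move=> x0; rewrite ge_min lexx/= le_min ler01 mulr_ge0// ltW.
have GM n x : 0 <= x -> `|G n x| <= M.
  move=> /(chi1 n)/andP[c0 c1]; rewrite normrM (ger0_norm c0) -[leRHS]mul1r.
  by apply: ler_pM.
have mG n : measurable_fun setT (G n).
  by apply: measurable_funM; apply: continuous_measurable_fun; apply: lipschitz_continuous;
    [exact: chiL|exact: DL].
have VG n : V (to_L2 leb (fun t => (wn 0 (2 * pi) t)%:C * (G n t)%:C)).
  apply: (@closure_Ek_lipschitz _ M (a n * (2 * M) + a n * M)) => //.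
  - by move=> x; rewrite in_itv/= => /andP[x0 _]; exact: GM.
  - move=> x y; rewrite !in_itv/= => /andP[x0 _] /andP[y0 _].
    have -> : G n x - G n y = chi n x * (D n x - D n y) + D n y * (chi n x - chi n y).
      by rewrite /G; ring.
    apply: le_trans (ler_normD _ _) _; rewrite mulrDl; apply: lerD.
      have /andP[c0 c1] := chi1 n x x0.
      rewrite normrM (ger0_norm c0) -[leRHS]mul1r; exact: ler_pM.
    rewrite normrM [in leRHS]mulrAC [leRHS]mulrC; exact: ler_pM.
  - have -> : G n 0 = 0 by rewrite /G /chi mulr0 (min_idPr ler01) mul0r.
    rewrite /G /D PhiB ?lerDl ?invr_ge0 ?(ltW (a0 n))//.
    rewrite (@eq_Rintegral _ _ _ _ _ (fun=> 0)); first by rewrite Rintegral_cst// mul0r !mulr0.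
    move=> t; rewrite inE/= in_itv/= => /andP[h _]; apply: F0.
    by rewrite negb_and -leNgt (ltW h) orbT.
apply: (closed_subspace_cvg (closure_span_subspace _) VG).
refine (L2_cvg_dct (mu := leb) (f_ := fun n t => (wn 0 (2 * pi) t)%:C * (G n t)%:C)
  (f := fun t => (F t)%:C) (g := fun x => (2 * M) ^+ 2 * wn 0 (2 * pi) x) _ sF _ _ _).
- move=> n; apply: (@sqint_wn _ _ _ (M ^+ 2)); first exact: (cmeasurable_real (mG n)).
  move=> x /andP[x0 _]; rewrite sqn_real -real_normK ?num_real// ler_sqr ?nnegrE//; exact: GM.
- have -> : EFin \o (fun x => (2 * M) ^+ 2 * wn 0 (2 * pi) x) =
      (fun x => ((2 * M) ^+ 2)%:E * (EFin \o wn 0 (2 * pi)) x)%E by apply/funext => x.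
  by apply: integrableZl => //; exact: integrable_wn.
- move=> n x; have [h|h] := boolP (0 <= x < 2 * pi); last first.
    by rewrite wn_out// F0// mul0r subrr sqn0 mulr0.
  rewrite wn_in// rmorph1 mul1r mulr1 -rmorphB/= sqn_real -real_normK ?num_real//.
  rewrite ler_sqr ?nnegrE ?mulr_ge0//; apply: le_trans (ler_normB _ _) _.
  have /andP[x0 _] := h; have := GM n x x0; have := FM x; lra.
have aeF : {ae leb, forall x, derivable Phi x 1 /\ derive1 Phi x = F x}.
  apply: FTC1Ny => //; have := @integrable_locally _ F setT measurableT iF.
  by rewrite patch_setT.
have ae0 : {ae leb, forall x, x != 0 :> R}.
  exists [set 0]; split => //; first exact: lebesgue_measure_set1.
  by move=> x /= /negP; rewrite negbK => /eqP.
apply: filterS2 aeF ae0; first exact: (ae_filter_ringOfSetsType leb).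
move=> x [dPhi PhiF] x0.
have [h|h] := boolP (0 <= x < 2 * pi); last first.
  rewrite wn_out// F0//; under eq_fun do rewrite mul0r subrr sqn0; exact: cvg_cst.
rewrite wn_in//; under eq_fun do rewrite mul1r -rmorphB/= sqn_real.
have xp : 0 < x by rewrite lt0r x0; case/andP: h.
suff GF : G n x @[n --> \oo] --> F x.
  have : G n x - F x @[n --> \oo] --> F x - F x by apply: cvgB => //; exact: cvg_cst.
  by rewrite subrr => h0; have h1 := cvgM h0 h0; rewrite mulr0 in h1; exact: h1.
apply/cvgrPdist_lt => e e0.
have : h^-1 *: (Phi (h *: 1 + x) - Phi x) @[h --> 0^'] --> F x.
  by rewrite -PhiF derive1E.
move/cvgrPdist_lt => /(_ _ e0) /nbhs_ballP[r /= r0 hr].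
have [n0 hn0] : exists n0 : nat, forall n, (n0 <= n)%N -> (a n)^-1 < r /\ 1 <= a n * x.
  exists (maxn (Num.bound r^-1) (Num.bound x^-1)) => n; rewrite geq_max => /andP[n1 n2].
  have ir0 : 0 <= r^-1 by rewrite invr_ge0 ltW.
  have ix0 : 0 <= x^-1 by rewrite invr_ge0 ltW.
  split.
    rewrite invf_plt ?posrE//; apply: (lt_le_trans (archi_boundP ir0)).
    by rewrite ler_nat ltnW.
  rewrite -ler_pdivrMr// div1r; apply: (le_trans (ltW (archi_boundP ix0))).
  by rewrite ler_nat ltnW.
exists n0 => // n /= /hn0[n1 n2].
rewrite /G /chi (min_idPl n2) mul1r /D.
have := hr (a n)^-1; rewrite -ball_normE/= sub0r normrN gtr0_norm ?invr_gt0// => /(_ n1).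
rewrite invr_eq0 gt_eqF// => /(_ isT); rewrite invrK -[_ *: 1]/(_ * 1) mulr1.
by rewrite -[_ *: _]/(_ * _) [_ + x]addrC.
Qed.

(** Truncation at height [n] reduces to bounded real functions; real and imaginary parts are
    recombined by linearity of the closure. *)
Lemma closure_Ek (f : R -> R[i]) : square_integrable leb f ->
  (forall x, ~~ (0 <= x < 2 * pi) -> f x = 0) -> V (to_L2 leb f).
Proof.
move=> sf f0; have [mf _] := sf; have [_ V0 Vl] := closure_span_subspace (range Ek).
pose b (n : nat) x : R := if sqn (f x) <= n%:R then 1 else 0.
have mb n : measurable_fun setT (b n).
  apply: measurable_fun_ifT => //.
  by apply: measurable_fun_ler => //; exact: measurable_sqn.
have bf n : V (to_L2 leb (fun x => (b n x)%:C * f x)).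
  have bd x : sqn ((b n x)%:C * f x) <= n%:R.
    by rewrite sqnM sqn_real /b; case: ifP => h; rewrite ?expr1n ?mul1r// expr0n/= mul0r ler0n.
  have [m1 m2] : cmeasurable (T := measurableTypeR R) (fun x => (b n x)%:C * f x).
    by apply: cmeasurableM => //; exact: (cmeasurable_real (mb n)).
  have z0 x : ~~ (0 <= x < 2 * pi) -> (b n x)%:C * f x = 0 by move=> /f0 ->; rewrite mulr0.
  have V1 := closure_Ek_bounded m1 (fun x => norm_Re_le (bd x)) (fun x h => congr1 _ (z0 x h)).
  have V2 := closure_Ek_bounded m2 (fun x => norm_Im_le (bd x)) (fun x h => congr1 _ (z0 x h)).
  have := Vl (0 +i* 1) _ _ V2 V1.
  have sr (g : R -> R) : measurable_fun setT g -> (forall x, g x ^+ 2 <= sqn (f x)) ->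
      square_integrable leb (fun x => (g x)%:C).
    move=> mg gf; apply: (square_integrable_dom (mu := leb) (g := fun x => sqn (f x)) (cmeasurable_real mg)).
      exact: sqint_integrable.
    by move=> x; rewrite sqn_real.
  have bf1 x : sqn ((b n x)%:C * f x) <= sqn (f x).
    by rewrite sqnM sqn_real /b; case: ifP => h; rewrite ?expr1n ?mul1r// expr0n/= mul0r sqn_ge0.
  have s1 := sr _ m1 (fun x => le_trans (ler_wpDr (sqr_ge0 _) (lexx _)) (bf1 x)).
  have s2 := sr _ m2 (fun x => le_trans (ler_wpDl (sqr_ge0 _) (lexx _)) (bf1 x)).
  have [s3 <-] := to_L2Z (0 +i* 1) s2; have [_ <-] := to_L2D s3 s1.
  congr (V (to_L2 _ _)); apply/funext => x.
  by case: (_ * f x) => u v; apply/eqP; rewrite eq_complex/=; apply/andP; split; apply/eqP; ring.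
apply: (closed_subspace_cvg (closure_span_subspace _) bf).
have bdf n x : sqn ((b n x)%:C * f x - f x) <= sqn (f x).
  rewrite /b; case: ifP => _; first by rewrite mul1r subrr sqn0 sqn_ge0.
  by rewrite mul0r sub0r sqnN.
refine (L2_cvg_dct (mu := leb) (f_ := fun n x => (b n x)%:C * f x) (f := f) (g := fun x => sqn (f x)) _ sf _ bdf _).
- move=> n; have := sqint_mul_bounded (M := 1) sf (cmeasurable_real (mb n)).
  under eq_fun do rewrite mulrC; apply => x.
  by rewrite sqn_real /b; case: ifP => _; rewrite ?expr1n// expr0n.
- exact: sqint_integrable.
apply: aeW => x; apply/cvgrPdist_lt => e e0.
exists (Num.bound (sqn (f x))) => // n /= hn; rewrite /b ifT ?mul1r ?subrr ?sqn0 ?subrr ?normr0//.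
by apply: (le_trans (ltW (archi_boundP (sqn_ge0 _)))); rewrite ler_nat.
Qed.

Lemma dot_Ek (f : R -> R[i]) k : square_integrable leb f ->
  (forall x, ~~ (0 <= x < 2 * pi) -> f x = 0) ->
  dot (to_L2 leb f : L2 leb) (Ek k) = (Num.sqrt (2 * pi))^-1%:C * fourier_integral f k%:~R.
Proof.
move=> sf f0; rewrite dot_to_L2//; last exact: sqint_wek.
have cf : cintegrable leb (fun t => f t * cval (expNi (k%:~R * t))).
  apply: (@sqint_cintegrable _ 0 (2 * pi)) => [|x /f0 ->]; last by rewrite mul0r.
  apply: (sqint_mul_bounded (M := 1) sf); first exact: measurable_expNiM.
  by move=> x; rewrite sqn_cval.
rewrite /fourier_integral -cintegralZ//; congr cintegral; apply/funext => t.
rewrite !rmorphM/= -ekN opprK !conjCR /ek.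
have [h|h] := boolP (0 <= t < 2 * pi); last by rewrite f0// !mul0r mulr0.
by rewrite wn_in// mul1r; ring.
Qed.

Lemma parseval_window (f : R -> R[i]) : square_integrable leb f ->
  (forall x, ~~ (0 <= x < 2 * pi) -> f x = 0) ->
  (\esum_(k in [set: int]) (sqn (fourier_integral f k%:~R))%:E =
   (2 * pi)%:E * \int[leb]_x (sqn (f x))%:E)%E.
Proof.
move=> sf f0; rewrite (hn2_to_L2 sf) -(parseval_closure Ek_onb (closure_Ek sf f0)).
have -> : 2 * pi = sqn (Num.sqrt (2 * pi))%:C :> R by rewrite sqn_real sqr_sqrtr// ltW.
rewrite -EFinM -(Qr_Z (bessel Ek_onb)) -(QeE (bessel Ek_onb)).
apply: eq_esum => k _; rewrite dotZl dot_Ek// mulrA -rmorphM/= mulfV ?mul1r//.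
by rewrite gt_eqF.
Qed.

End trigonometric_density.

(** * Plancherel's theorem *)
Section esum_integral.
Context {R : realType}.

Lemma esum_one (I : choiceType) (a : I -> \bar R) (k : I) : (0 <= a k)%E ->
  (forall i, i != k -> a i = 0%E) -> (\esum_(i in [set: I]) a i = a k)%E.
Proof.
move=> ak h; rewrite -(esum_set1 ak) [RHS]esum_mkcond; apply: eq_esum => i _.
by case: ifPn => //; rewrite in_set1 => /h.
Qed.

(** Turns an unordered countable sum into a series along the numbering [pickle], the form in which
    sums and integrals are exchanged. *)
Lemma esum_count (I : countType) (a : I -> \bar R) : (forall i, (0 <= a i)%E) ->
  (\esum_(i in [set: I]) a i = \sum_(0 <= n <oo) oapp a 0 (pickle_inv n))%E.
Proof.
move=> a0; rewrite nneseries_esumT; last by move=> n; case: pickle_inv => //=.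
transitivity (\esum_(n in range (@pickle I)) oapp a 0 (pickle_inv n))%E.
  rewrite (@reindex_esum _ _ _ setT _ (@pickle I)).
    by apply: eq_esum => i _; rewrite pickleK_inv.
  split=> [i _|i j _ _|n [i _ <-]]; [by exists i| |by exists i].
  exact: (pcan_inj (@pickleK I)).
rewrite [LHS]esum_mkcond; apply: eq_esum => n _.
case: ifPn => // /negP h; case E : (pickle_inv n) => [i|]//=.
by case: h; rewrite inE; exists i => //; have := @pickle_invK I n; rewrite E.
Qed.

Lemma esumZl (I : countType) (a : I -> R) (c : R) : (forall i, 0 <= a i) -> 0 <= c ->
  (\esum_(i in [set: I]) (c * a i)%:E = c%:E * \esum_(i in [set: I]) (a i)%:E)%E.
Proof.
move=> a0 c0; rewrite !esum_count; last 2 first.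
- by move=> i; rewrite lee_fin.
- by move=> i; rewrite lee_fin mulr_ge0.
rewrite -nneseriesZl; last first.
  by move=> n _; case: pickle_inv => //= i; rewrite lee_fin.
by apply: eq_eseriesr => n _; case: pickle_inv => [i|]/=; rewrite ?mule0.
Qed.

Lemma integral_esum d (T : measurableType d) (mu : {measure set T -> \bar R}) (I : countType)
  (f : I -> T -> \bar R) : (forall i, measurable_fun setT (f i)) ->
  (forall i x, (0 <= f i x)%E) ->
  (\int[mu]_x (\esum_(i in [set: I]) f i x) = \esum_(i in [set: I]) \int[mu]_x f i x)%E.
Proof.
move=> mf f0; rewrite [RHS]esum_count; last by move=> i; exact: integral_ge0.
have E n : (oapp (fun i => \int[mu]_x f i x) 0 (pickle_inv n) =
    \int[mu]_x oapp (f^~ x) 0 (@pickle_inv I n))%E.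
  by case: pickle_inv => //=; rewrite integral0.
under [RHS]eq_eseriesr do rewrite E.
rewrite -integral_nneseries//.
- by apply: eq_integral => x _; rewrite esum_count.
- by move=> n; case: pickle_inv => /=.
- by move=> n x _; case: pickle_inv => /=.
Qed.

Lemma measurable_esum d (T : measurableType d) (I : countType)
  (f : I -> T -> \bar R) : (forall i, measurable_fun setT (f i)) ->
  (forall i x, (0 <= f i x)%E) -> measurable_fun setT (fun x => \esum_(i in [set: I]) f i x)%E.
Proof.
move=> mf f0.
have -> : (fun x => \esum_(i in [set: I]) f i x)%E =
    (fun x => \sum_(0 <= n <oo) oapp (f^~ x) 0 (@pickle_inv I n))%E.
  by apply/funext => x; rewrite esum_count.
apply: ge0_emeasurable_sum; first by move=> n x _ _; case: pickle_inv => /=.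
by move=> n _; case: pickle_inv => /=.
Qed.

End esum_integral.

Section unfolding.
Context {R : realType}.
Local Notation leb := (@lebesgue_measure R).

Lemma window_index (a x : R) : 0 < a -> exists2 k : int, wn 0 a (x - a * k%:~R) = 1 &
  forall l, l != k -> wn 0 a (x - a * l%:~R) = 0.
Proof.
move=> a0; exists (Num.floor (x / a)).
  have /andP[h1 h2] := floor_itv (x / a).
  rewrite wn_in//; apply/andP; split.
    by rewrite subr_ge0 mulrC -ler_pdivlMr.
  by rewrite ltrBlDl -[X in _ + X]mulr1 -mulrDr mulrC -ltr_pdivrMr// -intrD1.
move=> l lk; apply: wn_out; apply: contra lk => /andP[h1 h2].
rewrite eq_sym; apply/eqP/floor_def; apply/andP; split.
  by rewrite ler_pdivlMr// mulrC -subr_ge0.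
by rewrite ltr_pdivrMr// mulrC intrD mulrDr mulr1 -ltrBlDl.
Qed.

(** The translates of the window by the multiples of [a] partition the line. *)
Lemma integral_unfold (h : R -> \bar R) (a : R) : 0 < a -> measurable_fun [set: R] h ->
  (forall x, (0 <= h x)%E) ->
  (\int[leb]_x h x = \esum_(k in [set: int]) \int[leb]_x ((wn 0 a x)%:E * h (x + a * k%:~R)%R))%E.
Proof.
move=> a0 mh h0.
have mw (b : R) : measurable_fun [set: R] (fun x => (wn 0 a (x - b))%:E).
  apply/measurable_EFinP; apply: (measurableT_comp (measurable_wn 0 a)).
  by have := measurable_affine 1 (- b); under eq_fun do rewrite mul1r.
transitivity (\int[leb]_x (\esum_(k in [set: int]) ((wn 0 a (x - a * k%:~R))%:E * h x)))%E.
  apply: eq_integral => x _; have [k k1 k0] := window_index x a0.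
  rewrite (@esum_one _ _ _ k) ?k1 ?mul1e//.
  by move=> l /k0 ->; rewrite mul0e.
rewrite (integral_esum leb (f := fun (k : int) x => ((wn 0 a (x - a * k%:~R))%:E * h x)%E)); last 2 first.
- by move=> k; apply: emeasurable_funM => //; exact: mw.
- by move=> k x; rewrite mule_ge0// lee_fin wn_ge0.
apply: eq_esum => k _.
have := @ge0_integral_affine R 1 (a * k%:~R) (fun x => ((wn 0 a (x - a * k%:~R))%:E * h x)%E) ltr01.
rewrite invr1 mul1e => <-.
- by apply: eq_integral => x _; rewrite mul1r addrK.
- by apply: emeasurable_funM => //; exact: mw.
- by move=> x; rewrite mule_ge0// lee_fin wn_ge0.
Qed.

End unfolding.

Lemma cexpD (R : realType) (x y : R) : cval (expNi (x + y)) = cval (expNi x) * cval (expNi y).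
Proof. by rewrite expNiD. Qed.

Section plancherel.
Context {R : realType}.
Local Notation leb := (@lebesgue_measure R).
Implicit Types (f g : R -> R[i]).

Lemma cmeasurable_affine (a b : R) f : cmeasurable (T := measurableTypeR R) f ->
  cmeasurable (T := measurableTypeR R) (fun x => f (a * x + b)).
Proof.
by move=> [m1 m2]; split; [apply: (measurableT_comp m1)|apply: (measurableT_comp m2)];
  exact: measurable_affine.
Qed.

Lemma sqint_affine (a b : R) f : 0 < a -> square_integrable leb f ->
  square_integrable leb (fun x => f (a * x + b)).
Proof.
move=> a0 sf; have [mf _] := sf; have /square_integrable_sqn[_ fin] := sf.
apply/square_integrable_sqn; split; first exact: cmeasurable_affine.
rewrite (@ge0_integral_affine R a b (fun x => (sqn (f x))%:E))//.
- by apply: lte_mul_pinfty => //; rewrite lee_fin invr_ge0 ltW.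
- exact/measurable_EFinP/measurable_sqn.
- by move=> x; rewrite lee_fin sqn_ge0.
Qed.

Lemma cintegral_affine (a b : R) f : 0 < a -> cintegrable leb f ->
  cintegral leb (fun x => f (a * x + b)) = (a^-1)%:C * cintegral leb f.
Proof.
move=> a0 [i1 i2]; rewrite /cintegral.
rewrite (Rintegral_affine b a0 i1) (Rintegral_affine b a0 i2).
by apply/eqP; rewrite eq_complex/=; apply/andP; split; apply/eqP; ring.
Qed.

(** Rescaling [[a, a + A[] to a period turns the integer frequencies into multiples of [2 pi / A];
    modulation by the exponential of frequency [s] translates this grid. *)
Lemma parseval_grid f (a A s : R) : 0 < A -> square_integrable leb f ->
  (forall x, ~~ (a <= x < a + A) -> f x = 0) ->
  (\esum_(k in [set: int]) (sqn (fourier_integral f (s + 2 * pi / A * k%:~R)))%:E =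
   A%:E * \int[leb]_x (sqn (f x))%:E)%E.
Proof.
move=> A0 sf f0.
have pp : 0 < 2 * pi :> R by rewrite mulr_gt0// pi_gt0.
pose T := A / (2 * pi); have T0 : 0 < T by rewrite divr_gt0.
pose g u := f (T * u + a) * cval (expNi (s * T * u)).
have sg : square_integrable leb g.
  apply: (sqint_mul_bounded (M := 1)); [exact: sqint_affine|exact: measurable_expNiM|].
  by move=> x; rewrite sqn_cval.
have g0 x : ~~ (0 <= x < 2 * pi) -> g x = 0.
  move=> h; rewrite /g f0 ?mul0r//; apply: contra h => /andP[h1 h2].
  have {}h1 : 0 <= T * x by rewrite -(lerD2r a) add0r.
  have {}h2 : T * x < A by rewrite -(ltrD2r a) [A + a]addrC.
  rewrite -(pmulr_rge0 x T0) h1 -(ltr_pM2l T0)/=.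
  by rewrite [T * (2 * pi)](divfK _ A)// gt_eqF.
have := parseval_window sg g0.
have -> : (\int[leb]_x (sqn (g x))%:E = (T^-1)%:E * \int[leb]_x (sqn (f x))%:E)%E.
  rewrite -(@ge0_integral_affine R T a (fun x => (sqn (f x))%:E))//.
  - by apply: eq_integral => x _; rewrite /g sqnM sqn_cval mulr1.
  - by apply/measurable_EFinP/measurable_sqn; case: sf.
  - by move=> x; rewrite lee_fin sqn_ge0.
have fE (k : int) : sqn (fourier_integral g k%:~R) =
    T^-1 ^+ 2 * sqn (fourier_integral f (s + 2 * pi / A * k%:~R)).
  pose y := s + 2 * pi / A * k%:~R.
  have cy : cintegrable leb (fun t => f t * cval (expNi (y * t))).
    apply: (@sqint_cintegrable _ a (a + A)) => [|x /f0 ->]; last by rewrite mul0r.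
    apply: (sqint_mul_bounded (M := 1) sf); first exact: measurable_expNiM.
    by move=> x; rewrite sqn_cval.
  have -> : fourier_integral g k%:~R = cval (expNi (- (y * a))) * ((T^-1)%:C * fourier_integral f y).
    rewrite -(cintegral_affine a T0 cy).
    have sc := sqint_affine a T0 sf.
    rewrite -cintegralZ.
      congr cintegral; apply/funext => u; rewrite /g.
      have -> : y * (T * u + a) = s * T * u + k%:~R * u + y * a.
        have fe (q : R) : q != 0 -> (s + q / A * k%:~R) * (A / q * u + a) =
            s * (A / q) * u + k%:~R * u + (s + q / A * k%:~R) * a.
          by move=> q0; field; rewrite q0 gt_eqF.
        by apply: fe; rewrite gt_eqF.
      rewrite !cexpD.
      have e1 : cval (expNi (- (y * a))) * cval (expNi (y * a)) = 1 by rewrite -cexpD addNr expNi0.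
      transitivity (f (T * u + a) * cval (expNi (s * T * u)) * cval (expNi (k%:~R * u)) *
        (cval (expNi (- (y * a))) * cval (expNi (y * a)))); first by rewrite e1 mulr1.
      by ring.
    have [i1 i2] := cy.
    by split; [exact: (integrable_affine a T0 i1)|exact: (integrable_affine a T0 i2)].
  by rewrite sqnM sqn_cval mul1r sqnM sqn_real.
under eq_esum do rewrite fE.
rewrite esumZl ?sqr_ge0//; last by move=> k; exact: sqn_ge0.
set X := (\esum_(k in _) _)%E; set Y := (\int[leb]_x _)%E => h.
have : ((T ^+ 2)%:E * ((T^-1 ^+ 2)%:E * X) = (T ^+ 2)%:E * ((2 * pi)%:E * ((T^-1)%:E * Y)))%E.
  by rewrite h.
rewrite !muleA -!EFinM -exprMn mulfV ?gt_eqF// expr1n mul1e => ->.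
have fe (q : R) : q != 0 -> (A / q) ^+ 2 * q / (A / q) = A.
  by move=> q0; field; rewrite q0 gt_eqF.
by rewrite /T fe// gt_eqF.
Qed.

(** For these functions the Fourier integral converges absolutely at every point. *)
Definition compact_sqint f := square_integrable leb f /\
  exists2 A : R, 0 < A & forall x, ~~ (- A <= x < A) -> f x = 0.

Lemma compact_sqintW f a b : square_integrable leb f ->
  (forall x, ~~ (a <= x < b) -> f x = 0) -> compact_sqint f.
Proof.
move=> sf f0; split => //; exists (`|a| + `|b| + 1); first by rewrite ltr_wpDl ?addr_ge0.
move=> x h; apply: f0; apply: contra h => /andP[h1 h2].
have := ler_norm (- a); have := ler_norm b; rewrite normrN => h3 h4.
have := normr_ge0 a; have := normr_ge0 b; move=> h5 h6.
by apply/andP; split; lra.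
Qed.

Lemma compact_sqint_cintegrable f x : compact_sqint f ->
  cintegrable leb (fun t => f t * cval (expNi (x * t))).
Proof.
move=> [sf [A A0 f0]]; apply: (@sqint_cintegrable _ (- A) A) => [|t /f0 ->]; last by rewrite mul0r.
apply: (sqint_mul_bounded (M := 1) sf); first exact: measurable_expNiM.
by move=> t; rewrite sqn_cval.
Qed.

Lemma compact_sqint_comb c f g : compact_sqint f -> compact_sqint g ->
  compact_sqint (fun x => c * f x + g x) /\
  forall x, fourier_integral (fun x => c * f x + g x) x = c * fourier_integral f x + fourier_integral g x.
Proof.
move=> cf cg; split.
  have [[sf [A A0 f0]] [sg [B B0 g0]]] := (cf, cg).
  have [s1 _] := to_L2Z c sf; have [s2 _] := to_L2D s1 sg.
  apply: (@compact_sqintW _ (- (A + B)) (A + B)) => // x h.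
  rewrite f0 ?g0 ?mulr0 ?addr0//; apply: contra h => /andP[h1 h2]; apply/andP; split; lra.
move=> x; rewrite /fourier_integral -cintegral_comb; [|exact: compact_sqint_cintegrable..].
by congr cintegral; apply/funext => t; rewrite mulrDl mulrA.
Qed.

(** The difference is the inner product of [f] with a windowed difference of exponentials, of norm
    at most a multiple of [|x - y|]. This yields the measurability of the Fourier integral. *)
Lemma fourier_integral_lipschitz f : compact_sqint f ->
  exists2 K : R, 0 <= K &
    forall x y, sqn (fourier_integral f x - fourier_integral f y) <= K * (x - y) ^+ 2.
Proof.
move=> cf; have [sf [A A0 f0]] := cf.
pose e (x t : R) := cval (expNi (- x * t)).
exists (hn (to_L2 leb f : L2 leb) ^+ 2 * (A ^+ 2 * (A - - A))) => [|x y].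
  by rewrite mulr_ge0 ?sqr_ge0// mulr_ge0 ?sqr_ge0// opprK addr_ge0// ltW.
have me z : cmeasurable (T := measurableTypeR R) (e z) by exact: measurable_expNiM.
have bd t : - A <= t < A -> sqn (e x t - e y t) <= A ^+ 2 * (x - y) ^+ 2.
  move=> /andP[t1 t2]; apply: le_trans (expNi_dist _ _) _.
  rewrite -mulrBl exprMn mulrC ler_pM ?sqr_ge0//.
    by rewrite -real_normK ?num_real// ler_sqr ?nnegrE ?(ltW A0)// ler_norml t1 ltW.
  by rewrite -opprB opprK le_eqVlt; apply/orP; left; apply/eqP; ring.
have mxy := cmeasurableB (me x) (me y).
have s1 := sqint_wn mxy bd.
have -> : fourier_integral f x - fourier_integral f y =
    dot (to_L2 leb f : L2 leb) (to_L2 leb (fun t => (wn (- A) A t)%:C * (e x t - e y t))).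
  rewrite dot_to_L2// -mulN1r addrC /fourier_integral -cintegral_comb; [|exact: compact_sqint_cintegrable..].
  congr cintegral; apply/funext => t.
  have [h|/f0 ->] := boolP (- A <= t < A); last by rewrite !mul0r mulr0 addr0.
  rewrite wn_in// mul1r rmorphB/= /e !mulNr !cval_expNiN !conjCK; ring.
apply: le_trans (dot_CS _ _) _; rewrite -mulrA ler_wpM2l ?sqr_ge0//.
have A2 : - A <= A by lra.
have M0 : 0 <= A ^+ 2 * (x - y) ^+ 2 by rewrite mulr_ge0 ?sqr_ge0.
apply: le_trans (hn2_wn A2 mxy bd M0) _.
by rewrite le_eqVlt; apply/orP; left; apply/eqP; ring.
Qed.

Lemma cmeasurable_lipschitz (F : R -> R[i]) (K : R) :
  (forall x y, sqn (F x - F y) <= K * (x - y) ^+ 2) -> cmeasurable (T := measurableTypeR R) F.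
Proof.
move=> FK.
have b (x y : R) : Num.sqrt (K * (x - y) ^+ 2) <= Num.sqrt `|K| * `|x - y|.
  rewrite -[`|x - y|]sqrtr_sqr -sqrtrM// ler_wsqrtr// ler_wpM2r ?sqr_ge0//; exact: ler_norm.
split; apply: continuous_measurable_fun;
  apply: (@lipschitz_continuous _ _ (Num.sqrt `|K|)) => x y; apply: le_trans (b x y).
  by rewrite -raddfB; exact: norm_Re_le.
by rewrite -raddfB; exact: norm_Im_le.
Qed.

Lemma cmeasurable_fourier_integral f : compact_sqint f ->
  cmeasurable (T := measurableTypeR R) (fourier_integral f).
Proof. by move=> /fourier_integral_lipschitz[K _]; exact: cmeasurable_lipschitz. Qed.

(** [parseval_grid] is averaged over [s] in one mesh of the grid: its left side unfolds into the
    integral over the line, and its right side does not depend on [s]. *)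
Lemma plancherel_compact f : compact_sqint f ->
  (\int[leb]_x (sqn (fourier_integral f x))%:E = (2 * pi)%:E * \int[leb]_x (sqn (f x))%:E)%E.
Proof.
move=> cf; have [sf [A A0 f0]] := cf.
have mF := cmeasurable_fourier_integral cf.
have mS : measurable_fun [set: R] (fun x => (sqn (fourier_integral f x))%:E).
  exact/measurable_EFinP/measurable_sqn.
have B0 : 0 < A + A by rewrite addr_gt0.
have pp : 0 < 2 * pi :> R by rewrite mulr_gt0// pi_gt0.
have b0 : 0 < 2 * pi / (A + A) by rewrite divr_gt0.
have f0' x : ~~ (- A <= x < - A + (A + A)) -> f x = 0 by rewrite addKr; exact: f0.
rewrite (integral_unfold b0 mS); last by move=> x; rewrite lee_fin sqn_ge0.
rewrite -(integral_esum leb (f := fun (k : int) x => ((wn 0 (2 * pi / (A + A)) x)%:E *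
   (sqn (fourier_integral f (x + 2 * pi / (A + A) * k%:~R)))%:E)%E)).
- transitivity (\int[leb]_x ((A + A)%:E * \int[leb]_x (sqn (f x))%:E * (wn 0 (2 * pi / (A + A)) x)%:E))%E.
    apply: eq_integral => x _; rewrite muleC -(parseval_grid x B0 sf f0') -esumZl ?wn_ge0//.
    by move=> k; exact: sqn_ge0.
  rewrite ge0_integralZl//.
  + rewrite integral_wn ?(ltW b0)// muleAC -EFinM subr0; congr (_%:E * _)%E.
    by field; rewrite gt_eqF.
  + by apply/measurable_EFinP; exact: measurable_wn.
  + by move=> x _; rewrite lee_fin wn_ge0.
  + rewrite mule_ge0 ?lee_fin ?(ltW B0)//; apply: integral_ge0 => x _.
    by rewrite lee_fin sqn_ge0.
- move=> k; apply: emeasurable_funM.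
    by apply/measurable_EFinP; exact: measurable_wn.
  have := cmeasurable_affine 1 (2 * pi / (A + A) * k%:~R) mF; under eq_fun do rewrite mul1r.
  by move=> m; exact/measurable_EFinP/measurable_sqn.
- by move=> k x; rewrite mule_ge0// lee_fin ?wn_ge0 ?sqn_ge0.
Qed.

Lemma plancherel_hn f : compact_sqint f ->
  square_integrable leb (fourier_integral f) /\
  hn (to_L2 leb (fourier_integral f) : L2 leb) ^+ 2 = 2 * pi * hn (to_L2 leb f : L2 leb) ^+ 2.
Proof.
move=> cf; have [sf _] := cf; have P := plancherel_compact cf.
have s : square_integrable leb (fourier_integral f).
  apply: (square_integrable_le (M := 2 * pi * hn (to_L2 leb f : L2 leb) ^+ 2)).
    exact: cmeasurable_fourier_integral.
  by rewrite P (hn2_to_L2 sf) EFinM.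
by split => //; apply: EFin_inj; rewrite -(hn2_to_L2 s) P (hn2_to_L2 sf) EFinM.
Qed.

End plancherel.

Section fubini.
Context {R : realType}.
Local Notation leb := (@lebesgue_measure R).
Local Notation T := (measurableTypeR R).
Implicit Types (f g : R -> R[i]).

Lemma integrable_prod (a b : T -> R) : (forall x, 0 <= a x) -> (forall x, 0 <= b x) ->
  leb.-integrable setT (EFin \o a) -> leb.-integrable setT (EFin \o b) ->
  (leb \x leb)%E.-integrable setT (EFin \o (fun p : T * T => a p.1 * b p.2)).
Proof.
move=> a0 b0 ia ib.
have ma : measurable_fun setT a by apply/measurable_EFinP; exact: measurable_int ia.
have mb : measurable_fun setT b by apply/measurable_EFinP; exact: measurable_int ib.
have mab : measurable_fun [set: T * T] (EFin \o (fun p : T * T => a p.1 * b p.2)).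
  by apply/measurable_EFinP; apply: measurable_funM; exact: measurableT_comp.
apply/(integrable12ltyP leb leb mab).
have E (x : T) : (\int[leb]_y `|(EFin \o (fun p : T * T => (a p.1 * b p.2)%R)) (x, y)| =
    (a x)%:E * \int[leb]_y (b y)%:E)%E.
  rewrite -ge0_integralZl; [|by []|exact/measurable_EFinP|by move=> y _; rewrite lee_fin|by rewrite lee_fin].
  by apply: eq_integral => y _; rewrite /= ger0_norm ?mulr_ge0.
have fin (c : T -> R) : (forall x, 0 <= c x) -> leb.-integrable setT (EFin \o c) ->
    (\int[leb]_x (c x)%:E < +oo)%E.
  move=> c0 /integrableP[_]; congr (_ < _)%E.
  by apply: eq_integral => y _; rewrite /= ger0_norm.
under eq_integral do rewrite E muleC.
rewrite ge0_integralZl; [|by []|exact/measurable_EFinP|by move=> y _; rewrite lee_fin|by apply: integral_ge0 => x _; rewrite lee_fin].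
apply: lte_mul_pinfty; last exact: fin.
- by apply: integral_ge0 => x _; rewrite lee_fin.
- by rewrite ge0_fin_numE ?fin//; apply: integral_ge0 => x _; rewrite lee_fin.
Qed.

Lemma Rintegral_fubini (r : T -> T -> R) :
  (leb \x leb)%E.-integrable setT (EFin \o (fun p : T * T => r p.1 p.2)) ->
  (forall x, leb.-integrable setT (EFin \o r x)) ->
  (forall y, leb.-integrable setT (EFin \o r^~ y)) ->
  \int[leb]_x (\int[leb]_y r x y) = \int[leb]_y (\int[leb]_x r x y).
Proof.
move=> ir i1 i2; rewrite /Rintegral; congr fine.
transitivity (\int[leb]_x \int[leb]_y (r x y)%:E)%E.
  by apply: eq_integral => x _; rewrite fineK//; exact: integrable_fin_num (i1 x).
transitivity (\int[leb]_y \int[leb]_x (r x y)%:E)%E; first exact: (Fubini ir).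
by apply: eq_integral => y _; rewrite fineK//; exact: integrable_fin_num (i2 y).
Qed.

(** The majorant is a sum of two products to suit square-integrable functions with bounded support:
    in [fourier_exchange], [|f(t) g(x)|] is bounded by [|g(x)|^2 + |f(t)|^2] on the product of the
    supports. *)
Lemma cintegral_fubini (h : T -> T -> R[i]) (a b : T -> R) (a' b' : T -> R) :
  cmeasurable (fun p : T * T => h p.1 p.2) ->
  (forall x, cintegrable leb (h x)) -> (forall y, cintegrable leb (h^~ y)) ->
  (forall x, 0 <= a x) -> (forall x, 0 <= b x) -> (forall x, 0 <= a' x) -> (forall x, 0 <= b' x) ->
  leb.-integrable setT (EFin \o a) -> leb.-integrable setT (EFin \o b) ->
  leb.-integrable setT (EFin \o a') -> leb.-integrable setT (EFin \o b') ->
  (forall x y, sqn (h x y) <= (a x * b y + a' x * b' y) ^+ 2) ->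
  cintegral leb (fun x => cintegral leb (h x)) = cintegral leb (fun y => cintegral leb (h^~ y)).
Proof.
move=> [m1 m2] h1 h2 a0 b0 a0' b0' ia ib ia' ib' hb.
have iD : (leb \x leb)%E.-integrable setT
    (EFin \o (fun p : T * T => a p.1 * b p.2 + a' p.1 * b' p.2)).
  have := integrableD measurableT (integrable_prod a0 b0 ia ib) (integrable_prod a0' b0' ia' ib').
  by apply: eq_integrable => // x _ /=; rewrite EFinD.
have nn p q : `|a p * b q + a' p * b' q| = a p * b q + a' p * b' q.
  by rewrite ger0_norm// addr_ge0// mulr_ge0.
rewrite /cintegral.
have -> : \int[leb]_x (\int[leb]_y complex.Re (h x y)) = \int[leb]_y (\int[leb]_x complex.Re (h x y)).
  apply: (@Rintegral_fubini (fun x y => complex.Re (h x y))).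
  - apply: le_integrable iD => //; first exact/measurable_EFinP.
    move=> [x y] _ /=; rewrite lee_fin nn.
    by have := norm_Re_le (hb x y); rewrite sqrtr_sqr nn.
  - by move=> x; have [] := h1 x.
  - by move=> x; have [] := h2 x.
have -> // : \int[leb]_x (\int[leb]_y complex.Im (h x y)) = \int[leb]_y (\int[leb]_x complex.Im (h x y)).
apply: (@Rintegral_fubini (fun x y => complex.Im (h x y))).
- apply: le_integrable iD => //; first exact/measurable_EFinP.
  move=> [x y] _ /=; rewrite lee_fin nn.
  by have := norm_Im_le (hb x y); rewrite sqrtr_sqr nn.
- by move=> x; have [] := h1 x.
- by move=> x; have [] := h2 x.
Qed.

(** The multiplication formula, from which the Fourier transform will be shown to be onto. *)
Lemma fourier_exchange f g : compact_sqint f -> compact_sqint g ->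
  cintegral leb (fun x => fourier_integral f x * g x) =
  cintegral leb (fun x => f x * fourier_integral g x).
Proof.
move=> cf cg; have [sf [A A0 f0]] := cf; have [sg [B B0 g0]] := cg.
have [[mf _] [mg _]] := (sf, sg).
pose h (x t : T) := f t * cval (expNi (x * t)) * g x.
have comb (k : R -> R[i]) (c : R[i]) x : compact_sqint k ->
    cintegrable leb (fun t => c * (k t * cval (expNi (x * t)))) /\
    cintegral leb (fun t => c * (k t * cval (expNi (x * t)))) = c * fourier_integral k x.
  move=> ck; have [k1 e] := compact_sqint_comb (c - 1) ck ck.
  have E : (fun t => c * (k t * cval (expNi (x * t)))) =
      (fun t => ((c - 1) * k t + k t) * cval (expNi (x * t))).
    by apply/funext => t; ring.
  split; first by rewrite E; exact: compact_sqint_cintegrable.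
  rewrite E; transitivity ((c - 1) * fourier_integral k x + fourier_integral k x); first exact: (e x).
  by ring.
have h1E x : h x = (fun t => g x * (f t * cval (expNi (x * t)))).
  by apply/funext => t; rewrite /h; ring.
have h2E t : h^~ t = (fun x => f t * (g x * cval (expNi (t * x)))).
  by apply/funext => x; rewrite /h (mulrC x t); ring.
transitivity (cintegral leb (fun x => cintegral leb (h x))).
  congr cintegral; apply/funext => x; rewrite h1E.
  by have [_ ->] := comb f (g x) x cf; rewrite mulrC.
transitivity (cintegral leb (fun t => cintegral leb (h^~ t))); last first.
  congr cintegral; apply/funext => t; rewrite h2E.
  by have [_ ->] := comb g (f t) t cg.
apply: (@cintegral_fubini h (fun x => sqn (g x)) (wn (- A) A) (wn (- B) B) (fun t => sqn (f t))).
- apply: cmeasurableM; first apply: cmeasurableM.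
  + by have [n1 n2] := mf; split; [apply: (measurableT_comp n1)|apply: (measurableT_comp n2)]; exact: measurable_snd.
  + have mp : measurable_fun setT (fun p : T * T => p.1 * p.2).
      by apply: measurable_funM; [exact: measurable_fst|exact: measurable_snd].
    split.
      apply: (measurableT_comp (f := @cos R) _ mp).
      by apply: continuous_measurable_fun; exact: continuous_cos.
    apply: (measurableT_comp (f := fun x : R => - sin x) _ mp).
    by apply: continuous_measurable_fun => x; apply: cvgN; exact: continuous_sin.
  + by have [n1 n2] := mg; split; [apply: (measurableT_comp n1)|apply: (measurableT_comp n2)]; exact: measurable_fst.
- by move=> x; rewrite h1E; have [] := comb f (g x) x cf.
- by move=> t; rewrite h2E; have [] := comb g (f t) t cg.
- by move=> x; exact: sqn_ge0.
- by move=> x; exact: wn_ge0.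
- by move=> x; exact: wn_ge0.
- by move=> x; exact: sqn_ge0.
- exact: sqint_integrable.
- exact: integrable_wn.
- exact: integrable_wn.
- exact: sqint_integrable.
move=> x t; rewrite /h !sqnM sqn_cval mulr1.
have [tA|tA] := boolP (- A <= t < A); last by rewrite f0// sqn0 mul0r sqr_ge0.
have [xB|xB] := boolP (- B <= x < B); last by rewrite g0// sqn0 mulr0 sqr_ge0.
rewrite !wn_in// mulr1 mul1r; have := sqn_ge0 (f t); have := sqn_ge0 (g x).
set a := sqn (g x); set b := sqn (f t); move: a b => a b a0 b0; nra.
Qed.

End fubini.

Lemma twopi_gt0 (R : realType) : 0 < 2 * pi :> R.
Proof. exact: (mulr_gt0 (ltr0Sn R 1) (pi_gt0 R)). Qed.

Lemma twopi_neq0 (R : realType) : 2 * pi != 0 :> R.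
Proof. exact: lt0r_neq0 (twopi_gt0 R). Qed.

Lemma cvg_sq (R : realType) (f : nat -> R) (l : R) : f @ \oo --> l ->
  f n ^+ 2 @[n --> \oo] --> l ^+ 2.
Proof. by move=> h; rewrite expr2; exact: cvgM. Qed.

(** * The Fourier transform on the space L2 of the line *)

Section fourier_operator.
Context {R : realType}.
Local Notation leb := (@lebesgue_measure R).
Implicit Types (f g : R -> R[i]) (u v xi eta : L2 leb).

Definition trunc (n : nat) f (t : R) : R[i] := if `|t| <= n%:R then f t else 0.

Lemma trunc_compact n f : square_integrable leb f -> compact_sqint (trunc n f).
Proof.
move=> sf; apply: (@compact_sqintW _ _ (- (n.+1%:R)) n.+1%:R); last first.
  move=> x h; rewrite /trunc ifF//; apply: contraNF h; rewrite ler_norml => /andP[h1 h2].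
  by rewrite -natr1; apply/andP; split; lra.
have -> : trunc n f = (fun t => f t * (if `|t| <= n%:R then 1 else 0 : R)%:C).
  by apply/funext => t; rewrite /trunc; case: ifP => _; rewrite ?mulr1 ?mulr0.
apply: (sqint_mul_bounded (M := 1)) => //; last first.
  by move=> x; rewrite sqn_real; case: ifP => _; rewrite ?expr1n// expr0n.
apply: cmeasurable_real; apply: measurable_fun_ifT => //.
by apply: measurable_fun_ler => //; exact: measurableT_comp.
Qed.

Lemma trunc_cvg xi : (fun n => to_L2 leb (trunc n xi) : L2 leb) @ \oo --> xi.
Proof.
have sx := L2_sqint xi; rewrite -[X in _ --> X](to_L2K xi).
refine (L2_cvg_dct (mu := leb) (f_ := fun n => trunc n xi) (f := xi) (g := fun x => sqn (xi x)) _ sx _ _ _).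
- by move=> n; have [] := trunc_compact n sx.
- exact: sqint_integrable.
- move=> n x; rewrite /trunc; case: ifP => _; first by rewrite subrr sqn0 sqn_ge0.
  by rewrite sub0r sqnN.
apply: aeW => x; apply/cvgrPdist_lt => e e0.
exists (Num.bound `|x|) => // n /= hn; rewrite /trunc ifT ?subrr ?sqn0 ?subrr ?normr0//.
by apply: (le_trans (ltW (archi_boundP (normr_ge0 _)))); rewrite ler_nat.
Qed.

(** The approximants whose limit defines [fourier]. *)
Definition Fn (n : nat) xi : L2 leb := to_L2 leb (fourier_integral (trunc n xi)).

Lemma to_L2_fourier_comb c f g : compact_sqint f -> compact_sqint g ->
  to_L2 leb (fourier_integral (fun x => c * f x + g x)) =
  c *: to_L2 leb (fourier_integral f) + to_L2 leb (fourier_integral g).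
Proof.
move=> cf cg; have [_ e] := compact_sqint_comb c cf cg.
have [[sf _] [sg _]] := (plancherel_hn cf, plancherel_hn cg).
have [s1 <-] := to_L2Z c sf; have [_ <-] := to_L2D s1 sg.
by congr (to_L2 _); apply/funext => x; rewrite e.
Qed.

Lemma hn_fourierB f g : compact_sqint f -> compact_sqint g ->
  hn (to_L2 leb (fourier_integral f) - to_L2 leb (fourier_integral g) : L2 leb) =
  Num.sqrt (2 * pi) * hn (to_L2 leb f - to_L2 leb g : L2 leb).
Proof.
move=> cf cg; have [cgf _] := compact_sqint_comb (-1) cg cf.
have [_ h] := plancherel_hn cgf.
have [[sf _] [sg _]] := (cf, cg).
have pp : 0 <= 2 * pi :> R by rewrite mulr_ge0// pi_ge0.
have e1 : to_L2 leb (fun x => -1 * g x + f x) = to_L2 leb f - to_L2 leb g.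
  have [s1 e1] := to_L2Z (-1) sg; have [_ ->] := to_L2D s1 sf.
  by rewrite e1 scaleN1r addrC.
rewrite e1 to_L2_fourier_comb// scaleN1r addrC in h.
apply/eqP; rewrite -(@eqrXn2 _ 2)// ?mulr_ge0 ?hn_ge0 ?sqrtr_ge0//.
by rewrite exprMn sqr_sqrtr; [apply/eqP; exact: h|exact: pp].
Qed.

Lemma fourier_cvg xi : Fn^~ xi @ \oo --> fourier xi.
Proof.
apply: L2_complete; apply/cauchyP => e /gt0_complex[r r0 ->].
have pp := twopi_gt0 R.
have sp : 0 < Num.sqrt (2 * pi) :> R by rewrite sqrtr_gt0.
have r1 : 0 < r / (2 * Num.sqrt (2 * pi)) by rewrite divr_gt0// mulr_gt0.
have /cvg_hnP/cvgrPdist_lt/(_ _ r1)[N _ hN] := @trunc_cvg xi.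
have {}hN n : (N <= n)%N -> hn (to_L2 leb (trunc n xi) - xi : L2 leb) < r / (2 * Num.sqrt (2 * pi)).
  by move=> /hN; rewrite sub0r normrN ger0_norm ?hn_ge0.
exists (Fn N xi); exists N => // n /= Nn; rewrite -ball_normE/= hnE ltcR.
have sx := L2_sqint xi.
rewrite hn_fourierB; [|exact: trunc_compact..].
have -> : to_L2 leb (trunc N xi) - to_L2 leb (trunc n xi) =
    (to_L2 leb (trunc N xi) - xi) + (xi - to_L2 leb (trunc n xi)) by rewrite addrA subrK.
apply: (@le_lt_trans _ _ (Num.sqrt (2 * pi) * (hn (to_L2 leb (trunc N xi) - xi : L2 leb) +
    hn (to_L2 leb (trunc n xi) - xi : L2 leb)))).
  apply: ler_wpM2l; first exact: (ltW sp).
  by rewrite [hn (to_L2 leb (trunc n xi) - _)]hnBC; exact: hnD.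
rewrite mulrC -ltr_pdivlMr//.
have -> : r / Num.sqrt (2 * pi) = r / (2 * Num.sqrt (2 * pi)) + r / (2 * Num.sqrt (2 * pi)).
  by move: (Num.sqrt _) (lt0r_neq0 sp) => q q0; field.
by apply: ltrD; apply: hN.
Qed.

(** The truncations stop changing once [n] exceeds the support, so the sequence defining [fourier]
    is eventually constant. *)
Lemma fourier_compact f : compact_sqint f ->
  fourier (to_L2 leb f) = to_L2 leb (fourier_integral f).
Proof.
move=> cf; have [sf [A A0 f0]] := cf.
have h : \forall n \near \oo, Fn n (to_L2 leb f) = to_L2 leb (fourier_integral f).
  exists (Num.bound A) => [//|n An]; rewrite /Fn; congr (to_L2 leb _); apply/funext => x.
  have cn : compact_sqint (trunc n (to_L2 leb f)) by apply: trunc_compact; exact: L2_sqint.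
  apply: ae_eq_cintegral.
  - by apply: cmeasurableM; [have [[]] := cn|exact: measurable_expNiM].
  - by apply: cmeasurableM; [have [] := sf|exact: measurable_expNiM].
  apply: filterS (to_L2E sf).
  move=> t /= ft; congr (_ * _); rewrite /trunc -/(L2_fun (to_L2 leb f) t).
  case: ifPn => // h; rewrite f0//; apply: contra h => /andP[h1 h2].
  have An' : A <= n%:R.
    by apply: (le_trans (ltW (archi_boundP (ltW A0)))); rewrite ler_nat.
  by rewrite ler_norml; apply/andP; split; lra.
apply/eqP; rewrite -subr_eq0; apply/eqP/hn_eq0.
have /cvg_hnP h1 := @fourier_cvg (to_L2 leb f).
have h2 : hn (to_L2 leb (fourier_integral f) - fourier (to_L2 leb f) : L2 leb) @[n --> \oo] --> (0 : R).
  move/cvgrPdist_lt : h1 => h1; apply/cvgrPdist_lt => e e0.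
  by move: (h1 _ e0); apply: filterS2 h => n ->.
rewrite hnBC; apply: (@cvg_unique _ _ (hn (to_L2 leb (fourier_integral f) - fourier (to_L2 leb f) : L2 leb) @[n --> \oo])) => //.
exact: cvg_cst.
Qed.

Lemma fourier_linear : linear_op (@fourier R).
Proof.
move=> a u v.
have E n : Fn n (a *: u + v) = a *: Fn n u + Fn n v.
  rewrite /Fn -to_L2_fourier_comb; [|exact/trunc_compact/L2_sqint..].
  congr (to_L2 _); apply/funext => x; apply: ae_eq_cintegral.
  - apply: cmeasurableM; last exact: measurable_expNiM.
    by have [[]] := trunc_compact n (L2_sqint (a *: u + v)).
  - apply: cmeasurableM; last exact: measurable_expNiM.
    apply: cmeasurableD; last by have [[]] := trunc_compact n (L2_sqint v).
    apply: cmeasurableM; first exact: cmeasurable_cst.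
    by have [[]] := trunc_compact n (L2_sqint u).
  apply: filterS (L2_lin a u v).
  move=> t e; congr (_ * _); rewrite /trunc; case: ifP => _; first exact: e.
  by rewrite mulr0 addr0.
have h1 := @fourier_cvg (a *: u + v).
have h2 : Fn n (a *: u + v) @[n --> \oo] --> a *: fourier u + fourier v.
  under eq_fun do rewrite E.
  by apply: cvgD; [apply: cvgZ; [exact: cvg_cst|exact: fourier_cvg]|exact: fourier_cvg].
exact: (@cvg_unique _ (@norm_hausdorff _ _) _ _ _ _ h1 h2).
Qed.

Lemma fourier_hn xi : hn (fourier xi) ^+ 2 = 2 * pi * hn xi ^+ 2.
Proof.
have h1 := cvg_sq (cvg_hn (@fourier_cvg xi)); have h2 := cvg_sq (cvg_hn (@trunc_cvg xi)).
have E : (fun n => hn (Fn n xi) ^+ 2) =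
    (fun n => 2 * pi * hn (to_L2 leb (trunc n xi) : L2 leb) ^+ 2).
  apply/funext => n; have [_ e] := plancherel_hn (trunc_compact n (L2_sqint xi)).
  exact: e.
rewrite E in h1; apply: (cvg_unique _ h1); first exact: norm_hausdorff.
by apply: cvgM; [exact: cvg_cst|exact: h2].
Qed.

Lemma dot_fourier u v : dot (fourier u) (fourier v) = (2 * pi)%:C * dot u v.
Proof. exact: (dot_of_hn fourier_linear fourier_hn). Qed.

Lemma fourier_inj : injective (@fourier R).
Proof.
move=> u v e; apply/eqP; rewrite -subr_eq0; apply/eqP/hn_eq0/eqP.
have pp := twopi_neq0 R.
rewrite -sqrf_eq0 -(mulrI_eq0 _ (mulfI pp)) -fourier_hn (linear_opB _ _ fourier_linear) e subrr hn0.
by rewrite expr0n.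
Qed.

(** Complex conjugation turns the bilinear formula [fourier_exchange] into a statement about the
    sesquilinear [dot]. *)
Definition conjL2 u : L2 leb := to_L2 leb (fun t => (u t)^*).

Lemma sqint_conj f : square_integrable leb f -> square_integrable leb (fun t => (f t)^*).
Proof.
move=> sf; have [mf _] := sf.
refine (square_integrable_dom (mu := leb) (g := fun x => sqn (f x)) (cmeasurable_conj mf) _ _).
  exact: sqint_integrable.
by move=> x; rewrite sqn_conj.
Qed.

Lemma conjL2_ae u : \forall t \ae leb, conjL2 u t = (u t)^*.
Proof. exact/to_L2E/sqint_conj/L2_sqint. Qed.

Lemma conjL2K : involutive conjL2.
Proof.
move=> u; apply: L2_ext; have := conjL2_ae (conjL2 u); have := conjL2_ae u.
apply: filterS2.
by move=> t -> ->; rewrite conjCK.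
Qed.

Lemma conjL2_to f : square_integrable leb f ->
  conjL2 (to_L2 leb f) = to_L2 leb (fun t => (f t)^*).
Proof.
move=> sf; apply: L2_ext.
have := conjL2_ae (to_L2 leb f); have := to_L2E sf; have := to_L2E (sqint_conj sf).
apply: filterS3.
by move=> t -> + -> => ->.
Qed.

Lemma conjL2Z (c : R) u : conjL2 (c%:C *: u) = c%:C *: conjL2 u.
Proof.
apply: L2_ext; have := conjL2_ae (c%:C *: u); have := conjL2_ae u.
have h1 := L2_Z (c%:C) u; have h2 := L2_Z (c%:C) (conjL2 u).
have FF := ae_filter_ringOfSetsType leb.
move=> h3 h4; near=> t.
have -> : conjL2 (c%:C *: u) t = ((c%:C *: u : L2 leb) t)^* by near: t.
have -> : (c%:C *: u : L2 leb) t = c%:C * u t by near: t.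
have -> : (c%:C *: conjL2 u : L2 leb) t = c%:C * conjL2 u t by near: t.
have -> : conjL2 u t = (u t)^* by near: t.
by rewrite rmorphM/= conjCR.
Unshelve. all: by end_near. Qed.

Lemma conjL2B u v : conjL2 (u - v) = conjL2 u - conjL2 v.
Proof.
have [su sv] := (L2_sqint u, L2_sqint v).
have [s e] := to_L2B su sv; rewrite !to_L2K in e; rewrite -e conjL2_to//.
have [_ <-] := to_L2B (sqint_conj su) (sqint_conj sv).
by congr to_L2; apply/funext => x; rewrite rmorphB.
Qed.

Lemma hn_conjL2 u : hn (conjL2 u) = hn u.
Proof.
apply/eqP; rewrite -(@eqrXn2 _ 2) ?hn_ge0//; apply/eqP/EFin_inj.
rewrite -(hn2_to_L2 (sqint_conj (L2_sqint u))) -hn2_L2.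
by apply: eq_integral => x _; rewrite sqn_conj.
Qed.

Lemma cvg_conjL2 (w : nat -> L2 leb) u : w @ \oo --> u -> conjL2 (w n) @[n --> \oo] --> conjL2 u.
Proof.
move=> /cvg_hnP h; apply/cvg_hnP.
by under eq_fun do rewrite -conjL2B hn_conjL2.
Qed.

Lemma cvg_dot (H : innerProductType R) (x y : nat -> H) (a b : H) : x @ \oo --> a -> y @ \oo --> b ->
  (fun n => dot (x n) (y n) : R[i]^o) @ \oo --> (dot a b : R[i]^o).
Proof.
move=> xa yb; apply/cvg_sqnP => e e0.
have h1 : 2 * (hn (x n - a) * hn (x n - a) * (hn (y n) * hn (y n))) +
    2 * (hn a ^+ 2 * (hn (y n - b) * hn (y n - b))) @[n --> \oo] -->
    (2 * (0 * 0 * (hn b * hn b)) + 2 * (hn a ^+ 2 * (0 * 0)) : R).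
  have /cvg_hnP xa' := xa; have /cvg_hnP yb' := yb; have yb2 := cvg_hn yb.
  apply: cvgD; (apply: cvgM; first exact: cvg_cst).
    by apply: cvgM; apply: cvgM.
  by apply: cvgM; [exact: cvg_cst|exact: cvgM].
rewrite !(mul0r, mulr0, addr0) in h1.
move/cvgrPdist_lt : h1 => /(_ _ e0); apply: filterS => n; rewrite sub0r normrN.
move=> /(le_lt_trans (ler_norm _)); apply: le_lt_trans.
have -> : dot (x n) (y n) - dot a b = dot (x n - a) (y n) + dot a (y n - b).
  by rewrite dotBl dotBr addrA subrK.
apply: le_trans (sqnD_le2 _ _) _; rewrite -!expr2.
by apply: lerD; rewrite ler_wpM2l// dot_CS.
Qed.

Lemma fourier_adjoint u v : dot (fourier u) (conjL2 v) = dot u (conjL2 (fourier v)).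
Proof.
have h1 := cvg_dot (@fourier_cvg u) (cvg_conjL2 (@trunc_cvg v)).
have h2 := cvg_dot (@trunc_cvg u) (cvg_conjL2 (@fourier_cvg v)).
have E : (fun n => dot (Fn n u) (conjL2 (to_L2 leb (trunc n v)))) =
    (fun n => dot (to_L2 leb (trunc n u) : L2 leb) (conjL2 (Fn n v))).
  apply/funext => n.
  have cu := trunc_compact n (L2_sqint u); have cv := trunc_compact n (L2_sqint v).
  have [[su _] [sv _]] := (cu, cv).
  have [[s1 _] [s2 _]] := (plancherel_hn cu, plancherel_hn cv).
  rewrite /Fn (conjL2_to sv) (conjL2_to s2).
  rewrite (dot_to_L2 s1 (sqint_conj sv)) (dot_to_L2 su (sqint_conj s2)).
  have e := fourier_exchange cu cv.
  transitivity (cintegral leb (fun x => fourier_integral (trunc n u) x * trunc n v x)).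
    by congr cintegral; apply/funext => x; rewrite conjCK.
  by rewrite e; congr cintegral; apply/funext => x; rewrite conjCK.
rewrite E in h1.
exact: (@cvg_complex_unique _ nat \oo _ _ _ _ h1 h2).
Qed.

(** An explicit inverse. With F for [fourier], the adjoint formula and Plancherel's identity show
    that [conj F conj F] is multiplication by [2 pi]; conjugating this relation gives the claim. *)
Lemma fourier_surj eta : fourier ((2 * pi)^-1%:C *: conjL2 (fourier (conjL2 eta))) = eta.
Proof.
have pp := twopi_gt0 R.
have key h : conjL2 (fourier (conjL2 (fourier h))) = (2 * pi)%:C *: h.
  have e u : dot u (conjL2 (fourier (conjL2 (fourier h))) - (2 * pi)%:C *: h) = 0.
    rewrite dotBr -fourier_adjoint conjL2K dot_fourier dotZr conjCR subrr//.
  by apply/eqP; rewrite -subr_eq0; apply/eqP/hn_eq0/eqP; rewrite -sqrf_eq0 hn2E e.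
rewrite (linear_opZ _ _ fourier_linear) -[fourier (conjL2 _)]conjL2K key conjL2Z conjL2K scalerA.
by rewrite -rmorphM/= mulVf ?gt_eqF// scale1r.
Qed.

Lemma fourier_invK eta : fourier (fourier_inv eta) = eta.
Proof. by apply: (@xgetPex _ 0 [set xi | fourier xi = eta]); eexists; exact: fourier_surj. Qed.

End fourier_operator.

(** * The wavelet representations *)
Section dilation.
Context {R : realType}.
Local Notation leb := (@lebesgue_measure R).
Implicit Types (f g : R -> R[i]) (u v : L2 leb) (a b : R).

Lemma cvg_bounded_op (H : innerProductType R) (A : H -> H) (C : R) (w : nat -> H) (x : H) :
  linear_op A -> (forall y, hn (A y) <= C * hn y) -> w @ \oo --> x -> A (w n) @[n --> \oo] --> A x.
Proof.
move=> lA bA /cvg_hnP wx; apply/cvg_hnP.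
have h : C * hn (w n - x) @[n --> \oo] --> C * 0 by apply: cvgM; [exact: cvg_cst|exact: wx].
apply/cvgrPdist_lt => e e0; move/cvgrPdist_lt : h => /(_ e e0); apply: filterS => n.
rewrite mulr0 sub0r normrN => h1.
have -> : A (w n) - A x = A (w n - x) by rewrite linear_opB.
rewrite sub0r normrN ger0_norm ?hn_ge0//.
by apply: le_lt_trans (bA _) _; apply: le_lt_trans (ler_norm _) h1.
Qed.

Lemma ae_imp (P Q : R -> Prop) : {ae leb, forall x, P x} -> (forall x, P x -> Q x) ->
  {ae leb, forall x, Q x}.
Proof. by move=> h PQ; apply: filterS h; first exact: (ae_filter_ringOfSetsType leb). Qed.

Lemma ae_imp2 (P Q S : R -> Prop) : {ae leb, forall x, P x} -> {ae leb, forall x, Q x} ->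
  (forall x, P x -> Q x -> S x) -> {ae leb, forall x, S x}.
Proof. by move=> h k PQ; apply: filterS2 h k; first exact: (ae_filter_ringOfSetsType leb). Qed.

(** Unitary for [a > 0]. The dilation of the representation is [dil] of [1 / N] on the line, and
    [dil] of [N] on the Fourier side. *)
Definition dil a u : L2 leb := to_L2 leb (fun x => (Num.sqrt a)%:C * u (a * x)).

Lemma sqint_scaled a f : 0 < a -> square_integrable leb f ->
  square_integrable leb (fun x => (Num.sqrt a)%:C * f (a * x)).
Proof.
move=> a0 sf; have := sqint_affine 0 a0 sf; under eq_fun do rewrite addr0.
by move=> /(to_L2Z (Num.sqrt a)%:C)[].
Qed.

Lemma ae_scale a (P : R -> Prop) : 0 < a ->
  (\forall x \ae leb, P x) -> \forall x \ae leb, P (a * x).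
Proof.
move=> a0 h; have := ae_affine 0 a0 h.
by congr (almost_everywhere _ _); apply/funext => x; rewrite addr0.
Qed.

Lemma dil_to a f : 0 < a -> square_integrable leb f ->
  dil a (to_L2 leb f) = to_L2 leb (fun x => (Num.sqrt a)%:C * f (a * x)).
Proof.
move=> a0 sf; apply: to_L2_ext.
- by apply: sqint_scaled => //; exact: L2_sqint.
- exact: sqint_scaled.
by apply: (ae_imp (ae_scale a0 (to_L2E sf))) => x ->.
Qed.

Lemma dil_linear a : 0 < a -> linear_op (dil a).
Proof.
move=> a0 c u v.
have [su sv] := (L2_sqint u, L2_sqint v).
have [s1 e1] := to_L2Z c (sqint_scaled a0 su).
have [s2 e2] := to_L2D s1 (sqint_scaled a0 sv).
rewrite /dil -e1 -e2; apply: to_L2_ext => //.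
  by apply: sqint_scaled => //; exact: L2_sqint.
apply: (ae_imp (ae_scale a0 (L2_lin c u v))) => x ->.
by rewrite mulrDr mulrCA.
Qed.

Lemma dil_hn a u : 0 < a -> hn (dil a u) = hn u.
Proof.
move=> a0; have su := L2_sqint u.
suff : hn (dil a u) ^+ 2 = hn u ^+ 2.
  by move/eqP; rewrite eqrXn2 ?hn_ge0// => /eqP.
apply: EFin_inj; rewrite -(hn2_to_L2 (sqint_scaled a0 su)) -hn2_L2.
have ms : measurable_fun [set: R] (fun x => (sqn (u x))%:E).
  by apply/measurable_EFinP/measurable_sqn; case: su.
transitivity (\int[leb]_x (a%:E * (sqn (u (a * x + 0)))%:E))%E.
  apply: eq_integral => x _; rewrite sqnM sqn_real sqr_sqrtr ?ltW// addr0.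
  by rewrite EFinM.
rewrite ge0_integralZl; [|by []| |by move=> x _; rewrite lee_fin sqn_ge0|by rewrite lee_fin ltW].
  rewrite (@ge0_integral_affine R a 0 (fun x => (sqn (u x))%:E))//.
    by rewrite muleA -EFinM mulfV ?gt_eqF// mul1e.
  by move=> x; rewrite lee_fin sqn_ge0.
exact: (measurableT_comp ms (measurable_affine a 0)).
Qed.

Lemma dilM a b u : 0 < a -> 0 < b -> dil a (dil b u) = dil (b * a) u.
Proof.
move=> a0 b0; rewrite {2}/dil dil_to//; last by apply: sqint_scaled => //; exact: L2_sqint.
congr (to_L2 leb _); apply/funext => x.
by rewrite mulrA -rmorphM/= -sqrtrM ?ltW// [a * b]mulrC mulrA.
Qed.

Lemma dil1 u : dil 1 u = u.
Proof.
rewrite -[RHS]to_L2K; congr (to_L2 leb _); apply/funext => x.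
by rewrite sqrtr1 !mul1r.
Qed.

Lemma dilVK a u : 0 < a -> dil a (dil a^-1 u) = u.
Proof. by move=> a0; rewrite dilM ?invr_gt0// mulVf ?gt_eqF// dil1. Qed.

Lemma fourier_dil a u : 0 < a -> fourier (dil a u) = dil a^-1 (fourier u).
Proof.
move=> a0; have ia0 : 0 < a^-1 by rewrite invr_gt0.
have E n : fourier (dil a (to_L2 leb (trunc n u))) = dil a^-1 (Fn n u).
  have ct := trunc_compact n (L2_sqint u); have [st [A A0 t0]] := ct.
  have cs : compact_sqint (fun x => (Num.sqrt a)%:C * trunc n u (a * x)).
    apply: (@compact_sqintW _ _ (- (A / a)) (A / a)); first exact: sqint_scaled.
    move=> x h; rewrite t0 ?mulr0//; apply: contra h => /andP[h1 h2].
    by rewrite -mulNr ler_pdivrMr// ltr_pdivlMr// mulrC h1.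
  have [si _] := plancherel_hn ct.
  rewrite dil_to// fourier_compact// /Fn dil_to//.
  congr (to_L2 leb _); apply/funext => x.
  have ci := compact_sqint_cintegrable (a^-1 * x) ct.
  have sa : Num.sqrt a^-1 = Num.sqrt a * a^-1 :> R.
    rewrite sqrtrV ?ltW//; apply: (mulfI (x := Num.sqrt a)); first by rewrite gt_eqF// sqrtr_gt0.
    by rewrite mulrA -expr2 sqr_sqrtr ?ltW// !mulfV ?gt_eqF// sqrtr_gt0.
  rewrite sa rmorphM/= -mulrA; have := cintegral_affine 0 a0 ci => <-.
  rewrite /fourier_integral -cintegralZ.
    congr cintegral; apply/funext => t; rewrite addr0 -mulrA; congr (_ * (_ * cval (expNi _))).
    by rewrite mulrACA mulVf ?gt_eqF// mul1r.
  have [i1 i2] := ci.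
  by split; [exact: (integrable_affine 0 a0 i1)|exact: (integrable_affine 0 a0 i2)].
have h1 : fourier (dil a (to_L2 leb (trunc n u))) @[n --> \oo] --> fourier (dil a u).
  have lf : linear_op (@fourier R \o dil a).
    by move=> c x y; rewrite /= dil_linear// fourier_linear.
  apply: (@cvg_bounded_op _ (@fourier R \o dil a) (Num.sqrt (2 * pi)) _ u lf); last exact: trunc_cvg.
  move=> v; rewrite -(@ler_pXn2r _ 2) ?nnegrE ?hn_ge0 ?mulr_ge0 ?hn_ge0 ?sqrtr_ge0//.
  by rewrite exprMn sqr_sqrtr ?(ltW (twopi_gt0 R))// /= fourier_hn dil_hn.
have h2 : dil a^-1 (Fn n u) @[n --> \oo] --> dil a^-1 (fourier u).
  apply: (@cvg_bounded_op _ (dil a^-1) 1 _ _ (dil_linear ia0)); last exact: fourier_cvg.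
  by move=> v; rewrite dil_hn// mul1r.
have E' : (fun n => fourier (dil a (to_L2 leb (trunc n u)))) = (fun n => dil a^-1 (Fn n u)).
  by apply/funext => n; exact: E.
rewrite E' in h1.
exact: (@cvg_unique _ (@norm_hausdorff _ _) _ _ _ _ h1 h2).
Qed.

Lemma dilationE (N : nat) u : (0 < N)%N -> dilation N u = dil N%:R^-1 u.
Proof.
move=> N0; congr (to_L2 leb _); apply/funext => x.
by rewrite sqrtrV ?ler0n// [N%:R^-1 * x]mulrC.
Qed.

Lemma fourier_dilation (N : nat) u : (0 < N)%N -> fourier (dilation N u) = dil N%:R (fourier u).
Proof.
by move=> N0; rewrite dilationE// fourier_dil ?invrK// invr_gt0 ltr0n.
Qed.

Definition ae_bounded g := cmeasurable (T := measurableTypeR R) g /\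
  exists M : R, \forall x \ae leb, sqn (g x) <= M.

Definition mulL2 g u : L2 leb := to_L2 leb (fun x => g x * u x).

Section mul.
Variable g : R -> R[i].
Hypothesis bg : ae_bounded g.

Lemma sqint_mulL2 f : square_integrable leb f -> square_integrable leb (fun x => g x * f x).
Proof.
move=> sf; have [mg [M gM]] := bg; have [mf _] := sf.
have mgf := cmeasurableM mg mf.
apply/square_integrable_sqn; split => //.
have /square_integrable_sqn[_ fin] := sf.
apply: (@le_lt_trans _ _ (\int[leb]_x ((`|M|)%:E * (sqn (f x))%:E))%E).
  apply: ae_ge0_le_integral => //.
  - by move=> x _; rewrite lee_fin sqn_ge0.
  - exact/measurable_EFinP/measurable_sqn.
  - by move=> x _; rewrite mule_ge0 ?lee_fin ?sqn_ge0.
  - by apply: measurable_funeM; exact/measurable_EFinP/measurable_sqn.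
  - apply: (ae_imp gM) => x hx _; rewrite -EFinM lee_fin sqnM ler_wpM2r ?sqn_ge0//.
    exact: le_trans hx (ler_norm _).
rewrite ge0_integralZl; [|by []| |by move=> x _; rewrite lee_fin sqn_ge0|by rewrite lee_fin].
  by apply: lte_mul_pinfty => //; rewrite lee_fin.
exact/measurable_EFinP/measurable_sqn.
Qed.

Lemma mulL2_ae u : \forall x \ae leb, mulL2 g u x = g x * u x.
Proof. exact/to_L2E/sqint_mulL2/L2_sqint. Qed.

Lemma mulL2_to f : square_integrable leb f -> mulL2 g (to_L2 leb f) = to_L2 leb (fun x => g x * f x).
Proof.
move=> sf; apply: to_L2_ext; [exact/sqint_mulL2/L2_sqint|exact: sqint_mulL2|].
by apply: (ae_imp (to_L2E sf)) => x ->.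
Qed.

Lemma mulL2_linear : linear_op (mulL2 g).
Proof.
move=> c u v; have [su sv] := (sqint_mulL2 (L2_sqint u), sqint_mulL2 (L2_sqint v)).
have [s1 e1] := to_L2Z c su; have [s2 e2] := to_L2D s1 sv.
rewrite /mulL2 -e1 -e2; apply: to_L2_ext => //; first exact/sqint_mulL2/L2_sqint.
by apply: (ae_imp (L2_lin c u v)) => x ->; rewrite mulrDr mulrCA.
Qed.

Lemma ae_bounded_conj : ae_bounded (fun x => (g x)^*).
Proof.
have [mg [M gM]] := bg; split; first exact: cmeasurable_conj.
by exists M; apply: (ae_imp gM) => x; rewrite sqn_conj.
Qed.

Lemma mulL2_hn : exists C : R, forall u, hn (mulL2 g u) <= C * hn u.
Proof.
have [mg [M gM]] := bg; exists (Num.sqrt `|M|) => u.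
rewrite -(@ler_pXn2r _ 2) ?nnegrE ?hn_ge0 ?mulr_ge0 ?hn_ge0 ?sqrtr_ge0//.
rewrite exprMn sqr_sqrtr// -lee_fin [leRHS]EFinM /mulL2 -(hn2_to_L2 (sqint_mulL2 (L2_sqint u))) -hn2_L2.
have mu := L2_cmeas u.
rewrite -ge0_integralZl; [|by []| |by move=> x _; rewrite lee_fin sqn_ge0|by rewrite lee_fin]; last first.
  exact/measurable_EFinP/measurable_sqn.
apply: ae_ge0_le_integral => //.
- by move=> x _; rewrite lee_fin sqn_ge0.
- by apply/measurable_EFinP/measurable_sqn; exact: cmeasurableM.
- by move=> x _; rewrite mule_ge0 ?lee_fin ?sqn_ge0.
- by apply: measurable_funeM; exact/measurable_EFinP/measurable_sqn.
- apply: (ae_imp gM) => x hx _; rewrite -EFinM lee_fin sqnM ler_wpM2r ?sqn_ge0//.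
  exact: le_trans hx (ler_norm _).
Qed.

End mul.

Lemma mulL2_adj g u v : ae_bounded g -> dot (mulL2 g u) v = dot u (mulL2 (fun x => (g x)^*) v).
Proof.
move=> bg; have bc := ae_bounded_conj bg.
rewrite !L2_dotE; have [mg _] := bg; have [mu mv] := (L2_cmeas u, L2_cmeas v).
apply: ae_eq_cintegral.
- apply: cmeasurable_mul_conj => //; exact: L2_cmeas.
- apply: cmeasurable_mul_conj => //; exact: L2_cmeas.
apply: (ae_imp2 (mulL2_ae bg u) (mulL2_ae bc v)) => x -> ->.
by rewrite rmorphM/= conjCK mulrCA mulrA.
Qed.

Lemma mulL2M g f u : ae_bounded g -> ae_bounded f ->
  mulL2 g (mulL2 f u) = mulL2 (fun x => g x * f x) u.
Proof.
move=> bg bf; rewrite {2}/mulL2 mulL2_to//; last exact/sqint_mulL2/L2_sqint.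
by congr (to_L2 leb _); apply/funext => x; rewrite mulrA.
Qed.

Lemma mulL2_lin g f c u : ae_bounded g -> ae_bounded f ->
  mulL2 (fun x => c * g x + f x) u = c *: mulL2 g u + mulL2 f u.
Proof.
move=> bg bf; have su := L2_sqint u.
have [s1 e1] := to_L2Z c (sqint_mulL2 bg su).
have [s2 e2] := to_L2D s1 (sqint_mulL2 bf su).
rewrite -e1 -e2; congr (to_L2 leb _); apply/funext => x.
by rewrite mulrDl mulrA.
Qed.

Lemma mulL2_ae_eq g f u : ae_bounded g -> ae_bounded f -> (\forall x \ae leb, g x = f x) ->
  mulL2 g u = mulL2 f u.
Proof.
move=> bg bf gf; apply: to_L2_ext; try by apply: sqint_mulL2 => //; exact: L2_sqint.
by apply: (ae_imp gf) => x ->.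
Qed.

Lemma mulL2_1 u : mulL2 (fun=> 1) u = u.
Proof.
rewrite -[RHS]to_L2K; congr (to_L2 leb _); apply/funext => x.
by rewrite mul1r.
Qed.

Lemma dil_mulL2 a g u : 0 < a -> ae_bounded g ->
  ae_bounded (fun x => g (a * x)) /\ dil a (mulL2 g u) = mulL2 (fun x => g (a * x)) (dil a u).
Proof.
move=> a0 bg; have [mg [M gM]] := bg; have su := L2_sqint u.
have bga : ae_bounded (fun x => g (a * x)).
  split; last by exists M; exact: (ae_scale a0 gM).
  by have := cmeasurable_affine a 0 mg; under eq_fun do rewrite addr0.
split => //; rewrite dil_to//; last exact: sqint_mulL2.
rewrite /dil mulL2_to//; last exact: sqint_scaled.
by congr (to_L2 leb _); apply/funext => x; rewrite mulrCA.
Qed.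

Lemma Linfty_ae_bounded (f : circle R -> R[i]) : Linfty f -> ae_bounded (fun x => f (expNi x)).
Proof.
move=> [mf [M fM]]; split => //; exists (M ^+ 2); apply: (ae_imp fM) => x.
rewrite norm_normc lecR => h; rewrite -normc_sqn ler_sqr ?nnegrE//; first exact: normc_ge0.
exact: le_trans (normc_ge0 _) h.
Qed.

Lemma Linfty_shift (f : circle R -> R[i]) (z : circle R) : Linfty f ->
  Linfty (fun w => f (circle_mul z w)).
Proof.
have [y <-] := expNi_surj z; move=> [mf [M fM]]; split.
  have := cmeasurable_affine 1 y mf; congr cmeasurable; apply/funext => x.
  by rewrite -expNiD mul1r addrC.
exists M; have := ae_affine y ltr01 fM; rewrite /circle_ae.
congr (almost_everywhere _ _); apply/funext => x.
by rewrite -expNiD mul1r addrC.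
Qed.

Lemma LinftyM (f h : circle R -> R[i]) : Linfty f -> Linfty h -> Linfty (fun w => f w * h w).
Proof.
move=> [mf [M fM]] [mh [M' hM]]; split; first exact: cmeasurableM.
exists (M * M'); apply: (ae_imp2 fM hM) => x h1 h2; rewrite normrM rmorphM/=.
by apply: ler_pM.
Qed.

Lemma Linfty_cst c : Linfty (fun _ : circle R => c).
Proof.
split; first exact: cmeasurable_cst.
by exists (Normc.normc c); apply: aeW => x; rewrite -norm_normc.
Qed.

End dilation.

Section bounded_operators.
Context {R : realType} {H : innerProductType R}.

(** The representation axioms provide continuity, whereas a direct sum is controlled by combining
    bounds of its summands. *)
Lemma continuous_bounded (A : H -> H) : linear_op A -> continuous A ->
  exists2 C : R, 0 <= C & forall v, hn (A v) <= C * hn v.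
Proof.
move=> lA cA; have A0 := linear_op0 lA.
have /cvgrPdist_lt/(_ 1 ltr01)/nbhs_ballP[r' /= /gt0_complex[r r0 ->] hr] := cA 0.
have {}hr v : hn v < r -> hn (A v) < 1.
  move=> vr; have := hr v; rewrite -ball_normE/= hnE ltcR hnBC subr0 => /(_ vr).
  by rewrite hnE A0 -[1]/(1%:C) ltcR hnBC subr0.
exists (2 / r) => [|v]; first by rewrite divr_ge0// ltW.
have [v0|v0] := eqVneq (hn v) 0.
  by rewrite v0 mulr0 (hn_eq0 v0) A0 hn0.
have vp : 0 < hn v by rewrite lt0r v0 hn_ge0.
pose c := r / (2 * hn v).
have c0 : 0 < c by rewrite divr_gt0// mulr_gt0.
have hc w : hn (c%:C *: w) = c * hn w.
  by rewrite hnZ; congr (_ * _); rewrite normcE sqn_real sqrtr_sqr gtr0_norm.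
have := hr (c%:C *: v); rewrite hc (linear_opZ _ _ lA) hc.
have cv : c * hn v = r / 2.
  by rewrite /c; move: (hn v) v0 => t t0; field.
rewrite cv ltr_pdivrMr// ltr_pMr// ltr1n => /(_ isT) h.
rewrite -(ler_pM2l c0) mulrCA cv.
have -> : 2 / r * (r / 2) = 1 by field; rewrite gt_eqF.
exact: ltW.
Qed.

Lemma hilbert_geometric : hilbert_space H -> forall u : nat -> H,
  (forall n, hn (u n.+1 - u n) <= 2^-1 ^+ n) -> exists l : H, u @ \oo --> l.
Proof.
move=> hH u hu.
have us n k : hn (u (n + k)%N - u n) <= 2 * 2^-1 ^+ n - 2 * 2^-1 ^+ (n + k).
  elim: k => [|k IH]; first by rewrite addn0 subrr hn0 subrr.
  rewrite addnS.
  have -> : u (n + k).+1 - u n = (u (n + k).+1 - u (n + k)%N) + (u (n + k)%N - u n) by rewrite addrA subrK.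
  apply: le_trans (hnD _ _) _; have := hu (n + k)%N; rewrite exprS; lra.
have : cauchy (u @ \oo).
  apply/cauchyP => e /gt0_complex[r r0 ->].
  have [N hN] : exists N : nat, 2 * 2^-1 ^+ N < r.
    have /cvgrPdist_lt/(_ (r / 2)) : (2^-1 : R) ^+ n @[n --> \oo] --> (0 : R).
      by apply: cvg_expr; rewrite ger0_norm// invf_lt1// ltr1n.
    move=> /(_ (divr_gt0 r0 (ltr0Sn R 1)))[N _ NP]; exists N; have := NP N (leqnn N).
    by rewrite /= sub0r normrN ger0_norm ?exprn_ge0//; lra.
  exists (u N); exists N => [//|n Nn]; rewrite /= -ball_normE/= hnE ltcR hnBC.
  rewrite -(subnKC Nn); apply: le_lt_trans (us _ _) _.
  have : 0 <= (2^-1 : R) ^+ (N + (n - N)) by rewrite exprn_ge0.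
  lra.
by move=> /hH h; exists (lim (u @ \oo)).
Qed.

End bounded_operators.

(** * Direct sums of representations *)

Section dsum_facts.
Context {R : realType} {I : finType} (H : I -> innerProductType R).
Implicit Types u v : dsum H.

Lemma dsum_dotE u v : dot u v = \sum_i dot (u i) (v i). Proof. by []. Qed.

Lemma hn2_dsum u : hn u ^+ 2 = \sum_i hn (u i) ^+ 2.
Proof.
rewrite hn2E dsum_dotE raddf_sum/=; apply: eq_bigr => i _.
by rewrite hn2E.
Qed.

Lemma hn_dsum_le u i : hn (u i) <= hn u.
Proof.
rewrite -(@ler_pXn2r _ 2) ?nnegrE ?hn_ge0// hn2_dsum (bigD1 i)//= lerDl.
by apply: sumr_ge0 => j _; exact: sqr_ge0.
Qed.

Lemma dsum_ext u v : (forall i, u i = v i) -> u = v.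
Proof. exact: functional_extensionality_dep. Qed.

Lemma cvg_sum0 (J : Type) (s : seq J) (f : J -> nat -> R) : (forall j, f j @ \oo --> (0 : R)) ->
  \sum_(j <- s) f j n @[n --> \oo] --> (0 : R).
Proof.
move=> hf; elim: s => [|j s IH].
  by under eq_fun do rewrite big_nil; exact: cvg_cst.
under eq_fun do rewrite big_cons.
by have h := cvgD (hf j) IH; rewrite addr0 in h; exact: h.
Qed.

Lemma hilbert_dsum : (forall i, hilbert_space (H i)) -> hilbert_space (dsum H).
Proof.
move=> hH; apply: hilbert_of_seq => u hu.
pose l : dsum H := fun i => xget 0 [set l : H i | (fun n => u n i) @ \oo --> l].
have lP i : hn (u n i - l i) @[n --> \oo] --> (0 : R).
  apply/cvg_hnP; apply: (@xgetPex _ 0 [set l : H i | (fun n => u n i) @ \oo --> l]).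
  apply: (hilbert_geometric (hH i)) => n.
  exact: le_trans (hn_dsum_le (u n.+1 - u n) i) (hu n).
exists l; apply/cvg_hnP.
have h2 : hn (u n - l) ^+ 2 @[n --> \oo] --> (0 : R).
  under eq_fun do rewrite hn2_dsum.
  apply: cvg_sum0 => i; have := cvg_sq (lP i); rewrite expr0n; exact.
apply/cvgrPdist_lt => e e0; move/cvgrPdist_lt : h2 => /(_ _ (exprn_gt0 2 e0)).
apply: filterS => n; rewrite !sub0r !normrN !ger0_norm ?hn_ge0 ?sqr_ge0//.
by rewrite ltr_pXn2r ?nnegrE ?hn_ge0 ?(ltW e0).
Qed.

Lemma dsum_representation (rho : forall i, (circle R -> R[i]) -> H i -> H i) :
  (forall i, Linfty_representation (rho i)) ->
  Linfty_representation (fun f (v : dsum H) i => rho i f (v i)).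
Proof.
move=> hr; split.
- move=> f Lf.
  have lin : linear_op (fun (v : dsum H) i => rho i f (v i)).
    move=> a u v; apply: dsum_ext => i.
    by have [l _] := rep_linear_op (hr i) Lf; rewrite -[RHS]l.
  split => //.
  have /choice[C hC] i : exists C : R, 0 <= C /\ forall v : H i, hn (rho i f v) <= C * hn v.
    have [l c] := rep_linear_op (hr i) Lf.
    by have [C C0 h] := continuous_bounded l c; exists C.
  apply: (@continuous_of_bound _ _ _ (Num.sqrt (\sum_i C i ^+ 2)) lin) => v.
  rewrite -(@ler_pXn2r _ 2) ?nnegrE ?hn_ge0 ?mulr_ge0 ?hn_ge0 ?sqrtr_ge0//.
  rewrite exprMn sqr_sqrtr; last by apply: sumr_ge0 => i _; exact: sqr_ge0.
  rewrite hn2_dsum mulr_suml; apply: ler_sum => i _.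
  have [C0 h] := hC i; rewrite -exprMn ler_pXn2r ?nnegrE ?hn_ge0 ?mulr_ge0 ?hn_ge0//.
  by apply: le_trans (h _) _; rewrite ler_wpM2l// hn_dsum_le.
- move=> f g Lf Lg fg; apply/funext => v; apply: dsum_ext => i.
  by rewrite (rep_ae (hr i) Lf Lg fg).
- by move=> a f g Lf Lg v; apply: dsum_ext => i; exact: (rep_linear (hr i)).
- by move=> f g Lf Lg v; apply: dsum_ext => i; exact: (rep_mul (hr i)).
- by move=> v; apply: dsum_ext => i; exact: (rep_one (hr i)).
- move=> f Lf u v; rewrite !dsum_dotE; apply: eq_bigr => i _.
  exact: (rep_adj (hr i)).
Qed.

End dsum_facts.

Section representation_powers.
Context {R : realType} {H : innerProductType R}.
Variable rho : (circle R -> R[i]) -> H -> H.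
Hypothesis rep : Linfty_representation rho.

Lemma representation_twist (z : circle R) :
  Linfty_representation (fun f => rho (fun w => f (circle_mul z w))).
Proof.
split.
- by move=> f Lf; apply: (rep_linear_op rep); exact: Linfty_shift.
- move=> f g Lf Lg fg; apply: (rep_ae rep); [exact: Linfty_shift..|].
  have [y <-] := expNi_surj z.
  have := ae_affine y ltr01 fg; rewrite /circle_ae.
  congr (almost_everywhere _ _); apply/funext => x.
  by rewrite -expNiD mul1r addrC.
- by move=> a f g Lf Lg v; apply: (rep_linear rep); exact: Linfty_shift.
- by move=> f g Lf Lg v; apply: (rep_mul rep); exact: Linfty_shift.
- exact: (rep_one rep).
- by move=> f Lf u v; apply: (rep_adj rep); exact: Linfty_shift.
Qed.

(** The function [z^k] for all integers [k], so that the powers of T, inverses included, are values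
    of the representation ([op_expz_cval]). *)
Definition zk (k : int) (w : circle R) : R[i] :=
  match k with Posz n => cval w ^+ n | Negz n => (cval w)^-1 ^+ n.+1 end.

Lemma zkE k x : zk k (expNi x) = ek k x.
Proof.
case: k => n; first by rewrite ek_nat.
by rewrite NegzE ekN ek_nat /= -cval_conj rmorphXn.
Qed.

Lemma Linfty_zk k : Linfty (zk k).
Proof.
split.
  have -> : (fun x => zk k (expNi x)) = ek k by apply/funext => x; exact: zkE.
  exact: measurable_ek.
exists 1; apply: aeW => x; rewrite zkE norm_normc lecR.
by rewrite normcE sqn_ek sqrtr1.
Qed.

Lemma zkD k l w : zk k w * zk l w = zk (k + l) w.
Proof. by have [x <-] := expNi_surj w; rewrite !zkE ek_add. Qed.

Lemma zk0 : zk 0 = fun=> 1. Proof. by apply/funext => w. Qed.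
Lemma zk1 : zk 1 = @cval R. Proof. by apply/funext => w; rewrite -[LHS]/(cval w ^+ 1) expr1. Qed.

Lemma rho_zkD k l v : rho (zk k) (rho (zk l) v) = rho (zk (k + l)) v.
Proof.
rewrite -(rep_mul rep); [|exact: Linfty_zk..].
by congr (rho _ v); apply/funext => w; rewrite zkD.
Qed.

Lemma rho_zk0 v : rho (zk 0) v = v. Proof. by rewrite zk0 (rep_one rep). Qed.

Lemma unitary_zk k : unitary_op (rho (zk k)).
Proof.
have [l _] := rep_linear_op rep (Linfty_zk k).
split => //.
- move=> u v; rewrite (rep_adj rep (Linfty_zk k)).
  have -> : (fun w => (zk k w)^*) = zk (- k).
    by apply/funext => w; have [x <-] := expNi_surj w; rewrite !zkE ekN.
  by rewrite rho_zkD addNr rho_zk0.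
- apply/seteqP; split => // v _; exists (rho (zk (- k)) v) => //.
  by rewrite rho_zkD subrr rho_zk0.
Qed.

Lemma op_inv_zk k v : op_inv (rho (zk k)) v = rho (zk (- k)) v.
Proof.
by apply: (unitary_inj (unitary_zk k)); rewrite (op_invK (unitary_zk k)) rho_zkD subrr rho_zk0.
Qed.

Lemma op_expz_cval k v : op_expz (rho (@cval R)) k v = rho (zk k) v.
Proof.
rewrite -zk1; case: k => n /=.
  elim: n => [|n IH]; first by rewrite rho_zk0.
  by rewrite iterS IH rho_zkD -PoszD add1n.
rewrite op_inv_zk; elim: n => [|n IH] //=.
by rewrite op_inv_zk IH rho_zkD; congr (rho (zk _) v); lia.
Qed.

End representation_powers.

Local Opaque fourier fourier_inv fourier_mult dilation to_L2 dil mulL2.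

Section classical_representation.
Context {R : realType}.
Local Notation leb := (@lebesgue_measure R).
Implicit Types (u v : L2R R) (f g : circle R -> R[i]).

Lemma fourier_multE f v : fourier (fourier_mult f v) = mulL2 (fun x => f (expNi x)) (fourier v).
Proof. exact: (fourier_invK (to_L2 leb (fun x => f (expNi x) * L2_fun (fourier v) x))). Qed.

Lemma classical_Linfty : Linfty_representation (@fourier_mult R).
Proof.
have dotF u v : dot u v = (2 * pi)^-1%:C * dot (fourier u) (fourier v).
  by rewrite dot_fourier mulrA -rmorphM/= mulVf ?twopi_neq0// mul1r.
have hnF v : hn (fourier v) = Num.sqrt (2 * pi) * hn v.
  apply/eqP; rewrite -(@eqrXn2 _ 2) ?hn_ge0 ?mulr_ge0 ?sqrtr_ge0 ?hn_ge0//.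
  by rewrite exprMn sqr_sqrtr ?(ltW (twopi_gt0 R))// fourier_hn.
split.
- move=> f /Linfty_ae_bounded bf.
  have lin : linear_op (fourier_mult f).
    move=> a u v; apply: fourier_inj.
    exact: (etrans (fourier_multE f (a *: u + v)) (etrans (congr1 (mulL2 _) (fourier_linear a u v))
      (etrans (mulL2_linear bf a (fourier u) (fourier v)) (etrans (f_equal2 (fun s t => a *: s + t)
      (esym (fourier_multE f u)) (esym (fourier_multE f v)))
      (esym (fourier_linear a (fourier_mult f u) (fourier_mult f v))))))).
  split => //; have [C hC] := mulL2_hn bf.
  apply: (@continuous_of_bound _ _ _ C lin) => v.
  have sp : 0 < Num.sqrt (2 * pi) :> R by rewrite sqrtr_gt0 twopi_gt0.
  by rewrite -(ler_pM2l sp) -hnF fourier_multE mulrCA -hnF; exact: hC.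
- move=> f g /Linfty_ae_bounded bf /Linfty_ae_bounded bg fg.
  apply/funext => v; apply: fourier_inj; rewrite !fourier_multE.
  exact: mulL2_ae_eq.
- move=> a f g /Linfty_ae_bounded bf /Linfty_ae_bounded bg v; apply: fourier_inj.
  exact: (etrans (fourier_multE (fun z => a * f z + g z) v) (etrans (mulL2_lin a (fourier v) bf bg)
    (etrans (f_equal2 (fun s t => a *: s + t) (esym (fourier_multE f v)) (esym (fourier_multE g v)))
    (esym (fourier_linear a (fourier_mult f v) (fourier_mult g v)))))).
- move=> f g /Linfty_ae_bounded bf /Linfty_ae_bounded bg v; apply: fourier_inj.
  exact: (etrans (fourier_multE (fun z => f z * g z) v) (etrans (esym (mulL2M (fourier v) bf bg))
    (etrans (congr1 (mulL2 _) (esym (fourier_multE g v))) (esym (fourier_multE f (fourier_mult g v)))))).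
- by move=> v; apply: fourier_inj; rewrite fourier_multE mulL2_1.
- move=> f /Linfty_ae_bounded bf u v.
  exact: (etrans (dotF (fourier_mult f u) v) (etrans (congr1 (fun x => _ * dot x (fourier v)) (fourier_multE f u))
    (etrans (congr1 (fun x => _ * x) (mulL2_adj (fourier u) (fourier v) bf))
    (esym (etrans (dotF u (fourier_mult (fun z => (f z)^*) v))
    (congr1 (fun x => _ * dot (fourier u) x) (fourier_multE (fun z => (f z)^*) v))))))).
Qed.

Lemma dilation_unitary (N : nat) : (0 < N)%N -> unitary_op (@dilation R N).
Proof.
move=> N0; have N0' : 0 < (N%:R^-1 : R) by rewrite invr_gt0 ltr0n.
have lin : linear_op (@dilation R N) by move=> a u v; rewrite !dilationE//; exact: dil_linear.
have hnd u : hn (dilation N u) ^+ 2 = 1 * hn u ^+ 2 by rewrite dilationE// dil_hn// mul1r.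
split => //.
  by move=> u v; rewrite (dot_of_hn lin hnd) mul1r.
apply/seteqP; split => // v _; exists (dil (N%:R^-1)^-1 v) => //.
by rewrite dilationE// dilVK.
Qed.

Lemma dilation_mult (N : nat) f v : (0 < N)%N -> Linfty f ->
  Linfty (fun w => f (circle_exp w N)) /\
  dilation N (fourier_mult f v) = fourier_mult (fun w => f (circle_exp w N)) (dilation N v).
Proof.
move=> N0 Lf; have bf := Linfty_ae_bounded Lf.
have N0' : 0 < N%:R :> R by rewrite ltr0n.
have [b e] := dil_mulL2 (fourier v) N0' bf.
have E : (fun x => f (expNi (N%:R * x))) = (fun x => f (circle_exp (expNi x) N)).
  by apply/funext => x; rewrite expNiMn.
split.
  have [mf [M fM]] := Lf; split; first by have [] := b; rewrite E.
  exists M; have := ae_scale N0' fM; rewrite /circle_ae.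
  by congr (almost_everywhere _ _); apply/funext => x; rewrite expNiMn.
apply: fourier_inj.
exact: (etrans (fourier_dilation (fourier_mult f v) N0) (etrans (congr1 (dil N%:R) (fourier_multE f v))
  (etrans e (etrans (f_equal2 (@mulL2 R) E (esym (fourier_dilation v N0)))
  (esym (fourier_multE (fun w => f (circle_exp w N)) (dilation N v))))))).
Qed.

(** Covariance comes from [(z_k t)^N = z_(k+1) t^N]; unitarity from [|alpha_k| = 1] and from the
    cyclic shift being a permutation. *)
Lemma cycle_representation (N p : nat) (z : 'I_p -> circle R) (alpha : 'I_p -> R[i]) : (0 < N)%N ->
  (forall k, circle_exp (z k) N = z (ordS k)) -> (forall k, sqn (alpha k) = 1) ->
  wavelet_representation N (cycle_wavelet N z alpha).
Proof.
move=> N0 zN a1; have uD := dilation_unitary N0.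
have aa k : alpha k * (alpha k)^* = 1 by rewrite mul_conjc_sqn a1.
have uU : unitary_op (wU (cycle_wavelet N z alpha)).
  have [lD dD sD] := uD; split.
  - move=> a u v; apply: dsum_ext => k.
    rewrite -[LHS]/(alpha k *: dilation N (a *: u (ordS k) + v (ordS k))) lD scalerDr.
    rewrite -[RHS]/(a *: (alpha k *: dilation N (u (ordS k))) + alpha k *: dilation N (v (ordS k))).
    by congr (_ + _); rewrite !scalerA mulrC.
  - move=> u v; rewrite !dsum_dotE [RHS](reindex_inj (@ordS_inj p)); apply: eq_bigr => k _.
    rewrite -[LHS]/(dot (alpha k *: dilation N (u (ordS k))) (alpha k *: dilation N (v (ordS k)))).
    by rewrite dotZl dotZr mulrA aa mul1r dD.
  apply/seteqP; split => // v _.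
  have /choice[w hw] k : exists w, dilation N w = (alpha k)^* *: v k.
    have : range (@dilation R N) ((alpha k)^* *: v k) by rewrite sD.
    by case=> w _ hw; exists w.
  exists (fun k => w (ord_pred k)) => //; apply: dsum_ext => k.
  rewrite -[LHS]/(alpha k *: dilation N (w (ord_pred (ordS k)))) ordSK hw.
  by rewrite scalerA aa scale1r.
have rep : Linfty_representation (wpi (cycle_wavelet N z alpha)).
  exact: (@dsum_representation _ _ _ (fun k f => fourier_mult (fun w => f (circle_mul (z k) w)))
    (fun k => representation_twist classical_Linfty (z k))).
split => //; first by apply: hilbert_dsum => k; exact: L2_complete.
move=> f Lf v; have := op_invK uU v.
set w := op_inv _ v => <-; apply: dsum_ext => k.
rewrite -[LHS]/(alpha k *: dilation N (fourier_mult (fun t => f (circle_mul (z (ordS k)) t)) (w (ordS k)))).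
rewrite -[RHS]/(fourier_mult (fun t => f (circle_exp (circle_mul (z k) t) N)) (alpha k *: dilation N (w (ordS k)))).
have Ls := Linfty_shift (z (ordS k)) Lf.
have [L1 ->] := dilation_mult (w (ordS k)) N0 Ls.
have E : (fun t => f (circle_exp (circle_mul (z k) t) N)) =
    (fun t => f (circle_mul (z (ordS k)) (circle_exp t N))).
  by apply/funext => t; rewrite circle_mulX zN.
by rewrite E; have [lin _] := rep_linear_op classical_Linfty L1; rewrite (linear_opZ _ _ lin).
Qed.

Lemma dsum_wavelet_representation (N : nat) (I : finType) (H : I -> innerProductType R)
    (W : forall i, wavelet_data (H i)) :
  (forall i, wavelet_representation N (W i)) -> wavelet_representation N (dsum_wavelet W).
Proof.
move=> hW.
have uU : unitary_op (wU (dsum_wavelet W)).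
  split.
  - move=> a u v; apply: dsum_ext => i.
    by have [l _ _] := wavelet_unitary (hW i); rewrite -[RHS]l.
  - move=> u v; rewrite !dsum_dotE; apply: eq_bigr => i _.
    by have [_ d _] := wavelet_unitary (hW i); rewrite -[RHS]d.
  apply/seteqP; split => // v _; exists (fun i => op_inv (wU (W i)) (v i)) => //.
  by apply: dsum_ext => i; exact: (op_invK (wavelet_unitary (hW i))).
have rep : Linfty_representation (wpi (dsum_wavelet W)).
  exact: (@dsum_representation _ _ _ (fun i => wpi (W i)) (fun i => wavelet_rep (hW i))).
split => //; first by apply: hilbert_dsum => i; exact: wavelet_hilbert (hW i).
move=> f Lf v; have := op_invK uU v.
set w := op_inv _ v => <-; apply: dsum_ext => i.
rewrite -[LHS]/(wU (W i) (wpi (W i) f (w i))).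
rewrite -[RHS]/(wpi (W i) (fun z => f (circle_exp z N)) (wU (W i) (w i))).
rewrite -(wavelet_covariant (hW i) Lf).
by rewrite (op_invKl (wavelet_unitary (hW i))).
Qed.

End classical_representation.

(** * Periodization *)
Section windows.
Context {R : realType}.
Local Notation leb := (@lebesgue_measure R).
Implicit Types (f k : R -> R[i]).

Lemma compact_cintegrable k : compact_sqint k -> cintegrable leb k.
Proof. by move=> [sk [A A0 k0]]; exact: (sqint_cintegrable sk k0). Qed.

Lemma compact_sqintM (M : R) (c : R -> R[i]) k : cmeasurable (T := measurableTypeR R) c ->
  (forall x, sqn (c x) <= M) -> compact_sqint k -> compact_sqint (fun x => c x * k x).
Proof.
move=> mc cM [sk [A A0 k0]]; split; last by exists A => // x /k0 ->; rewrite mulr0.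
have -> : (fun x => c x * k x) = (fun x => k x * c x) by apply/funext => x; exact: mulrC.
exact: (sqint_mul_bounded sk mc cM).
Qed.

Lemma compact_sqint_affine (a b : R) k : 0 < a -> compact_sqint k ->
  compact_sqint (fun x => k (a * x + b)).
Proof.
move=> a0 [sk [A A0 k0]].
apply: (@compact_sqintW _ _ ((- A - b) / a) ((A - b) / a)); first exact: sqint_affine.
move=> x h; apply: k0; apply: contra h => /andP[h1 h2].
by rewrite ler_pdivrMr// ltr_pdivlMr// [x * a]mulrC lerBlDr h1 ltrBrDr.
Qed.

Lemma compact_sqint_wn a b k : compact_sqint k -> compact_sqint (fun x => (wn a b x)%:C * k x).
Proof.
apply: (@compact_sqintM 1) => [|x]; first by apply: cmeasurable_real; exact: measurable_wn.
by rewrite sqn_real wn_sqr wn_le1.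
Qed.

Lemma compact_sqint_sum (I : Type) (s : seq I) (f : I -> R -> R[i]) :
  (forall i, compact_sqint (f i)) ->
  compact_sqint (fun x => \sum_(i <- s) f i x) /\
  cintegral leb (fun x => \sum_(i <- s) f i x) = \sum_(i <- s) cintegral leb (f i).
Proof.
move=> cf; elim: s => [|i s [IH1 IH2]].
  have -> : (fun x => \sum_(i <- [::]) f i x) = (fun=> 0) by apply/funext => x; rewrite big_nil.
  rewrite big_nil /cintegral !Rintegral_cst// !mul0r; split => //; split; last by exists 1.
  exact: square_integrable0.
have -> : (fun x => \sum_(i <- i :: s) f i x) = (fun x => f i x + \sum_(i <- s) f i x).
  by apply/funext => x; rewrite big_cons.
rewrite big_cons -IH2; split; last by rewrite cintegralD//; exact: compact_cintegrable.
have [+ _] := compact_sqint_comb 1 (cf i) IH1.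
by congr compact_sqint; apply/funext => x; rewrite mul1r.
Qed.

(** The complex counterpart of [integral_unfold]: a bounded support leaves finitely many windows, so
    finite additivity is enough. *)
Lemma cintegral_windows k (a : R) (s : seq int) : 0 < a -> uniq s -> compact_sqint k ->
  (forall x (l : int), k x != 0 -> 0 <= x - a * l%:~R < a -> l \in s) ->
  cintegral leb k = \sum_(l <- s) cintegral leb (fun y => (wn 0 a y)%:C * k (y + a * l%:~R)).
Proof.
move=> a0 us ck cov.
have cw (l : int) : compact_sqint (fun x => (wn 0 a (x - a * l%:~R))%:C * k x).
  apply: (@compact_sqintM 1) => // [|x]; last by rewrite sqn_real wn_sqr wn_le1.
  apply: cmeasurable_real; apply: (measurableT_comp (measurable_wn 0 a)).
  by have := measurable_affine 1 (- (a * l%:~R)); under eq_fun do rewrite mul1r.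
have -> : k = (fun x => \sum_(l <- s) (wn 0 a (x - a * l%:~R))%:C * k x).
  apply/funext => x; rewrite -mulr_suml.
  have [->|kx] := eqVneq (k x) 0; first by rewrite mulr0.
  have [l l1 l0] := window_index x a0.
  have ls : l \in s.
    apply: cov kx _; apply: contrapT => /negP /wn_out; rewrite l1.
    by move/eqP; rewrite oner_eq0.
  rewrite (big_rem l)//= l1 big_seq big1 ?addr0 ?mul1r// => l' l's; rewrite l0//.
  by apply: contraTneq l's => ->; rewrite mem_rem_uniqF.
have [_ ->] := compact_sqint_sum s cw; apply: eq_bigr => l _.
have := cintegral_affine (a * l%:~R) ltr01 (compact_cintegrable (cw l)).
rewrite invr1 mul1r => <-; congr cintegral; apply/funext => y; rewrite mul1r addrK.
have [kz|kz] := eqVneq (k (y + a * l%:~R)) 0; first by rewrite -mulr_suml kz !mulr0.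
have [l' l1 l0] := window_index (y + a * l%:~R) a0.
have ls : l' \in s.
  apply: cov kz _; apply: contrapT => /negP /wn_out; rewrite l1.
  by move/eqP; rewrite oner_eq0.
rewrite -mulr_suml (big_rem l')//= l1 big_seq big1 ?addr0 ?mul1r// => l2 l2s; rewrite l0//.
by apply: contraTneq l2s => ->; rewrite mem_rem_uniqF.
Qed.

Lemma cintegral_grid k (M : nat) : (0 < M)%N -> compact_sqint k ->
  (forall x, ~~ (0 <= x < 2 * pi) -> k x = 0) ->
  cintegral leb k = \sum_(r < M) (M%:R^-1)%:C *
    cintegral leb (fun u => (wn 0 (2 * pi) u)%:C * k ((u + 2 * pi * r%:R) / M%:R)).
Proof.
move=> M0 ck k0; have Mp : 0 < M%:R :> R by rewrite ltr0n.
have pp := twopi_gt0 R; have a0 : 0 < 2 * pi / M%:R :> R by rewrite divr_gt0.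
rewrite (@cintegral_windows k (2 * pi / M%:R) [seq r%:Z | r <- iota 0 M])//; last 2 first.
- by rewrite map_inj_uniq ?iota_uniq// => x y [].
- move=> x l kx /andP[h1 h2].
  have /andP[x0 x2] : 0 <= x < 2 * pi by apply: contraNT kx => /k0 ->.
  have l0 : 0 <= l.
    rewrite leNgt; apply/negP => l0; have : l%:~R <= (-1)%:~R :> R by rewrite ler_int; lia.
    by rewrite mulrNz => /(ler_wpM2l (ltW a0)); lra.
  have lM : (l < M%:Z)%R.
    rewrite ltNge; apply/negP => l1; have : (M%:Z)%:~R <= l%:~R :> R by rewrite ler_int.
    by rewrite -pmulrn => /(ler_wpM2l (ltW a0)); rewrite divfK ?gt_eqF//; lra.
  by case: l l0 lM {h1 h2} => // n _ nM; rewrite mem_map ?mem_iota// => ? ? [].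
rewrite big_map -[X in iota 0 X]subn0 -/(index_iota 0 M) big_mkord; apply: eq_bigr => r _.
set f := fun y => _.
have cf : cintegrable leb f.
  apply: compact_cintegrable; apply: compact_sqint_wn.
  have := compact_sqint_affine (2 * pi / M%:R * r%:~R) ltr01 ck.
  by congr compact_sqint; apply/funext => y; rewrite mul1r.
have := cintegral_affine 0 (_ : 0 < M%:R^-1) cf; rewrite invr_gt0 => /(_ Mp).
rewrite invrK => h.
have -> : (fun u => (wn 0 (2 * pi) u)%:C * k ((u + 2 * pi * r%:R) / M%:R)) =
  (fun x => f (M%:R^-1 * x + 0)).
  apply/funext => u; rewrite /f addr0 [M%:R^-1 * u]mulrC; congr ((_)%:C * k _).
    by rewrite /wn pmulr_lge0 ?invr_gt0// ltr_pM2r ?invr_gt0.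
  by rewrite mulrDl -pmulrn [_ / _ * _]mulrAC.
by rewrite h mulrA -rmorphM/= mulVf ?gt_eqF// mul1r.
Qed.

End windows.

Lemma esum_finType (R : realType) (I : finType) (a : I -> \bar R) : (forall i, (0 <= a i)%E) ->
  (\esum_(i in [set: I]) a i = \sum_i a i)%E.
Proof.
move=> a0; rewrite (esum_fset (@finite_finset I setT))//.
have -> : [set: I] = [set` enum I] by apply/seteqP; split => // j _ /=; rewrite mem_enum.
by rewrite -fsbig_seq ?enum_uniq// big_enum.
Qed.

Section argument_windows.
Context {R : realType} {J : finType} (theta : J -> R).
Local Notation leb := (@lebesgue_measure R).
Implicit Types (h k : J -> R -> R[i]).

(** The box [|l| <= L], listed through [l = n - L]. *)
Definition args (L : nat) : seq (J * int) :=
  [seq (j, n%:Z - L%:Z) | j <- enum J, n <- iota 0 (2 * L).+1].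

Lemma args_uniq L : uniq (args L).
Proof.
apply: allpairs_uniq; [exact: enum_uniq|exact: iota_uniq|].
by move=> [j n] [j' n'] _ _ /= [-> /addIr[->]].
Qed.

Lemma size_args L : size (args L) = (#|J| * (2 * L).+1)%N.
Proof. by rewrite size_allpairs size_iota -cardE. Qed.

Lemma mem_args L j (l : int) : `|l| <= L%:Z -> (j, l) \in args L.
Proof.
move=> lL; apply/allpairsP; exists (j, `|(l + L%:Z)%R|%N); split => /=.
- by rewrite mem_enum.
- by rewrite (mem_iota 0 (2 * L).+1); lia.
- by congr (_, _); lia.
Qed.

(** Ensures that [args L] contains every index whose argument lies in [[-b, b]] for some [y] of the
    period, see [covers_index]. *)
Definition covers (b : R) (L : nat) := forall j, b + `|theta j| + 2 * pi <= 2 * pi * L%:R.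

Lemma covers_index b L j x (l : int) : covers b L -> `|x - theta j| <= b ->
  0 <= x - 2 * pi * l%:~R < 2 * pi -> `|l| <= L%:Z.
Proof.
move=> /(_ j) hL xb /andP[h1 h2]; have pp := twopi_gt0 R.
have hx : `|x| <= b + `|theta j|.
  by rewrite -[x](subrK (theta j)); apply: le_trans (ler_normD _ _) _; rewrite lerD2r.
move: hx; rewrite ler_norml => /andP[x1 x2].
rewrite -(ler_int R) intr_norm -pmulrn -(ler_pM2l pp) -[X in X * `|_|]gtr0_norm// -normrM.
rewrite ler_norml; apply/andP; split; lra.
Qed.

Lemma arg_unfold k b L : covers b L -> (forall j, compact_sqint (k j)) ->
  (forall j x, k j x != 0 -> `|x| <= b) ->
  compact_sqint (fun y => (wn 0 (2 * pi) y)%:C * \sum_(p <- args L) k p.1 (arg theta p y)) /\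
  \sum_j cintegral leb (k j) =
  cintegral leb (fun y => (wn 0 (2 * pi) y)%:C * \sum_(p <- args L) k p.1 (arg theta p y)).
Proof.
move=> hL ck kb; have pp := twopi_gt0 R.
pose f (p : J * int) y := (wn 0 (2 * pi) y)%:C * k p.1 (arg theta p y).
have cs' j : compact_sqint (fun x => k j (x - theta j)).
  have := compact_sqint_affine (- theta j) ltr01 (ck j).
  by congr compact_sqint; apply/funext => x; rewrite mul1r.
have cf p : compact_sqint (f p).
  apply: compact_sqint_wn.
  have := compact_sqint_affine (- theta p.1 + 2 * pi * p.2%:~R) ltr01 (ck p.1).
  by congr compact_sqint; apply/funext => x; rewrite mul1r addrA.
have -> : (fun y => (wn 0 (2 * pi) y)%:C * \sum_(p <- args L) k p.1 (arg theta p y)) =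
    (fun y => \sum_(p <- args L) f p y) by apply/funext => y; rewrite mulr_sumr.
have [c1 c2] := compact_sqint_sum (args L) cf; split => //; rewrite c2 big_allpairs_dep big_enum/=.
apply: eq_bigr => j _.
have := cintegral_affine (- theta j) ltr01 (compact_cintegrable (ck j)).
rewrite invr1 mul1r => <-.
have -> : (fun x => k j (1 * x - theta j)) = (fun x => k j (x - theta j)).
  by apply/funext => x; rewrite mul1r.
rewrite (@cintegral_windows _ _ (2 * pi) [seq n%:Z - L%:Z | n <- iota 0 (2 * L).+1])//.
- rewrite big_map; apply: eq_bigr => n _; congr cintegral; apply/funext => y.
  by rewrite /f /arg /= addrAC.
- by rewrite map_inj_uniq ?iota_uniq// => x y /addIr[].
- move=> x l /kb xb /(covers_index hL xb) lL; apply/mapP; exists `|(l + L%:Z)%R|%N; last lia.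
  by rewrite (mem_iota 0 (2 * L).+1); lia.
Qed.

(** Translation by [theta j] followed by unfolding into periods. This version has the full sum and
    nonnegative functions; [arg_unfold] has complex functions of bounded support and a finite
    sum. *)
Lemma arg_integral (h : J -> R -> R) : (forall j, measurable_fun [set: R] (h j)) ->
  (forall j x, 0 <= h j x) ->
  (\int[leb]_y ((wn 0 (2 * pi) y)%:E * \esum_(p in [set: J * int]) (h p.1 (arg theta p y))%:E)
   = \sum_j \int[leb]_x (h j x)%:E)%E.
Proof.
move=> mh h0; have pp := twopi_gt0 R.
have ma p : measurable_fun [set: R] (fun y => h p.1 (arg theta p y)).
  apply: (measurableT_comp (mh p.1)).
  by have := measurable_affine 1 (- theta p.1 + 2 * pi * p.2%:~R); under eq_fun do rewrite mul1r addrA.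
have mw p : measurable_fun [set: R] (fun y => (wn 0 (2 * pi) y * h p.1 (arg theta p y))%:E).
  by apply/measurable_EFinP; apply: measurable_funM => //; exact: measurable_wn.
have w0 p y : (0 <= (wn 0 (2 * pi) y * h p.1 (arg theta p y))%:E)%E.
  by rewrite lee_fin mulr_ge0 ?wn_ge0.
transitivity (\int[leb]_y \esum_(p in [set: J * int]) (wn 0 (2 * pi) y * h p.1 (arg theta p y))%:E)%E.
  apply: eq_integral => y _.
  by rewrite -(@esumZl _ _ (fun p => h p.1 (arg theta p y)))// wn_ge0.
rewrite (integral_esum leb mw w0).
transitivity (\esum_(j in [set: J]) \esum_(l in [set: int])
    \int[leb]_y (wn 0 (2 * pi) y * h j (arg theta (j, l) y))%:E)%E.
  rewrite (@esum_esum _ _ _ setT (fun=> setT) (fun j l =>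
    \int[leb]_y (wn 0 (2 * pi) y * h j (arg theta (j, l) y))%:E))%E; last first.
    by move=> j l _ _; apply: integral_ge0 => y _; exact: w0 (j, l) y.
  have -> : [set: J] `*`` (fun=> [set: int]) = [set: J * int] by apply/seteqP; split.
  by apply: eq_esum => -[j l] _.
rewrite esum_finType; last first.
  by move=> j; apply: esum_ge0 => l _; apply: integral_ge0 => y _; exact: w0 (j, l) y.
apply: eq_bigr => j _.
have := @ge0_integral_affine R 1 (- theta j) (fun x => (h j x)%:E) ltr01.
rewrite invr1 mul1e => <-//; last 2 first.
- by apply/measurable_EFinP; exact: mh.
- by move=> x; rewrite lee_fin.
rewrite (@integral_unfold _ _ (2 * pi))//; last 2 first.
- apply/measurable_EFinP; apply: (measurableT_comp (mh j)); exact: measurable_affine.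
- by move=> x; rewrite lee_fin.
apply: eq_esum => l _; apply: eq_integral => y _; rewrite -EFinM; congr (_ * h j _)%:E.
by rewrite /arg /= mul1r addrAC.
Qed.

Lemma arg_le_integral (h : J -> R -> R) L : (forall j, measurable_fun [set: R] (h j)) ->
  (forall j x, 0 <= h j x) ->
  (\int[leb]_y (wn 0 (2 * pi) y * \sum_(p <- args L) h p.1 (arg theta p y))%:E
   <= \sum_j \int[leb]_x (h j x)%:E)%E.
Proof.
move=> mh h0; rewrite -(arg_integral mh h0).
have ma p : measurable_fun [set: R] (fun y => h p.1 (arg theta p y)).
  apply: (measurableT_comp (mh p.1)).
  by have := measurable_affine 1 (- theta p.1 + 2 * pi * p.2%:~R); under eq_fun do rewrite mul1r addrA.
apply: ge0_le_integral => //.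
- by move=> y _; rewrite lee_fin mulr_ge0 ?wn_ge0// sumr_ge0.
- apply/measurable_EFinP; apply: measurable_funM; first exact: measurable_wn.
  exact: measurable_sum.
- apply: emeasurable_funM; first by apply/measurable_EFinP; exact: measurable_wn.
  apply: (measurable_esum (f := fun (p : J * int) y => (h p.1 (arg theta p y))%:E)) => p.
    by apply/measurable_EFinP; exact: ma.
  by move=> y; rewrite lee_fin.
- move=> y _; rewrite EFinM lee_wpmul2l ?lee_fin ?wn_ge0//.
  by apply: (@esum_seq_le _ _ (fun p => h p.1 (arg theta p y))) => //; exact: args_uniq.
Qed.

End argument_windows.

Section folding.
Context {R : realType}.
Local Notation leb := (@lebesgue_measure R).

Lemma cmeasurable_continuous (f : R -> R[i]) : continuous (f : R -> R[i]^o) ->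
  cmeasurable (T := measurableTypeR R) f.
Proof.
move=> cf; split; apply: continuous_measurable_fun => x; apply/cvgrPdist_lt => e e0;
  have /cvg_sqnP/(_ (e ^+ 2) (exprn_gt0 2 e0)) := cf x; apply: filterS => y h;
  rewrite -raddfB; rewrite -sqnN opprB in h;
  have s : Num.sqrt (sqn (f x - f y)) < e by rewrite -[ltRHS]gtr0_norm// -sqrtr_sqr ltr_sqrt// exprn_gt0.
- exact: le_lt_trans (norm_Re_le (lexx _)) s.
- exact: le_lt_trans (norm_Im_le (lexx _)) s.
Qed.

Lemma compact_sqintZ (c : R[i]) (k : R -> R[i]) : compact_sqint k -> compact_sqint (fun x => c * k x).
Proof.
have mc : cmeasurable (T := measurableTypeR R) (fun=> c) by exact: cmeasurable_cst.
exact: (compact_sqintM mc (fun=> lexx (sqn c))).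
Qed.

(** The period is cut into [M] equal pieces; piece [r] is recognized by [M y - 2 pi r] lying in the
    period. *)
Lemma window_grid (M : nat) (y : R) : (0 < M)%N ->
  wn 0 (2 * pi) y = \sum_(r < M) wn 0 (2 * pi) (M%:R * y - 2 * pi * r%:R).
Proof.
move=> M0; have Mp : 0 < M%:R :> R by rewrite ltr0n.
have pp := twopi_gt0 R.
have [l l1 l0] := window_index (M%:R * y) pp.
have /andP[h1 h2] : 0 <= M%:R * y - 2 * pi * l%:~R < 2 * pi.
  by apply: contrapT => /negP /wn_out; rewrite l1 => /eqP; rewrite oner_eq0.
have e : 0 <= y < 2 * pi = (0 <= l < M%:Z)%R.
  apply/idP/idP => /andP[y0 y1].
    rewrite leNgt -[X in _ && X]negbK -leNgt; apply/andP; split; apply/negP => hl.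
      have : l%:~R <= (-1)%:~R :> R by rewrite ler_int; lia.
      rewrite mulrNz => /(ler_wpM2l (ltW pp)); have := mulr_ge0 (ltW Mp) y0; lra.
    have : (M%:Z)%:~R <= l%:~R :> R by rewrite ler_int; lia.
    rewrite -pmulrn => /(ler_wpM2l (ltW pp)); move: y1; rewrite -(ltr_pM2l Mp); lra.
  have hl0 : 0 <= l%:~R :> R by rewrite ler0z.
  have : (l + 1)%:~R <= (M%:Z)%:~R :> R by rewrite ler_int; lia.
  rewrite -pmulrn intrD => /(ler_wpM2l (ltW pp)) hl.
  rewrite -(pmulr_rge0 _ Mp) -(ltr_pM2l Mp); have := mulr_ge0 (ltW pp) hl0.
  by move=> ?; apply/andP; split; lra.
have [lM|lM] := boolP (0 <= l < M%:Z)%R; last first.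
  rewrite wn_out ?e// big1// => r _; rewrite (l0 r%:Z)//.
  by apply: contraNneq lM => <-; have := ltn_ord r; lia.
rewrite wn_in ?e//; case: l lM l1 l0 {e h1 h2} => // l /andP[_ lM] l1 l0.
have {}lM : (l < M)%N by [].
rewrite (bigD1 (Ordinal lM))//= [X in X + _]l1 big1 ?addr0// => r rl.
by apply: (l0 r%:Z); apply: contraNneq rl => -[rl]; apply/eqP/val_inj.
Qed.

Lemma integral_grid (h : R -> R) (M : nat) : (0 < M)%N -> measurable_fun [set: R] h ->
  (forall x, 0 <= h x) ->
  (\int[leb]_y (wn 0 (2 * pi) y * h y)%:E = \int[leb]_u (wn 0 (2 * pi) u *
    (M%:R^-1 * \sum_(r < M) h ((u + 2 * pi * r%:R) / M%:R)))%:E)%E.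
Proof.
move=> M0 mh h0; have Mp : 0 < M%:R :> R by rewrite ltr0n.
pose f (r : 'I_M) u := wn 0 (2 * pi) u * h ((u + 2 * pi * r%:R) / M%:R).
have mf r : measurable_fun [set: R] (f r).
  apply: measurable_funM; first exact: measurable_wn.
  apply: (measurableT_comp mh).
  have := measurable_affine (M%:R^-1 : R) (2 * pi * r%:R / M%:R).
  have -> // : (fun x : R => M%:R^-1 * x + 2 * pi * r%:R / M%:R) = (fun x => (x + 2 * pi * r%:R) / M%:R).
  by apply/funext => u; rewrite [RHS]mulrDl [u / _]mulrC.
have f0 r u : 0 <= f r u by rewrite mulr_ge0 ?wn_ge0.
transitivity (\sum_(r < M) (M%:R^-1)%:E * \int[leb]_u (f r u)%:E)%E; last first.
  transitivity (\sum_(r < M) \int[leb]_u (M%:R^-1 * f r u)%:E)%E.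
    apply: eq_bigr => r _; rewrite -ge0_integralZl//;
      do ?[by apply/measurable_EFinP; exact: mf|by move=> u _; rewrite lee_fin|by rewrite lee_fin invr_ge0 ltW].
  rewrite -ge0_integral_sum//.
  - apply: eq_integral => u _; rewrite sumEFin; congr EFin.
    by rewrite !mulr_sumr; apply: eq_bigr => r _; rewrite mulrCA.
  - by move=> r; apply/measurable_EFinP; apply: measurable_funM; [exact: measurable_cst|exact: mf].
  - by move=> r u _; rewrite lee_fin mulr_ge0 ?invr_ge0// ltW.
transitivity (\sum_(r < M) \int[leb]_y (f r (M%:R * y + - (2 * pi * r%:R)))%:E)%E; last first.
  apply: eq_bigr => r _.
  rewrite (@ge0_integral_affine R M%:R (- (2 * pi * r%:R)) (fun x => (f r x)%:E))//.
  - by apply/measurable_EFinP; exact: mf.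
  - by move=> u; rewrite lee_fin.
rewrite -ge0_integral_sum//.
- apply: eq_integral => y _; rewrite sumEFin; congr EFin.
  rewrite (window_grid y M0) mulr_suml; apply: eq_bigr => r _; rewrite /f subrK.
  by rewrite [M%:R * y]mulrC mulfK// gt_eqF.
- by move=> r; apply/measurable_EFinP; apply: (measurableT_comp (mf r)); exact: measurable_affine.
- by move=> r y _; rewrite lee_fin.
Qed.

(** An exponential whose frequency is a multiple of [M] has the same value at the [M] points lying
    over [u]. The corresponding coefficients of [G] are therefore all the coefficients of its mean
    over these points, to which Parseval's identity applies. *)
Lemma fold_parseval (G : R -> R[i]) (M : nat) : (0 < M)%N ->
  compact_sqint (fun y => (wn 0 (2 * pi) y)%:C * G y) ->
  (\esum_(k in [set: int]) (sqn ((2 * pi)^-1%:C *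
     cintegral leb (fun y => (wn 0 (2 * pi) y)%:C * (G y * (ek (M%:Z * k) y)^*))%R))%:E =
   ((2 * pi)^-1)%:E * \int[leb]_u (wn 0 (2 * pi) u *
     sqn (M%:R^-1%:C * \sum_(r < M) G ((u + 2 * pi * r%:R) / M%:R))%R)%:E)%E.
Proof.
move=> M0 cG; have Mp : 0 < M%:R :> R by rewrite ltr0n.
have pp := twopi_gt0 R.
pose f u := (wn 0 (2 * pi) u)%:C * (M%:R^-1%:C * \sum_(r < M) G ((u + 2 * pi * r%:R) / M%:R)).
have inw (u : R) (r : 'I_M) : 0 <= u < 2 * pi -> 0 <= (u + 2 * pi * r%:R) / M%:R < 2 * pi.
  move=> /andP[u0 u1]; rewrite divr_ge0 ?addr_ge0 ?mulr_ge0 ?(ltW Mp)//=; last exact: pi_ge0.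
  rewrite ltr_pdivrMr//; have : (r.+1%:R : R) <= M%:R by rewrite ler_nat.
  by rewrite -natr1 => /(ler_wpM2l (ltW pp)); lra.
have cr (r : 'I_M) : compact_sqint (fun u => (wn 0 (2 * pi) u)%:C *
    ((wn 0 (2 * pi) ((u + 2 * pi * r%:R) / M%:R))%:C * G ((u + 2 * pi * r%:R) / M%:R))).
  apply: compact_sqint_wn.
  have := compact_sqint_affine (2 * pi * r%:R / M%:R) (_ : 0 < M%:R^-1) cG.
  rewrite invr_gt0 => /(_ Mp); congr compact_sqint; apply/funext => u.
  by rewrite [_^-1 * _]mulrC -mulrDl.
have cf : compact_sqint f.
  have [+ _] := compact_sqint_sum (enum 'I_M) cr.
  move/(compact_sqintZ M%:R^-1%:C).
  congr compact_sqint; apply/funext => u; rewrite /f big_enum/= [RHS]mulrCA; congr (_ * _).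
  rewrite mulr_sumr; apply: eq_bigr => r _.
  have [uw|uw] := boolP (0 <= u < 2 * pi); last by rewrite wn_out// !mul0r.
  by rewrite (wn_in (inw u r uw)) mul1r.
have f0 u : ~~ (0 <= u < 2 * pi) -> f u = 0 by rewrite /f => /wn_out ->; rewrite mul0r.
have mek k : cmeasurable (T := measurableTypeR R) (fun y => (ek k y)^*).
  by apply: cmeasurable_conj; exact: measurable_ek.
have ek1 k (x : R) : sqn (ek k x)^* <= 1 by rewrite sqn_conj sqn_ek.
have ckk k : compact_sqint (fun y => (wn 0 (2 * pi) y)%:C * (G y * (ek (M%:Z * k) y)^*)).
  have := compact_sqintM (mek (M%:Z * k)) (ek1 _) cG.
  by congr compact_sqint; apply/funext => u; rewrite mulrC mulrA.
have ekM k (u : R) (r : nat) : ek (M%:Z * k) ((u + 2 * pi * r%:R) / M%:R) = ek k u.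
  rewrite -(ek_periodic k r u) /ek -pmulrn intrM -pmulrn; congr (cval (expNi _)).
  by move: (M%:R) (u + _) (gt_eqF Mp) => t v /negbT t0; field.
(* The two conjugations turn the [e^{iku}] of the pairing into the [e^{-iku}] of
   [fourier_integral]. *)
have E k : cintegral leb (fun y => (wn 0 (2 * pi) y)%:C * (G y * (ek (M%:Z * k) y)^*)) =
    (fourier_integral (fun u => (f u)^*) k%:~R)^*.
  pose kr (r : 'I_M) (u : R) := (wn 0 (2 * pi) u)%:C * ((wn 0 (2 * pi) ((u + 2 * pi * r%:R) / M%:R))%:C *
    (G ((u + 2 * pi * r%:R) / M%:R) * (ek (M%:Z * k) ((u + 2 * pi * r%:R) / M%:R))^*)).
  have ckr r : compact_sqint (kr r).
    apply: compact_sqint_wn.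
    have := compact_sqint_affine (2 * pi * r%:R / M%:R) (_ : 0 < M%:R^-1) (ckk k).
    rewrite invr_gt0 => /(_ Mp); congr compact_sqint; apply/funext => u.
    by rewrite [_^-1 * _]mulrC -mulrDl.
  rewrite (cintegral_grid M0 (ckk k)); last first.
    by move=> x /wn_out ->; rewrite mul0r.
  have cfe : compact_sqint (fun u => (f u)^* * cval (expNi (k%:~R * u))).
    have := compact_sqintM (mek k) (ek1 _) cf; move=> [/sqint_conj sk [A A0 k0]].
    split; last by exists A => // u /k0 h; rewrite -[cval _]conjCK -rmorphM mulrC -/(ek k u) h rmorph0.
    by move: sk; congr square_integrable; apply/funext => u; rewrite rmorphM/= conjCK mulrC.
  rewrite /fourier_integral -cintegral_conj; last exact: compact_cintegrable.
  transitivity (cintegral leb (fun u => \sum_(r < M) M%:R^-1%:C * kr r u)).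
    have ckr' r : compact_sqint (fun u => M%:R^-1%:C * kr r u).
      exact: compact_sqintZ.
    have [_ ->] := compact_sqint_sum (index_enum 'I_M) ckr'.
    by apply: eq_bigr => r _; rewrite cintegralZ//; exact: compact_cintegrable.
  congr cintegral; apply/funext => u; rewrite rmorphM/= conjCK -/(ek k u) /f.
  rewrite -mulr_sumr.
  have [uw|uw] := boolP (0 <= u < 2 * pi); last first.
    by rewrite big1 ?mulr0 ?wn_out ?mul0r// => r _; rewrite /kr (wn_out uw) mul0r.
  rewrite [in RHS]mulrCA -!mulrA; congr (_ * _); rewrite mulr_suml mulr_sumr; apply: eq_bigr => r _.
  by rewrite /kr (wn_in (inw u r uw)) mul1r ekM mulrA.
under eq_esum do rewrite E sqnM sqn_conj sqn_real.
rewrite (esumZl (a := fun k : int => sqn (fourier_integral (fun u => (f u)^*) k%:~R))); last 2 first.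
- by move=> k; exact: sqn_ge0.
- exact: sqr_ge0.
rewrite parseval_window; last 2 first.
- by have [/sqint_conj] := cf.
- by move=> u /f0 ->; rewrite rmorph0.
have -> : (\int[leb]_x (sqn (f x)^*)%:E = \int[leb]_u (wn 0 (2 * pi) u *
     sqn (M%:R^-1%:C * \sum_(r < M) G ((u + 2 * pi * r%:R) / M%:R))%R)%:E)%E.
  by apply: eq_integral => u _; rewrite sqn_conj /f sqn_wn.
rewrite muleA -EFinM; congr (_%:E * _)%E.
by move: (2 * pi) (twopi_neq0 R) => t t0; field.
Qed.

End folding.

(** * Overlaps with the infinite products *)

Section overlap.
Context {R : realType}.
Local Notation leb := (@lebesgue_measure R).
Variables (N : nat) (m0 : circle R -> R[i]) (K : R).
Hypothesis lp : lowpass N m0 K.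
Variables (J : finType) (theta : J -> R) (tau : J -> J).
Hypothesis cs : csystem N m0 theta tau.
Local Notation ph := (ph N m0 theta tau).
Local Notation arg := (arg theta).
Local Notation args := (@args J).
Local Notation corrR := (corrR N m0 theta tau xpredT).
Implicit Types (g : J -> R -> R[i]) (a b M : R) (L : nat).

Lemma cmeasurable_ph j : cmeasurable (T := measurableTypeR R) (ph j).
Proof. by apply: cmeasurable_continuous; exact: (continuous_ph lp cs). Qed.

Lemma measurable_sqn_ph j : measurable_fun [set: R] (fun x => sqn (ph j x)).
Proof. exact: measurable_sqn (cmeasurable_ph j). Qed.

Lemma ph_integral : (\sum_j \int[leb]_x (sqn (ph j x))%:E =
  \int[leb]_y (wn 0 (2 * pi) y * corrR y)%:E)%E.
Proof.
rewrite -(arg_integral theta measurable_sqn_ph (fun j x => sqn_ge0 _)).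
by apply: eq_integral => y _; rewrite EFinM -(corrE lp cs).
Qed.

Lemma ph_integral_le : (\sum_j \int[leb]_x (sqn (ph j x))%:E <= (2 * pi)%:E)%E.
Proof.
rewrite -(arg_integral theta measurable_sqn_ph (fun j x => sqn_ge0 _)).
rewrite -[X in (_ <= X%:E)%E]subr0 -(integral_wn (ltW (twopi_gt0 R))).
have pos p y : (0 <= (sqn (ph p.1 (arg p y)))%:E)%E by rewrite lee_fin sqn_ge0.
apply: ge0_le_integral => //.
- by move=> y _; rewrite mule_ge0 ?lee_fin ?wn_ge0//; apply: esum_ge0 => p _; exact: pos.
- apply: emeasurable_funM; first by apply/measurable_EFinP; exact: measurable_wn.
  apply: (measurable_esum (f := fun (p : J * int) y => (sqn (ph p.1 (arg p y)))%:E)) => // p.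
  apply/measurable_EFinP; apply: (measurableT_comp (measurable_sqn_ph p.1)).
  by have := measurable_affine 1 (- theta p.1 + 2 * pi * p.2%:~R); under eq_fun do rewrite mul1r addrA.
- by apply/measurable_EFinP; exact: measurable_wn.
- move=> y _; rewrite -[leRHS]mule1 lee_wpmul2l ?lee_fin ?wn_ge0//.
  exact: (corr_le1 lp cs xpredT y).
Qed.

Lemma ph_integral_full : (forall y, corrR y = 1) ->
  (\sum_j \int[leb]_x (sqn (ph j x))%:E = (2 * pi)%:E)%E.
Proof.
move=> full; rewrite ph_integral -[in RHS](subr0 (2 * pi)) -(integral_wn (ltW (twopi_gt0 R))).
by apply: eq_integral => y _; rewrite full mulr1.
Qed.

Lemma sqint_ph j : square_integrable leb (ph j).
Proof.
apply/square_integrable_sqn; split; first exact: cmeasurable_ph.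
apply: le_lt_trans (le_trans _ ph_integral_le) (ltry _).
rewrite (bigD1 j)//= leeDl// sume_ge0// => k _.
by apply: integral_ge0 => x _; rewrite lee_fin sqn_ge0.
Qed.

(** The Fourier side of a test vector. The inner radius [a] matters along the powers of the inverse
    of [U], where it tends to infinity; the outer radius [b] along those of [U], and for the
    finiteness of sums. *)
Record nice g a b M : Prop := {
  nice_meas : forall j, cmeasurable (T := measurableTypeR R) (g j);
  nice_bound : forall j x, sqn (g j x) <= M;
  nice_supp : forall j x, g j x != 0 -> a <= `|x| <= b }.

(* Periodization of [g * conj ph]; the sum is exhaustive if [args L] covers the support of [g]. *)
Definition overlap L g (y : R) : R[i] :=
  \sum_(p <- args L) g p.1 (arg p y) * (ph p.1 (arg p y))^*.

Lemma nice_compact g a b M j : nice g a b M -> compact_sqint (g j).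
Proof.
move=> ng; have g0 x : ~~ (- (b + 1) <= x < b + 1) -> g j x = 0.
  move=> h; apply: contraNeq h => /(nice_supp ng)/andP[_]; rewrite ler_norml => /andP[? ?].
  by apply/andP; split; lra.
apply: (compact_sqintW _ g0).
have := sqint_wn (a := - (b + 1)) (b := b + 1) (nice_meas ng j) (fun x _ => nice_bound ng j x).
congr square_integrable; apply/funext => x.
have [h|/g0 ->] := boolP (- (b + 1) <= x < b + 1); last by rewrite mulr0.
by rewrite wn_in// mul1r.
Qed.

Lemma measurable_arg p : measurable_fun [set: R] (arg p).
Proof.
by have := measurable_affine 1 (- theta p.1 + 2 * pi * p.2%:~R); under eq_fun do rewrite mul1r addrA.
Qed.

Lemma cmeasurable_arg p (f : R -> R[i]) : cmeasurable (T := measurableTypeR R) f ->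
  cmeasurable (T := measurableTypeR R) (fun y => f (arg p y)).
Proof. by move=> [m1 m2]; split; [apply: (measurableT_comp m1)|apply: (measurableT_comp m2)]; exact: measurable_arg. Qed.

Lemma cmeasurable_overlap L g a b M : nice g a b M ->
  cmeasurable (T := measurableTypeR R) (overlap L g).
Proof.
move=> ng; apply: cmeasurable_sum => p; apply: cmeasurableM.
  exact: (cmeasurable_arg p (nice_meas ng p.1)).
apply: cmeasurable_conj; exact: (cmeasurable_arg p (cmeasurable_ph p.1)).
Qed.

Lemma overlap_CS L g y : sqn (overlap L g y) <=
  (\sum_(p <- args L) sqn (g p.1 (arg p y))) * (\sum_(p <- args L) sqn (ph p.1 (arg p y))).
Proof.
apply: le_trans (sqn_sum_CS _ _ _ _) _; rewrite le_eqVlt; apply/orP; left; apply/eqP.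
by congr (_ * _); apply: eq_bigr => p _; rewrite sqn_conj.
Qed.

Lemma overlap_le L g y : sqn (overlap L g y) <= \sum_(p <- args L) sqn (g p.1 (arg p y)).
Proof.
apply: le_trans (overlap_CS L g y) _; rewrite ler_piMr ?sumr_ge0//.
  by move=> p _; exact: sqn_ge0.
by apply: (sum_sqn_ph_le1 lp cs); exact: args_uniq.
Qed.

(** Cauchy-Schwarz used in the sense opposite to [overlap_le]: the values of [g] are bounded crudely
    by [M] times their number, and the sum of the [|ph|^2] beyond radius [a] is kept, because its
    integral vanishes as [a] grows. *)
Lemma overlap_tail L g a b M y : nice g a b M -> sqn (overlap L g y) <=
  (size (args L))%:R * M * \sum_(p <- args L) (if a <= `|arg p y| then sqn (ph p.1 (arg p y)) else 0).
Proof.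
move=> ng.
have -> : overlap L g y = \sum_(p <- args L) g p.1 (arg p y) *
    (if a <= `|arg p y| then ph p.1 (arg p y) else 0)^*.
  apply: eq_bigr => p _; case: ifPn => // ap; suff -> : g p.1 (arg p y) = 0 by rewrite !mul0r.
  by apply: contraNeq ap => /(nice_supp ng)/andP[].
apply: le_trans (sqn_sum_CS _ _ _ _) _; apply: ler_pM.
- by apply: sumr_ge0 => p _; exact: sqn_ge0.
- by apply: sumr_ge0 => p _; exact: sqn_ge0.
- apply: (@le_trans _ _ (\sum_(p <- args L) M)); first by apply: ler_sum => p _; exact: nice_bound ng _ _.
  by rewrite big_const_seq count_predT iter_addr_0 mulr_natl.
- by apply: ler_sum => p _; rewrite sqn_conj; case: ifP => // _; rewrite sqn0.
Qed.

Lemma compact_overlap L g a b M : nice g a b M ->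
  compact_sqint (fun y => (wn 0 (2 * pi) y)%:C * overlap L g y).
Proof.
move=> ng; apply: (@compact_sqintW _ _ 0 (2 * pi)); last by move=> y /wn_out ->; rewrite mul0r.
apply: (sqint_wn (M := (size (args L))%:R * M) (cmeasurable_overlap L ng)) => y _.
apply: le_trans (overlap_le L g y) _.
apply: (@le_trans _ _ (\sum_(p <- args L) M)); first by apply: ler_sum => p _; exact: nice_bound ng _ _.
by rewrite big_const_seq count_predT iter_addr_0 mulr_natl.
Qed.

Lemma compact_mul_ae (f k : R -> R[i]) : ae_bounded f -> compact_sqint k ->
  compact_sqint (fun x => f x * k x).
Proof.
move=> bf [sk [A A0 k0]]; split; last by exists A => // x /k0 ->; rewrite mulr0.
exact: sqint_mulL2.
Qed.

(** The points [arg p y + theta p.1] all represent the same point of the circle as [y], so after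
    unfolding the factor [f] comes out of the sum. *)
Lemma overlap_pairing L g a b M (f : circle R -> R[i]) : nice g a b M -> covers theta b L ->
  Linfty f ->
  \sum_j cintegral leb (fun x => g j x * (f (expNi (x + theta j)) * ph j x)^*) =
  cintegral leb (fun y => (wn 0 (2 * pi) y)%:C * (overlap L g y * (f (expNi y))^*)).
Proof.
move=> ng cov Lf.
have bf j : ae_bounded (fun x => (f (expNi (x + theta j)))^*).
  apply: ae_bounded_conj; have := Linfty_ae_bounded (Linfty_shift (expNi (theta j)) Lf).
  by congr ae_bounded; apply/funext => x; rewrite -expNiD addrC.
pose k j x := g j x * (f (expNi (x + theta j)) * ph j x)^*.
have ck j : compact_sqint (k j).
  have h1 : compact_sqint (fun x => (ph j x)^* * g j x).
    apply: (@compact_sqintM _ 1) => [|x|]; last exact: nice_compact ng.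
      by apply: cmeasurable_conj; exact: cmeasurable_ph.
    by rewrite sqn_conj (sqn_ph_le1 lp cs).
  have := compact_mul_ae (bf j) h1; congr compact_sqint; apply/funext => x.
  by rewrite /k rmorphM/= mulrA mulrC.
have [] := arg_unfold cov ck.
  move=> j x kx; have /(nice_supp ng)/andP[] // : g j x != 0.
  by apply: contraNneq kx => gx; rewrite /k gx mul0r.
move=> _ ->; congr cintegral; apply/funext => y; congr (_ * _).
rewrite mulr_suml; apply: eq_bigr => p _.
have e : expNi (arg p y + theta p.1) = expNi y.
  by rewrite -[RHS](expNi_periodic _ p.2) /arg; congr expNi; ring.
by rewrite /k e rmorphM/= [X in _ * X]mulrC mulrA.
Qed.

Lemma esum_args L b (h : J -> R -> R) y : covers theta b L -> 0 <= y < 2 * pi ->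
  (forall j x, 0 <= h j x) -> (forall j x, h j x != 0 -> `|x| <= b) ->
  (\esum_(p in [set: J * int]) (h p.1 (arg p y))%:E = (\sum_(p <- args L) h p.1 (arg p y))%:E)%E.
Proof.
move=> cov y02 h0 hb; apply/eqP; rewrite eq_le; apply/andP; split; last first.
  by apply: (@esum_seq_le _ _ (fun p => h p.1 (arg p y))) => //; exact: args_uniq.
apply: (esum_le_seq (a := fun p => h p.1 (arg p y))) => s us; rewrite lee_fin.
rewrite (bigID (fun p => p \in args L))/= [X in _ + X]big1 ?addr0; last first.
  move=> [j l] /negP pL; apply: contrapT => /eqP /hb hp; apply: pL; apply: mem_args.
  apply: (covers_index (j := j) (x := y + 2 * pi * l%:~R) cov); last by rewrite addrK.
  by move: hp; rewrite /arg /= addrAC.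
rewrite -big_filter; apply: ler_sum_subseq => //; first exact: filter_uniq.
  exact: args_uniq.
by move=> p; rewrite mem_filter => /andP[].
Qed.

Lemma nice_norm L g a b M : nice g a b M -> covers theta b L ->
  (\sum_j \int[leb]_x (sqn (g j x))%:E =
   \int[leb]_y (wn 0 (2 * pi) y * \sum_(p <- args L) sqn (g p.1 (arg p y)))%:E)%E.
Proof.
move=> ng cov.
rewrite -(arg_integral theta (fun j => measurable_sqn (nice_meas ng j)) (fun j x => sqn_ge0 _)).
apply: eq_integral => y _; rewrite EFinM.
have [y02|/wn_out ->] := boolP (0 <= y < 2 * pi); last by rewrite !mul0e.
congr (_ * _)%E; apply: (esum_args (h := fun j x => sqn (g j x)) cov y02) => j x; first exact: sqn_ge0.
move=> gx; have /(nice_supp ng)/andP[] // : g j x != 0.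
by apply: contraNneq gx => ->; rewrite sqn0.
Qed.

(** Within radius [d] the arguments are separated: for each [y] at most one index has a nonzero [g].
    The overlap is then a single product, and there [|ph|^2 >= 1 - e] because [ph] is continuous
    with value 1 at 0. *)
Lemma overlap_small (e : R) : 0 < e -> exists2 d : R, 0 < d & forall L g a b M y, nice g a b M -> b <= d ->
  (1 - e) * \sum_(p <- args L) sqn (g p.1 (arg p y)) <= sqn (overlap L g y).
Proof.
move=> e0; have pp := twopi_gt0 R; have [c c0 hc] := cs_gap cs.
have /choice[r hr] j : exists r : R, 0 < r /\ forall x, `|x| <= r -> 1 - e <= sqn (ph j x).
  have := @continuous_sqn_ph _ _ _ _ lp _ _ _ cs j 0.
  move=> /cvgrPdist_lt/(_ e e0)/nbhs_ballP[r /= r0 hr]; exists (r / 2); split; first by rewrite divr_gt0.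
  move=> x xr; have := hr x; rewrite -ball_normE/= sub0r normrN => /(_ _)/wrap[].
    by apply: le_lt_trans xr _; rewrite ltr_pdivrMr// ltr_pMr// ltr1n.
  by rewrite (ph0 lp cs) sqn1 => /(le_lt_trans (ler_norm _)); lra.
(* The three bounds serve respectively for [|ph|^2 >= 1 - e], for separating distinct cycle points,
   and for separating translates by multiples of [2 pi]. *)
pose d := Num.min (\big[Num.min/1]_j r j) (Num.min (Num.sqrt c / 4) (pi / 2)).
have dr j : d <= r j by rewrite /d ge_min (bigminD1 j)//= ge_min lexx.
have d0 : 0 < d.
  rewrite /d !lt_min !divr_gt0 ?sqrtr_gt0 ?pi_gt0//= andbT.
  by elim/big_ind: _ => //= [x y x0 y0|j _]; [rewrite lt_min x0|have [] := hr j].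
have dc : (2 * d) ^+ 2 < c.
  have h : d <= Num.sqrt c / 4 by rewrite /d !ge_min lexx orbT.
  have s0 : 0 < Num.sqrt c by rewrite sqrtr_gt0.
  rewrite -(sqr_sqrtr (ltW c0)) ltr_sqr ?nnegrE ?mulr_ge0 ?(ltW d0) ?(ltW s0)//; lra.
have dp : 2 * d < 2 * pi.
  have h : d <= pi / 2 by rewrite /d !ge_min lexx !orbT.
  have := pi_gt0 R; lra.
exists d => // L g a b M y ng bd.
have uniq_p p q : g p.1 (arg p y) != 0 -> g q.1 (arg q y) != 0 -> p = q.
  move=> /(nice_supp ng)/andP[_ hp] /(nice_supp ng)/andP[_ hq].
  have hpq : `|arg p y - arg q y| <= 2 * d.
    apply: le_trans (ler_normB _ _) _; have := le_trans hp bd; have := le_trans hq bd; lra.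
  have e1 : p.1 = q.1.
    apply/eqP; apply: contrapT => /negP /hc; apply/negP; rewrite -ltNge.
    have ep (t : J * int) : expNi (theta t.1) = expNi (y - arg t y).
      by rewrite -[RHS](expNi_periodic _ t.2) /arg; congr expNi; ring.
    rewrite !ep; apply: le_lt_trans (expNi_dist _ _) (le_lt_trans _ dc).
    rewrite -(real_normK (num_real (_ - _))) ler_sqr ?nnegrE ?mulr_ge0 ?(ltW d0)//.
    by rewrite (_ : _ - _ = arg q y - arg p y) 1?distrC//; ring.
  rewrite [p]surjective_pairing [q]surjective_pairing -e1; congr (_, _); apply/eqP.
  rewrite -subr_eq0; apply: contrapT => /negP l0.
  have : arg p y - arg q y = 2 * pi * (p.2 - q.2)%:~R by rewrite /arg e1 intrB; ring.
  move: hpq => /[swap] ->; rewrite normrM (gtr0_norm pp) => h.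
  have : (1 : R) <= `|(p.2 - q.2)%:~R| by rewrite -intr_norm -[1]/(1%:~R) ler_int; lia.
  move=> /(ler_wpM2l (ltW pp)); lra.
have [[p pL gp]|none] := pselect (exists2 p, p \in args L & g p.1 (arg p y) != 0); last first.
  rewrite big_seq big1 ?mulr0 ?sqn_ge0// => p pL.
  suff -> : g p.1 (arg p y) = 0 by rewrite sqn0.
  by apply: contrapT => /eqP h; apply: none; exists p.
have z q : q != p -> g q.1 (arg q y) = 0.
  by move=> qp; apply: contrapT => /eqP h; move/eqP: qp; apply; exact: uniq_p.
rewrite /overlap !(bigD1_seq p)//= ?args_uniq//.
rewrite [X in _ * (_ + X)]big1 => [|q /z ->]; last by rewrite sqn0.
rewrite [X in sqn (_ + X)]big1 => [|q /z ->]; last by rewrite mul0r.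
rewrite !addr0 sqnM sqn_conj mulrC ler_wpM2l ?sqn_ge0//.
have [_] := hr p.1; apply; have /(nice_supp ng)/andP[_ h] := gp.
exact: le_trans h (le_trans bd (dr _)).
Qed.

End overlap.

(* The Fourier side of a direct sum of the representations attached to cycles: [j] ranges
   over all the points of the cycles and [sigma] is the cyclic successor. *)
Record fourier_model (R : realType) (N : nat) (m0 : circle R -> R[i]) (J : finType)
    (theta : J -> R) (tau sigma : J -> J) (H : innerProductType R) (W : wavelet_data H)
    (F : H -> J -> L2 (@lebesgue_measure R)) : Prop := {
  fm_rep : wavelet_representation N W;
  fm_sigma : forall j, tau (sigma j) = j;
  fm_tau : forall j, sigma (tau j) = j;
  fm_lin : forall a u v j, F (a *: u + v) j = a *: F u j + F v j;
  fm_dot : forall u v, \sum_j dot (F u j) (F v j) = (2 * pi)%:C * dot u v;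
  fm_surj : forall x : J -> L2 (@lebesgue_measure R), exists v, forall j, F v j = x j;
  fm_U : forall v j, F (wU W v) j = alp N m0 theta j *: dil N%:R (F v (sigma j));
  fm_pi : forall f v j, Linfty f ->
    F (wpi W f v) j = mulL2 (fun x => f (expNi (x + theta j))) (F v j) }.

(** * The quadratic form on the Fourier side *)

Section model.
Context {R : realType}.
Local Notation leb := (@lebesgue_measure R).
Variables (N : nat) (m0 : circle R -> R[i]) (K : R).
Hypothesis lp : lowpass N m0 K.
Variables (J : finType) (theta : J -> R) (tau : J -> J).
Hypothesis cs : csystem N m0 theta tau.
Local Notation ph := (ph N m0 theta tau).
Local Notation arg := (arg theta).
Local Notation args := (@args J).
Local Notation overlap := (overlap N m0 theta tau).
Variables (sigma : J -> J) (H : innerProductType R) (W : wavelet_data H).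
Variable F : H -> J -> L2 leb.
Hypothesis fm : fourier_model N m0 theta tau sigma W F.
Variable phi : H.
Hypothesis phiF : forall j, F phi j = to_L2 leb (ph j).
Implicit Types (u v : H) (a b M : R) (L : nat) (f : circle R -> R[i]).

Let Np : 0 < N%:R :> R. Proof. by rewrite ltr0n; have := lp_N2 lp; case: N. Qed.
Let pp := twopi_gt0 R.

Lemma fm_norm v : 2 * pi * hn v ^+ 2 = \sum_j hn (F v j) ^+ 2.
Proof.
have := fm_dot fm v v; rewrite dotuu -rmorphM/= => /(congr1 (@complex.Re R)) /= <-.
by rewrite raddf_sum/=; apply: eq_bigr => j _; rewrite hn2E.
Qed.

Lemma fm_sub u v j : F (u - v) j = F u j - F v j.
Proof. by have := fm_lin fm (-1) v u j; rewrite !scaleN1r addrC [RHS]addrC. Qed.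

Lemma fm_inj u v : (forall j, F u j = F v j) -> u = v.
Proof.
move=> h; apply/eqP; rewrite -subr_eq0; apply/eqP/hn_eq0.
have := fm_norm (u - v); rewrite big1 => [|j _]; last first.
  by rewrite fm_sub h subrr hn0 expr0n.
by move=> /eqP; rewrite mulf_eq0 (negbTE (twopi_neq0 R))/= sqrf_eq0 => /eqP.
Qed.

Lemma phi_fm_norm : ((2 * pi * hn phi ^+ 2)%:E = \sum_j \int[leb]_x (sqn (ph j x))%:E)%E.
Proof.
rewrite fm_norm -sumEFin; apply: eq_bigr => j _.
by rewrite phiF -hn2_to_L2//; exact: (sqint_ph lp cs).
Qed.

Definition nicev v a b M := exists2 g, nice g a b M & forall j, F v j = to_L2 leb (g j).

Lemma covers_ex b : exists L, covers theta b L.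
Proof.
pose c := b + \sum_j `|theta j| + 2 * pi.
have [L hL] : exists L : nat, c / (2 * pi) <= L%:R.
  exists (Num.bound `|c / (2 * pi)|).
  exact: le_trans (ler_norm _) (ltW (archi_boundP (normr_ge0 _))).
exists L => j; rewrite [leRHS]mulrC -ler_pdivrMr//; apply: le_trans hL; rewrite ler_pM2r ?invr_gt0//.
rewrite lerD2r lerD2l (bigD1 j)//= lerDl sumr_ge0//.
Qed.

Lemma nicev_pairing g v L a b M f : nice g a b M -> (forall j, F v j = to_L2 leb (g j)) ->
  covers theta b L -> Linfty f ->
  dot v (wpi W f phi) = (2 * pi)^-1%:C *
    cintegral leb (fun y => (wn 0 (2 * pi) y)%:C * (overlap L g y * (f (expNi y))^*)).
Proof.
move=> ng gF cov Lf.
rewrite -(overlap_pairing lp cs ng cov Lf).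
have -> : \sum_j cintegral leb (fun x => g j x * (f (expNi (x + theta j)) * ph j x)^*) =
    \sum_j dot (F v j) (F (wpi W f phi) j).
  apply: eq_bigr => j _.
  have bf : ae_bounded (fun x => f (expNi (x + theta j))).
    have := Linfty_ae_bounded (Linfty_shift (expNi (theta j)) Lf).
    by congr ae_bounded; apply/funext => x; rewrite -expNiD addrC.
  have sp := sqint_ph lp cs j.
  rewrite (fm_pi fm _ _ Lf) gF phiF (mulL2_to bf sp).
  by rewrite (dot_to_L2 (proj1 (nice_compact j ng)) (sqint_mulL2 bf sp)).
by rewrite (fm_dot fm) mulrA -rmorphM/= mulVf ?twopi_neq0// mul1r.
Qed.

Lemma Linfty_zkM k f : Linfty f -> Linfty (fun w => zk k w * f w).
Proof. by move=> Lf; apply: LinftyM => //; exact: Linfty_zk. Qed.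

(** Coefficients along the multiples of [P]: the value [P = 1] gives Q, and [P = N] one channel of
    the filter bank. *)
Lemma grid_sum g v L a b M f (P : nat) : nice g a b M -> (forall j, F v j = to_L2 leb (g j)) ->
  covers theta b L -> Linfty f -> (0 < P)%N ->
  (\esum_(k in [set: int]) (sqn (dot v (wpi W (fun w => zk (P%:Z * k) w * f w) phi)))%:E =
   ((2 * pi)^-1)%:E * \int[leb]_u (wn 0 (2 * pi) u * sqn (P%:R^-1%:C * \sum_(r < P)
     overlap L g ((u + 2 * pi * r%:R) / P%:R) * (f (expNi ((u + 2 * pi * r%:R) / P%:R)))^*)%R)%:E)%E.
Proof.
move=> ng gF cov Lf P0.
have bf := ae_bounded_conj (Linfty_ae_bounded Lf).
have cG : compact_sqint (fun y => (wn 0 (2 * pi) y)%:C * (overlap L g y * (f (expNi y))^*)).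
  have := compact_mul_ae bf (compact_overlap lp cs L ng).
  by congr compact_sqint; apply/funext => y; rewrite mulrC mulrA.
rewrite -(fold_parseval P0 cG); apply: eq_esum => k _.
rewrite (nicev_pairing ng gF cov (Linfty_zkM _ Lf)); do 2 congr (_ _); congr (_ * _).
congr cintegral; apply/funext => y; congr (_ * _).
by rewrite rmorphM/= zkE -mulrA; congr (_ * _); rewrite mulrC.
Qed.

(** These are the [T^k phi], see [shiftsE], written without iterated inverses. *)
Definition shifts (k : int) : H := wpi W (zk k) phi.

Lemma nicev_Qe g v L a b M : nice g a b M -> (forall j, F v j = to_L2 leb (g j)) ->
  covers theta b L ->
  (Qe shifts v = ((2 * pi)^-1)%:E * \int[leb]_y (wn 0 (2 * pi) y * sqn (overlap L g y))%:E)%E.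
Proof.
move=> ng gF cov; have := grid_sum ng gF cov (Linfty_cst 1) (ltn0Sn 0).
under eq_esum => k _.
  have -> : (fun w : circle R => zk (1%:Z * k) w * 1) = zk k.
    by apply/funext => w; rewrite mul1r mulr1.
  over.
rewrite /Qe => ->; congr (_ * _)%E; apply: eq_integral => y _; congr (_ * sqn _)%:E.
by rewrite big_ord1 mulr0 addr0 !divr1 invr1 !rmorph1 mul1r mulr1.
Qed.

Lemma nicev_hn g v L a b M : nice g a b M -> (forall j, F v j = to_L2 leb (g j)) ->
  covers theta b L -> ((hn v ^+ 2)%:E = ((2 * pi)^-1)%:E *
    \int[leb]_y (wn 0 (2 * pi) y * \sum_(p <- args L) sqn (g p.1 (arg p y)))%:E)%E.
Proof.
move=> ng gF cov; rewrite -(nice_norm ng cov).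
have -> : (\sum_j \int[leb]_x (sqn (g j x))%:E = (2 * pi * hn v ^+ 2)%:E)%E.
  rewrite fm_norm -sumEFin; apply: eq_bigr => j _.
  by rewrite gF -hn2_to_L2//; have [] := nice_compact j ng.
by rewrite -EFinM mulrA mulVf ?twopi_neq0// mul1r.
Qed.

Lemma measurable_wsqn (h : R -> R[i]) : cmeasurable (T := measurableTypeR R) h ->
  measurable_fun [set: R] (fun y => (wn 0 (2 * pi) y * sqn (h y))%:E).
Proof.
move=> mh; apply/measurable_EFinP; apply: measurable_funM; first exact: measurable_wn.
exact: measurable_sqn.
Qed.

Lemma measurable_wargs g L a b M : nice g a b M -> measurable_fun [set: R]
  (fun y => (wn 0 (2 * pi) y * \sum_(p <- args L) sqn (g p.1 (arg p y)))%:E).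
Proof.
move=> ng; apply/measurable_EFinP; apply: measurable_funM; first exact: measurable_wn.
apply: measurable_sum => p.
apply: (measurableT_comp (measurable_sqn (nice_meas ng p.1))); exact: measurable_arg.
Qed.

Lemma nicev_Qe_le v a b M : nicev v a b M -> (Qe shifts v <= (hn v ^+ 2)%:E)%E.
Proof.
move=> [g ng gF]; have [L cov] := covers_ex b.
rewrite (nicev_Qe ng gF cov) (nicev_hn ng gF cov) lee_wpmul2l ?lee_fin ?invr_ge0 ?(ltW pp)//.
apply: ge0_le_integral => //.
- by move=> y _; rewrite lee_fin mulr_ge0 ?wn_ge0 ?sqn_ge0.
- exact: measurable_wsqn (cmeasurable_overlap lp cs L ng).
- exact: measurable_wargs ng.
- by move=> y _; rewrite lee_fin ler_wpM2l ?wn_ge0// (overlap_le lp cs).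
Qed.

Lemma nicev_Qe_small (e : R) : 0 < e -> exists2 d : R, 0 < d & forall v a b M,
  nicev v a b M -> b <= d -> (((1 - e) * hn v ^+ 2)%:E <= Qe shifts v)%E.
Proof.
move=> e0; have [d d0 hd] := overlap_small lp cs e0; exists d => // v a b M nv bd.
have [e1|e1] := leP e 1; last first.
  apply: le_trans (Qe_ge0 _ _); rewrite lee_fin mulr_le0_ge0 ?sqr_ge0// subr_le0 ltW//.
move: nv => [g ng gF]; have [L cov] := covers_ex b.
rewrite (nicev_Qe ng gF cov) EFinM (nicev_hn ng gF cov) muleCA.
rewrite lee_wpmul2l ?lee_fin ?invr_ge0 ?(ltW pp)//.
have e10 : 0 <= 1 - e by rewrite subr_ge0.
rewrite -ge0_integralZl//; first last.
- by move=> y _; rewrite lee_fin mulr_ge0 ?wn_ge0 ?sumr_ge0// => p _; exact: sqn_ge0.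
- exact: measurable_wargs ng.
apply: ge0_le_integral => //.
- move=> y _; rewrite -EFinM lee_fin mulr_ge0// mulr_ge0 ?wn_ge0 ?sumr_ge0// => p _; exact: sqn_ge0.
- by apply: measurable_funeM; exact: measurable_wargs ng.
- exact: measurable_wsqn (cmeasurable_overlap lp cs L ng).
- move=> y _; rewrite -EFinM lee_fin mulrCA ler_wpM2l ?wn_ge0//; exact: hd ng bd.
Qed.

(** The number of indices and the bound [M] stay explicit: along the powers of the inverse of [U]
    one grows, the other decays, and [Qr_contract] needs them to compensate. *)
Lemma nicev_Qe_tail v L a b M : nicev v a b M -> covers theta b L -> 0 <= M ->
  (Qe shifts v <= ((2 * pi)^-1 * ((size (args L))%:R * M))%:E *
    \sum_j \int[leb]_x (if a <= `|x| then sqn (ph j x) else 0)%:E)%E.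
Proof.
move=> [g ng gF] cov M0.
rewrite (nicev_Qe ng gF cov) EFinM -muleA lee_wpmul2l ?lee_fin ?invr_ge0 ?(ltW pp)//.
pose h j x : R := if a <= `|x| then sqn (ph j x) else 0.
have hE j x : h j x = (a <= `|x|)%R%:R * sqn (ph j x) by rewrite /h; case: ifP => _; rewrite ?mul1r ?mul0r.
have mi : measurable_fun [set: R] (fun x : R => ((a <= `|x|)%R%:R : R)).
  have -> : (fun x : R => ((a <= `|x|)%R%:R : R)) = \1_([set x : R | a <= `|x|]).
    by apply/funext => x; rewrite indicE mem_setE.
  apply: measurable_indic; have := @normr_measurable R setT measurableT `[a, +oo[%classic (measurable_itv _).
  rewrite setTI; congr measurable; apply/seteqP; split => x /=; rewrite in_itv/= andbT//.
have mh j : measurable_fun [set: R] (h j).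
  have -> : h j = fun x => (a <= `|x|)%R%:R * sqn (ph j x) by apply/funext => x.
  by apply: measurable_funM => //; exact: (measurable_sqn_ph lp cs).
have h0 j x : 0 <= h j x by rewrite /h; case: ifP => // _; exact: sqn_ge0.
apply: le_trans (lee_wpmul2l _ (arg_le_integral theta L mh h0)); last first.
  by rewrite lee_fin mulr_ge0.
have ma p : measurable_fun [set: R] (fun y => h p.1 (arg p y)).
  apply: (measurableT_comp (mh p.1)); exact: measurable_arg.
have mw : measurable_fun [set: R] (fun y => (wn 0 (2 * pi) y * \sum_(p <- args L) h p.1 (arg p y))%:E).
  apply/measurable_EFinP; apply: measurable_funM; first exact: measurable_wn.
  exact: measurable_sum.
have w0 y : (0 <= (wn 0 (2 * pi) y * \sum_(p <- args L) h p.1 (arg p y))%:E)%E.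
  by rewrite lee_fin mulr_ge0 ?wn_ge0 ?sumr_ge0.
rewrite -ge0_integralZl//; last by rewrite lee_fin mulr_ge0.
apply: ge0_le_integral => //.
- by move=> y _; rewrite lee_fin mulr_ge0 ?wn_ge0 ?sqn_ge0.
- exact: measurable_wsqn (cmeasurable_overlap lp cs L ng).
- exact: measurable_funeM.
- move=> y _; rewrite -EFinM lee_fin mulrCA ler_wpM2l ?wn_ge0//.
  exact: overlap_tail ng.
Qed.

End model.

(** * Dilations *)
Section model_dilations.
Context {R : realType}.
Local Notation leb := (@lebesgue_measure R).
Variables (N : nat) (m0 : circle R -> R[i]) (K : R).
Hypothesis lp : lowpass N m0 K.
Variables (J : finType) (theta : J -> R) (tau : J -> J).
Hypothesis cs : csystem N m0 theta tau.
Local Notation ph := (ph N m0 theta tau).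
Variables (sigma : J -> J) (H : innerProductType R) (W : wavelet_data H).
Variable F : H -> J -> L2 leb.
Hypothesis fm : fourier_model N m0 theta tau sigma W F.
Variable phi : H.
Hypothesis phiF : forall j, F phi j = to_L2 leb (ph j).
Implicit Types (u v : H) (a b M : R) (L : nat) (f : circle R -> R[i]).
Local Notation nicev := (nicev F).
Local Notation shifts := (shifts W phi).

Let uU := wavelet_unitary (fm_rep fm).
Let Np : 0 < N%:R :> R. Proof. by rewrite ltr0n; have := lp_N2 lp; case: N. Qed.
Let N0 : (0 < N)%N. Proof. by have := lp_N2 lp; case: N. Qed.
Let pp := twopi_gt0 R.

Lemma nice_dil (g : J -> R -> R[i]) (c : J -> R[i]) (s : J -> J) (t a b M : R) : 0 < t ->
  (forall j, sqn (c j) = 1) -> nice g a b M ->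
  nice (fun j x => c j * ((Num.sqrt t)%:C * g (s j) (t * x))) (a / t) (b / t) (t * M).
Proof.
move=> t0 c1 ng; split.
- move=> j; apply: cmeasurableM; first exact: cmeasurable_cst.
  apply: cmeasurableM; first exact: cmeasurable_cst.
  by have := cmeasurable_affine t 0 (nice_meas ng (s j)); under eq_fun do rewrite addr0.
- move=> j x; rewrite !sqnM c1 mul1r sqn_real sqr_sqrtr ?(ltW t0)// ler_wpM2l ?(ltW t0)//.
  exact: nice_bound ng _ _.
- move=> j x h; have /(nice_supp ng) : g (s j) (t * x) != 0.
    by apply: contraNneq h => ->; rewrite !mulr0.
  by rewrite normrM (gtr0_norm t0) ler_pdivrMr// ler_pdivlMr// [`|x| * t]mulrC.
Qed.

Lemma dil_nice (g : J -> R -> R[i]) (c : R[i]) (t a b M : R) j : 0 < t -> nice g a b M ->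
  c *: dil t (to_L2 leb (g j)) = to_L2 leb (fun x => c * ((Num.sqrt t)%:C * g j (t * x))).
Proof.
move=> t0 ng; have sg := proj1 (nice_compact j ng).
exact: (etrans (congr1 (fun x => c *: x) (dil_to t0 sg)) (esym (proj2 (to_L2Z c (sqint_scaled t0 sg))))).
Qed.

Lemma nicev_U v a b M : nicev v a b M -> nicev (wU W v) (a / N%:R) (b / N%:R) (N%:R * M).
Proof.
move=> [g ng gF]; exists (fun j x => alp N m0 theta j * ((Num.sqrt N%:R)%:C * g (sigma j) (N%:R * x))).
  exact: nice_dil (sqn_alp lp cs) ng.
move=> j; apply: (etrans (fm_U fm v j)).
exact: (etrans (congr1 (fun x => alp N m0 theta j *: dil N%:R x) (gF (sigma j))) (dil_nice _ _ Np ng)).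
Qed.

Lemma nicev_Uinv v a b M : nicev v a b M ->
  nicev (op_inv (wU W) v) (a * N%:R) (b * N%:R) (N%:R^-1 * M).
Proof.
move=> [g ng gF]; have Nip : 0 < (N%:R^-1 : R) by rewrite invr_gt0.
exists (fun j x => (alp N m0 theta (tau j))^* * ((Num.sqrt N%:R^-1)%:C * g (tau j) (N%:R^-1 * x))).
  have := nice_dil tau (c := fun j => (alp N m0 theta (tau j))^*) Nip _ ng.
  by rewrite !invrK; apply => j; rewrite sqn_conj (sqn_alp lp cs).
move=> j; have := fm_U fm (op_inv (wU W) v) (tau j).
rewrite (op_invK uU) (fm_tau fm) gF => h.
apply: esym; apply: (etrans (esym (dil_nice _ _ Nip ng))).
rewrite h (linear_opZ _ _ (dil_linear Nip)) scalerA mulrC mul_conjc_sqn (sqn_alp lp cs) scale1r.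
have := dilVK (F (op_inv (wU W) v) j) Nip; rewrite invrK; exact.
Qed.

Lemma nicev_iterU n v a b M : nicev v a b M ->
  nicev (iter n (wU W) v) (a / N%:R ^+ n) (b / N%:R ^+ n) (N%:R ^+ n * M).
Proof.
move=> nv; elim: n => [|n IH]; first by rewrite expr0 !divr1 mul1r.
have := nicev_U IH; rewrite !exprSr !invfM -!mulrA [_^-1 * (N%:R)^-1]mulrC.
by rewrite [X in nicev _ _ _ X]mulrCA.
Qed.

Lemma nicev_iterUinv n v a b M : nicev v a b M ->
  nicev (iter n (op_inv (wU W)) v) (a * N%:R ^+ n) (b * N%:R ^+ n) ((N%:R ^+ n)^-1 * M).
Proof.
move=> nv; elim: n => [|n IH]; first by rewrite expr0 !mulr1 invr1 mul1r.
have := nicev_Uinv IH; rewrite !exprSr !invfM -!mulrA.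
by rewrite [X in nicev _ _ _ X]mulrCA [X in nicev _ _ _ X]mulrCA.
Qed.

(** The dense class on which identities are proved; it is stable under all powers of [U]
    ([nicevs_expz]), and [0 < a] keeps the supports away from 0. *)
Definition nicevs : set H := [set v | exists a b M, [/\ 0 < a, 0 <= M & nicev v a b M]].

(** Each component is cut off near 0, near infinity and where it is large. The result converges at
    every nonzero point, and dominated convergence applies. *)
Lemma dense_nicev : dense_in nicevs.
Proof.
move=> v eps e0.
pose f j : R -> R[i] := F v j.
have sf j : square_integrable leb (f j) by exact: L2_sqint.
pose t n j x := (n.+1%:R^-1 <= `|x|) && (`|x| <= n.+1%:R) && (sqn (f j x) <= n.+1%:R).
pose g n j x := if t n j x then f j x else 0.
have mt n j : measurable_fun [set: R] (t n j).
  apply: measurable_and; last first.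
    by apply: measurable_fun_ler => //; exact: measurable_sqn (proj1 (sf j)).
  by apply: measurable_and; apply: measurable_fun_ler => //; exact: normr_measurable.
have mg n j : cmeasurable (T := measurableTypeR R) (g n j).
  have [m1 m2] := proj1 (sf j); split.
    have -> : (fun x => complex.Re (g n j x)) = (fun x => if t n j x then complex.Re (f j x) else 0).
      by apply/funext => x; rewrite /g; case: ifP.
    exact: (measurable_fun_ifT (mt n j) m1 (measurable_cst _)).
  have -> : (fun x => complex.Im (g n j x)) = (fun x => if t n j x then complex.Im (f j x) else 0).
    by apply/funext => x; rewrite /g; case: ifP.
  exact: (measurable_fun_ifT (mt n j) m2 (measurable_cst _)).
have ng n : nice (g n) n.+1%:R^-1 n.+1%:R n.+1%:R.
  split => // j x; rewrite /g /t; case: ifPn => [/andP[h1 h2]|_]; rewrite ?sqn0 ?eqxx//.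
have sg n j : square_integrable leb (g n j) by have [] := nice_compact j (ng n).
have cg j : (fun n => to_L2 leb (g n j) : L2 leb) @ \oo --> F v j.
  rewrite -[X in _ --> X](to_L2K (F v j)).
  refine (L2_cvg_dct (mu := leb) (f_ := fun n => g n j) (f := f j) (g := fun x => sqn (f j x)) _ (sf j) _ _ _).
  - by move=> n; exact: sg.
  - exact: sqint_integrable.
  - by move=> n x; rewrite /g; case: ifP => _; rewrite ?subrr ?sqn0 ?sqn_ge0// sub0r sqnN.
  have x0 : \forall x \ae leb, x != 0.
    exists [set 0]; split; [exact: measurable_set1|exact: lebesgue_measure_set1|].
    by move=> x /= /negP; rewrite negbK => /eqP.
  apply: (ae_imp x0) => x xn0.
  apply/cvgrPdist_lt => e e1.
  pose m := (Num.bound `|x| + (Num.bound `|x|^-1 + Num.bound (sqn (f j x))))%N.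
  exists m => // n /= mn.
  have ge (y : R) (k : nat) : 0 <= y -> (Num.bound y <= m)%N -> y <= n.+1%:R.
    move=> y0 ym; apply: ltW; apply: lt_le_trans (archi_boundP y0) _.
    by rewrite ler_nat (leq_trans ym)// (leq_trans mn).
  have xp : 0 < `|x| by rewrite normr_gt0.
  have -> : g n j x = f j x.
    rewrite /g /t ifT// -andbA; apply/and3P; split.
    - rewrite -[`|x|]invrK lef_pV2 ?posrE ?invr_gt0//; apply: ge => //; rewrite ?invr_ge0//.
      by rewrite /m addnCA leq_addr.
    - by apply: ge => //; rewrite /m leq_addr.
    - by apply: ge => //; [exact: sqn_ge0|rewrite /m addnA leq_addl].
  by rewrite subrr sqn0 subrr normr0.
have /choice[w hw] n : exists w, forall j, F w j = to_L2 leb (g n j) by exact: (fm_surj fm).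
have hc : hn (v - w n) ^+ 2 @[n --> \oo] --> (0 : R).
  have -> : (fun n => hn (v - w n) ^+ 2) =
      (fun n => (2 * pi)^-1 * \sum_j hn (F v j - to_L2 leb (g n j)) ^+ 2).
    apply/funext => n; have := fm_norm fm (v - w n) => h.
    have h2 : \sum_j hn (F (v - w n) j) ^+ 2 = \sum_j hn (F v j - to_L2 leb (g n j)) ^+ 2.
      apply: eq_bigr => j _.
      exact: (congr1 (fun x => hn x ^+ 2) (etrans (fm_sub fm v (w n) j) (congr1 (fun x => F v j - x) (hw n j)))).
    by rewrite -h2 -h mulrA mulVf ?twopi_neq0// mul1r.
  rewrite -[0 in X in _ --> X](mulr0 (2 * pi)^-1); apply: cvgM; first exact: cvg_cst.
  apply: cvg_sum0 => j; have /cvg_hnP/cvg_sq := cg j; rewrite expr0n => h.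
  have -> : (fun n => hn (F v j - to_L2 leb (g n j)) ^+ 2) = (fun n => hn (to_L2 leb (g n j) - F v j) ^+ 2).
    by apply/funext => n; exact: (congr1 (fun x => x ^+ 2) (hnBC _ _)).
  exact: h.
move/cvgrPdist_lt : hc => /(_ _ (exprn_gt0 2 e0))[n _ /(_ n (leqnn n))] /=.
rewrite sub0r normrN ger0_norm ?sqr_ge0// ltr_pXn2r ?nnegrE ?hn_ge0 ?(ltW e0)// => h.
exists (w n) => //; exists n.+1%:R^-1, n.+1%:R, n.+1%:R; split; rewrite ?invr_gt0//.
by exists (g n).
Qed.

Lemma Qe_shifts_le v : (Qe shifts v <= (hn v ^+ 2)%:E)%E.
Proof.
apply: (Qe_bounded dense_nicev) => w [a [b [M [_ _ nw]]]].
exact: (nicev_Qe_le lp cs fm phiF nw).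
Qed.

(** Each application of [U] divides the radius of the Fourier support by [N] and preserves the norm,
    so [nicev_Qe_small] eventually applies. *)
Lemma Qr_expand v : nicevs v -> forall e : R, 0 < e ->
  \forall n \near \oo, (1 - e) * hn v ^+ 2 <= Qr shifts (iter n (wU W) v).
Proof.
move=> [a [b [M [a0 M0 nv]]]] e e0; have [d d0 hd] := nicev_Qe_small lp cs fm phiF e0.
have bN : b * N%:R^-1 ^+ n @[n --> \oo] --> (0 : R).
  rewrite -[0 in X in _ --> X](mulr0 b); apply: cvgM; first exact: cvg_cst.
  apply: cvg_expr; rewrite ger0_norm ?invr_ge0 ?(ltW Np)// invf_lt1// ltr1n.
  by have := lp_N2 lp.
move/cvgrPdist_lt : bN => /(_ _ d0); apply: filterS => n; rewrite sub0r normrN => h.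
have hi : hn (iter n (wU W) v) = hn v by elim: (n) => //= k; rewrite (unitary_hn uU).
rewrite -lee_fin -(QeE Qe_shifts_le) -hi.
apply: hd (nicev_iterU n nv) _; rewrite -exprVn; apply: le_trans (ler_norm _) (ltW h).
Qed.

Lemma cvg_ph_tail (d : R) : 0 < d -> exists r : R, forall a, r < a ->
  (\sum_j \int[leb]_x (if a <= `|x| then sqn (ph j x) else 0)%:E <= d%:E)%E.
Proof.
move=> d0; pose u j : L2 leb := to_L2 leb (ph j).
have hu : \sum_j hn (u j - to_L2 leb (trunc n (u j))) ^+ 2 @[n --> \oo] --> (0 : R).
  apply: cvg_sum0 => j; have /cvg_hnP/cvg_sq := @trunc_cvg R (u j); rewrite expr0n => h.
  have -> : (fun n => hn (u j - to_L2 leb (trunc n (u j))) ^+ 2) = (fun n => hn (to_L2 leb (trunc n (u j)) - u j) ^+ 2).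
    by apply/funext => n; exact: (congr1 (fun x => x ^+ 2) (hnBC _ _)).
  exact: h.
move/cvgrPdist_lt : hu => /(_ _ d0)[n _ /(_ n (leqnn n))] /=.
rewrite sub0r normrN ger0_norm ?sumr_ge0// => [hn_d|j _]; last exact: sqr_ge0.
exists n%:R => a na; apply: le_trans (_ : (_ <= (\sum_j hn (u j - to_L2 leb (trunc n (u j))) ^+ 2)%:E)%E) _; last first.
  by rewrite lee_fin ltW.
rewrite -sumEFin; apply: lee_sum => j _.
have su : square_integrable leb (u j) by exact: L2_sqint.
have [st e] := to_L2B su (proj1 (trunc_compact n su)).
rewrite to_L2K in e.
have -> : hn (u j - to_L2 leb (trunc n (u j))) ^+ 2 = hn (to_L2 leb (fun x => u j x - trunc n (u j) x) : L2 leb) ^+ 2.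
  by rewrite e.
rewrite -hn2_to_L2//.
apply: ae_ge0_le_integral => //.
- by move=> x _; case: ifP => _; rewrite lee_fin ?sqn_ge0.
- apply/measurable_EFinP; apply: measurable_fun_ifT => //; last exact: (measurable_sqn_ph lp cs).
  by apply: measurable_fun_ler => //; exact: normr_measurable.
- by move=> x _; rewrite lee_fin sqn_ge0.
- by apply/measurable_EFinP; exact: measurable_sqn (proj1 st).
- apply: (ae_imp (to_L2E (sqint_ph lp cs j))) => x ux _.
  rewrite lee_fin -/(u j) /trunc; case: ifPn => [ax|_]; last exact: sqn_ge0.
  by rewrite ifF ?subr0 ?ux//; apply/negbTE; rewrite -ltNge (lt_le_trans na).
Qed.

(** The inverse of [U] pushes the Fourier support beyond any radius, where little of the integral of
    [|ph|^2] is left. *)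
Lemma Qr_contract v : nicevs v -> forall e : R, 0 < e ->
  \forall n \near \oo, Qr shifts (iter n (op_inv (wU W)) v) <= e.
Proof.
move=> [a [b [M [a0 M0 nv]]]] e e0.
have [L cov] := covers_ex theta b.
have N1 n : 1 <= N%:R ^+ n :> R by rewrite exprn_ege1// ler1n.
have covn n : covers theta (b * N%:R ^+ n) (L * N ^ n).
  move=> j; have := cov j; have := N1 n; rewrite natrM natrX; set t := N%:R ^+ n => t1 h.
  have t0 : 0 <= t by exact: le_trans ler01 t1.
  have := ler_wpM2r t0 h; rewrite mulrA => h'; apply: le_trans h'.
  have q0 : 0 <= (`|theta j| + 2 * pi) * (t - 1) by rewrite mulr_ge0 ?subr_ge0 ?addr_ge0 ?(ltW pp).
  rewrite -subr_ge0; have -> // : (b + `|theta j| + 2 * pi) * t - (b * t + `|theta j| + 2 * pi) =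
    (`|theta j| + 2 * pi) * (t - 1) by ring.
(* The number of indices grows like [N^n] while the bound of the square modulus decays like [N^-n];
   [C] controls their product uniformly in [n]. *)
pose C := (2 * pi)^-1 * (#|J|%:R * (2 * L%:R + 1) * M).
have ip : 0 <= (2 * pi)^-1 :> R by rewrite invr_ge0 ltW.
have C0 : 0 <= C by rewrite /C mulr_ge0// mulr_ge0// mulr_ge0// addr_ge0// mulr_ge0.
have C1 : 0 < C + 1 by rewrite ltr_wpDl.
have [r hr] := cvg_ph_tail (divr_gt0 e0 C1).
have aN : \forall n \near \oo, r < a * N%:R ^+ n.
  have c : N%:R^-1 ^+ n @[n --> \oo] --> (0 : R).
    apply: cvg_expr; rewrite ger0_norm ?invr_ge0 ?(ltW Np)// invf_lt1// ltr1n.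
    by have := lp_N2 lp.
  have r1 : 0 < a / (`|r| + 1) by rewrite divr_gt0// ltr_wpDl.
  move/cvgrPdist_lt : c => /(_ _ r1); apply: filterS => n.
  have tp : 0 < N%:R ^+ n :> R by exact: lt_le_trans ltr01 (N1 n).
  rewrite sub0r normrN exprVn ger0_norm ?invr_ge0 ?(ltW tp)//.
  rewrite ltr_pdivlMr ?ltr_wpDl// mulrC ltr_pdivrMr//.
  by apply: le_lt_trans; have := ler_norm r; lra.
apply: filterS aN => n rn.
have tp : 0 < N%:R ^+ n :> R by exact: lt_le_trans ltr01 (N1 n).
rewrite -lee_fin -(QeE Qe_shifts_le).
have Mn0 : 0 <= (N%:R ^+ n)^-1 * M by rewrite mulr_ge0// invr_ge0 ltW.
apply: le_trans (nicev_Qe_tail lp cs fm phiF (nicev_iterUinv n nv) (covn n) Mn0) _.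
have {}hr := hr _ rn.
apply: le_trans (lee_wpmul2l _ hr) _.
  by rewrite lee_fin mulr_ge0// mulr_ge0.
rewrite -EFinM lee_fin.
apply: (@le_trans _ _ (C * (e / (C + 1)))); last first.
  by rewrite mulrCA ger_pMr// ler_pdivrMr// mul1r lerDl.
rewrite ler_wpM2r ?(ltW (divr_gt0 e0 C1))// /C ler_wpM2l ?invr_ge0 ?(ltW pp)//.
rewrite size_args mulrA ler_wpM2r//.
rewrite natrM -mulrA ler_wpM2l// ler_pdivrMr//.
have -> : (2 * (L * N ^ n)).+1%:R = 2 * (L%:R * N%:R ^+ n) + 1 :> R by rewrite -natr1 !natrM natrX.
have -> : (2 * L%:R + 1) * N%:R ^+ n = 2 * (L%:R * N%:R ^+ n) + N%:R ^+ n :> R by ring.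
by rewrite lerD2l.
Qed.

End model_dilations.

(** Unitarity is orthonormality of the rows; for a square matrix it gives that of the columns, which
    is what the expanded square uses. *)
Lemma unitary_columns (R : realType) n (A : 'M[R[i]]_n) (x : 'I_n -> R[i]) : A \is unitarymx ->
  \sum_i sqn (\sum_j x j * (A i j)^*) = \sum_j sqn (x j).
Proof.
move=> /unitarymxP /mulmx1C h.
have hE j k : \sum_i (A i j)^* * A i k = (j == k)%:R.
  move/matrixP: h => /(_ j k); rewrite !mxE => <-.
  by apply: eq_bigr => i _; rewrite !mxE.
suff : (\sum_i sqn (\sum_j x j * (A i j)^*))%:C = (\sum_j sqn (x j))%:C by case.
rewrite !rmorph_sum/=.
transitivity (\sum_i \sum_j \sum_k x j * (x k)^* * ((A i j)^* * A i k)).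
  apply: eq_bigr => i _; rewrite -mul_conjc_sqn rmorph_sum/= mulr_suml; apply: eq_bigr => j _.
  by rewrite mulr_sumr; apply: eq_bigr => k _; rewrite rmorphM/= conjCK; ring.
rewrite exchange_big/=; apply: eq_bigr => j _; rewrite exchange_big/= (bigD1 j)//= [X in _ + X]big1 ?addr0.
  by rewrite -mulr_sumr hE eqxx mulr1 mul_conjc_sqn.
by move=> k kj; rewrite -mulr_sumr hE eq_sym (negbTE kj) mulr0.
Qed.

(** * The filter bank *)

Section filter_bank.
Context {R : realType}.
Local Notation leb := (@lebesgue_measure R).
Variables (N : nat) (m0 : circle R -> R[i]) (K : R).
Hypothesis lp : lowpass N m0 K.
Variables (J : finType) (theta : J -> R) (tau : J -> J).
Hypothesis cs : csystem N m0 theta tau.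
Local Notation ph := (ph N m0 theta tau).
Local Notation overlap := (overlap N m0 theta tau).
Variables (sigma : J -> J) (H : innerProductType R) (W : wavelet_data H).
Variable F : H -> J -> L2 leb.
Hypothesis fm : fourier_model N m0 theta tau sigma W F.
Variable phi : H.
Hypothesis phiF : forall j, F phi j = to_L2 leb (ph j).
Implicit Types (u v : H) (a b M : R) (L : nat) (f : circle R -> R[i]).
Local Notation nicev := (nicev F).
Local Notation shifts := (shifts W phi).

Let rep := wavelet_rep (fm_rep fm).
Let uU := wavelet_unitary (fm_rep fm).
Let Np : 0 < N%:R :> R. Proof. by rewrite ltr0n; have := lp_N2 lp; case: N. Qed.
Let N0 : (0 < N)%N. Proof. by have := lp_N2 lp; case: N. Qed.
Let pp := twopi_gt0 R.

Lemma Linfty_m0 : Linfty m0.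
Proof.
split.
  apply: (@cmeasurable_lipschitz _ _ (K ^+ 2)) => x y.
  apply: le_trans (lp_L lp _ _) _; rewrite ler_wpM2l ?sqr_ge0//; exact: expNi_dist.
exists (Num.sqrt N%:R); apply: aeW => x; rewrite norm_normc lecR normcE ler_sqrt ?(ltW Np)//.
by have := qm0_le1 lp (expNi x); rewrite /qm0 ler_pdivrMr// mul1r.
Qed.

Lemma phi_scaling : wU W phi = wpi W m0 phi.
Proof.
apply: (fm_inj fm) => j.
have bf : ae_bounded (fun x => m0 (expNi (x + theta j))).
  have := Linfty_ae_bounded (Linfty_shift (expNi (theta j)) Linfty_m0).
  by congr ae_bounded; apply/funext => x; rewrite -expNiD addrC.
have sp := sqint_ph lp cs.
have sd := sqint_scaled Np (sp (sigma j)).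
have E : (fun x => alp N m0 theta j * ((Num.sqrt N%:R)%:C * ph (sigma j) (N%:R * x))) =
   (fun x => m0 (expNi (x + theta j)) * ph j x).
  apply/funext => x; rewrite (ph_refine lp cs) (fm_sigma fm) /fac.
  have -> : (Num.sqrt N%:R)%:C = sqrtN R N by [].
  have aa : alp N m0 theta j * (alp N m0 theta j)^* = 1 by rewrite mul_conjc_sqn (sqn_alp lp cs).
  have s0 := sqrtN_neq0 lp.
  have <- : alp N m0 theta j * (alp N m0 theta j)^* * (m0 (expNi (x + theta j)) * ph j x) =
      m0 (expNi (x + theta j)) * ph j x by rewrite aa mul1r.
  by field.
apply: (etrans (fm_U fm phi j)); apply: (etrans (congr1 (fun x => _ *: dil N%:R x) (phiF (sigma j)))).
apply: (etrans (congr1 (fun x => _ *: x) (dil_to Np (sp (sigma j))))).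
apply: (etrans (esym (proj2 (to_L2Z (alp N m0 theta j) sd)))).
apply: (etrans (congr1 (to_L2 leb) E)); apply: esym; apply: (etrans (fm_pi fm phi j Linfty_m0)).
exact: (etrans (congr1 (fun x => mulL2 _ x) (phiF j)) (mulL2_to bf (sp j))).
Qed.

Lemma zk_exp k (w : circle R) : zk k (circle_exp w N) = zk (N%:Z * k) w.
Proof.
have [x <-] := expNi_surj w; rewrite -expNiMn !zkE /ek intrM -pmulrn.
by rewrite [N%:R * k%:~R]mulrC mulrA.
Qed.

(** Covariance moves [z^k] across [U], where it becomes [z^(N k)]. *)
Lemma U_zk_wpi f v k : Linfty f ->
  wU W (wpi W (zk k) (op_inv (wU W) (wpi W f v))) = wpi W (fun w => zk (N%:Z * k) w * f w) v.
Proof.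
move=> Lf; rewrite (wavelet_covariant (fm_rep fm) (Linfty_zk k)).
have -> : (fun z : circle R => zk k (circle_exp z N)) = zk (N%:Z * k) by apply/funext => z; exact: zk_exp.
by rewrite -(rep_mul rep)//; exact: Linfty_zk.
Qed.

(** Since [U T^k phi = pi(z^(N k) m0) phi], the form at the inverse image of [v] is the channel of
    [m0]. *)
Lemma Qe_Uinv v : (Qe shifts (op_inv (wU W) v) = \esum_(k in [set: int])
  (sqn (dot v (wpi W (fun w => zk (N%:Z * k) w * m0 w) phi)))%:E)%E.
Proof.
apply: eq_esum => k _; congr (sqn _)%:E.
rewrite -(U_zk_wpi _ _ Linfty_m0) -phi_scaling (op_invKl uU) -[in RHS](op_invK uU v).
by have [_ -> _] := uU.
Qed.

Lemma cmeasurable_grid (f : R -> R[i]) (c : R) (P : nat) : cmeasurable (T := measurableTypeR R) f ->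
  cmeasurable (T := measurableTypeR R) (fun x : R => f ((x + c) / P%:R)).
Proof.
move=> mf; have := cmeasurable_affine (P%:R^-1) (c / P%:R) mf.
by congr cmeasurable; apply/funext => u; rewrite [_^-1 * _]mulrC -mulrDl.
Qed.

Definition grid_mean (g : J -> R -> R[i]) L f (P : nat) (u : R) : R[i] :=
  P%:R^-1%:C * \sum_(r < P) overlap L g ((u + 2 * pi * r%:R) / P%:R) *
    (f (expNi ((u + 2 * pi * r%:R) / P%:R)))^*.

Lemma cmeasurable_grid_mean g L f P a b M : nice g a b M -> Linfty f ->
  cmeasurable (T := measurableTypeR R) (grid_mean g L f P).
Proof.
move=> ng Lf; apply: cmeasurableM; first exact: cmeasurable_cst.
apply: cmeasurable_sum => r; apply: cmeasurableM.
  exact: cmeasurable_grid (cmeasurable_overlap lp cs L ng).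
apply: cmeasurable_conj; exact: (@cmeasurable_grid (fun y => f (expNi y)) _ _ (proj1 Lf)).
Qed.

Lemma integral_overlap_grid g L a b M : nice g a b M ->
  (\int[leb]_y (wn 0 (2 * pi) y * sqn (overlap L g y))%:E =
   \int[leb]_u (wn 0 (2 * pi) u *
    (N%:R^-1 * \sum_(r < N) sqn (overlap L g ((u + 2 * pi * r%:R) / N%:R))))%:E)%E.
Proof.
move=> ng; apply: (integral_grid (h := fun y => sqn (overlap L g y)) N0).
  exact: measurable_sqn (cmeasurable_overlap lp cs L ng).
by move=> y; exact: sqn_ge0.
Qed.

Lemma measurable_overlap_grid g L a b M : nice g a b M -> measurable_fun [set: R]
  (fun x : R => (wn 0 (2 * pi) x *
    (N%:R^-1 * \sum_(r < N) sqn (overlap L g ((x + 2 * pi * r%:R) / N%:R))))%:E).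
Proof.
move=> ng; apply/measurable_EFinP; apply: measurable_funM; first exact: measurable_wn.
apply: measurable_funM; first exact: measurable_cst.
apply: measurable_sum => r; apply: measurable_sqn.
exact: cmeasurable_grid (cmeasurable_overlap lp cs L ng).
Qed.

(** Cauchy-Schwarz over the [N] roots, with [sum |m0|^2 = N]. It involves [m0] alone, for use in the
    multiresolution analysis, where no completing filters are given. *)
Lemma nicev_Qe_Uinv_le v a b M : nicev v a b M ->
  (Qe shifts (op_inv (wU W) v) <= Qe shifts v)%E.
Proof.
move=> [g ng gF]; have [L cov] := covers_ex theta b.
rewrite Qe_Uinv (grid_sum lp cs fm phiF ng gF cov Linfty_m0 N0).
rewrite (nicev_Qe lp cs fm phiF ng gF cov) lee_wpmul2l ?lee_fin ?invr_ge0 ?(ltW pp)//.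
rewrite (integral_overlap_grid L ng).
apply: ge0_le_integral => //.
- by move=> u _; rewrite lee_fin mulr_ge0 ?wn_ge0 ?sqn_ge0.
- exact: measurable_wsqn (cmeasurable_grid_mean L N ng Linfty_m0).
- exact: measurable_overlap_grid ng.
- move=> u _; rewrite lee_fin ler_wpM2l ?wn_ge0// sqnM sqn_real.
  apply: le_trans (ler_wpM2l (sqr_ge0 _) (sqn_sum_CS _ _ _ _)) _.
  have -> : \sum_(r < N) sqn (m0 (expNi ((u + 2 * pi * r%:R) / N%:R)))^* = N%:R.
    by rewrite -[RHS](lp_R lp u); apply: eq_bigr => r _; rewrite sqn_conj.
  rewrite le_eqVlt; apply/orP; left; apply/eqP.
  by move: (\sum_(_ < _) _) (gt_eqF Np) => s /negbT n0; field.
Qed.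

(** For almost every [u], the grid sum of channel [i] is, up to the factor [sqrtN], the pairing of
    row [i] of the filter matrix with the vector of overlaps at the [N] roots; unitarity preserves
    the sum of squares. *)
Lemma filter_bank v a b M (m : nat -> circle R -> R[i]) : nicev v a b M ->
  (forall i : 'I_N, Linfty (m i)) ->
  circle_ae (fun w => filter_matrix N m w \is unitarymx) ->
  (Qe shifts v = \sum_(i < N) \esum_(k in [set: int])
    (sqn (dot v (wpi W (fun w => zk (N%:Z * k) w * m i w) phi)))%:E)%E.
Proof.
move=> [g ng gF] Lm um; have [L cov] := covers_ex theta b.
under eq_bigr do rewrite (grid_sum lp cs fm phiF ng gF cov (Lm _) N0).
rewrite (nicev_Qe lp cs fm phiF ng gF cov) (integral_overlap_grid L ng).
rewrite -ge0_sume_distrr; last first.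
  by move=> i _; apply: integral_ge0 => u _; rewrite lee_fin mulr_ge0 ?wn_ge0 ?sqn_ge0.
congr (_ * _)%E.
rewrite -ge0_integral_sum//; last 2 first.
- by move=> i; exact: measurable_wsqn (cmeasurable_grid_mean L N ng (Lm i)).
- by move=> i u _; rewrite lee_fin mulr_ge0 ?wn_ge0 ?sqn_ge0.
apply: ge0_ae_eq_integral => //.
- exact: measurable_overlap_grid ng.
- by apply: emeasurable_sum => i; exact: measurable_wsqn (cmeasurable_grid_mean L N ng (Lm i)).
- move=> u _; rewrite lee_fin mulr_ge0 ?wn_ge0// mulr_ge0 ?invr_ge0 ?(ltW Np)// sumr_ge0// => r _.
  exact: sqn_ge0.
- by move=> u _; apply: sume_ge0 => i _; rewrite lee_fin mulr_ge0 ?wn_ge0 ?sqn_ge0.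
have Nip : 0 < (N%:R^-1 : R) by rewrite invr_gt0.
(* The columns of the filter matrix run through angles that decrease by [2 pi / N]. Starting at the
   largest root [(u + 2 pi (N - 1)) / N], column [j] is the root of number [N - 1 - j], whence
   [rev_ord]. *)
have aff := ae_affine (2 * pi * N.-1%:R / N%:R) Nip um.
apply: (ae_imp aff) => u uu _; rewrite sumEFin -mulr_sumr; congr (_ * _)%:E.
have {uu} := unitary_columns (fun j : 'I_N => overlap L g ((u + 2 * pi * (rev_ord j)%:R) / N%:R)) uu.
rewrite [X in _ -> _ * X = _](reindex_inj rev_ord_inj)/= => <-.
rewrite mulr_sumr; apply: eq_bigr => i _; rewrite [in RHS](reindex_inj rev_ord_inj)/= [in RHS]sqnM sqn_real.
have -> : \sum_(j < N) overlap L g ((u + 2 * pi * (N - j.+1)%:R) / N%:R) *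
    (m i (expNi ((u + 2 * pi * (N - j.+1)%:R) / N%:R)))^* =
  sqrtN R N * \sum_(j < N) overlap L g ((u + 2 * pi * (N - j.+1)%:R) / N%:R) *
    (filter_matrix N m (expNi (N%:R^-1 * u + 2 * pi * N.-1%:R / N%:R)) i j)^*.
  rewrite mulr_sumr; apply: eq_bigr => j _; rewrite mxE -expNiMn -expNiD rmorphM/= mulrCA; congr (_ * _).
  have -> : (sqrtN R N)^-1^* = (sqrtN R N)^-1 by rewrite /sqrtN -fmorphV/= conjCR.
  rewrite mulVKf ?(sqrtN_neq0 lp)//; congr (m i (expNi _))^*.
  have jN := ltn_ord j; rewrite -subn1 !natrB//.
  by move: (gt_eqF Np) => /negbT n0; rewrite -natr1; field.
rewrite [in RHS]sqnM sqn_sqrtN mulrA; congr (_ * _).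
by move: (gt_eqF Np) => /negbT n0; field.
Qed.

End filter_bank.

(** Over [-M <= j <= M] the sum telescopes to [q (1 + M) - q (- M)], which tends to [c]; as the
    terms are nonnegative, these ranges exhaust the unordered sum. *)
Lemma esum_telescope (R : realType) (q : int -> R) (c : R) :
  (forall j, 0 <= q (1 - j) - q (- j)) -> (forall j, 0 <= q j <= c) ->
  (forall e, 0 < e -> \forall n \near \oo, c - e <= q n%:Z) ->
  (forall e, 0 < e -> \forall n \near \oo, q (- n%:Z) <= e) ->
  (\esum_(j in [set: int]) (q (1 - j) - q (- j))%:E = c%:E)%E.
Proof.
move=> q0 qc qp qn; pose s (M : nat) := [seq n%:Z - M%:Z | n <- iota 0 (2 * M).+1].
have us M : uniq (s M) by rewrite map_inj_uniq ?iota_uniq// => x y /addIr[].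
have sE M : \sum_(j <- s M) (q (1 - j) - q (- j)) = q (1 + M%:Z) - q (- M%:Z).
  rewrite big_map -[X in iota 0 X]subn0 -/(index_iota 0 (2 * M).+1).
  transitivity (\sum_(0 <= n < (2 * M).+1) (- q (1 + M%:Z - n.+1%:Z) - - q (1 + M%:Z - n%:Z))).
    by apply: eq_bigr => n _; rewrite [in RHS]opprK [RHS]addrC; congr (q _ - q _); lia.
  by rewrite telescope_sumr// opprK addrC; congr (q _ - q _); lia.
apply/eqP; rewrite eq_le; apply/andP; split.
  apply: (esum_le_seq (a := fun j => q (1 - j) - q (- j))) => t ut; rewrite lee_fin.
  pose M := \max_(j <- t) `|j|%N.
  apply: (@le_trans _ _ (\sum_(j <- s M) (q (1 - j) - q (- j)))).
    apply: ler_sum_subseq => // j jt; apply/mapP; exists `|(j + M%:Z)%R|%N.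
      have jM : (`|j| <= M)%N by rewrite /M (big_rem j)//= leq_maxl.
      by rewrite (mem_iota 0 (2 * M).+1); lia.
    have jM : (`|j| <= M)%N by rewrite /M (big_rem j)//= leq_maxl.
    lia.
  rewrite sE; have /andP[_ h1] := qc (1 + M%:Z); have /andP[h2 _] := qc (- M%:Z); lra.
apply/lee_addgt0Pr => e e0.
have e2 : 0 < e / 2 by rewrite divr_gt0.
have [M _ hM] := qp _ e2; have [M' _ hM'] := qn _ e2.
pose P := maxn M M'.
have h1 := hM P.+1 (leq_trans (leq_maxl M M') (leqnSn _)); have h2 := hM' P (leq_maxr M M').
apply: (@le_trans _ _ ((\sum_(j <- s P) (q (1 - j) - q (- j)))%:E + e%:E)%E); last first.
  by rewrite leeD2r//; apply: (@esum_seq_le _ _ (fun j => q (1 - j) - q (- j))).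
rewrite -EFinD lee_fin sE.
have e12 : (1 + P%:Z)%R = P.+1%:Z by lia.
rewrite e12; move: h1 h2 => /=; lra.
Qed.

Section onb.
Context {R : realType} {H : innerProductType R} {I : choiceType}.
Variable e : I -> H.
Hypothesis onb : forall k l, dot (e k) (e l) = (k == l)%:R.

(** The squared distance from [v] to its projection on finitely many basis vectors is [|v|^2] minus
    a partial sum of Q. *)
Lemma onb_approx v (eps : R) : 0 < eps ->
  exists2 w, linear_span (range e) w & hn (v - w) ^+ 2 < hn v ^+ 2 - Qr e v + eps.
Proof.
move=> e0; have [|s us hs] := @esum_gt_seq R I (fun k => sqn (dot v (e k))) (Qr e v - eps)%:E.
  by rewrite (_ : \esum_(k in _) _ = Qe e v)// (QeE (bessel onb)) lte_fin gtrBl.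
exists (\sum_(k <- s) dot v (e k) *: e k); last first.
  by rewrite onb_proj//; move: hs; rewrite lte_fin; lra.
exists (size s), (fun i => dot v (e (tnth (in_tuple s) i))), (fun i => e (tnth (in_tuple s) i)).
split; first by move=> i; exists (tnth (in_tuple s) i).
by rewrite big_tnth.
Qed.

Lemma onb_closure v : hn v ^+ 2 <= Qr e v -> closure (linear_span (range e)) v.
Proof.
move=> hv; apply/closure_hnP => eps e0.
have [w sw hw] := onb_approx v (exprn_gt0 2 e0); exists w => //.
by rewrite -(@ltr_pXn2r _ 2) ?nnegrE ?hn_ge0 ?(ltW e0)//; lra.
Qed.

End onb.

Lemma unitary_closure_span (R : realType) (H : innerProductType R) (A : H -> H) (E : set H)
    (X : set H) y : unitary_op A -> closed_subspace X -> (forall u, E u -> X (A u)) ->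
  closure (linear_span E) y -> X (A y).
Proof.
move=> uA cX EX cy; have [w [sw wy]] := closure_hn_seq cy.
have [lA _ _] := uA; have [_ X0 XD] := cX.
have XZ a u : X u -> X (a *: u) by move=> Xu; have := XD a u 0 Xu X0; rewrite addr0.
apply: (closed_subspace_cvg (w := fun n => A (w n)) cX).
  move=> n; have [k [c [u [Eu ->]]]] := sw n; rewrite (linear_op_sum _ _ _ lA).
  elim/big_ind : _ => // [a b Xa Xb|i _]; first by have := XD 1 a b Xa Xb; rewrite scale1r.
  by rewrite (linear_opZ _ _ lA); apply/XZ/EX.
apply/cvg_hnP; move/cvg_hnP : wy.
have -> // : (fun n => hn (A (w n) - A y)) = (fun n => hn (w n - y)).
by apply/funext => n; rewrite -(linear_opB _ _ lA) (unitary_hn uA).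
Qed.

(** * Scaling vector, frame and multiresolution analysis *)
Section conclusions.
Context {R : realType}.
Local Notation leb := (@lebesgue_measure R).
Variables (N : nat) (m0 : circle R -> R[i]) (K : R).
Hypothesis lp : lowpass N m0 K.
Variables (J : finType) (theta : J -> R) (tau : J -> J).
Hypothesis cs : csystem N m0 theta tau.
Local Notation ph := (ph N m0 theta tau).
Variables (sigma : J -> J) (H : innerProductType R) (W : wavelet_data H).
Variable F : H -> J -> L2 leb.
Hypothesis fm : fourier_model N m0 theta tau sigma W F.
Variable phi : H.
Hypothesis phiF : forall j, F phi j = to_L2 leb (ph j).
Implicit Types (u v w : H) (f : circle R -> R[i]).
Local Notation shifts := (shifts W phi).
Local Notation nicevs := (nicevs F).
Local Notation U := (wU W).

Let rep := wavelet_rep (fm_rep fm).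
Let uU := wavelet_unitary (fm_rep fm).
Let uUj j := op_expz_unitary j uU.
Let Np : 0 < N%:R :> R. Proof. by rewrite ltr0n; have := lp_N2 lp; case: N. Qed.
Let N0 : (0 < N)%N. Proof. by have := lp_N2 lp; case: N. Qed.
Let Qb := Qe_shifts_le lp cs fm phiF.

Lemma nicevs_expz j v : nicevs v -> nicevs (op_expz U j v).
Proof.
move=> [a [b [M [a0 M0 nv]]]]; case: j => n /=.
  exists (a / N%:R ^+ n), (b / N%:R ^+ n), (N%:R ^+ n * M).
  split; [by rewrite divr_gt0 ?exprn_gt0|by rewrite mulr_ge0// exprn_ge0// ltW|].
  exact: (nicev_iterU lp cs fm n nv).
exists (a * N%:R ^+ n.+1), (b * N%:R ^+ n.+1), ((N%:R ^+ n.+1)^-1 * M).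
split; [by rewrite mulr_gt0 ?exprn_gt0|by rewrite mulr_ge0// invr_ge0 exprn_ge0// ltW|].
exact: (nicev_iterUinv lp cs fm n.+1 nv).
Qed.

Lemma Qr_expz_near v (d : R) : 0 < d -> exists2 u, nicevs u & hn (v - u) < d.
Proof. exact: (dense_nicev fm v). Qed.

Lemma expzB j u v : op_expz U j (u - v) = op_expz U j u - op_expz U j v.
Proof. by have [l _ _] := uUj j; exact: linear_opB. Qed.

Lemma model_cyclic (P : H -> H) : orthogonal_projection P ->
  (forall v, P (U v) = U (P v)) ->
  (forall f, Linfty f -> forall v, P (wpi W f v) = wpi W f (P v)) -> P phi = phi -> P = id.
Proof.
move=> [lP PP Pad] PU Pf Pphi; apply/funext => v.
pose w := v - P v; have Pw : P w = 0 by rewrite /w linear_opB// PP subrr.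
suff : w = 0 by move/eqP; rewrite subr_eq0 => /eqP.
(* [P] fixes every [T^k phi] and kills every [U^n w], so these vectors are orthogonal. *)
have Q0 n : Qr shifts (iter n U w) = 0.
  have Pn : P (iter n U w) = 0.
    elim: n => //= n IH; rewrite PU IH; have [lU _ _] := uU; exact: linear_op0.
  rewrite /Qr /Qe esum1// => k _.
  have <- : P (shifts k) = shifts k by rewrite (Pf _ (Linfty_zk k)) Pphi.
  by rewrite -Pad Pn dot0l sqn0.
apply: contrapT => /eqP w0.
have wp : 0 < hn w.
  by rewrite lt0r hn_ge0 andbT; apply: contra w0 => /eqP/hn_eq0 ->.
(* For [u] within [|w| / 4] of [w], the form at [U^n u] is at least [|u|^2 / 2], so at least
   [9/32 |w|^2]; but as it vanishes at [U^n w], it is at most [2 |w - u|^2], that is [1/8 |w|^2]. *)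
have [u nu hu] := @Qr_expz_near w (hn w / 4) (divr_gt0 wp (ltr0Sn _ _)).
have h12 : 0 < 2^-1 :> R by rewrite invr_gt0.
have [n _ /(_ n (leqnn n)) /= hn_] := Qr_expand lp cs fm phiF nu h12.
have e : iter n U u = iter n U w + iter n U (u - w).
  by rewrite -[iter n U (u - w)]/(op_expz U n (u - w)) expzB addrC subrK.
have := Qr_D Qb (iter n U w) (iter n U (u - w)) ltr01; rewrite -e Q0 mulr0 add0r invr1.
have := Qr_le Qb (iter n U (u - w)).
rewrite -[iter n U (u - w)]/(op_expz U n (u - w)) (unitary_hn (uUj n)) hnBC => h1 h2.
have h3 : 3 / 4 * hn w <= hn u by have := hn_dist w u; lra.
have h4 : hn (w - u) ^+ 2 <= (hn w / 4) ^+ 2 by rewrite ler_sqr ?nnegrE ?hn_ge0 ?divr_ge0 ?ltW.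
have h0 : 0 <= 3 / 4 * hn w by lra.
have h5 : (3 / 4 * hn w) ^+ 2 <= hn u ^+ 2 by rewrite ler_sqr ?nnegrE ?hn_ge0.
have h6 : 0 < hn w ^+ 2 by rewrite exprn_gt0.
rewrite (_ : (hn w / 4) ^+ 2 = hn w ^+ 2 / 16) in h4; last by field.
rewrite (_ : (3 / 4 * hn w) ^+ 2 = 9 / 16 * hn w ^+ 2) in h5; last by field.
have aux (x y z a b : R) : (1 - 2^-1) * y <= b -> a <= z -> b <= (1 + 1) * a -> z <= x / 16 ->
  9 / 16 * x <= y -> 0 < x -> False by lra.
exact: (aux _ _ _ _ _ hn_ h1 h2 h4 h5 h6).
Qed.

Lemma model_scaling_vector : scaling_vector W m0 phi.
Proof.
split; first exact: (phi_scaling lp cs fm phiF).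
by move=> [P [oP nid PU Pf Pphi]]; apply: nid; exact: model_cyclic.
Qed.

Lemma model_frame (m : nat -> circle R -> R[i]) : m 0%N = m0 ->
  (forall i, (0 < i < N)%N -> Linfty (m i)) ->
  circle_ae (fun z => filter_matrix N m z \is unitarymx) ->
  normalized_tight_frame (fun t : 'I_N.-1 * int * int =>
    op_expz U t.1.2 (op_expz (wT W) t.2 (op_inv U (wpi W (m t.1.1.+1) phi)))).
Proof.
move=> mm0 Lm um; set e3 := fun t => _.
have Lm' (i : nat) : (i < N)%N -> Linfty (m i).
  by case: i => [_|i iN]; [rewrite mm0; exact: Linfty_m0 lp|exact: Lm].
pose D i u := (\esum_(k in [set: int])
    (sqn (dot u (wpi W (fun z => zk (N%:Z * k) z * m i z) phi)))%:E)%E.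
have D0 i u : (0 <= D i u)%E by apply: esum_ge0 => k _; rewrite lee_fin sqn_ge0.
have QD u : nicevs u -> (Qe shifts u = Qe shifts (op_inv U u) + \sum_(i < N.-1) D i.+1 u)%E.
  move=> [a [b [M [_ _ nu]]]].
  rewrite (filter_bank lp cs fm phiF nu (fun i => Lm' i (ltn_ord i)) um).
  rewrite -(big_mkord xpredT (fun i => D i u)) big_ltn// big_add1 big_mkord; congr (_ + _)%E.
  by rewrite (Qe_Uinv lp cs fm phiF) /D mm0.
(* The adjoint moves [U^j] to the other side as [U^-j]; the inverse of [U] in the definition of the
   wavelets raises the exponent to [1 - j]. *)
have e3E v t : sqn (dot v (e3 t)) = sqn (dot (op_expz U (1 - t.1.2) v)
    (wpi W (fun z => zk (N%:Z * t.2) z * m t.1.1.+1 z) phi)).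
  have Li : Linfty (m t.1.1.+1) by apply: Lm'; have := ltn_ord t.1.1; lia.
  rewrite /e3 /wT (op_expz_cval rep) (dot_op_expz _ _ _ uU) -(U_zk_wpi fm _ _ Li).
  have [_ <- _] := uU.
  by rewrite -(op_expzS _ _ uU) [(- t.1.2 + 1)%R]addrC.
have Qe3 v : nicevs v -> Qe e3 v = (hn v ^+ 2)%:E.
  move=> nv; pose q j := Qr shifts (op_expz U j v).
  have hnj j : hn (op_expz U j v) = hn v by exact: unitary_hn.
  have E j : (\sum_(i < N.-1) D i.+1 (op_expz U (1 - j) v) = (q (1 - j) - q (- j))%:E)%E.
    have := QD _ (nicevs_expz (1 - j) nv).
    rewrite -(op_expzP _ _ uU) [(1 - j - 1)%R](_ : _ = - j); last by rewrite addrAC subrr add0r.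
    rewrite !(QeE Qb) -/(q (1 - j)) -/(q (- j)) EFinB => ->.
    by rewrite addeAC subee// add0e.
  transitivity (\esum_(j in [set: int]) (q (1 - j) - q (- j))%:E)%E; last first.
    apply: esum_telescope.
    - by move=> j; rewrite -lee_fin -E; apply: sume_ge0 => i _; exact: D0.
    - by move=> j; rewrite (Qr_ge0 Qb) -(hnj j) (Qr_le Qb).
    - move=> e e0.
      have c0 : 0 < e / (hn v ^+ 2 + 1) by rewrite divr_gt0// ltr_wpDl ?sqr_ge0.
      apply: filterS (Qr_expand lp cs fm phiF nv c0) => n; apply: le_trans.
      rewrite mulrBl mul1r lerD2l lerN2 mulrAC ler_pdivrMr ?ltr_wpDl ?sqr_ge0//.
      by rewrite ler_wpM2l ?(ltW e0)// lerDl.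
    - move=> e e0; apply: filterS (Qr_contract lp cs fm phiF nv e0) => n; apply: le_trans.
      by rewrite /q; case: n.
  transitivity (\esum_(i in [set: 'I_N.-1]) \esum_(j in [set: int]) D i.+1 (op_expz U (1 - j) v))%E.
    rewrite (@esum_esum _ _ _ setT (fun=> setT) (fun (i : 'I_N.-1) (j : int) => D i.+1 (op_expz U (1 - j) v)))//.
    have -> : [set: 'I_N.-1] `*`` (fun=> [set: int]) = [set: 'I_N.-1 * int] by apply/seteqP; split.
    rewrite /D (@esum_esum _ _ _ setT (fun=> setT) (fun (p : 'I_N.-1 * int) (k : int) =>
      (sqn (dot (op_expz U (1 - p.2) v) (wpi W (fun z => zk (N%:Z * k) z * m p.1.+1 z) phi)))%:E)); last first.
      by move=> *; rewrite lee_fin sqn_ge0.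
    have -> : [set: 'I_N.-1 * int] `*`` (fun=> [set: int]) = [set: 'I_N.-1 * int * int] by apply/seteqP; split.
    by apply: eq_esum => t _; rewrite e3E.
  rewrite esum_finType; last by move=> i; apply: esum_ge0.
  by rewrite -esum_sum//; apply: eq_esum => j _; rewrite E.
have dn := dense_nicev fm.
have Qb3 v : (Qe e3 v <= (hn v ^+ 2)%:E)%E.
  by apply: (Qe_bounded dn) => w /Qe3 ->.
move=> v; have h : Qr e3 v = hn v ^+ 2.
  by apply: (Qr_eq_dense Qb3 dn) => w /Qe3; rewrite (QeE Qb3) => -[].
have -> : complex.Re (`|v| ^+ 2) = hn v ^+ 2 by rewrite hnE -rmorphXn.
rewrite -h -(QeE Qb3); apply: eq_esum => t _.
by rewrite Re_normsq.
Qed.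

Lemma shiftsE k : shifts k = op_expz (wT W) k phi.
Proof. by rewrite /wT (op_expz_cval rep). Qed.

Lemma dot_shifts k l : dot (shifts k) (shifts l) = dot phi (shifts (l - k)).
Proof.
have [_ <- _] := unitary_zk rep (- k).
by rewrite -[shifts k]/(wpi W (zk k) phi) -[shifts l]/(wpi W (zk l) phi) !(rho_zkD rep) addNr (rho_zk0 rep) addrC.
Qed.

Lemma Qr_Uinv_le v : Qr shifts (op_inv U v) <= Qr shifts v.
Proof.
have [w [nw wv]] := dense_seq v (dense_nicev fm).
have iv : op_inv U (w n) @[n --> \oo] --> op_inv U v.
  have [l _ _] := op_inv_unitary uU.
  apply: (cvg_bounded_op (C := 1) l) => // y.
  by rewrite mul1r (unitary_hn (op_inv_unitary uU)).
apply: (ler_cvg_to (Qr_cvg Qb iv) (Qr_cvg Qb wv)); apply: nearW => n.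
have [a [b [M [_ _ nn]]]] := nw n; rewrite -lee_fin -!(QeE Qb).
exact: (nicev_Qe_Uinv_le lp cs fm phiF nn).
Qed.

(** In [Q(phi) <= |phi|^2 = 1] the term [k = 0] already equals 1, so all the other coefficients
    vanish. *)
Lemma model_onb : hn phi = 1 -> forall k l, dot (shifts k) (shifts l) = (k == l)%:R.
Proof.
move=> phi1 k l; rewrite dot_shifts.
have p0 : dot phi (shifts 0) = 1.
  by rewrite -[shifts 0]/(wpi W (zk 0) phi) (rho_zk0 rep) dotuu phi1 expr1n.
have [->|kl] := eqVneq k l; first by rewrite subrr.
apply: sqn_eq0; apply/eqP; rewrite eq_le sqn_ge0 andbT.
have lk : l - k != 0 by rewrite subr_eq0 eq_sym.
have := Qr_seq Qb phi (s := [:: 0; l - k]); rewrite /= inE eq_sym lk => /(_ isT).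
rewrite big_cons big_seq1 p0 sqn1; have := Qr_le Qb phi; rewrite phi1 expr1n; lra.
Qed.

(** [V n] is defined by the membership of [U^n v] in the closed span of the [T^k phi], which makes
    the dilation axiom a shift of exponents. *)
Lemma model_mra : hn phi = 1 -> exists V, mra W V /\ mra_generator W V phi.
Proof.
move=> phi1; have onb := model_onb phi1.
pose X := closure (linear_span (range shifts)).
have cX : closed_subspace X by exact: closure_span_subspace.
have Xs k : X (shifts k) by apply: span_sub_closure; exists k.
(* Q at [U T^k phi] is at least Q at [T^k phi], which is 1; Bessel's inequality is then an equality,
   so [U T^k phi] lies in the closed span. *)
have XU y : X y -> X (U y).
  apply: (unitary_closure_span uU cX) => _ [k _ <-]; apply: (onb_closure onb).
  rewrite (unitary_hn uU); apply: le_trans (_ : _ <= Qr shifts (shifts k)) _.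
    have := Qr_seq Qb (shifts k) (s := [:: k]) isT; rewrite big_seq1 onb eqxx sqn1.
    by rewrite hn2E onb eqxx.
  by have := Qr_Uinv_le (U (shifts k)); rewrite (op_invKl uU).
pose V (n : int) : set H := [set v | X (op_expz U n v)].
have lj j : linear_op (op_expz U j) by have [] := uUj j.
have gen : mra_generator W V phi.
  split; first by rewrite /V /= -[phi](rho_zk0 rep); exact: Xs.
  have -> : (fun k => op_expz (wT W) k phi) = shifts by apply/funext => k; rewrite shiftsE.
  by split.
exists V; split => //; split.
- move=> n; have [_ X0 XD] := cX; split.
  + apply: closed_hnP => v hv; rewrite /V /=; apply/closure_hnP => e e0.
    have [w Vw hw] := hv (e / 2) (divr_gt0 e0 (ltr0Sn _ _)).
    move: Vw; rewrite /V /= => /closure_hnP /(_ (e / 2) (divr_gt0 e0 (ltr0Sn _ _)))[x sx hx].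
    exists x => //; have -> : op_expz U n v - x = op_expz U n (v - w) + (op_expz U n w - x).
      by rewrite expzB addrA subrK.
    by apply: le_lt_trans (hnD _ _) _; rewrite (unitary_hn (uUj n)); lra.
  + by rewrite /V /= linear_op0.
  + by move=> a u v; rewrite /V /= lj; exact: XD.
- by move=> n v; rewrite /V /= (op_expzS _ _ uU); exact: XU.
- apply/seteqP; split => // v _; apply/closure_hnP => e e0.
  have e4 : 0 < e / 4 by rewrite divr_gt0.
  have [u nu hu] := Qr_expz_near v e4.
  have c0 : 0 < (e / 4) ^+ 2 / (hn u ^+ 2 + 1) by rewrite divr_gt0 ?exprn_gt0// ltr_wpDl ?sqr_ge0.
  (* For large [n] the form Q captures nearly the whole norm of [U^n u], which is thus close to
     [V 0]; hence [u] is close to [V n]. *)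
  have [n _ /(_ n (leqnn n)) /= hn_] := Qr_expand lp cs fm phiF nu c0.
  have [w sw hw] := onb_approx onb (iter n U u) (exprn_gt0 2 e4).
  have [z _ zw] : range (op_expz U n%:Z) w by have [_ _ ->] := uUj n%:Z.
  have Xw : X w by exact: subset_closure.
  rewrite -zw in Xw; exists z; first by exists n%:Z.
  have h1 : hn (u - z) ^+ 2 < (e / 2) ^+ 2.
    rewrite -(unitary_hn (uUj n%:Z)) expzB zw; apply: lt_le_trans hw _.
    rewrite (unitary_hn (unitary_iter n uU)).
    have h2 : (e / 4) ^+ 2 / (hn u ^+ 2 + 1) * hn u ^+ 2 <= (e / 4) ^+ 2.
      rewrite mulrAC ler_pdivrMr ?ltr_wpDl ?sqr_ge0// ler_wpM2l ?sqr_ge0//.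
      by rewrite lerDl.
    have h3 : (e / 2) ^+ 2 = 4 * (e / 4) ^+ 2 by field.
    have := sqr_ge0 (e / 4); lra.
  have h2 : hn (u - z) < e / 2.
    by rewrite -(@ltr_pXn2r _ 2) ?nnegrE ?hn_ge0 ?divr_ge0 ?(ltW e0).
  have -> : v - z = (v - u) + (u - z) by rewrite addrA subrK.
  by apply: le_lt_trans (hnD _ _) _; lra.
- apply/seteqP; split => [v Vv|v -> n _]; last first.
    by rewrite /V /= linear_op0//; have [] := cX.
  (* On a vector lying in all the [V n], Q stays equal to the squared norm along the powers of the
     inverse of [U], which contradicts [Qr_contract] at a nearby test vector. *)
  have Qv n : Qr shifts (iter n (op_inv U) v) = hn v ^+ 2.
    have := Vv (- n%:Z) I; rewrite /V /= => /(parseval_closure onb).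
    have -> : op_expz U (- n%:Z) v = iter n (op_inv U) v by case: (n).
    by rewrite (unitary_hn (unitary_iter n (op_inv_unitary uU))).
  apply: contrapT => /= v0.
  have vp : 0 < hn v.
    by rewrite lt0r hn_ge0 andbT; apply/eqP => /hn_eq0.
  have [u nu hu] := @Qr_expz_near v (hn v / 4) (divr_gt0 vp (ltr0Sn _ _)).
  have c0 : 0 < hn v ^+ 2 / 4 by rewrite divr_gt0 ?exprn_gt0.
  have [n _ /(_ n (leqnn n)) /= hn_] := Qr_contract lp cs fm phiF nu c0.
  have uI := unitary_iter n (op_inv_unitary uU); have [lI _ _] := uI.
  have e : iter n (op_inv U) v = iter n (op_inv U) u + iter n (op_inv U) (v - u).
    by rewrite (linear_opB _ _ lI) addrC subrK.
  have := Qr_D Qb (iter n (op_inv U) u) (iter n (op_inv U) (v - u)) ltr01.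
  rewrite -e Qv invr1; have := Qr_le Qb (iter n (op_inv U) (v - u)); rewrite (unitary_hn uI) => h1 h2.
  have h4 : hn (v - u) ^+ 2 <= (hn v / 4) ^+ 2 by rewrite ler_sqr ?nnegrE ?hn_ge0 ?divr_ge0 ?ltW.
  rewrite (_ : (hn v / 4) ^+ 2 = hn v ^+ 2 / 16) in h4; last by field.
  have := exprn_gt0 2 vp; lra.
- move=> n; apply/seteqP; split => [_ [v Vv <-]|v Vv].
    by rewrite /V /= -(op_expzSr _ _ uU) subrK.
  exists (op_inv U v); last exact: op_invK.
  by rewrite /V /= -[n](subrK 1) (op_expzSr _ _ uU) (op_invK uU).
- by exists phi.
Qed.

(** Both sides amount to [|phi| = 1]: orthonormality implies it, [model_mra] gives the converse, and
    the total integral is [2 pi |phi|^2]. *)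
Lemma model_orthogonal : orthogonal_scaling_vector W phi <->
  (\sum_j \int[leb]_x (sqn (ph j x))%:E = (2 * pi)%:E)%E.
Proof.
have pp := twopi_gt0 R; rewrite -(phi_fm_norm lp cs fm phiF); split.
  move=> [V [_ [_ [+ _]]]] => /(_ 0 0); rewrite eqxx /= dotuu => /(congr1 (@complex.Re R)) /= ->.
  by rewrite mulr1.
move=> [/eqP]; rewrite -[eqbRHS]mulr1 (inj_eq (mulfI (twopi_neq0 R))) sqrf_eq1.
rewrite [_ == -1](_ : _ = false) ?orbF => [/eqP phi1|]; last first.
  by apply/eqP => h; have := hn_ge0 phi; rewrite h ler0N1.
exact: model_mra.
Qed.

End conclusions.

(** * Families of cycles *)
Section cyclic_indices.
Variable p : nat.
Implicit Types a b : 'I_p.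

Lemma val_iter_ordS l a : val (iter l (@ordS p) a) = ((a + l) %% p)%N.
Proof.
elim: l => [|l IH] /=; first by rewrite addn0 modn_small.
by rewrite IH -addn1 modnDml addn1 addnS.
Qed.

Lemma iter_ordS a b : exists l, iter l (@ordS p) a = b.
Proof.
exists (b + p - a)%N; apply: val_inj; rewrite val_iter_ordS subnKC; last by rewrite ltnW// ltn_addl.
by rewrite modnDr modn_small.
Qed.

Lemma iter_ordSp a : iter p (@ordS p) a = a.
Proof. by apply: val_inj; rewrite val_iter_ordS modnDr modn_small. Qed.

Lemma iter_ord_pred a b : exists l, iter l (@ord_pred p) a = b.
Proof.
have [l <-] := iter_ordS b a; exists l.
by elim: l => // l IH; rewrite iterSr [X in ord_pred X]iterS ordSK.
Qed.

End cyclic_indices.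

Section cycles.
Context {R : realType}.
Variables (N : nat) (m0 : circle R -> R[i]) (K : R).
Hypothesis lp : lowpass N m0 K.
Local Notation E z k := (circle_exp z (N ^ k)).
Implicit Types (w : circle R).
Let Np : 0 < N%:R :> R. Proof. by rewrite ltr0n; have := lp_N2 lp; case: N. Qed.

Lemma norm_sqrtN (x : R[i]) : (`|x| = sqrtN R N) <-> (sqn x = N%:R).
Proof.
rewrite norm_normc normcE /sqrtN; split => [[h]|->//].
by rewrite -[LHS]sqr_sqrtr ?sqn_ge0// h sqr_sqrtr// ltW.
Qed.

Lemma cycle_iter p (z : 'I_p -> circle R) k l : m0_cycle_enum N m0 z ->
  z (iter l (@ordS p) k) = E (z k) l.
Proof.
move=> [_ _ zN _]; elim: l => [|l IH]; first by rewrite expn0 circle_exp1.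
by rewrite iterS -zN IH -circle_expM expnSr.
Qed.

Lemma cycle_range p q (z : 'I_p -> circle R) (y : 'I_q -> circle R) k l :
  m0_cycle_enum N m0 z -> m0_cycle_enum N m0 y -> z k = y l -> range z = range y.
Proof.
have sub p' q' (z' : 'I_p' -> circle R) (y' : 'I_q' -> circle R) k' l' : m0_cycle_enum N m0 z' ->
    m0_cycle_enum N m0 y' -> z' k' = y' l' -> range z' `<=` range y'.
  move=> hz hy e _ [a _ <-]; have [m <-] := iter_ordS k' a.
  by rewrite (cycle_iter _ _ hz) e -(cycle_iter _ _ hy); exists (iter m (@ordS q') l').
move=> hz hy e; apply/seteqP; split; [exact: sub hz hy e|exact: sub hy hz (esym e)].
Qed.

Lemma cycle_enum_pt p (z : 'I_p -> circle R) k : m0_cycle_enum N m0 z -> cycle_pt N m0 (z k).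
Proof.
move=> hz; have [p0 _ _ m0z] := hz; exists p; split => //.
  by rewrite -(cycle_iter _ _ hz) iter_ordSp.
by move=> l; rewrite -(cycle_iter _ _ hz); apply/norm_sqrtN.
Qed.

(** Minimality of the period makes the points distinct: if [z i = z j] with [i < j], then [p - j]
    further steps give the smaller period [i + (p - j)]. *)
Lemma cycle_pt_enum w : cycle_pt N m0 w -> exists p (z : 'I_p -> circle R) (k : 'I_p),
  m0_cycle_enum N m0 z /\ z k = w.
Proof.
move=> [d [d0 wd hw]].
have ex : exists d, (0 < d)%N && (E w d == w) by exists d; rewrite d0 wd eqxx.
case: (ex_minnP ex) => p /andP[p0 /eqP wp] pmin {d d0 wd ex}.
pose z (i : 'I_p) := E w i; exists p, z, (Ordinal p0); split; last by rewrite /z /= expn0 circle_exp1.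
have lt_neq (i j : 'I_p) : (i < j)%N -> z i <> z j.
  move=> ij; rewrite /z => e; have jp := ltn_ord j.
  have := congr1 (fun v => E v (p - j)) e; rewrite -!circle_expM -!expnD subnKC ?wp; last exact: ltnW.
  by move=> h; have := pmin (i + (p - j))%N; rewrite h eqxx andbT => /(_ _)/wrap[]; lia.
split => //.
- move=> i j e; apply: val_inj => /=; apply/eqP; rewrite eqn_leq; apply/andP; split; rewrite leqNgt.
    by apply/negP => /lt_neq; apply.
  by apply/negP => /lt_neq; apply.
- move=> i; rewrite /z /= -circle_expM -expnSr.
  have [ip|ip] := ltnP i.+1 p; first by rewrite modn_small.
  have -> : i.+1 = p by apply/eqP; rewrite eqn_leq ip ltn_ord.
  by rewrite modnn expn0 circle_exp1.
- by move=> i; apply/norm_sqrtN; exact: hw.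
Qed.

Lemma cycle_pt_in_cycles w : cycle_pt N m0 w -> exists2 C, m0_cycles N m0 C & C w.
Proof.
by move=> /cycle_pt_enum[p [z [k [hz <-]]]]; exists (range z); [exists p, z|exists k].
Qed.

(* The values of [|m0|^2] at the N-th roots of a point sum to N. *)
Lemma cycle_sibling w : sqn (m0 w) = N%:R -> m0 (circle_mul (expNi (2 * pi / N%:R)) w) = 0.
Proof.
move=> mw; have N2 := lp_N2 lp; have [y yw] := expNi_surj (circle_exp w N).
set v := circle_mul _ w.
have vN : circle_exp v N = expNi y.
  rewrite /v circle_mulX -expNiMn -yw mulrC divfK ?gt_eqF// -expNiD addrC.
  by have := expNi_periodic y 1; rewrite mulr1.
have [r rN wr] := nroot_surj N2 (esym yw); have [s sN vs] := nroot_surj N2 vN.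
have rs : Ordinal sN != Ordinal rN.
  apply/eqP => -[e]; have : v = w by rewrite vs wr e.
  move=> /(congr1 (@cval R)); rewrite cval_mul => h.
  have [x xw] := expNi_surj w.
  have : expNi (2 * pi / N%:R + x) = expNi x.
    by apply: cval_inj; rewrite expNiD xw.
  move=> /expNi_eq[l]; rewrite addrC => /addrI hl; have pp := twopi_gt0 R.
  have {hl} : N%:R^-1 = l%:~R :> R by apply: (mulfI (twopi_neq0 R)).
  move=> hl; have l0 : (0 : R) < l%:~R by rewrite -hl invr_gt0.
  have l1 : l%:~R < (1 : R) by rewrite -hl invf_lt1// ltr1n.
  by move: l0 l1; rewrite ltr0z ltrz1; lia.
apply: sqn_eq0; rewrite vs; apply/eqP; rewrite eq_le sqn_ge0 andbT.
have := lp_R lp y; rewrite (bigD1 (Ordinal rN))//= -wr mw (bigD1 (Ordinal sN))//=.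
have : 0 <= \sum_(i < N | (i != Ordinal rN) && (i != Ordinal sN)) sqn (m0 (nroot N y i)).
  by apply: sumr_ge0 => i _; exact: sqn_ge0.
lra.
Qed.

(** By [cycle_sibling], the rotation by the angle [2 pi / N] injects the points where [|m0|^2 = N]
    into the finite zero set of [m0]; a cycle is the orbit of any of its points. *)
Lemma finite_cycles : finite_set (m0_cycles N m0).
Proof.
pose P : set (circle R) := [set w | sqn (m0 w) = N%:R].
pose rho w := circle_mul (expNi (2 * pi / N%:R)) w.
have fP : finite_set P.
  have rinj : {in P &, injective rho}.
    move=> w v _ _ /(congr1 (@cval R)); rewrite !cval_mul => /mulfI h; apply: cval_inj; apply: h.
    by rewrite -normr_eq0 cval_norm oner_eq0.
  rewrite -(eq_finite_set (inj_card_eq rinj)); apply: sub_finite_set (lp_Z lp).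
  by move=> _ [w Pw <-]; exact: cycle_sibling.
apply: sub_finite_set (finite_image (fun w => [set x | exists l, x = E w l]) fP).
move=> C [p [z [hz ->]]]; have [p0 _ _ m0z] := hz.
exists (z (Ordinal p0)); first by apply/norm_sqrtN.
apply/seteqP; split => [_ [l ->]|_ [k _ <-]].
  by rewrite -(cycle_iter _ _ hz); exists (iter l (@ordS p) (Ordinal p0)).
by have [l <-] := iter_ordS (Ordinal p0) k; exists l; rewrite (cycle_iter _ _ hz).
Qed.

End cycles.

Section cycle_family.
Context {R : realType}.
Variables (N : nat) (m0 : circle R -> R[i]) (K : R).
Hypothesis lp : lowpass N m0 K.
Variables (n : nat) (p : 'I_n -> nat) (z : forall i, 'I_(p i) -> circle R).
Variable (theta : forall i, 'I_(p i) -> R).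
Hypothesis hz : forall i, m0_cycle_enum N m0 (@z i).
Hypothesis z_inj : injective (fun i => range (@z i)).
Hypothesis zE : forall i (k : 'I_(p i)), z k = expNi (theta k).

(** All the cycle points, tagged by their cycle: the index set [J] of the preceding sections. *)
Definition cpt : Type := {i : 'I_n & 'I_(p i)}.
HB.instance Definition _ := Finite.on cpt.

Definition ctheta (j : cpt) : R := theta (tagged j).
Definition cpred (j : cpt) : cpt := Tagged (fun i => 'I_(p i)) (ord_pred (tagged j)).
Definition csucc (j : cpt) : cpt := Tagged (fun i => 'I_(p i)) (ordS (tagged j)).

Lemma csuccK j : cpred (csucc j) = j.
Proof. by case: j => i k; rewrite /cpred /csucc /= ordSK. Qed.
Lemma cpredK j : csucc (cpred j) = j.
Proof. by case: j => i k; rewrite /cpred /csucc /= ord_predK. Qed.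

Lemma family_csystem : csystem N m0 ctheta cpred.
Proof.
split.
- move=> [i k] [i' k']; rewrite /ctheta /= -!zE => e.
  have ii : i = i' by apply: z_inj; exact: cycle_range (hz i) (hz i') e.
  by subst i'; have [_ /(_ _ _ e) -> _ _] := hz i.
- move=> [i k]; rewrite /ctheta /= -!zE; have [_ _ -> _] := hz i.
  by rewrite ord_predK.
- by move=> [i k]; rewrite /ctheta /= -zE; apply/norm_sqrtN; have [] := hz i.
Qed.

Definition all_cycles := forall C, m0_cycles N m0 C -> exists i, range (@z i) = C.

(** The family consists of [n] distinct cycles, and an injection into a set of [n] elements is
    onto. *)
Lemma card_all_cycles : (m0_cycles N m0 #= `I_n) <-> all_cycles.
Proof.
have hC i : m0_cycles N m0 (range (@z i)) by exists (p i), (@z i).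
split => [/card_esym/card_set_bijP[f [_ finj fsurj]] C /fsurj[a /= an <-]|h].
  have /choice[g hg] i : exists a : 'I_n, f a = range (@z i).
    by have [b /= bn <-] := fsurj _ (hC i); exists (Ordinal bn).
  have ginj : injective g by move=> i j e; apply: z_inj; rewrite -!hg e.
  have [g' _ gK] := injF_bij ginj; exists (g' (Ordinal an)).
  by rewrite -hg gK.
pose f C := xget 0%N [set a : nat | exists i : 'I_n, a = i /\ range (@z i) = C].
have fE i : f (range (@z i)) = i.
  rewrite /f; case: xgetP => [_ -> [j [-> /z_inj ->]]//|/(_ i)[]].
  by exists i.
apply/card_set_bijP; exists f; split.
- by move=> C /h[i <-] /=; rewrite fE.
- by move=> C D; rewrite !inE => /h[i <-] /h[j <-]; rewrite !fE => /val_inj ->.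
- by move=> a /= an; exists (range (@z (Ordinal an))) => //; rewrite fE.
Qed.

Lemma all_cycles_full : all_cycles -> forall w, cycle_pt N m0 w -> exists j, expNi (ctheta j) = w.
Proof.
move=> h w /(cycle_pt_in_cycles lp)[C /h[i <-] [k _ <-]].
by exists (Tagged (fun i => 'I_(p i)) k); rewrite /ctheta /= -zE.
Qed.

Lemma iter_cpred l i (k : 'I_(p i)) : iter l cpred (Tagged (fun i => 'I_(p i)) k) =
  Tagged (fun i => 'I_(p i)) (iter l (@ord_pred (p i)) k).
Proof. by elim: l => //= l ->. Qed.

Lemma all_cycles_dim : m0_cycles N m0 !=set0 -> all_cycles -> has_dim (transfer_fixed N m0) n.
Proof.
move=> [C [q [y [hy _]]]] h; have full := all_cycles_full h.
have ex : exists w, cycle_pt N m0 w.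
  by have [q0 _ _ _] := hy; exists (y (Ordinal q0)); exact: cycle_enum_pt hy.
have p0 i : (0 < p i)%N by have [] := hz i.
apply: (fixed_dim lp family_csystem full ex (kappa := fun j : cpt => tag j)
  (jj := fun i => Tagged (fun i => 'I_(p i)) (Ordinal (p0 i)))) => //.
move=> [i k] /=; have [l lk] := iter_ord_pred (Ordinal (p0 i)) k; exists l.
by rewrite iter_cpred lk.
Qed.

End cycle_family.

(** All the cycles are enumerated afresh, independently of the given ones, so that their total
    number is itself a dimension of the eigenspace. *)
Lemma cycles_dim (R : realType) (N : nat) (m0 : circle R -> R[i]) (K : R) : lowpass N m0 K ->
  m0_cycles N m0 !=set0 -> exists M, m0_cycles N m0 #= `I_M /\ has_dim (transfer_fixed N m0) M.
Proof.
move=> lp ne; have /finite_setP[M cM] := finite_cycles lp; exists M; split => //.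
have [f [fC finj fsurj]] := card_set_bijP (card_esym cM).
have /choice[t ht] (i : 'I_M) : exists t : {p : nat & 'I_p -> circle R},
    m0_cycle_enum N m0 (projT2 t) /\ f i = range (projT2 t).
  by have [p [z [hz e]]] := fC i (ltn_ord i); exists (existT _ p z).
have /choice[th hth] := @expNi_surj R.
apply: (@all_cycles_dim _ _ _ _ lp M (fun i => projT1 (t i)) (fun i => projT2 (t i))
  (fun i k => th (projT2 (t i) k))) => //.
- by move=> i; have [] := ht i.
- move=> i j /=; have [_ <-] := ht i; have [_ <-] := ht j => e; apply: val_inj.
  by apply: finj; rewrite ?inE/=.
- by move=> C /fsurj[a /= aM <-]; exists (Ordinal aM); have [_ <-] := ht (Ordinal aM).
Qed.

(** The product at [j] depends on the angles along the backward orbit of [j], so it is the same in a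
    larger system or under other indices. *)
Lemma ph_map (R : realType) (N : nat) (m0 : circle R -> R[i]) (J J' : finType) (theta : J -> R)
    (tau : J -> J) (theta' : J' -> R) (tau' : J' -> J') (h : J -> J') j :
  (forall k, theta' (h k) = theta k) -> (forall k, tau' (h k) = h (tau k)) ->
  ph N m0 theta' tau' (h j) = ph N m0 theta tau j.
Proof.
move=> hth htau; have it l : iter l tau' (h j) = h (iter l tau j) by elim: l => //= l ->.
apply/funext => x; have E : php N m0 theta' tau' (h j) x = php N m0 theta tau j x.
  by apply/funext => L; apply: eq_bigr => l _; rewrite it /fac /alp hth.
by rewrite /ph E.
Qed.

(** * The system of the given cycles and its extension by a missing one *)

Section extension.
Context {R : realType}.
Local Notation leb := (@lebesgue_measure R).
Variables (N : nat) (m0 : circle R -> R[i]) (K : R).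
Hypothesis lp : lowpass N m0 K.

(** The integrand is continuous with value 1 at 0, so it exceeds [1 / 2] on an interval. *)
Lemma ph_integral_gt0 (J : finType) (theta : J -> R) (tau : J -> J) j : csystem N m0 theta tau ->
  (0 < \int[leb]_x (sqn (ph N m0 theta tau j x))%:E)%E.
Proof.
move=> cs; have := @continuous_sqn_ph _ _ _ _ lp _ _ _ cs j 0.
have h12 : 0 < 2^-1 :> R by rewrite invr_gt0.
move=> /cvgrPdist_lt/(_ _ h12)/nbhs_ballP[d /= d0 hd].
apply: lt_le_trans (_ : (\int[leb]_x (2^-1 * wn (- (d / 2)) (d / 2) x)%:E <= _)%E).
  under eq_integral do rewrite EFinM.
  rewrite ge0_integralZl//; last first.
  - by move=> x _; rewrite lee_fin wn_ge0.
  - by apply/measurable_EFinP; exact: measurable_wn.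
  rewrite integral_wn; last by lra.
  by rewrite -EFinM lte_fin; lra.
apply: ge0_le_integral => //.
- by move=> x _; rewrite lee_fin mulr_ge0 ?wn_ge0.
- by apply/measurable_EFinP; apply: measurable_funM => //; exact: measurable_wn.
- by apply/measurable_EFinP; exact: (measurable_sqn_ph lp cs).
- move=> x _; rewrite lee_fin.
  have [xd|/wn_out ->] := boolP (- (d / 2) <= x < d / 2); last by rewrite mulr0 sqn_ge0.
  rewrite wn_in// mulr1; have := hd x; rewrite -ball_normE/= sub0r normrN => /(_ _)/wrap[].
    by move: xd => /andP[? ?]; rewrite ltr_norml; apply/andP; split; lra.
  by rewrite (ph0 lp cs) sqn1 => /(le_lt_trans (ler_norm _)); lra.
Qed.

Variables (n : nat) (p : 'I_n -> nat) (z : forall i, 'I_(p i) -> circle R).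
Variable (theta : forall i, 'I_(p i) -> R).
Hypothesis hz : forall i, m0_cycle_enum N m0 (@z i).
Hypothesis z_inj : injective (fun i => range (@z i)).
Hypothesis zE : forall i (k : 'I_(p i)), z k = expNi (theta k).

(** A missing cycle is adjoined to the system. The products of the given cycles are unchanged by
    [ph_map] and already exhaust the bound [2 pi] of [ph_integral_le], which leaves nothing for the
    positive integrals of the new cycle. *)
Lemma all_cycles_of_integral :
  (\sum_j \int[leb]_x (sqn (ph N m0 (ctheta theta) (@cpred n p) j x))%:E = (2 * pi)%:E)%E ->
  all_cycles N m0 z.
Proof.
move=> tot C [q [y [hy CE]]]; apply: contrapT => nC.
have [q0 yinj yN ym0] := hy; have /choice[th hth] := @expNi_surj R.
pose th' (j : cpt p + 'I_q) := match j with inl j => ctheta theta j | inr k => th (y k) end.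
pose tau' (j : cpt p + 'I_q) : cpt p + 'I_q :=
  match j with inl j => inl (cpred j) | inr k => inr (ord_pred k) end.
have csF := family_csystem hz z_inj zE.
have disj (i : 'I_n) (k : 'I_(p i)) l : z k <> y l.
  by move=> e; apply: nC; exists i; rewrite CE; exact: cycle_range (hz i) hy e.
have cs' : csystem N m0 th' tau'.
  split.
  - move=> [j|k] [j'|k'] /=; rewrite ?hth.
    + by move/(cs_inj csF) ->.
    + by case: j => i k; rewrite /ctheta /= -zE => /disj.
    + by case: j' => i k'; rewrite /ctheta /= -zE => /esym/disj.
    + by move/yinj ->.
  - by move=> [j|k] /=; [exact: (cs_tau csF)|rewrite !hth yN ord_predK].
  - by move=> [j|k] /=; [exact: (cs_m0 csF)|rewrite hth; apply/norm_sqrtN].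
have := ph_integral_le lp cs'; rewrite big_sumType/=.
under eq_bigr => j _.
  under eq_integral => x _.
    rewrite (@ph_map _ N m0 _ _ (ctheta theta) (@cpred n p) th' tau' inl)//.
    over.
  over.
rewrite tot; apply/negP; rewrite -ltNge (bigD1 (Ordinal q0))//=.
rewrite lteDl//; apply: lt_le_trans (ph_integral_gt0 (inr (Ordinal q0)) cs') _.
rewrite leeDl// sume_ge0// => k _; apply: integral_ge0 => x _.
by rewrite lee_fin sqn_ge0.
Qed.

Let alpha (i : 'I_n) (k : 'I_(p i)) : R[i] := m0 (z k) / sqrtN R N.

Lemma phi_hatE i (k : 'I_(p i)) :
  phi_hat N m0 (@alpha i) (@theta i) k = ph N m0 (ctheta theta) (@cpred n p) (Tagged (fun i => 'I_(p i)) k).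
Proof.
rewrite (@ph_map _ N m0 _ _ (@theta i) (@ord_pred (p i)) _ _ (fun k => Tagged (fun i => 'I_(p i)) k))//.
apply/funext => x.
have E : phi_hat_partial N m0 (@alpha i) (@theta i) k x = php N m0 (@theta i) (@ord_pred (p i)) k x.
  by apply/funext => L; apply: eq_bigr => l _; rewrite /fac /alp /alpha zE.
by rewrite /phi_hat /ph E.
Qed.

Lemma phi_hat_cvg i (k : 'I_(p i)) x : cvg (phi_hat_partial N m0 (@alpha i) (@theta i) k x @ \oo).
Proof.
have csF := family_csystem hz z_inj zE.
have [c _] := php_cvg lp csF (Tagged (fun i => 'I_(p i)) k) x.
have -> : phi_hat_partial N m0 (@alpha i) (@theta i) k x =
    php N m0 (ctheta theta) (@cpred n p) (Tagged (fun i => 'I_(p i)) k) x.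
  apply/funext => L; apply: eq_bigr => l _.
  by rewrite iter_cpred /fac /alp /alpha /ctheta /= zE.
by apply/cvg_ex; eexists; exact: c.
Qed.

Lemma sqn_alpha i (k : 'I_(p i)) : sqn (alpha k) = 1.
Proof.
have csF := family_csystem hz z_inj zE.
by rewrite /alpha zE; exact: (sqn_alp lp csF (Tagged (fun i => 'I_(p i)) k)).
Qed.

Let W := dsum_wavelet (fun i => cycle_wavelet N (@z i) (@alpha i)).
Let F (v : dsum (fun i => cycle_space R (p i))) (j : cpt p) : L2 leb := fourier (v (tag j) (tagged j)).
Let phi : dsum (fun i => cycle_space R (p i)) := fun i => cycle_phi N m0 (@alpha i) (@theta i).

Lemma cycles_fourier_model :
  fourier_model N m0 (ctheta theta) (@cpred n p) (@csucc n p) W F.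
Proof.
have N0 : (0 < N)%N by have := lp_N2 lp; case: N.
split.
- apply: dsum_wavelet_representation => i; apply: cycle_representation => //.
    by have [_ _ zN _] := hz i.
  exact: sqn_alpha.
- exact: csuccK.
- exact: cpredK.
- move=> a u v j; exact: fourier_linear.
- move=> u v; rewrite dsum_dotE.
  transitivity (\sum_i \sum_k (2 * pi)%:C * dot (u i k) (v i k)).
    rewrite sig_big_dep/=; apply: eq_bigr => j _; exact: dot_fourier.
  by rewrite mulr_sumr; apply: eq_bigr => i _; rewrite dsum_dotE mulr_sumr.
- move=> x; exists (fun i k => fourier_inv (x (Tagged (fun i => 'I_(p i)) k))) => -[i k].
  exact: fourier_invK.
- move=> v [i k].
  have e : F (wU W v) (existT _ i k) = fourier (alpha k *: dilation N (v i (ordS k))) by [].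
  have l : linear_op (@fourier R) := @fourier_linear R.
  apply: (etrans e); apply: (etrans (linear_opZ (alpha k) _ l)).
  have ae : alpha k = alp N m0 (ctheta theta) (existT _ i k) by rewrite /alpha zE.
  by rewrite ae; congr (_ *: _); exact: fourier_dilation.
- move=> f v [i k] Lf.
  apply: (etrans (fourier_multE (fun w => f (circle_mul (z k) w)) (v i k))).
  apply: (congr1 (fun g => mulL2 g (fourier (v i k)))); apply/funext => x.
  by rewrite /ctheta /= zE -expNiD addrC.
Qed.

Lemma cycles_phi j : F phi j = to_L2 leb (ph N m0 (ctheta theta) (@cpred n p) j).
Proof.
case: j => i k; rewrite -phi_hatE.
exact: fourier_invK.
Qed.

End extension.

Lemma lowpass_of_transfer (R : realType) (N : nat) (m0 : circle R -> R[i]) : (2 <= N)%N ->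
  lipschitz_circle m0 -> (forall w, transfer N m0 (fun=> 1) w = 1) ->
  finite_set [set w | m0 w = 0] -> exists K, lowpass N m0 K.
Proof.
move=> N2 [K hK] m0R m0Z; exists `|K|.
have N0 : N%:R != 0 :> R[i] by rewrite pnatr_eq0 -lt0n; exact: ltnW.
split => //.
- move=> y; have := m0R (expNi y); rewrite /transfer sum_nroot// => h.
  have {h} : \sum_(r < N) (sqn (m0 (nroot N y r)))%:C = N%:R.
    transitivity (N%:R * (N%:R^-1 * \sum_(r < N) `|m0 (nroot N y r)| ^+ 2 * 1) : R[i]); last by rewrite h mulr1.
    by rewrite mulVKf//; apply: eq_bigr => r _; rewrite mulr1 norm_sqn.
  rewrite -rmorph_sum/= => /(congr1 (@complex.Re R)) /= ->.
  by rewrite -(rmorph_nat (real_complex R)).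
- move=> z w; have := hK z w; rewrite !norm_normc -rmorphM/= lecR !normcE => h.
  have h2 : Num.sqrt (sqn (m0 z - m0 w)) <= `|K| * Num.sqrt (sqn (cval z - cval w)).
    by apply: le_trans h _; rewrite ler_wpM2r ?sqrtr_ge0// ler_norm.
  rewrite -[leLHS]sqr_sqrtr ?sqn_ge0// -[X in _ * X]sqr_sqrtr ?sqn_ge0// -exprMn.
  by rewrite ler_sqr ?nnegrE ?mulr_ge0 ?sqrtr_ge0.
Qed.

Theorem theorem3p9 (R : realType) (N : nat) (m0 : circle R -> R[i])
    (n : nat) (p : 'I_n -> nat) (z : forall i, 'I_(p i) -> circle R)
    (theta : forall i, 'I_(p i) -> R) :
  (2 <= N)%N ->
  lipschitz_circle m0 ->
  (forall w, transfer N m0 (fun=> 1) w = 1) ->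
  finite_set [set w | m0 w = 0] ->
  m0_cycles N m0 !=set0 ->
  (forall i, m0_cycle_enum N m0 (@z i)) ->
  injective (fun i => range (@z i)) ->
  (forall i j, z i j = expNi (theta i j)) ->
  let alpha i (j : 'I_(p i)) : R[i] := m0 (z i j) / sqrtN R N in
  let W := dsum_wavelet (fun i => cycle_wavelet N (@z i) (@alpha i)) in
  let phi : dsum (fun i => cycle_space R (p i)) :=
    fun i => cycle_phi N m0 (@alpha i) (@theta i) in
  [/\ (forall i k x, cvg (phi_hat_partial N m0 (@alpha i) (@theta i) k x @ \oo)) /\
      (forall i k, square_integrable (@lebesgue_measure R) (phi_hat N m0 (@alpha i) (@theta i) k)),
      wavelet_representation N W,
      scaling_vector W m0 phi,
      (orthogonal_scaling_vector W phi <-> (m0_cycles N m0 #= `I_n)) /\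
      ((m0_cycles N m0 #= `I_n) <-> has_dim (transfer_fixed N m0) n)
    & (`I_n.+1 #<= m0_cycles N m0) ->
      forall m : nat -> circle R -> R[i],
      m 0%N = m0 ->
      (forall i, (0 < i < N)%N -> Linfty (m i)) ->
      circle_ae (fun w => filter_matrix N m w \is unitarymx) ->
      let psi i := op_inv (wU W) (wpi W (m i) phi) in
      normalized_tight_frame (fun t : 'I_N.-1 * int * int =>
        op_expz (wU W) t.1.2 (op_expz (wT W) t.2 (psi t.1.1.+1)))].
Proof.
move=> N2 m0L m0R m0Z ne hz z_inj zE alpha W phi.
have [K lp] := lowpass_of_transfer N2 m0L m0R m0Z.
have csF := family_csystem hz z_inj zE.
have fm := cycles_fourier_model lp hz z_inj zE.
have phiF := cycles_phi N m0 zE.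
split.
- split => i k; first exact: (phi_hat_cvg lp hz z_inj zE).
  by have := sqint_ph lp csF (Tagged (fun i => 'I_(p i)) k); rewrite -(phi_hatE N m0 zE).
- exact: (fm_rep fm).
- exact: (model_scaling_vector lp csF fm phiF).
- split.
    apply: (iff_trans (model_orthogonal lp csF fm phiF)).
    apply: (iff_trans _ (iff_sym (card_all_cycles hz z_inj))); split.
      exact: (all_cycles_of_integral lp hz z_inj zE).
    move=> h; apply: (ph_integral_full lp csF); apply: (corrR_full lp csF).
      exact: (all_cycles_full lp zE h).
    have [C [q [w [hw _]]]] := ne; have [q0 _ _ _] := hw.
    by exists (w (Ordinal q0)); exact: (cycle_enum_pt _ hw).
  split=> [/(card_all_cycles hz z_inj)|hd].
    exact: (all_cycles_dim lp hz z_inj zE ne).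
  (* Lawton's condition implies Cohen's: the number of all the cycles is a dimension of the same
     eigenspace, and the dimension is unique. *)
  have [M [cM hM]] := cycles_dim lp ne.
  by rewrite (has_dim_uniq hd hM).
- by move=> _ m mm0 Lm um psi; exact: (model_frame lp csF fm phiF mm0 Lm um).
Qed.
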